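(* Let $(\gamma,\mathbf u)$ and $(\gamma_h,\mathbf u_h)$ be the $j$-th eigenpairs of the elastic eigenvalue problem and of the Crouzeix–Raviart scheme, respectively (see context). Assume that $\mathbf u\in\mathbf H^{1+s}(\Omega)$ with $0<s<1$ and that $$\|\mathbf u-\mathbf u_h\|_h\ge c\,\gamma(h)^{-1}h^{s}$$ for some constant $c>0$ independent of $h$ and $\lambda$. Then, when $h$ is small enough, $$\gamma_h\le\gamma .$$
   Context: **Continuous problem.** $\Omega\subset\mathbb R^2$ is a bounded polygonal domain, $\partial\Omega=\Gamma_D\cup\Gamma_N$, $|\Gamma_D|>0$. Bold spaces are spaces of $\mathbb R^2$-valued functions. $\mathbf H^1_E(\Omega)=\{\mathbf v\in \mathbf H^1(\Omega):\mathbf v|_{\Gamma_D}=0\}$, $\varepsilon(\mathbf v)=\frac12(\nabla\mathbf v+(\nabla\mathbf v)^T)$, and $\mu,\lambda>0$ are the Lamé parameters. Put $a(\mathbf u,\mathbf v)=2\mu(\varepsilon(\mathbf u),\varepsilon(\mathbf v))+\lambda(\operatorname{div}\mathbf u,\operatorname{div}\mathbf v)$ and $b(\mathbf u,\mathbf v)=(\mathbf u,\mathbf v)$ ($L^2$ inner products). The eigenvalue problem is: find $\gamma\in\mathbb R$, $\mathbf u\in\mathbf H^1_E(\Omega)$ with $b(\mathbf u,\mathbf u)=1$ and $a(\mathbf u,\mathbf v)=\gamma b(\mathbf u,\mathbf v)$ for all $\mathbf v\in\mathbf H^1_E(\Omega)$; eigenvalues are ordered increasingly with multiplicity, $0<\gamma_1\le\gamma_2\le\cdots$.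 **Crouzeix–Raviart scheme.** $\mathcal T_h$ is a shape-regular triangulation of $\Omega$, $h$ the mesh size, $\mathcal E_h^0$ and $\mathcal E_h^b$ the interior and boundary edges, $h_e$ the length of $e$. For an interior edge $e=T^+\cap T^-$, $[\![\mathbf v]\!]|_e=(\mathbf v|_{T^+})|_e-(\mathbf v|_{T^-})|_e$. The space is $V_h=\{\mathbf v\in\mathbf L^2(\Omega):\mathbf v|_T\in[P_1(T)]^2\ \forall T,\ \int_e[\![\mathbf v]\!]ds=0\ \forall e\in\mathcal E_h^0,\ \int_e\mathbf v\,ds=0\ \forall e\in\mathcal E_h^b\cap\Gamma_D\}$. Let $\gamma(h)=h^\delta$ with a fixed small constant $\delta>0$, and, for $\mathbf v,\mathbf w\in V_h+\mathbf H^1_E(\Omega)$, $$a_h(\mathbf v,\mathbf w)=2\mu\sum_T(\varepsilon(\mathbf v),\varepsilon(\mathbf w))_T+\lambda\sum_T(\operatorname{div}\mathbf v,\operatorname{div}\mathbf w)_T+\gamma(h)\sum_{e\in\mathcal E_h^0}\frac{2\mu}{h_e}\langle[\![\mathbf v]\!],[\![\mathbf w]\!]\rangle_e,$$ $b_h(\mathbf v,\mathbf w)=\sum_T(\mathbf v,\mathbf w)_T$. The scheme: find $\gamma_h\in\mathbb R$, $\mathbf u_h\in V_h$ with $b_h(\mathbf u_h,\mathbf u_h)=1$ and $a_h(\mathbf u_h,\mathbf v_h)=\gamma_hb_h(\mathbf u_h,\mathbf v_h)$ for all $\mathbf v_h\in V_h$; discrete eigenvalues are ordered increasingly with multiplicity.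 The mesh-dependent norm is $\|\mathbf v\|_h^2=2\mu\sum_T\|\varepsilon(\mathbf v)\|_T^2+\lambda\sum_T\|\operatorname{div}\mathbf v\|_T^2+\sum_{e\in\mathcal E_h^0}\|h_e^{-1/2}[\![\mathbf v]\!]\|_e^2$. **Pairing of eigenfunctions (convention).** The eigenfunction $\mathbf u$ of $\gamma$ is chosen to correspond to $\mathbf u_h$ so that the known a priori estimates hold with $C$ independent of $h$ and $\lambda$: $\|\mathbf u-\mathbf u_h\|_h\le C\gamma(h)^{-1}h^s$, $\|\mathbf u-\mathbf u_h\|\le C\gamma(h)^{-2}h^{2s}$, $|\gamma-\gamma_h|\le C\gamma(h)^{-2}h^{2s}$. *)

(* Defs.v *)
(* Stated over an arbitrary [R : realType], with MathComp-Analysis. *)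
From HB Require Import structures.
From mathcomp Require Import all_boot all_order all_algebra.
From mathcomp Require Import all_classical all_reals all_analysis.
Set Implicit Arguments.
Unset Strict Implicit.
Unset Printing Implicit Defensive.
Import Order.TTheory GRing.Theory Num.Theory.
Import numFieldTopology.Exports numFieldNormedType.Exports.
Local Open Scope classical_set_scope.
Local Open Scope ring_scope.

(** ** The plane *)

Notation plane R := (R * R)%type (only parsing).

(* An R^2-valued function on the plane is given by its two components. *)
Notation vfield R := ('I_2 -> plane R -> R).

(* The library norm on [R * R] is the max norm, so the Euclidean distance is
   spelled out. *)
Definition eucl_dist (R : realType) (x y : plane R) : R :=
  Num.sqrt ((x.1 - y.1) ^+ 2 + (x.2 - y.2) ^+ 2).

Notation plane_measure R :=
  (@lebesgue_measure R \x @lebesgue_measure R)%E.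

Definition basis_vec (R : realType) (j : 'I_2) : plane R :=
  if j == ord0 then (1, 0) else (0, 1).

Definition seg_point (R : realType) (p q : plane R) (t : R) : plane R :=
  p + t *: (q - p).

Definition segment (R : realType) (p q : plane R) : set (plane R) :=
  [set seg_point p q t | t in `[0, 1]].

(* int_[p,q] f ds *)
Definition line_int (R : realType) (p q : plane R) (f : plane R -> R) : R :=
  eucl_dist p q *
  \int[lebesgue_measure]_(t in `[0, 1]) f (seg_point p q t).

Definition segment_union (R : realType) (G : set (plane R)) : Prop :=
  exists l : seq (plane R * plane R),
    G = \bigcup_(e in [set` l]) segment e.1 e.2.

(** ** Weak derivatives, Sobolev spaces, traces *)

Definition pderiv (R : realType) (j : 'I_2) (phi : plane R -> R) :
  plane R -> R := fun x => 'D_(basis_vec R j) phi x.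

(* C^oo on the whole plane: all iterated partial derivatives exist and are
   (Frechet) differentiable everywhere. *)
Definition smooth (R : realType) (phi : plane R -> R) : Prop :=
  forall (w : seq 'I_2) (x : plane R), differentiable (foldr (@pderiv R) phi w) x.

Definition test_function (R : realType) (D : set (plane R))
    (phi : plane R -> R) : Prop :=
  smooth phi /\
  exists K : set (plane R),
    [/\ compact K, K `<=` D & forall x, ~ K x -> phi x = 0].

Definition L2 (R : realType) (D : set (plane R)) (f : plane R -> R) : Prop :=
  measurable_fun D f /\
  (\int[plane_measure R]_(x in D) ((f x) ^+ 2)%:E < +oo)%E.

Definition ip (R : realType) (D : set (plane R)) (f g : plane R -> R) : R :=
  \int[plane_measure R]_(x in D) (f x * g x).

Definition is_wderiv (R : realType) (D : set (plane R)) (j : 'I_2)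
    (f g : plane R -> R) : Prop :=
  L2 D g /\
  forall phi, test_function D phi -> ip D f (pderiv j phi) = - ip D g phi.

(* The weak derivative on the open set D, as a total operator: a representative
   of the a.e. unique class when it exists, and 0 otherwise. *)
Definition wderiv (R : realType) (D : set (plane R)) (j : 'I_2)
    (f : plane R -> R) : plane R -> R :=
  xget (fun=> 0) [set g | is_wderiv D j f g].

Definition H1 (R : realType) (D : set (plane R)) (f : plane R -> R) : Prop :=
  L2 D f /\ forall j, exists g, is_wderiv D j f g.

(* H^s, 0 < s < 1, through the Sobolev-Slobodeckij seminorm in dimension 2.
   The integrand is 0 on the diagonal, since x / 0 = 0. *)
Definition Hfrac (R : realType) (D : set (plane R)) (s : R)
    (f : plane R -> R) : Prop :=
  L2 D f /\
  (\int[plane_measure R]_(x in D) \int[plane_measure R]_(y in D)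
     ((f x - f y) ^+ 2 / (eucl_dist x y `^ (2 + 2 * s)))%:E < +oo)%E.

(* H^{1+s}, for vector fields *)
Definition H1frac (R : realType) (D : set (plane R)) (s : R)
    (v : vfield R) : Prop :=
  forall i, H1 D (v i) /\ forall j, Hfrac D s (wderiv D j (v i)).

(* g is the trace of f in H^1(D) on the segment [p,q] of the boundary of D:
   the H^1(D)-closure of the restriction map on functions smooth up to the
   boundary, with values in L^2([p,q]). *)
Definition is_trace (R : realType) (D : set (plane R)) (p q : plane R)
    (f g : plane R -> R) : Prop :=
  measurable_fun `[(0 : R), 1] (g \o seg_point p q) /\
  exists phi : nat -> plane R -> R,
    [/\ forall n, smooth (phi n),
        (\int[plane_measure R]_(x in D)
           ((f x - phi n x) ^+ 2)%:E)%E @[n --> \oo] --> 0%E,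
        forall j, (\int[plane_measure R]_(x in D)
           ((wderiv D j f x - pderiv j (phi n) x) ^+ 2)%:E)%E
           @[n --> \oo] --> 0%E &
        ((eucl_dist p q)%:E * \int[lebesgue_measure]_(t in `[0%R, 1%R])
           ((phi n (seg_point p q t) - g (seg_point p q t)) ^+ 2)%:E)%E
           @[n --> \oo] --> 0%E].

(* The trace as a total operator; only its values on [p,q] matter. *)
Definition trace (R : realType) (D : set (plane R)) (p q : plane R)
    (f : plane R -> R) : plane R -> R :=
  xget (fun=> 0) [set g | is_trace D p q f g].

(** ** Polygonal domains and the continuous problem *)

(* The condition [Omega = (closure Omega)°] rules out slits. *)
Definition polygonal_domain (R : realType) (Omega : set (plane R)) : Prop :=
  [/\ open Omega, connected Omega, Omega !=set0, bounded_set Omega &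
      Omega = (closure Omega)° /\ segment_union (closure Omega `\` Omega)].

(* bd Omega = GD u GN with finite unions of segments, and |GD| > 0, i.e. GD
   contains a nondegenerate segment. *)
Definition boundary_split (R : realType) (Omega GD GN : set (plane R)) : Prop :=
  [/\ segment_union GD, segment_union GN,
      closure Omega `\` Omega = GD `|` GN &
      exists p q : plane R, p != q /\ segment p q `<=` GD].

Definition H1E (R : realType) (Omega GD : set (plane R)) (v : vfield R) : Prop :=
  forall i, H1 Omega (v i) /\
    forall p q, segment p q `<=` GD -> is_trace Omega p q (v i) (fun=> 0).

Definition strain (R : realType) (D : set (plane R)) (v : vfield R)
    (i j : 'I_2) : plane R -> R :=
  fun x => 2^-1 * (wderiv D j (v i) x + wderiv D i (v j) x).

Definition wdiv (R : realType) (D : set (plane R)) (v : vfield R) :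
  plane R -> R := fun x => \sum_(i < 2) wderiv D i (v i) x.

(* 2 mu (eps v, eps w)_D + lam (div v, div w)_D *)
Definition elastic_form (R : realType) (mu lam : R) (D : set (plane R))
    (v w : vfield R) : R :=
  2 * mu * (\sum_(i < 2) \sum_(j < 2) ip D (strain D v i j) (strain D w i j))
  + lam * ip D (wdiv D v) (wdiv D w).

Definition vip (R : realType) (D : set (plane R)) (v w : vfield R) : R :=
  \sum_(i < 2) ip D (v i) (w i).

Definition vL2norm (R : realType) (D : set (plane R)) (v : vfield R) : R :=
  Num.sqrt (vip D v v).

Definition vsub (R : realType) (v w : vfield R) : vfield R :=
  fun i x => v i x - w i x.

(** ** Variational eigenvalue problems: find t and u in W with b(u,u) = 1 and
    a(u,v) = t b(u,v) for all v in W *)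

Definition in_eigenspace (R : realType) (W : vfield R -> Prop)
    (a b : vfield R -> vfield R -> R) (t : R) (u : vfield R) : Prop :=
  W u /\ forall v, W v -> a u v = t * b u v.

Definition eigenpair (R : realType) (W : vfield R -> Prop)
    (a b : vfield R -> vfield R -> R) (t : R) (u : vfield R) : Prop :=
  b u u = 1 /\ in_eigenspace W a b t u.

(* The eigenspace of t has dimension m: it has a b-orthonormal basis of m
   elements. Functions are identified when they agree almost everywhere, that
   is when the b-norm of the difference vanishes. *)
Definition multiplicity (R : realType) (W : vfield R -> Prop)
    (a b : vfield R -> vfield R -> R) (t : R) (m : nat) : Prop :=
  exists phi : 'I_m -> vfield R,
    [/\ forall k, in_eigenspace W a b t (phi k),
        forall k l, b (phi k) (phi l) = (k == l)%:R &
        forall u, in_eigenspace W a b t u ->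
          exists c : 'I_m -> R,
            let r := vsub u (fun i x => \sum_(k < m) c k * phi k i x) in
            b r r = 0].

(* t is the j-th (j >= 1) eigenvalue, in increasing order and counted with
   multiplicity: l lists all the eigenvalues that are at most t, each repeated
   according to its multiplicity. *)
Definition nth_eigenvalue (R : realType) (W : vfield R -> Prop)
    (a b : vfield R -> vfield R -> R) (j : nat) (t : R) : Prop :=
  exists l : seq R,
    [/\ sorted <=%R l, all (fun r => r <= t) l,
        forall r, r <= t -> multiplicity W a b r (count_mem r l),
        (0 < j <= size l)%N & nth 0 l j.-1 = t].

Definition nth_eigenpair (R : realType) (W : vfield R -> Prop)
    (a b : vfield R -> vfield R -> R) (j : nat) (t : R) (u : vfield R) : Prop :=
  nth_eigenvalue W a b j t /\ eigenpair W a b t u.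

(** ** Triangulations *)

(* Vertices are numbered, a triangle is the set of the numbers of its three
   vertices, and an edge is a pair (k, l) of vertex numbers with k < l. *)
Record mesh (R : realType) := Mesh {
  nvert : nat;
  vert : 'I_nvert -> plane R;
  tris : {set {set 'I_nvert}} }.

(* convex hull of the vertices in A (empty if A is) *)
Definition hull (R : realType) (M : mesh R) (A : {set 'I_(nvert M)}) :
    set (plane R) :=
  [set x | exists c : 'I_(nvert M) -> R,
    [/\ forall k, 0 <= c k, \sum_(k in A) c k = 1 &
        x = \sum_(k in A) c k *: vert k]].

Definition otri (R : realType) (M : mesh R) (T : {set 'I_(nvert M)}) :
    set (plane R) := (hull T)°.

Section Edges.
Context (R : realType) (M : mesh R).
Local Notation edge := ('I_(nvert M) * 'I_(nvert M))%type.


Definition edge_tris (e : edge) : {set {set 'I_(nvert M)}} :=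
  [set T in tris M | (e.1 \in T) && (e.2 \in T)].

Definition interior_edge (e : edge) : bool :=
  (e.1 < e.2)%N && (#|edge_tris e| == 2%N).

Definition boundary_edge (e : edge) : bool :=
  (e.1 < e.2)%N && (#|edge_tris e| == 1%N).

Definition edge_seg (e : edge) : set (plane R) :=
  segment (vert e.1) (vert e.2).

Definition edge_len (e : edge) : R := eucl_dist (vert e.1) (vert e.2).

Definition edge_int (e : edge) (f : plane R -> R) : R :=
  line_int (vert e.1) (vert e.2) f.

(* The triangles T^+ (n = 0) and T^- (n = 1) of e. For a boundary edge, only
   n = 0 makes sense. *)
Definition edge_side (e : edge) (n : nat) : {set 'I_(nvert M)} :=
  nth finset.set0 (enum (edge_tris e)) n.

Definition edge_trace (e : edge) (n : nat) (v : vfield R) : vfield R :=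
  fun i => trace (otri (edge_side e n)) (vert e.1) (vert e.2) (v i).

Definition jump (e : edge) (v : vfield R) : vfield R :=
  vsub (edge_trace e 0 v) (edge_trace e 1 v).

End Edges.

Definition is_triangulation (R : realType) (Omega GD GN : set (plane R))
    (M : mesh R) : Prop :=
  [/\ forall T, T \in tris M -> #|T| = 3%N /\ otri T !=set0,
      \bigcup_(T in [set` tris M]) hull T = closure Omega,
      forall T T', T \in tris M -> T' \in tris M ->
        hull T `&` hull T' = hull (T :&: T')%SET &
      forall e, boundary_edge (M := M) e ->
        edge_seg e `<=` GD \/ edge_seg e `<=` GN].

Definition diam (R : realType) (A : set (plane R)) : R :=
  sup [set d | exists x y, [/\ A x, A y & d = eucl_dist x y]].

(* diameter of the largest disc contained in A *)
Definition in_diam (R : realType) (A : set (plane R)) : R :=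
  sup [set d | exists (x : plane R) (r : R),
    [/\ 0 <= r, [set y | eucl_dist x y <= r] `<=` A & d = 2 * r]].

Definition shape_regular (R : realType) (sigma : R) (M : mesh R) : Prop :=
  forall T, T \in tris M -> diam (hull T) <= sigma * in_diam (hull T).

Definition mesh_size (R : realType) (M : mesh R) : R :=
  \big[Num.max/0]_(T in tris M) diam (hull T).

(** ** The Crouzeix-Raviart scheme *)

Definition affine_fun (R : realType) (p : plane R -> R) : Prop :=
  exists a0 a1 a2 : R, forall x, p x = a0 + a1 * x.1 + a2 * x.2.

Definition CR_space (R : realType) (Omega GD : set (plane R)) (M : mesh R)
    (v : vfield R) : Prop :=
  forall i : 'I_2,
    [/\ L2 Omega (v i),
        forall T, T \in tris M -> exists p, affine_fun p /\
          {ae plane_measure R, forall x, otri T x -> v i x = p x},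
        forall e, interior_edge (M := M) e -> edge_int e (jump e v i) = 0 &
        forall e, boundary_edge (M := M) e -> edge_seg e `<=` GD ->
          edge_int e (edge_trace e 0 v i) = 0].

(* gamma(h) = h^delta *)
Definition stab (R : realType) (delta : R) (M : mesh R) : R :=
  mesh_size M `^ delta.

(* The jumps are those of V_h + H^1_E functions, through the traces taken from
   the two sides of the edge. *)
Definition ah (R : realType) (mu lam delta : R) (M : mesh R)
    (v w : vfield R) : R :=
  \sum_(T in tris M) elastic_form mu lam (otri T) v w
  + stab delta M * \sum_(e | interior_edge (M := M) e)
      2 * mu / edge_len e *
      edge_int e (fun x => \sum_(i < 2) jump e v i x * jump e w i x).

Definition bh (R : realType) (M : mesh R) (v w : vfield R) : R :=
  \sum_(T in tris M) vip (otri T) v w.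

Definition normh (R : realType) (mu lam : R) (M : mesh R) (v : vfield R) : R :=
  Num.sqrt (
    \sum_(T in tris M) elastic_form mu lam (otri T) v v
    + \sum_(e | interior_edge (M := M) e)
        edge_int e (fun x => \sum_(i < 2)
          ((Num.sqrt (edge_len e))^-1 * jump e v i x) ^+ 2)).

(* Main.v *)
Require Import Defs.
From HB Require Import structures.
From mathcomp Require Import all_boot all_order all_algebra.
From mathcomp Require Import all_classical all_reals all_analysis.
From mathcomp Require Import measurable_realfun ring lra.
Set Implicit Arguments.
Unset Strict Implicit.
Unset Printing Implicit Defensive.
Import Order.TTheory GRing.Theory Num.Theory.
Import numFieldTopology.Exports numFieldNormedType.Exports.
Local Open Scope classical_set_scope.
Local Open Scope ring_scope.

(** Let [e = u - uh], let [P] be the Crouzeix-Raviart interpolant of [u] and let [w = u - P]. On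
    each triangle the gradient of [P] is the mean of the gradient of [u], so [w] is orthogonal to
    every discrete field for the broken elastic form. Combined with the two eigenvalue equations and
    the absence of jumps in [u], this gives [error_identity]: g - gh = E(e,e) + k J(e,e) - 2 k
    J(w,e) - 2 gh (w,uh) - gh (e,e). Here E is the broken elastic form, J the unweighted jump form,
    k = 2 mu st and st = h^delta.

    The assumed lower bound says that E(e,e) + J(e,e) is at least c^2 st^-2 h^(2 s). Half of the
    jump term absorbs J(w,e); since the penalty is weak, what is left is bounded below only by mu st
    times that quantity, which is still of order st^-1 h^(2 s). The remaining terms are O(h^(2 s)):
    J(w,w) by interpolation estimates, (w,uh) because it is O(h^(1 + s)), and (e,e) because it is at
    most C^2 st^-4 h^(4 s) while 4 delta < 2 s. As st tends to 0 the sign is decided for small h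
    ([final_arith]).

    The interpolation estimates ([interpolation_estimate]) combine Poincare and trace inequalities
    with explicit constants on a triangle ([tri_poincare], [tri_edge_poincare]), extended from
    smooth functions by density ([H1s_poincare]), with a bound of the cell variances of the gradient
    by the Slobodeckij seminorm ([frac_poincare]).

    The threshold h0 is fixed before the eigenpair is given. This is possible because the j-th
    eigenvalue is unique ([nth_eigenvalue_unique]) and because the normalised H^{1+s} eigenfunctions
    of one finite-dimensional eigenspace have bounded seminorm ([frac_semi_bound]).

    Weak derivatives and traces are chosen representatives, so their calculus is established almost
    everywhere, from the fundamental lemma of the calculus of variations ([ae_vanish]) and the
    completeness of L2 ([Riesz_Fischer]). *)

Lemma eq_cvgn (X : topologicalType) (u v : nat -> X) (l : X) :
  u =1 v -> u n @[n --> \oo] --> l -> v n @[n --> \oo] --> l.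
Proof. by move=> /funext ->. Qed.

Section ae.
Context d (T : measurableType d) (R : realType) (mu : {measure set T -> \bar R}).

Lemma ae_imply (P Q : T -> Prop) : (forall x, P x -> Q x) ->
  {ae mu, forall x, P x} -> {ae mu, forall x, Q x}.
Proof. by move=> PQ; apply: filterS. Qed.

Lemma ae_imply2 (P Q S : T -> Prop) : (forall x, P x -> Q x -> S x) ->
  {ae mu, forall x, P x} -> {ae mu, forall x, Q x} -> {ae mu, forall x, S x}.
Proof. by move=> PQ; apply: filterS2. Qed.

End ae.

(** * Square-integrable functions, their inner product and L2 convergence *)

Section L2toolkit.
Context d (T : measurableType d) (R : realType) (mu : {measure set T -> \bar R}).

Definition sq_int (D : set T) (f : T -> R) : Prop :=
  measurable_fun D f /\ (\int[mu]_(x in D) ((f x) ^+ 2)%:E < +oo)%E.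

Definition dot (D : set T) (f g : T -> R) : R := \int[mu]_(x in D) (f x * g x).

Variable D : set T.
Hypothesis mD : measurable D.
Implicit Types f g k : T -> R.

Lemma sq_int_integrable_sq f :
  sq_int D f -> mu.-integrable D (EFin \o (fun x => f x ^+ 2)).
Proof.
move=> [mf ff]; apply/integrableP; split.
  by apply/measurable_EFinP; exact: measurable_funX.
by under eq_integral do rewrite /= ger0_norm ?sqr_ge0//.
Qed.

Lemma sq_intM f g : sq_int D f -> sq_int D g ->
  mu.-integrable D (EFin \o (fun x => f x * g x)).
Proof.
move=> hf hg.
have i2 := integrableD mD (sq_int_integrable_sq hf) (sq_int_integrable_sq hg).
apply: (le_integrable mD _ _ i2).
  by apply/measurable_EFinP; apply: measurable_funM; [case: hf|case: hg].
move=> x _ /=; rewrite lee_fin [leRHS]ger0_norm ?addr_ge0 ?sqr_ge0//.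
rewrite normrM; have := sqr_ge0 (`|f x| - `|g x|).
rewrite -[f x ^+ 2]real_normK ?num_real// -[g x ^+ 2]real_normK ?num_real//.
have := normr_ge0 (f x); have := normr_ge0 (g x).
move: `|f x| `|g x| => a b *; nra.
Qed.

Lemma sq_int_of_integrable f : measurable_fun D f ->
  mu.-integrable D (EFin \o (fun x => f x ^+ 2)) -> sq_int D f.
Proof.
move=> mf /integrableP[_ i]; split => //.
by under eq_integral do rewrite -[f _ ^+ 2]ger0_norm ?sqr_ge0//.
Qed.

Lemma sq_int_lin a b f g : sq_int D f -> sq_int D g ->
  sq_int D (fun x => a * f x + b * g x).
Proof.
move=> hf hg; have [mf _] := hf; have [mg _] := hg.
apply: sq_int_of_integrable.
  by apply: measurable_funD; apply: measurable_funM => //; exact: measurable_cst.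
have i1 := integrableZl mD (a ^+ 2) (sq_int_integrable_sq hf).
have i2 := integrableZl mD (b ^+ 2) (sq_int_integrable_sq hg).
have i3 := integrableZl mD (2 * a * b) (sq_intM hf hg).
apply: eq_integrable (integrableD mD (integrableD mD i1 i2) i3) => // x _ /=.
by rewrite -?(EFinM, EFinD); congr EFin; ring.
Qed.

Lemma sq_intD f g : sq_int D f -> sq_int D g -> sq_int D (fun x => f x + g x).
Proof.
move=> hf hg; have := sq_int_lin 1 1 hf hg.
by under eq_fun do rewrite !mul1r.
Qed.

Lemma sq_intB f g : sq_int D f -> sq_int D g -> sq_int D (fun x => f x - g x).
Proof.
move=> hf hg; have := sq_int_lin 1 (-1) hf hg.
by under eq_fun do rewrite mul1r mulN1r.
Qed.

Lemma sq_intZ a f : sq_int D f -> sq_int D (fun x => a * f x).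
Proof.
move=> hf; have := sq_int_lin a 0 hf hf.
by under eq_fun do rewrite mul0r addr0.
Qed.

Lemma sq_int_sum (I : Type) (r : seq I) (F : I -> T -> R) :
  (forall i, sq_int D (F i)) -> sq_int D (fun x => \sum_(i <- r) F i x).
Proof.
move=> hF; elim: r => [|i r ih].
  under eq_fun do rewrite big_nil.
  split; first exact: measurable_cst.
  rewrite (_ : (\int[mu]_(x in D) _)%E = 0%E) ?ltry//.
  by apply: integral0_eq => x _; rewrite expr0n.
by under eq_fun do rewrite big_cons; exact: sq_intD.
Qed.

Lemma sq_intS (E : set T) f : measurable E -> E `<=` D -> sq_int D f -> sq_int E f.
Proof.
move=> mE ED [mf ff]; split; first exact: measurable_funS mf.
apply: le_lt_trans ff; apply: ge0_subset_integral => //.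
  by apply/measurable_EFinP; exact: measurable_funX.
by move=> x _; rewrite lee_fin sqr_ge0.
Qed.

Lemma dotC f g : dot D f g = dot D g f.
Proof. by apply: eq_Rintegral => x _; rewrite mulrC. Qed.

Lemma dot_linl a b f g k : sq_int D f -> sq_int D g -> sq_int D k ->
  dot D (fun x => a * f x + b * g x) k = a * dot D f k + b * dot D g k.
Proof.
move=> hf hg hk; rewrite /dot.
rewrite -(RintegralZl _ mD (sq_intM hf hk)) -(RintegralZl _ mD (sq_intM hg hk)).
rewrite -RintegralD//.
- by apply: eq_Rintegral => x _; ring.
- by apply: eq_integrable (integrableZl mD a (sq_intM hf hk)) => // x _ /=.
- by apply: eq_integrable (integrableZl mD b (sq_intM hg hk)) => // x _ /=.
Qed.

Lemma dot_linr a b f g k : sq_int D f -> sq_int D g -> sq_int D k ->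
  dot D k (fun x => a * f x + b * g x) = a * dot D k f + b * dot D k g.
Proof. by move=> *; rewrite dotC dot_linl// !(dotC k). Qed.

Lemma dot_ge0 f : 0 <= dot D f f.
Proof. by apply: Rintegral_ge0 => x _; rewrite -expr2 sqr_ge0. Qed.

Lemma dotEFin f : sq_int D f ->
  (\int[mu]_(x in D) (f x ^+ 2)%:E)%E = (dot D f f)%:E.
Proof.
move=> hf; rewrite /dot /Rintegral fineK//.
have := integrable_fin_num mD (sq_int_integrable_sq hf) => /=.
by under eq_integral do rewrite /= expr2.
Qed.

Lemma dot_sqr_lin a b f g : sq_int D f -> sq_int D g ->
  dot D (fun x => a * f x + b * g x) (fun x => a * f x + b * g x) =
  a ^+ 2 * dot D f f + 2 * a * b * dot D f g + b ^+ 2 * dot D g g.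
Proof.
move=> hf hg; have hs := sq_int_lin a b hf hg.
by rewrite dot_linl// !dot_linr// (dotC g f); ring.
Qed.

Lemma dot_CS f g : sq_int D f -> sq_int D g ->
  (dot D f g) ^+ 2 <= dot D f f * dot D g g.
Proof.
move=> hf hg.
have q a b : 0 <= a ^+ 2 * dot D f f + 2 * a * b * dot D f g + b ^+ 2 * dot D g g.
  by rewrite -dot_sqr_lin//; exact: dot_ge0.
have F0 := dot_ge0 f; have G0 := dot_ge0 g.
move: q F0 G0; move: (dot D f f) (dot D g g) (dot D f g) => A B C q A0 B0.
have [B00|Bp] := eqVneq B 0.
  subst B; rewrite mulr0.
  have [->|C0] := eqVneq C 0; first by rewrite expr0n.
  (* With B = 0 and a = 1 the form is A + 2 b C, affine in b, and this b sends it to -1. *)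
  have := q 1 (- (A + 1) / (2 * C)).
  suff -> : 1 ^+ 2 * A + 2 * 1 * (- (A + 1) / (2 * C)) * C +
      (- (A + 1) / (2 * C)) ^+ 2 * 0 = - 1 by rewrite ler0N1.
  by field.
have {}Bp : 0 < B by rewrite lt_def Bp.
(* The minimising direction of the form; its value there is B times the Gram determinant. *)
have := q B (- C).
have -> : B ^+ 2 * A + 2 * B * - C * C + (- C) ^+ 2 * B = B * (A * B - C ^+ 2) by ring.
by rewrite pmulr_rge0// subr_ge0.
Qed.

Lemma dot_CS_sqrt f g : sq_int D f -> sq_int D g ->
  `|dot D f g| <= Num.sqrt (dot D f f) * Num.sqrt (dot D g g).
Proof.
move=> hf hg; rewrite -sqrtrM ?dot_ge0// -sqrtr_sqr ler_sqrt.
  exact: dot_CS.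
by rewrite mulr_ge0 ?dot_ge0.
Qed.

Lemma eq_dot f f' g g' :
  measurable_fun D f -> measurable_fun D f' ->
  measurable_fun D g -> measurable_fun D g' ->
  {ae mu, forall x, D x -> f x = f' x} -> {ae mu, forall x, D x -> g x = g' x} ->
  dot D f g = dot D f' g'.
Proof.
move=> mf mf' mg mg' e1 e2; rewrite /dot /Rintegral; congr fine.
apply: ae_eq_integral => //.
- by apply/measurable_EFinP; exact: measurable_funM.
- by apply/measurable_EFinP; exact: measurable_funM.
by apply: filterS2 e1 e2 => x h1 h2 Dx /=; rewrite h1// h2.
Qed.

Lemma ae_sq_int f f' : measurable_fun D f' ->
  {ae mu, forall x, D x -> f x = f' x} -> sq_int D f -> sq_int D f'.
Proof.
move=> mf' e [mf i]; split => //.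
rewrite (_ : (\int[mu]_(x in D) _)%E = (\int[mu]_(x in D) (f x ^+ 2)%:E)%E)//.
apply: ae_eq_integral => //.
- by apply/measurable_EFinP; exact: measurable_funX.
- by apply/measurable_EFinP; exact: measurable_funX.
by apply: filterS e => x h Dx; rewrite h.
Qed.

Lemma dot_eq0 f : sq_int D f -> dot D f f = 0 ->
  {ae mu, forall x, D x -> f x = 0}.
Proof.
move=> hf f0; have [mf _] := hf.
have := dotEFin hf; rewrite f0 => h.
have m2 : measurable_fun D (fun x => (f x ^+ 2)%:E).
  by apply/measurable_EFinP; exact: measurable_funX.
have /(ae_eq_integral_abs mu mD m2) : (\int[mu]_(x in D) `|(f x ^+ 2)%:E| = 0)%E.
  rewrite -[RHS]h; apply: eq_integral => x _.
  by rewrite gee0_abs// lee_fin sqr_ge0.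
by apply: filterS => x /[apply] -[] /eqP; rewrite sqrf_eq0 => /eqP.
Qed.

Lemma dot0 f : measurable_fun D f ->
  {ae mu, forall x, D x -> f x = 0} -> dot D f f = 0.
Proof.
move=> mf e; rewrite (@eq_dot f (cst 0) f (cst 0))//.
by rewrite /dot /Rintegral integral0_eq// => x _; rewrite mul0r.
Qed.

Lemma dot0l f k : measurable_fun D f -> measurable_fun D k ->
  {ae mu, forall x, D x -> f x = 0} -> dot D f k = 0.
Proof.
move=> mf mk e; rewrite (@eq_dot f (cst 0) k k)//; last exact: aeW.
by rewrite /dot /Rintegral integral0_eq// => x _; rewrite mul0r.
Qed.

(* Convergence in L^2(D), with the Lebesgue integral valued in [0, +oo]. *)
Definition cvg2 (u : nat -> T -> R) f : Prop :=
  ((\int[mu]_(x in D) ((f x - u n x) ^+ 2)%:E)%E @[n --> \oo] --> 0%E).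

Lemma cvg2_dot (u : nat -> T -> R) f : (forall n, sq_int D (u n)) -> sq_int D f ->
  cvg2 u f <-> dot D (fun x => f x - u n x) (fun x => f x - u n x)
               @[n --> \oo] --> (0 : R).
Proof.
move=> hu hf; have hd n := sq_intB hf (hu n).
rewrite /cvg2; under eq_fun do rewrite dotEFin//.
split; first by move/fine_cvgP => [_].
by move=> h; apply: cvg_EFin => //; near=> n.
Unshelve. all: by end_near. Qed.

(** Cauchy-Schwarz: the error is at most the L2 distance times the norm of [k]. *)
Lemma cvg2_dotl (u : nat -> T -> R) f k : (forall n, sq_int D (u n)) ->
  sq_int D f -> sq_int D k -> cvg2 u f ->
  dot D (u n) k @[n --> \oo] --> dot D f k.
Proof.
move=> hu hf hk /(cvg2_dot hu hf) h.
have hd n := sq_intB hf (hu n).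
apply/cvgrPdist_le => e e0.
have : Num.sqrt (dot D (fun x => f x - u n x) (fun x => f x - u n x)) *
   Num.sqrt (dot D k k) @[n --> \oo] --> Num.sqrt (0 : R) * Num.sqrt (dot D k k).
  apply: cvgM; last exact: cvg_cst.
  exact: (continuous_cvg _ (@sqrt_continuous R 0) h).
rewrite sqrtr0 mul0r => /cvgrPdist_le/(_ _ e0); apply: filterS => n.
rewrite sub0r normrN ger0_norm ?mulr_ge0 ?sqrtr_ge0//; apply: le_trans.
have -> : dot D f k - dot D (u n) k = dot D (fun x => f x - u n x) k.
  have := dot_linl 1 (-1) hf (hu n) hk; rewrite mul1r mulN1r => <-.
  by congr dot; apply/funext => x; rewrite mul1r mulN1r.
exact: dot_CS_sqrt.
Qed.

Lemma cvg2_dot_self (u : nat -> T -> R) f : (forall n, sq_int D (u n)) ->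
  sq_int D f -> cvg2 u f ->
  dot D (u n) (u n) @[n --> \oo] --> dot D f f.
Proof.
move=> hu hf h; have hd n := sq_intB hf (hu n).
have h1 := cvg2_dotl hu hf hf h.
have := (cvg2_dot hu hf).1 h => h0.
(* The squared norm of [u n] is |f - u n|^2 + 2 (u n, f) - |f|^2, and every term has a known
   limit. *)
have : dot D (fun x => f x - u n x) (fun x => f x - u n x) +
   2 * dot D (u n) f - dot D f f @[n --> \oo] --> 0 + 2 * dot D f f - dot D f f.
  by apply: cvgB; [apply: cvgD => //; apply: cvgM => //; exact: cvg_cst|exact: cvg_cst].
have -> : 0 + 2 * dot D f f - dot D f f = dot D f f by ring.
apply: eq_cvgn => n.
have -> : (fun x => f x - u n x) = (fun x => 1 * f x + (-1) * u n x).
  by apply/funext => x; ring.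
by rewrite dot_sqr_lin// (dotC (u n) f); ring.
Qed.

Lemma cvg2_lin a b (u v : nat -> T -> R) f g :
  (forall n, sq_int D (u n)) -> (forall n, sq_int D (v n)) ->
  sq_int D f -> sq_int D g -> cvg2 u f -> cvg2 v g ->
  cvg2 (fun n x => a * u n x + b * v n x) (fun x => a * f x + b * g x).
Proof.
move=> hu hv hf hg h1 h2.
apply/cvg2_dot; [by move=> n; exact: sq_int_lin|exact: sq_int_lin|].
move/(cvg2_dot hu hf) : h1 => h1; move/(cvg2_dot hv hg) : h2 => h2.
have hd1 n := sq_intB hf (hu n); have hd2 n := sq_intB hg (hv n).
have : 2 * a ^+ 2 * dot D (fun x => f x - u n x) (fun x => f x - u n x) +
  2 * b ^+ 2 * dot D (fun x => g x - v n x) (fun x => g x - v n x)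
  @[n --> \oo] --> 2 * a ^+ 2 * 0 + 2 * b ^+ 2 * 0.
  by apply: cvgD; apply: cvgM => //; exact: cvg_cst.
rewrite !mulr0 addr0 => h3.
apply: (squeeze_cvgr _ (cvg_cst 0) h3); near=> n; rewrite dot_ge0 /=.
set p := (fun x => f x - u n x); set q := (fun x => g x - v n x).
have -> : (fun x => a * f x + b * g x - (a * u n x + b * v n x)) =
          (fun x => a * p x + b * q x) by apply/funext => x; rewrite /p/q; ring.
(* Nonnegativity of |a p - b q|^2 yields |a p + b q|^2 <= 2 a^2 |p|^2 + 2 b^2 |q|^2. *)
have := dot_ge0 (fun x => a * p x + (- b) * q x).
have hp : sq_int D p := hd1 n; have hq : sq_int D q := hd2 n.
rewrite !dot_sqr_lin//.
move: (dot D p p) (dot D p q) (dot D q q) => A B C; nra.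
Unshelve. all: by end_near. Qed.

(** By linearity f - g is the limit of u - u = 0, hence has norm 0. *)
Lemma cvg2_unique (u : nat -> T -> R) f g :
  (forall n, sq_int D (u n)) -> sq_int D f -> sq_int D g ->
  cvg2 u f -> cvg2 u g -> {ae mu, forall x, D x -> f x = g x}.
Proof.
move=> hu hf hg h1 h2.
have := cvg2_lin 1 (-1) hu hu hf hg h1 h2.
have z n : sq_int D (fun x => 1 * u n x + -1 * u n x) by exact: sq_int_lin.
have hfg := sq_int_lin 1 (-1) hf hg.
move/(cvg2_dot_self z hfg).
have -> : (fun n => dot D (fun x => 1 * u n x + -1 * u n x)
                          (fun x => 1 * u n x + -1 * u n x)) = cst 0.
  apply/funext => n; apply: dot0; first by have [] := z n.
  by apply: aeW => x _; ring.
move=> /(cvg_unique (@Rhausdorff R) (cvg_cst (0 : R)))/esym/(dot_eq0 hfg).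
by apply: filterS => x /[apply] /eqP; rewrite mul1r mulN1r subr_eq0 => /eqP.
Qed.

Lemma cvg2_measurable_sq_int (u : nat -> T -> R) f :
  (forall n, sq_int D (u n)) -> measurable_fun D f -> cvg2 u f -> sq_int D f.
Proof.
move=> hu mf h.
(* A sequence tending to 0 in the extended reals has a finite term, so f differs from some [u n] by
   a square-integrable function. *)
have /fine_cvgP[[n _ /(_ n (leqnn n)) fn] _] := h.
have hd : sq_int D (fun x => f x - u n x).
  by split; [apply: measurable_funB => //; case: (hu n)|rewrite ltey_eq fn].
have := sq_intD hd (hu n); congr sq_int; apply/funext => x; ring.
Qed.

Lemma ae_cvg2 (u v : nat -> T -> R) f g :
  (forall n, measurable_fun D (u n)) -> measurable_fun D f ->
  (forall n, measurable_fun D (v n)) -> measurable_fun D g ->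
  (forall n, {ae mu, forall x, D x -> u n x = v n x}) ->
  {ae mu, forall x, D x -> f x = g x} -> cvg2 u f -> cvg2 v g.
Proof.
move=> mu' mf mv mg e1 e2; apply: eq_cvgn => n.
apply: ae_eq_integral => //.
- by apply/measurable_EFinP; apply: measurable_funX; exact: measurable_funB.
- by apply/measurable_EFinP; apply: measurable_funX; exact: measurable_funB.
by apply: filterS2 e2 (e1 n) => x h1 h2 Dx; rewrite h1// h2.
Qed.

End L2toolkit.

(** * Affine changes of variables on the line and linear ones in the plane *)

Section affine_line.
Context (R : realType).
Local Notation leb := (@lebesgue_measure R).

(** A negative slope exchanges the open and the closed end, hence the quantified boundary flags. *)
Lemma preimage_affine_itvoc (al be a b : R) : al != 0 ->
  exists c d (b1 b2 : bool), [/\ (fun x => al * x + be) @^-1` [set` `]a, b]] =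
     [set` Interval (BSide b1 c) (BSide b2 d)],
     (c < d) = (a < b) & `|al| * (d - c) = b - a].
Proof.
move=> al0; have [alp|aln|/eqP] := ltgtP al 0; last by rewrite (negPf al0).
- exists ((b - be) / al), ((a - be) / al), true, true; split.
  + apply/seteqP; split => x /=; rewrite !in_itv/= ler_ndivrMr// ltr_ndivlMr//.
      by move=> /andP[? ?]; apply/andP; split; lra.
    by move=> /andP[? ?]; apply/andP; split; lra.
  + by rewrite ltr_nM2r ?invr_lt0// ltrD2r.
  + by rewrite ltr0_norm//; field.
- exists ((a - be) / al), ((b - be) / al), false, false; split.
  + apply/seteqP; split => x /=; rewrite !in_itv/= ltr_pdivrMr// ler_pdivlMr//.
      by move=> /andP[? ?]; apply/andP; split; lra.
    by move=> /andP[? ?]; apply/andP; split; lra.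
  + by rewrite ltr_pM2r ?invr_gt0// ltrD2r.
  + by rewrite gtr0_norm//; field.
Qed.

Lemma measurable_affine (al be : R) :
  measurable_fun [set: R] (fun x : R => al * x + be).
Proof. by apply: measurable_funD => //; exact: measurable_funM. Qed.

(** Lebesgue measure equals |al| times its pushforward under the map, because the two agree on
    half-open intervals; integration against a pushforward is composition. *)
Lemma ge0_integral_affine (al be : R) (f : R -> \bar R) : al != 0 ->
  measurable_fun [set: R] f -> (forall x, 0 <= f x)%E ->
  (\int[leb]_x f x = `|al|%:E * \int[leb]_x f (al * x + be)%R)%E.
Proof.
move=> al0 mf f0.
pose phi (x : measurableTypeR R) : measurableTypeR R := al * x + be.
have mphi : measurable_fun [set: measurableTypeR R] phi by exact: measurable_affine.
have n0 : (0 <= `|al|) by [].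
pose nu0 := mscale (NngNum n0) (pushforward leb phi); pose nu := nu0 mphi.
have e A : measurable A -> leb A = nu A.
  apply: lebesgue_measure_unique => //= _ [[a b]] _ <- /=.
  have [c [d [b1 [b2 [h1 h2 h3]]]]] := preimage_affine_itvoc be a b al0.
  rewrite /nu /nu0 /mscale /pushforward /=.
  rewrite -[X in _ = (_ * X)%E]/(leb (phi @^-1` _)).
  rewrite (_ : phi @^-1` _ = [set` Interval (BSide b1 c) (BSide b2 d)])//.
  rewrite !lebesgue_measure_itv/= !lte_fin h2.
  by case: ifP => _; rewrite ?mule0// -!EFinD -EFinM h3.
rewrite (_ : (\int[leb]_x f x = \int[nu]_x f x)%E); last first.
  by apply: eq_measure_integral => A mA _; exact: e.
rewrite ge0_integral_mscale//=.
by rewrite (@ge0_integral_pushforward _ _ _ _ _ _ mphi leb setT f)// preimage_setT.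
Qed.

End affine_line.

Section plane.
Context (R : realType).
Local Notation leb := (@lebesgue_measure R).
Local Notation mu2 := (plane_measure R).

Lemma measurable_slice_fst d' (T' : measurableType d') (g : plane R -> T') (y : R) :
  measurable_fun [set: plane R] g -> measurable_fun [set: R] (fun x => g (x, y)).
Proof.
by move=> mg; apply: (measurableT_comp mg); exact: measurable_fun_pair.
Qed.

Lemma measurable_slice_snd d' (T' : measurableType d') (g : plane R -> T') (x : R) :
  measurable_fun [set: plane R] g -> measurable_fun [set: R] (fun y => g (x, y)).
Proof.
by move=> mg; apply: (measurableT_comp mg); exact: measurable_fun_pair.
Qed.

(** Gaussian elimination: for fixed y substitute in x, exchange the integrals, then substitute in y.
    The Jacobians a11 and D / a11 multiply to the determinant. *)
Lemma ge0_integral_linear (a11 a12 a21 a22 : R) (f : plane R -> \bar R) :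
  a11 * a22 - a12 * a21 != 0 ->
  measurable_fun [set: plane R] f -> (forall x, 0 <= f x)%E ->
  (\int[mu2]_x f x = `|a11 * a22 - a12 * a21|%:E *
     \int[mu2]_x f (a11 * x.1 + a12 * x.2, a21 * x.1 + a22 * x.2)%R)%E.
Proof.
(* If the pivot vanishes, exchanging the two arguments of f swaps the rows of the matrix. *)
wlog a110 : a11 a12 a21 a22 f / a11 != 0.
  move=> H det0 mf f0; have [a110|/H] := eqVneq a11 0; last exact.
  have a210 : a21 != 0.
    by apply: contra_neq det0 => ->; rewrite a110 mul0r mulr0 subrr.
  have mfs : measurable_fun [set: plane R] (f \o (fun x => (x.2, x.1))).
    by apply: measurableT_comp => //; exact: measurable_swap.
  have sw (g : plane R -> \bar R) : measurable_fun [set: plane R] g ->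
     (forall x, 0 <= g x)%E ->
     (\int[mu2]_x g x = \int[mu2]_x g (x.2, x.1))%E.
    move=> mg g0; rewrite fubini_tonelli1// fubini_tonelli2//.
    by apply: measurableT_comp => //; exact: measurable_swap.
  rewrite sw// (H a21 a22 a11 a12 (f \o (fun x => (x.2, x.1))) a210)//.
    by rewrite distrC; congr (`| _ |%:E * _)%E; ring.
    by rewrite -oppr_eq0; apply: contra_neq det0 => <-; ring.
  by move=> x /=.
move=> dt0 mf f0.
set D := a11 * a22 - a12 * a21 in dt0 *.
have mg : measurable_fun [set: plane R]
    (fun x => f (a11 * x.1 + a12 * x.2, a21 * x.1 + a22 * x.2)).
  apply: measurableT_comp => //; apply: measurable_fun_pair => /=;
    by apply: measurable_funD; apply: measurable_funM.
rewrite [in RHS]fubini_tonelli2//= /fubini_G.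
have mh : measurable_fun [set: plane R]
   (fun x => f (x.1, (a21 / a11) * x.1 + (D / a11) * x.2)).
  apply: measurableT_comp => //; apply: measurable_fun_pair => //=;
    by apply: measurable_funD; apply: measurable_funM.
have -> : (\int[leb]_y \int[leb]_x f (a11 * x + a12 * y, a21 * x + a22 * y)%R =
   `|a11|^-1%:E *
    \int[leb]_y \int[leb]_x f (x, (a21 / a11) * x + (D / a11) * y)%R)%E.
  rewrite -ge0_integralZl//=; last 2 first.
  - exact: (measurable_fun_fubini_tonelli_G (m1 := leb) _ mh (fun=> f0 _)).
  - by move=> y _; exact: integral_ge0.
  apply: eq_integral => y _.
  rewrite (@ge0_integral_affine R a11 (a12 * y)
    (fun x => f (x, (a21 / a11) * x + (D / a11) * y)%R))//.
    rewrite muleA -EFinM mulVf ?normr_eq0// mul1e; apply: eq_integral => x _.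
    by congr (f (_, _)); rewrite /D; field.
  exact: (measurable_slice_fst y mh).
rewrite -(fubini_tonelli (m1 := leb) (m2 := leb) _ mh (fun=> f0 _))/=.
rewrite muleA -EFinM.
rewrite fubini_tonelli1//= -ge0_integralZl//=; last 2 first.
- exact: (measurable_fun_fubini_tonelli_F (m2 := leb) _ mh (fun=> f0 _)).
- by move=> y _; exact: integral_ge0.
apply: eq_integral => x _.
rewrite /fubini_F (@ge0_integral_affine R (D / a11) (a21 / a11 * x) (fun y => f (x, y)))//.
- congr (_ * _)%E; first by rewrite normf_div.
  by apply: eq_integral => y _; rewrite addrC.
- by rewrite mulf_neq0 ?invr_eq0.
- exact: (measurable_slice_snd x mf).
Qed.

(** The plane carries the product sigma-algebra, so an open set is written as a countable union of
    rational boxes. *)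
Lemma open_measurable_plane (U : set (plane R)) : open U -> measurable U.
Proof.
move=> oU.
pose B (i : (rat * rat) * (rat * rat)) : set (plane R) :=
  (`](ratr i.1.1 : R), ratr i.1.2[%classic) `*` (`](ratr i.2.1 : R), ratr i.2.2[%classic).
have -> : U = \bigcup_i (if `[< B i `<=` U >] then B i else set0).
  apply/seteqP; split => [x Ux|x [i _]]; last first.
    by case: asboolP => // /[apply].
  have /nbhs_ballP[e /= e0 eU] : nbhs x U by exact: open_nbhs_nbhs.
  have l (y : R) : y - e < y by rewrite ltrBlDr ltrDl.
  have r (y : R) : y < y + e by rewrite ltrDl.
  have [a1] := rat_in_itvoo (l x.1); have [a2] := rat_in_itvoo (r x.1).
  have [b1] := rat_in_itvoo (l x.2); have [b2] := rat_in_itvoo (r x.2).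
  rewrite !in_itv/= => /andP[h1 h2] /andP[h3 h4] /andP[h5 h6] /andP[h7 h8].
  exists ((a1, a2), (b1, b2)) => //; case: asboolP => [_|]; last first.
    case; rewrite /B /= => y [/=]; rewrite !in_itv/= => /andP[? ?] /andP[? ?].
    by apply: eU; split => /=; rewrite /ball/= ltr_norml; lra.
  by split => /=; rewrite in_itv/=; apply/andP.
apply: countable_bigcupT_measurable => //.
move=> i; case: ifP => // _; apply: measurableX; exact: measurable_itv.
Qed.

Lemma continuous_measurable_plane (f : plane R -> R) : continuous f ->
  measurable_fun [set: plane R] f.
Proof.
move=> cf; apply: (measurability _ (RGenOpens.measurableE R)).
move=> _ [_ [a [b ->] <-]]; rewrite setTI; apply: open_measurable_plane.
by move/continuousP : cf; apply; exact: interval_open.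
Qed.

End plane.

(** * Triangles as affine images of the reference triangle *)

Section triangle.
Context (R : realType).
Local Notation leb := (@lebesgue_measure R).
Local Notation mu2 := (plane_measure R).

Definition ref_tri : set (plane R) :=
  [set x | [/\ 0 <= x.1, 0 <= x.2 & x.1 + x.2 <= 1]].

Definition tri_map (a p q x : plane R) : plane R :=
  (a.1 + x.1 * (p.1 - a.1) + x.2 * (q.1 - a.1),
   a.2 + x.1 * (p.2 - a.2) + x.2 * (q.2 - a.2)).

Definition tri (a p q : plane R) : set (plane R) := tri_map a p q @` ref_tri.

(** Twice the signed area of the triangle, and the Jacobian of [tri_map]. *)
Definition tri_det (a p q : plane R) : R :=
  (p.1 - a.1) * (q.2 - a.2) - (q.1 - a.1) * (p.2 - a.2).

(** Barycentric coordinates by Cramer's rule, inverting [tri_map]. *)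
Definition tri_coord (a p q y : plane R) : plane R :=
  (((y.1 - a.1) * (q.2 - a.2) - (y.2 - a.2) * (q.1 - a.1)) / tri_det a p q,
   ((p.1 - a.1) * (y.2 - a.2) - (p.2 - a.2) * (y.1 - a.1)) / tri_det a p q).

Lemma tri_mapK a p q : tri_det a p q != 0 ->
  cancel (tri_map a p q) (tri_coord a p q).
Proof.
move=> d0 [x y]; rewrite /tri_coord /tri_map /=; congr pair;
  by rewrite /tri_det in d0 *; field.
Qed.

Lemma tri_coordK a p q : tri_det a p q != 0 ->
  cancel (tri_coord a p q) (tri_map a p q).
Proof.
move=> d0 [x y]; rewrite /tri_coord /tri_map /=; congr pair;
  by rewrite /tri_det in d0 *; field.
Qed.

Lemma measurable_tri_map a p q : measurable_fun [set: plane R] (tri_map a p q).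
Proof.
apply: measurable_fun_pair => /=; repeat apply: measurable_funD => //;
  by apply: measurable_funM.
Qed.

Lemma measurable_coord1 a p q :
  measurable_fun [set: plane R] (fun y => (tri_coord a p q y).1).
Proof.
apply: measurable_funM => //; apply: measurable_funB; apply: measurable_funM => //;
  exact: measurable_funB.
Qed.

Lemma continuous_lin2 (c0 c1 c2 : R) :
  continuous (fun y : plane R => c0 + c1 * y.1 + c2 * y.2).
Proof.
move=> y; apply: cvgD; [apply: cvgD; first exact: cvg_cst|];
  apply: cvgM; try exact: cvg_cst.
- exact: cvg_fst.
- exact: cvg_snd.
Qed.

Lemma continuous_tri_coord1 a p q : continuous (fun y => (tri_coord a p q y).1).
Proof.
rewrite (_ : (fun y => _) = (fun y => (a.2 * (q.1 - a.1) - a.1 * (q.2 - a.2))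
   / tri_det a p q + ((q.2 - a.2) / tri_det a p q) * y.1
   + (- (q.1 - a.1) / tri_det a p q) * y.2)); first exact: continuous_lin2.
by apply/funext => y; rewrite /tri_coord /=; ring.
Qed.

Lemma continuous_tri_coord2 a p q : continuous (fun y => (tri_coord a p q y).2).
Proof.
rewrite (_ : (fun y => _) = (fun y => (a.1 * (p.2 - a.2) - a.2 * (p.1 - a.1))
   / tri_det a p q + (- (p.2 - a.2) / tri_det a p q) * y.1
   + ((p.1 - a.1) / tri_det a p q) * y.2)); first exact: continuous_lin2.
by apply/funext => y; rewrite /tri_coord /=; ring.
Qed.

Lemma triE a p q : tri_det a p q != 0 ->
  tri a p q = [set y | ref_tri (tri_coord a p q y)].
Proof.
move=> d0; apply/seteqP; split => [_ [x xr <-]|y yr] /=.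
  by rewrite tri_mapK.
by exists (tri_coord a p q y) => //; rewrite tri_coordK.
Qed.

Lemma open_lt (f g : plane R -> R) : continuous f -> continuous g ->
  open [set x | f x < g x].
Proof.
move=> cf cg; rewrite (_ : [set x | _] = (fun x => g x - f x) @^-1` [set t | 0 < t]).
  by apply: open_comp; [move=> x _; apply: cvgB; [exact: cg|exact: cf]|exact: open_gt].
by apply/seteqP; split => x /=; rewrite subr_gt0.
Qed.

Lemma measurable_ref_tri : measurable (ref_tri : set (plane R)).
Proof.
have -> : ref_tri = ~` ([set x : plane R | x.1 < 0] `|` [set x | x.2 < 0]
    `|` [set x | 1 < x.1 + x.2]).
  apply/seteqP; split => x /=.
    by case=> h1 h2 h3 [[|]|]; rewrite ltNge ?h1 ?h2 ?h3.
  move/not_orP => [/not_orP[]] /negP; rewrite -leNgt => h1 /negP.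
  by rewrite -leNgt => h2 /negP; rewrite -leNgt.
apply: measurableC; apply: measurableU; first apply: measurableU;
  apply: open_measurable_plane; apply: open_lt; try exact: cst_continuous.
- by move=> x; exact: cvg_fst.
- by move=> x; exact: cvg_snd.
- by move=> x; apply: cvgD; [exact: cvg_fst|exact: cvg_snd].
Qed.

Definition ref_tri_int : set (plane R) :=
  [set x | [/\ 0 < x.1, 0 < x.2 & x.1 + x.2 < 1]].

Lemma measurable_ref_tri_int : measurable ref_tri_int.
Proof.
rewrite (_ : ref_tri_int = [set x : plane R | 0 < x.1] `&` ([set x | 0 < x.2]
  `&` [set x | x.1 + x.2 < 1])); last first.
  by apply/seteqP; split => [y []//|y [? []]].
apply: measurableI; [|apply: measurableI]; apply: open_measurable_plane;
  apply: open_lt; try exact: cst_continuous.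
- by move=> x; exact: cvg_fst.
- by move=> x; exact: cvg_snd.
- by move=> x; apply: cvgD; [exact: cvg_fst|exact: cvg_snd].
Qed.

Lemma ref_tri_intS : ref_tri_int `<=` ref_tri.
Proof. by move=> x [*]; split; exact: ltW. Qed.

(** Strict barycentric inequalities cut out an open subset of the triangle. What they miss is the
    boundary, which is null. *)
Lemma tri_interior a p q : tri_det a p q != 0 ->
  [set y | ref_tri_int (tri_coord a p q y)] `<=` (tri a p q)°.
Proof.
move=> d0; rewrite -open_subsetE.
  by move=> y yr; rewrite triE//; exact: ref_tri_intS.
rewrite (_ : [set y | _] = [set y | 0 < (tri_coord a p q y).1]
  `&` ([set y | 0 < (tri_coord a p q y).2]
  `&` [set y | (tri_coord a p q y).1 + (tri_coord a p q y).2 < 1])); last first.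
  by apply/seteqP; split => [y []//|y [? []]].
apply: openI; [|apply: openI]; apply: open_lt => //; try exact: cst_continuous.
- exact: continuous_tri_coord1.
- exact: continuous_tri_coord2.
- by move=> y; apply: cvgD; [exact: continuous_tri_coord1|exact: continuous_tri_coord2].
Qed.

Lemma null_sections (A : set (plane R)) : measurable A ->
  (forall x, exists z, xsection A x `<=` [set z]) -> mu2 A = 0%E.
Proof.
move=> mA h; rewrite /product_measure1 /=; apply: integral0_eq => x _ /=.
have [z hz] := h x; apply/eqP; rewrite -measure_le0 -(lebesgue_measure_set1 z).
by apply: le_measure; rewrite ?inE//; exact: measurable_xsection.
Qed.

(** The boundary lies on three lines: x = 0 is a product with a null factor, and the other two sides
    have at most one point above each abscissa. *)
Lemma ref_tri_boundary_null : mu2 (ref_tri `\` ref_tri_int) = 0%E.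
Proof.
have mi := measurable_ref_tri_int.
have m0 : measurable (ref_tri `\` ref_tri_int : set (plane R)).
  by apply: measurableD => //; exact: measurable_ref_tri.
have mN1 : measurable ([set 0] `*` setT : set (plane R)) by exact: measurableX.
pose L : set (plane R) := (ref_tri `\` ref_tri_int) `&` [set x | x.2 = 0].
pose H : set (plane R) := (ref_tri `\` ref_tri_int) `&` [set x | x.1 + x.2 = 1].
have mL : measurable L.
  apply: measurableI => //; rewrite (_ : [set x | _] = setT `*` [set 0]).
    exact: measurableX.
  by apply/seteqP; split => x /= => [->//|[_ ->]].
have mH : measurable H.
  apply: measurableI => //.
  rewrite (_ : [set x | _] = setT `&` (fun x : plane R => x.1 + x.2) @^-1` [set 1]).
    have mf : measurable_fun [set: plane R] (fun x => x.1 + x.2) by exact: measurable_funD.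
    by apply: mf.
  by rewrite setTI.
apply/eqP; rewrite -measure_le0.
apply: (@le_trans _ _ (mu2 (([set 0] `*` setT) `|` (L `|` H)))).
  apply: le_measure; rewrite ?inE//.
    by apply: measurableU => //; exact: measurableU.
  move=> [x y] [[/= h1 h2 h3] nh].
  have [->|x0] := eqVneq x 0; first by left.
  right; have [y0|y0] := eqVneq y 0; first by left; split => //; split.
  right; split; first by split.
  apply/eqP; rewrite eq_le h3 /= leNgt; apply/negP => h4; apply: nh.
  by split => //=; rewrite lt_neqAle eq_sym ?x0 ?y0.
rewrite (_ : 0 = mu2 ([set 0%R] `*` setT) + (mu2 L + mu2 H))%E.
  apply: (le_trans (measureU2 _ _ _)) => //; first exact: measurableU.
  by apply: leeD2l; exact: measureU2.
rewrite (_ : mu2 ([set 0] `*` setT) = 0%E) ?add0e; last first.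
  rewrite product_measure1E// -[RHS](mul0e (leb setT)); congr (_ * _)%E.
  exact: lebesgue_measure_set1.
rewrite !null_sections ?adde0// => x.
  exists (1 - x) => y; rewrite /xsection/= inE => -[_] /= <-; ring.
by exists 0 => y; rewrite /xsection/= inE => -[_] /= ->.
Qed.

Lemma ge0_integral_tri_map a p q (f : plane R -> \bar R) : tri_det a p q != 0 ->
  measurable_fun [set: plane R] f -> (forall x, 0 <= f x)%E ->
  (\int[mu2]_x f x = `|tri_det a p q|%:E * \int[mu2]_x f (tri_map a p q x))%E.
Proof.
move=> d0 mf f0.
have tr1 (c : R) (g : plane R -> \bar R) : measurable_fun [set: plane R] g ->
    (forall x, 0 <= g x)%E ->
    (\int[mu2]_x g x = \int[mu2]_x g (x.1 + c, x.2)%R)%E.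
  move=> mg g0.
  have mg' : measurable_fun [set: plane R] (fun x => g (x.1 + c, x.2)).
    by apply: measurableT_comp => //; apply: measurable_fun_pair => //=; exact: measurable_funD.
  rewrite !fubini_tonelli2//; apply: eq_integral => y _; rewrite /fubini_G.
  rewrite (@ge0_integral_affine R 1 c (fun x => g (x, y)))//.
    by rewrite normr1 mul1e; apply: eq_integral => x _; rewrite mul1r.
  exact: measurable_slice_fst.
have tr2 (c : R) (g : plane R -> \bar R) : measurable_fun [set: plane R] g ->
    (forall x, 0 <= g x)%E ->
    (\int[mu2]_x g x = \int[mu2]_x g (x.1, x.2 + c)%R)%E.
  move=> mg g0.
  have mg' : measurable_fun [set: plane R] (fun x => g (x.1, x.2 + c)).
    by apply: measurableT_comp => //; apply: measurable_fun_pair => //=; exact: measurable_funD.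
  rewrite !fubini_tonelli1//; apply: eq_integral => y _; rewrite /fubini_F.
  rewrite (@ge0_integral_affine R 1 c (fun x => g (y, x)))//.
    by rewrite normr1 mul1e; apply: eq_integral => x _; rewrite mul1r.
  exact: measurable_slice_snd.
have m1 : measurable_fun [set: plane R] (fun x => f (x.1, x.2 + a.2)).
  by apply: measurableT_comp => //; apply: measurable_fun_pair => //=; exact: measurable_funD.
have m2 : measurable_fun [set: plane R] (fun x => f (x.1 + a.1, x.2 + a.2)).
  by apply: measurableT_comp => //; apply: measurable_fun_pair => //=; exact: measurable_funD.
rewrite (tr2 a.2)// (tr1 a.1)//=.
rewrite (@ge0_integral_linear R (p.1 - a.1) (q.1 - a.1) (p.2 - a.2) (q.2 - a.2))//.
congr (_ * _)%E; apply: eq_integral => x _ /=; congr (f (_, _)); ring.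
Qed.

Lemma tri_open_measurable a p q : measurable ((tri a p q)°).
Proof. by apply: open_measurable_plane; exact: open_interior. Qed.

Lemma measurable_tri a p q : tri_det a p q != 0 -> measurable (tri a p q).
Proof.
move=> d0; rewrite triE//.
rewrite (_ : [set y | _] = setT `&` (tri_coord a p q @^-1` ref_tri)).
  have mt : measurable_fun [set: plane R] (tri_coord a p q).
    apply: measurable_fun_pair; apply: continuous_measurable_plane.
      exact: continuous_tri_coord1.
    exact: continuous_tri_coord2.
  by apply: mt => //; exact: measurable_ref_tri.
by rewrite setTI.
Qed.

(** Mesh cells are open, so the integral is over the interior. Its preimage is the reference
    triangle up to the null boundary. *)
Lemma ge0_integral_tri a p q (f : plane R -> \bar R) : tri_det a p q != 0 ->
  measurable_fun [set: plane R] f -> (forall x, 0 <= f x)%E ->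
  (\int[mu2]_(x in (tri a p q)°) f x =
   `|tri_det a p q|%:E * \int[mu2]_(x in ref_tri) f (tri_map a p q x))%E.
Proof.
move=> d0 mf f0.
have mD := tri_open_measurable a p q.
have mi : measurable_fun [set: plane R] (f \_ ((tri a p q)°)).
  by apply/(measurable_restrictT _ mD); exact: measurable_funS mf.
rewrite integral_mkcond (@ge0_integral_tri_map a p q)//; last first.
  by move=> x; rewrite patchE; case: ifP.
congr (_ * _)%E; rewrite [RHS]integral_mkcond.
have mt := measurable_tri_map a p q.
apply: ge0_ae_eq_integral => //.
- exact: measurableT_comp.
- apply/(measurable_restrictT _ measurable_ref_tri).
  by apply: measurable_funS (measurableT_comp mf mt).
- by move=> x _; rewrite patchE; case: ifP.
- by move=> x _; rewrite patchE; case: ifP.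
exists (ref_tri `\` ref_tri_int); split.
- by apply: measurableD; [exact: measurable_ref_tri|exact: measurable_ref_tri_int].
- exact: ref_tri_boundary_null.
move=> x /= h; apply: contrapT => nx; apply: h => _.
rewrite !patchE; have [xr|xr] := pselect (ref_tri x).
  have xi : ref_tri_int x by apply: contrapT => xi; exact: nx.
  rewrite (mem_set xr) mem_set//; apply: tri_interior => //=.
  by rewrite tri_mapK.
rewrite [in RHS]memNset// memNset// => /interior_subset.
by rewrite triE//= tri_mapK.
Qed.

(** The indicator of the boundary, pulled back by [tri_map], vanishes off the null boundary of the
    reference triangle. *)
Lemma tri_boundary_null a p q : tri_det a p q != 0 ->
  mu2 (tri a p q `\` (tri a p q)°) = 0%E.
Proof.
move=> d0; have mt := measurable_tri d0; have mD := tri_open_measurable a p q.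
have mB : measurable (tri a p q `\` (tri a p q)°) by exact: measurableD.
have := @ge0_integral_tri_map a p q (fun x => (\1_(tri a p q `\` (tri a p q)°) x)%:E) d0.
rewrite integral_indic// setIT => ->//; last first.
  by apply/measurable_EFinP; exact: measurable_indic.
have mN : measurable (ref_tri `\` ref_tri_int : set (plane R)).
  by apply: measurableD; [exact: measurable_ref_tri|exact: measurable_ref_tri_int].
rewrite (_ : (\int[mu2]_x _)%E = 0%E) ?mule0//.
rewrite -[RHS](@integral0 _ _ _ mu2 setT).
apply: ge0_ae_eq_integral => //.
  apply/measurable_EFinP.
  pose g : plane R -> R := \1_(tri a p q `\` (tri a p q)°).
  have mg : measurable_fun [set: plane R] g by exact: measurable_indic.
  exact: (measurableT_comp mg (measurable_tri_map a p q)).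
exists (ref_tri `\` ref_tri_int); split => //; first exact: ref_tri_boundary_null.
move=> x /= h; apply: contrapT => nx; apply: h => _.
congr EFin; rewrite indicE memNset// => -[]; rewrite {1}triE//= tri_mapK// => xr; apply.
by apply: tri_interior => //=; rewrite tri_mapK//; apply: contrapT => xi; exact: nx.
Qed.

End triangle.

(* The plane with the Borel structure carried by [plane_measure R]. *)
Notation mplane R := (measurableTypeR R * measurableTypeR R)%type (only parsing).

Lemma L2E (R : realType) (D : set (plane R)) (f : plane R -> R) :
  L2 D f <-> sq_int (plane_measure R) D f.
Proof. by []. Qed.

Lemma continuous_sqr (T : topologicalType) (R : realType) (f : T -> R) :
  continuous f -> continuous (fun s => f s ^+ 2).
Proof. by move=> cf s; apply: cvgM; exact: cf. Qed.

(** * Calculus on an interval *)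

Section calculus.
Context (R : realType).
Local Notation leb := (@lebesgue_measure R).
Local Notation mu2 := (plane_measure R).
Local Notation U := (`[(0 : R), 1]%classic).

Lemma integrable_itv_continuous (f : R -> R) (a b : R) : continuous f ->
  leb.-integrable `[a, b] (EFin \o f).
Proof.
move=> cf; apply: continuous_compact_integrable; first exact: segment_compact.
exact: continuous_subspaceT.
Qed.

Lemma continuous_derivable (f df : R -> R) :
  (forall s : R, is_derive s (1 : R) f (df s)) -> continuous f.
Proof.
move=> h s; apply/differentiable_continuous/derivable1_diffP.
by have [] := h s.
Qed.

Lemma FTC_itv (f df : R -> R) (a b : R) : a <= b ->
  (forall s : R, is_derive s (1 : R) f (df s)) -> continuous df ->
  \int[leb]_(s in `[a, b]) df s = f b - f a.
Proof.
rewrite le_eqVlt => /predU1P[->|ab] h cdf.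
  by rewrite set_itv1 Rintegral_set1 subrr.
rewrite /Rintegral (@continuous_FTC2 _ df f)//=.
- exact: continuous_subspaceT.
- have cf := continuous_derivable h.
  split; [move=> s _; by have [] := h s| |].
    by apply: cvg_at_right_filter; exact: cf.
  by apply: cvg_at_left_filter; exact: cf.
- by move=> s _; rewrite derive1E; apply: derive_val.
Qed.

Lemma sq_int_itv (f : R -> R) (a b : R) : continuous f -> sq_int leb `[a, b] f.
Proof.
move=> cf; apply: sq_int_of_integrable => //.
  apply: measurable_funTS; exact: continuous_measurable_fun.
apply: integrable_itv_continuous; exact: continuous_sqr.
Qed.

Lemma lebesgue_measure_cc (a b : R) : a <= b -> leb `[a, b] = (b - a)%:E.
Proof.
move=> ab; rewrite lebesgue_measure_itv/= lte_fin.
by move: ab; rewrite le_eqVlt => /predU1P[->|->//]; rewrite ltxx subrr.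
Qed.

Lemma Rintegral_cst_cc (a b c : R) : a <= b ->
  \int[leb]_(_ in `[a, b]) c = c * (b - a).
Proof.
move=> ab; rewrite Rintegral_cst//; congr (_ * _).
by rewrite -[RHS]/(fine (b - a)%:E) -lebesgue_measure_cc.
Qed.

Lemma dot_one (a b : R) : a <= b -> dot leb `[a, b] (cst 1) (cst 1) = b - a.
Proof. by move=> ab; rewrite /dot /= mulr1 Rintegral_cst_cc// mul1r. Qed.

(* Cauchy-Schwarz on an interval of length at most 1. *)
Lemma sq_Rintegral_le (f : R -> R) (a b : R) : a <= b -> b - a <= 1 ->
  sq_int leb `[a, b] f ->
  (\int[leb]_(s in `[a, b]) f s) ^+ 2 <= \int[leb]_(s in `[a, b]) (f s) ^+ 2.
Proof.
move=> ab ab1 hf; have m : measurable (`[a, b]%classic : set (measurableTypeR R)) by [].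
have h1 : sq_int leb `[a, b] (cst 1) by apply: sq_int_itv; exact: cst_continuous.
have := dot_CS m hf h1; rewrite dot_one// /dot.
under eq_Rintegral do rewrite mulr1.
under [X in _ <= X * _]eq_Rintegral do rewrite -expr2.
have : 0 <= \int[leb]_(x in `[a, b]) (f x ^+ 2).
  by apply: Rintegral_ge0 => x _; exact: sqr_ge0.
move: (Rintegral _ _ _) (Rintegral _ _ _) => A B B0.
by move/le_trans; apply; rewrite ler_piMr.
Qed.

(** Fundamental theorem of calculus and Cauchy-Schwarz. Length at most 1 removes the length factor,
    and enlarging the interval to [c, d] makes the right side independent of the two points. *)
Lemma sqdiff_le (f df : R -> R) (c d a b : R) : 0 <= d - c <= 1 ->
  (forall s : R, is_derive s (1 : R) f (df s)) -> continuous df ->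
  c <= a <= d -> c <= b <= d ->
  (f b - f a) ^+ 2 <= \int[leb]_(s in `[c, d]) (df s) ^+ 2.
Proof.
move=> /andP[cd0 cd1] h cdf.
wlog ab : a b / a <= b.
  move=> H ha hb; have [/H|/ltW/H] := leP a b; first exact.
  by rewrite -sqrrN opprB; exact.
move=> /andP[ca ad] /andP[cb bd].
rewrite -(FTC_itv ab h cdf).
have cdf2 : continuous (fun s => df s ^+ 2).
  exact: continuous_sqr.
apply: (le_trans (sq_Rintegral_le ab _ _)); first by lra.
  exact: sq_int_itv.
apply: fine_le; [exact: integrable_fin_num (integrable_itv_continuous _ _ cdf2)..|].
apply: ge0_subset_integral => //.
- apply/measurable_EFinP; apply: measurable_funTS; exact: continuous_measurable_fun.
- by move=> x _; rewrite lee_fin sqr_ge0.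
- by apply: subset_itv; rewrite bnd_simp.
Qed.

End calculus.

(** * Integration over the reference triangle by slices *)

Section ref_triangle.
Context (R : realType).
Local Notation leb := (@lebesgue_measure R).
Local Notation mu2 := (plane_measure R).
Local Notation U := (`[(0 : R), 1]%classic).

Lemma ref_tonelli2 (g : plane R -> \bar R) : measurable_fun [set: plane R] g ->
  (forall x, 0 <= g x)%E ->
  (\int[mu2]_(x in @ref_tri R) g x =
   \int[leb]_(y in U) \int[leb]_(x in `[0%R, (1 - y)%R]) g (x, y))%E /\
  measurable_fun U (fun y => \int[leb]_(x in `[0%R, (1 - y)%R]) g (x, y))%E.
Proof.
move=> mg g0.
have mr : measurable_fun [set: plane R] (g \_ (@ref_tri R)).
  by apply/(measurable_restrictT _ (@measurable_ref_tri R)); exact: measurable_funS mg.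
have r0 x : (0 <= (g \_ (@ref_tri R)) x)%E by rewrite patchE; case: ifP.
have e (y : R) : U y -> fubini_G leb (g \_ (@ref_tri R)) y =
   (\int[leb]_(x in `[0%R, (1 - y)%R]) g (x, y))%E.
  rewrite /= in_itv/= => /andP[y0 y1]; rewrite /fubini_G [RHS]integral_mkcond.
  apply: eq_integral => x _; rewrite !patchE; congr (if _ then _ else _).
  apply/idP/idP; rewrite !inE/= in_itv/=.
    by case=> /= -> _ ?; lra.
  by move=> /andP[? ?]; split => //=; lra.
split.
  rewrite integral_mkcond fubini_tonelli2// [RHS]integral_mkcond.
  apply: eq_integral => y _; rewrite patchE; case: ifPn => [|yU].
    by rewrite inE => /e.
  rewrite /fubini_G integral0_eq// => x _; rewrite patchE; case: ifPn => //.
  rewrite inE => -[/= h1 h2 h3]; exfalso; move: yU.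
  by rewrite notin_setE/= in_itv/= h2/=; lra.
apply: (eq_measurable_fun (fubini_G leb (g \_ (@ref_tri R)))).
  by move=> y; rewrite inE => /e.
apply: measurable_funTS; exact: measurable_fun_fubini_tonelli_G.
Qed.

Lemma ref_tonelli1 (g : plane R -> \bar R) : measurable_fun [set: plane R] g ->
  (forall x, 0 <= g x)%E ->
  (\int[mu2]_(x in @ref_tri R) g x =
   \int[leb]_(x in U) \int[leb]_(y in `[0%R, (1 - x)%R]) g (x, y))%E /\
  measurable_fun U (fun x => \int[leb]_(y in `[0%R, (1 - x)%R]) g (x, y))%E.
Proof.
move=> mg g0.
have mr : measurable_fun [set: plane R] (g \_ (@ref_tri R)).
  by apply/(measurable_restrictT _ (@measurable_ref_tri R)); exact: measurable_funS mg.
have r0 x : (0 <= (g \_ (@ref_tri R)) x)%E by rewrite patchE; case: ifP.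
have e (x : R) : U x -> fubini_F leb (g \_ (@ref_tri R)) x =
   (\int[leb]_(y in `[0%R, (1 - x)%R]) g (x, y))%E.
  rewrite /= in_itv/= => /andP[y0 y1]; rewrite /fubini_F [RHS]integral_mkcond.
  apply: eq_integral => y _; rewrite !patchE; congr (if _ then _ else _).
  apply/idP/idP; rewrite !inE/= in_itv/=.
    by case=> /= _ -> ?; lra.
  by move=> /andP[? ?]; split => //=; lra.
split.
  rewrite integral_mkcond fubini_tonelli1// [RHS]integral_mkcond.
  apply: eq_integral => y _; rewrite patchE; case: ifPn => [|yU].
    by rewrite inE => /e.
  rewrite /fubini_F integral0_eq// => x _; rewrite patchE; case: ifPn => //.
  rewrite inE => -[/= h1 h2 h3]; exfalso; move: yU.
  by rewrite notin_setE/= in_itv/= h1/=; lra.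
apply: (eq_measurable_fun (fubini_F leb (g \_ (@ref_tri R)))).
  by move=> y; rewrite inE => /e.
apply: measurable_funTS; exact: measurable_fun_fubini_tonelli_F.
Qed.

End ref_triangle.

Section bounded_domains.
Context (R : realType).
Local Notation leb := (@lebesgue_measure R).
Local Notation mu2 := (plane_measure R).

Definition box (N : R) : set (plane R) := `[- N, N]%classic `*` `[- N, N]%classic.

Lemma box_finite (N : R) : (mu2 (box N) < +oo)%E.
Proof.
rewrite /box product_measure1E//.
have fi : (leb (`[(- N)%R, N]%classic) < +oo)%E.
  by rewrite lebesgue_measure_itv/=; case: ifP => _; rewrite ?ltry// -EFinD ltry.
by apply: lte_mul_pinfty => //; rewrite ge0_fin_numE.
Qed.

Lemma continuous_box_bounded (f : plane R -> R) (N : R) : continuous f ->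
  exists M, forall x, box N x -> `|f x| <= M.
Proof.
move=> cf.
have cb : compact (f @` box N).
  apply: continuous_compact; first exact: continuous_subspaceT.
  by apply: compact_setX; exact: segment_compact.
have [M [_ hM]] := compact_bounded cb.
by exists (M + 1) => x xN; apply: (hM (M + 1)); [rewrite ltrDl|exists x].
Qed.

Lemma continuous_sq_int (D : set (plane R)) (N : R) (f : plane R -> R) :
  measurable (D : set (mplane R)) -> D `<=` box N -> continuous f -> sq_int mu2 D f.
Proof.
move=> mD DN cf.
have mB : measurable (box N : set (mplane R)) by apply: measurableX; exact: measurable_itv.
apply: (sq_intS mB) => //.
have [M hM] := continuous_box_bounded N cf.
have mf : measurable_fun (box N) f.
  by apply: measurable_funTS; exact: continuous_measurable_plane.
apply: sq_int_of_integrable => //.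
apply: measurable_bounded_integrable => //; first exact: box_finite.
  exact: measurable_funX.
exists (M ^+ 2); split; first exact: num_real.
move=> y My x xN /=; apply: le_trans (ltW My).
by rewrite normrX lerXn2r ?nnegrE ?(le_trans _ (hM x xN))//; exact: hM.
Qed.

End bounded_domains.

Section ref_iterated.
Context (R : realType).
Local Notation leb := (@lebesgue_measure R).
Local Notation mu2 := (plane_measure R).
Local Notation U := (`[(0 : R), 1]%classic).
Local Notation refT := (@ref_tri R).

Lemma ref_tri_box : refT `<=` box 1.
Proof.
move=> x [h1 h2 h3]; split; rewrite /= in_itv/=; apply/andP; split; lra.
Qed.

Lemma integrable_ref_tri (f : plane R -> R) : continuous f ->
  mu2.-integrable refT (EFin \o f).
Proof.
move=> cf.
have mr : measurable (refT : set (mplane R)) := @measurable_ref_tri R.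
have h1 := continuous_sq_int mr ref_tri_box cf.
have h2 : sq_int mu2 refT (cst 1).
  by apply: continuous_sq_int mr ref_tri_box _; exact: cst_continuous.
by have := sq_intM mr h1 h2; apply: eq_integrable => // x _ /=; rewrite mulr1.
Qed.

Lemma continuous_slice_fst (f : plane R -> R) (y : R) :
  continuous f -> continuous (fun x => f (x, y)).
Proof.
move=> cf x; apply: (@continuous2_cvg _ _ _ _ _ _ id (cst y) (fun a b => f (a, b))).
- by rewrite (_ : (fun z => f (z.1, z.2)) = f); [exact: cf|apply/funext => -[]].
- exact: cvg_id.
- exact: cvg_cst.
Qed.

Lemma continuous_slice_snd (f : plane R -> R) (x : R) :
  continuous f -> continuous (fun y => f (x, y)).
Proof.
move=> cf y; apply: (@continuous2_cvg _ _ _ _ _ _ (cst x) id (fun a b => f (a, b))).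
- by rewrite (_ : (fun z => f (z.1, z.2)) = f); [exact: cf|apply/funext => -[]].
- exact: cvg_cst.
- exact: cvg_id.
Qed.

(** Positive and negative parts are written through the absolute value, so that they inherit
    continuity. *)
Let pos (f : plane R -> R) := fun z => 2^-1 * (`|f z| + f z).
Let neg (f : plane R -> R) := fun z => 2^-1 * (`|f z| - f z).

Let pos_ge0 f z : 0 <= pos f z.
Proof. by rewrite /pos; have := ler_norm (- f z); rewrite normrN; lra. Qed.
Let neg_ge0 f z : 0 <= neg f z.
Proof. by rewrite /neg; have := ler_norm (f z); lra. Qed.
Let posB f z : f z = pos f z - neg f z.
Proof. by rewrite /pos/neg; lra. Qed.
Let pos_cont f : continuous f -> continuous (pos f).
Proof.
move=> cf z; apply: cvgM; first exact: cvg_cst.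
by apply: cvgD; [apply: cvg_norm; exact: cf|exact: cf].
Qed.
Let neg_cont f : continuous f -> continuous (neg f).
Proof.
move=> cf z; apply: cvgM; first exact: cvg_cst.
by apply: cvgB; [apply: cvg_norm; exact: cf|exact: cf].
Qed.

(** Tonelli for nonnegative f; a continuous f is the difference of its positive and negative parts.
    Integrability of the slice integrals is recorded because pointwise bounds are later integrated
    over the height. *)
Lemma ref_iter2 (f : plane R -> R) : continuous f ->
  leb.-integrable U (fun y => (\int[leb]_(x in `[0, 1 - y]) f (x, y))%:E) /\
  \int[mu2]_(z in refT) f z = \int[leb]_(y in U) \int[leb]_(x in `[0, 1 - y]) f (x, y).
Proof.
wlog f0 : f / forall z, 0 <= f z.
  move=> H cf.
  have [i1 e1] := H _ (pos_ge0 f) (pos_cont cf).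
  have [i2 e2] := H _ (neg_ge0 f) (neg_cont cf).
  have e y : \int[leb]_(x in `[0, 1 - y]) f (x, y) =
     \int[leb]_(x in `[0, 1 - y]) pos f (x, y) -
     \int[leb]_(x in `[0, 1 - y]) neg f (x, y).
    rewrite -RintegralB//.
    - by apply: eq_Rintegral => x _; rewrite posB.
    - by apply/integrable_itv_continuous/continuous_slice_fst/pos_cont.
    - by apply/integrable_itv_continuous/continuous_slice_fst/neg_cont.
  have mU : measurable (U : set (measurableTypeR R)) by [].
  split.
    apply: eq_integrable (integrableB mU i1 i2) => // y _ /=.
    by rewrite e.
  under eq_Rintegral do rewrite posB.
  rewrite RintegralB//; [|exact: measurable_ref_tri|exact/integrable_ref_tri/pos_cont
    |exact/integrable_ref_tri/neg_cont].
  rewrite e1 e2 -RintegralB//.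
  by apply: eq_Rintegral => y _; rewrite e.
move=> cf.
have mf : measurable_fun [set: plane R] (EFin \o f).
  by apply/measurable_EFinP; exact: continuous_measurable_plane.
have [e mF] := ref_tonelli2 mf (fun z => (f0 z : (0 <= (f z)%:E)%E)).
have fin y : (\int[leb]_(x in `[0%R, (1 - y)%R]) (EFin \o f) (x, y) =
   (\int[leb]_(x in `[0%R, (1 - y)%R]) f (x, y))%:E)%E.
  rewrite /Rintegral fineK//.
  apply: integrable_fin_num => //.
  exact/integrable_itv_continuous/continuous_slice_fst.
have hI : leb.-integrable U (fun y => (\int[leb]_(x in `[0, 1 - y]) f (x, y))%:E).
  apply/integrableP; split.
    by apply: eq_measurable_fun mF => y _; rewrite fin.
  rewrite (_ : (\int[leb]_(y in U) _)%E = (\int[mu2]_(z in refT) (f z)%:E)%E).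
    by apply: (@integrable_lty _ _ _ mu2); [exact: measurable_ref_tri|exact: integrable_ref_tri].
  rewrite e; apply: eq_integral => y _; rewrite fin gee0_abs// lee_fin.
  by apply: Rintegral_ge0 => x _.
split => //; rewrite /Rintegral e; congr fine.
by apply: eq_integral => y _; rewrite fin.
Qed.

Lemma ref_iter1 (f : plane R -> R) : continuous f -> (forall z, 0 <= f z) ->
  leb.-integrable U (fun x => (\int[leb]_(y in `[0, 1 - x]) f (x, y))%:E) /\
  \int[mu2]_(z in refT) f z = \int[leb]_(x in U) \int[leb]_(y in `[0, 1 - x]) f (x, y).
Proof.
move=> cf f0.
have mf : measurable_fun [set: plane R] (EFin \o f).
  by apply/measurable_EFinP; exact: continuous_measurable_plane.
have [e mF] := ref_tonelli1 mf (fun z => (f0 z : (0 <= (f z)%:E)%E)).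
have fin x : (\int[leb]_(y in `[0%R, (1 - x)%R]) (EFin \o f) (x, y) =
   (\int[leb]_(y in `[0%R, (1 - x)%R]) f (x, y))%:E)%E.
  rewrite /Rintegral fineK//.
  apply: integrable_fin_num => //.
  exact/integrable_itv_continuous/continuous_slice_snd.
have hI : leb.-integrable U (fun x => (\int[leb]_(y in `[0, 1 - x]) f (x, y))%:E).
  apply/integrableP; split.
    by apply: eq_measurable_fun mF => y _; rewrite fin.
  rewrite (_ : (\int[leb]_(y in U) _)%E = (\int[mu2]_(z in refT) (f z)%:E)%E).
    by apply: (@integrable_lty _ _ _ mu2); [exact: measurable_ref_tri|exact: integrable_ref_tri].
  rewrite e; apply: eq_integral => y _; rewrite fin gee0_abs// lee_fin.
  by apply: Rintegral_ge0 => x _.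
split => //; rewrite /Rintegral e; congr fine.
by apply: eq_integral => y _; rewrite fin.
Qed.

(** Substitution y -> 1 - y, which aligns the vertical slice at abscissa 1 - y with the horizontal
    slice at height y. *)
Lemma Rintegral_flip (h : R -> R) : leb.-integrable U (EFin \o h) ->
  (forall y, 0 <= h y) ->
  leb.-integrable U (fun y => (h (1 - y))%:E) /\
  \int[leb]_(y in U) h (1 - y) = \int[leb]_(y in U) h y.
Proof.
move=> ih h0.
have mU : measurable (U : set (measurableTypeR R)) by [].
have mh := measurable_int _ ih.
have mr : measurable_fun [set: R] ((EFin \o h) \_ U).
  by apply/(measurable_restrictT _ mU).
have r0 x : (0 <= ((EFin \o h) \_ U) x)%E by rewrite patchE; case: ifP => // _; rewrite lee_fin.
have n1 : (-1 : R) != 0 by rewrite oppr_eq0 oner_eq0.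
have ee y : ((EFin \o h) \_ U) (- 1 * y + 1) = ((fun y => (h (1 - y))%:E) \_ U) y.
  rewrite !patchE /= (_ : -1 * y + 1 = 1 - y); last by ring.
  congr (if _ then _ else _); apply/idP/idP; rewrite !inE/= !in_itv/=;
    move=> /andP[? ?]; apply/andP; split; lra.
have e := ge0_integral_affine 1 n1 mr r0.
rewrite normrN1 mul1e in e.
have e' : (\int[leb]_(y in U) (h (1 - y))%:E = \int[leb]_(y in U) (h y)%:E)%E.
  rewrite integral_mkcond [RHS]integral_mkcond e.
  by apply: eq_integral => y _; rewrite ee.
split; last by rewrite /Rintegral e'.
apply/integrableP; split.
  apply/(measurable_restrictT _ mU).
  rewrite (_ : _ \_ _ = ((EFin \o h) \_ U) \o (fun y => -1 * y + 1)).
    by apply: measurableT_comp mr _; exact: measurable_affine.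
  by apply/funext => y /=; rewrite ee.
under eq_integral do rewrite gee0_abs ?lee_fin//.
by rewrite e'; apply: (@integrable_lty _ _ _ leb).
Qed.

Lemma ref_tri_area : \int[mu2]_(z in refT) (1 : R) = 2^-1.
Proof.
have c1 : continuous (cst 1 : plane R -> R) by move=> x; exact: cvg_cst.
have [_ ->] := ref_iter2 c1.
rewrite (@eq_Rintegral _ _ _ leb U (fun y => 1 - y)); last first.
  move=> y; rewrite inE/= in_itv/= => /andP[? ?].
  by rewrite Rintegral_cst_cc; [ring|lra].
have d (s : R) : is_derive s (1 : R) (fun y : R => y - 2^-1 * y ^+ 2) (1 - s).
  by apply: is_derive_eq; rewrite /GRing.scale/=; field.
have c : continuous (fun y : R => 1 - y).
  by move=> s; apply: cvgB; [exact: cvg_cst|exact: cvg_id].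
by rewrite (FTC_itv ler01 d c) expr1n expr0n/=; field.
Qed.

End ref_iterated.

(** * Poincare, trace and Green formulas on the reference triangle *)

Section ref_poincare.
Context (R : realType).
Local Notation leb := (@lebesgue_measure R).
Local Notation mu2 := (plane_measure R).
Local Notation U := (`[(0 : R), 1]%classic).
Local Notation refT := (@ref_tri R).
Variables W W1 W2 : plane R -> R.
Hypothesis cW : continuous W.
Hypothesis cW1 : continuous W1.
Hypothesis cW2 : continuous W2.
Hypothesis dW1 : forall y s : R, is_derive s (1 : R) (fun t => W (t, y)) (W1 (s, y)).
Hypothesis dW2 : forall x s : R, is_derive s (1 : R) (fun t => W (x, t)) (W2 (x, s)).

Let Q1 y := \int[leb]_(s in `[0, 1 - y]) (W1 (s, y)) ^+ 2.
Let Q2 x := \int[leb]_(s in `[0, 1 - x]) (W2 (x, s)) ^+ 2.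
(** Energy of the two slices that meet at the point (1 - y, y) of the slanted side; its integral
    over y is the whole Dirichlet energy [grad2]. *)
Let k y := Q1 y + Q2 (1 - y).
Let A y := W (0, y).
Let grad2 := \int[mu2]_(z in refT) (W1 z) ^+ 2 + \int[mu2]_(z in refT) (W2 z) ^+ 2.
Let m := \int[leb]_(y in U) A y.

Let mU : measurable (U : set (measurableTypeR R)). Proof. by []. Qed.
Let mT : measurable (refT : set (mplane R)). Proof. exact: measurable_ref_tri. Qed.

Let Q1_ge0 y : 0 <= Q1 y.
Proof. by apply: Rintegral_ge0 => x _; exact: sqr_ge0. Qed.
Let Q2_ge0 y : 0 <= Q2 y.
Proof. by apply: Rintegral_ge0 => x _; exact: sqr_ge0. Qed.
Let k_ge0 y : 0 <= k y. Proof. by rewrite /k; have := Q1_ge0 y; have := Q2_ge0 (1 - y); lra. Qed.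

Let k_int : leb.-integrable U (EFin \o k) /\ \int[leb]_(y in U) k y = grad2.
Proof.
have [i1 e1] := ref_iter2 (continuous_sqr cW1).
have [i2 e2] := ref_iter1 (continuous_sqr cW2) (fun z => sqr_ge0 _).
have [i3 e3] := Rintegral_flip i2 Q2_ge0.
split.
  by apply: eq_integrable (integrableD mU i1 i3) => // y _.
by rewrite /grad2 e1 e2 -e3 -RintegralD.
Qed.

Let Q1P x x' y : 0 <= y -> 0 <= x -> 0 <= x' -> x + y <= 1 -> x' + y <= 1 ->
  (W (x, y) - W (x', y)) ^+ 2 <= Q1 y.
Proof.
move=> y0 x0 x'0 xy x'y; apply: (@sqdiff_le R (fun t => W (t, y)) (fun t => W1 (t, y))) => //.
- by apply/andP; split; lra.
- exact: continuous_slice_fst.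
- by apply/andP; split; lra.
- by apply/andP; split; lra.
Qed.

Let Q2P x y y' : 0 <= x -> 0 <= y -> 0 <= y' -> x + y <= 1 -> x + y' <= 1 ->
  (W (x, y) - W (x, y')) ^+ 2 <= Q2 x.
Proof.
move=> x0 y0 y'0 xy xy'; apply: (@sqdiff_le R (fun t => W (x, t)) (fun t => W2 (x, t))) => //.
- by apply/andP; split; lra.
- exact: continuous_slice_snd.
- by apply/andP; split; lra.
- by apply/andP; split; lra.
Qed.

(* For y' <= y, walk horizontally from (0, y) to the slanted side, then down it
   vertically to height y', then horizontally back to (0, y'). *)
Let edgeP y y' : U y -> U y' -> (A y - A y') ^+ 2 <= 3 * (k y + k y').
Proof.
wlog yy : y y' / y' <= y.
  move=> H hy hy'; have [/ltW/H h|/H] := ltP y y'; last exact.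
  by rewrite -sqrrN opprB (addrC (k y)); exact: h.
rewrite /= !in_itv/= => /andP[y0 y1] /andP[y'0 y'1].
have h1 : (A y - W (1 - y, y)) ^+ 2 <= Q1 y by apply: Q1P; lra.
have h2 : (W (1 - y, y) - W (1 - y, y')) ^+ 2 <= Q2 (1 - y) by apply: Q2P; lra.
have h3 : (W (1 - y, y') - A y') ^+ 2 <= Q1 y' by apply: Q1P; lra.
have h4 := Q2_ge0 (1 - y').
apply: (@le_trans _ _ (3 * (Q1 y + Q2 (1 - y) + Q1 y'))); last by rewrite /k; lra.
move: h1 h2 h3; move: (A y) (W (1 - y, y)) (W (1 - y, y')) (A y') => a b c d h1 h2 h3.
have := sqr_ge0 ((a - b) - (b - c)); have := sqr_ge0 ((b - c) - (c - d)).
by have := sqr_ge0 ((a - b) - (c - d)); nra.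
Qed.

(** Step horizontally to (0, y), then move along the edge by [edgeP]: the bound is 2 Q1 y + 6 (k y +
    k y'). *)
Let pointP x y y' : refT (x, y) -> U y' -> (W (x, y) - A y') ^+ 2 <= 8 * k y + 6 * k y'.
Proof.
move=> [/= x0 y0 xy] hy'; have hy : U y by rewrite /= in_itv/=; apply/andP; split; lra.
have h1 : (W (x, y) - A y) ^+ 2 <= Q1 y by apply: Q1P; lra.
have h2 := edgeP hy hy'; have h3 := Q2_ge0 (1 - y).
have h4 : Q1 y <= k y by rewrite /k; lra.
move: h1 h2 h4; move: (W (x, y)) (A y) (A y') (Q1 y) (k y) (k y') => a b c q k1 k2 *.
have := sqr_ge0 ((a - b) - (b - c)); nra.
Qed.

Let cA : continuous A. Proof. exact: continuous_slice_snd. Qed.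

Let grad2_ge0 : 0 <= grad2.
Proof. by apply: addr_ge0; apply: Rintegral_ge0 => z _; exact: sqr_ge0. Qed.

Let int_aff (a b : R) : leb.-integrable U (fun y => (a * k y + b)%:E).
Proof.
have [ik _] := k_int; have ic : leb.-integrable U (EFin \o cst b).
  by apply: integrable_itv_continuous; exact: cst_continuous.
exact: eq_integrable (integrableD mU (integrableZl mU a ik) ic).
Qed.

Let Rint_aff (a b : R) : \int[leb]_(y in U) (a * k y + b) = a * grad2 + b.
Proof.
have [ik ek] := k_int; rewrite RintegralD//.
- by rewrite Rintegral_cst_cc ?ler01// RintegralZl// ek subr0 mulr1.
- exact: (integrableZl mU a ik).
- by apply: integrable_itv_continuous; exact: cst_continuous.
Qed.

(** Average of [pointP] over y', the square passing under the integral by Cauchy-Schwarz. *)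
Let meanP x y : refT (x, y) -> (W (x, y) - m) ^+ 2 <= 8 * k y + 6 * grad2.
Proof.
move=> xyT; have [ik ek] := k_int.
have iA := integrable_itv_continuous 0 1 cA.
have cB : continuous (fun y' => W (x, y) - A y').
  by move=> t; apply: cvgB; [exact: cvg_cst|exact: cA].
have -> : W (x, y) - m = \int[leb]_(y' in U) (W (x, y) - A y').
  rewrite RintegralB//.
    by rewrite Rintegral_cst_cc ?ler01// subr0 mulr1.
  by apply: integrable_itv_continuous; exact: cst_continuous.
apply: (le_trans (sq_Rintegral_le _ _ _)); rewrite ?subr0//.
  exact: sq_int_itv.
rewrite addrC -Rint_aff; apply: le_Rintegral => //.
- exact/integrable_itv_continuous/continuous_sqr.
- exact: int_aff.
- by move=> y' y'U; rewrite [leRHS]addrC; exact: pointP.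
Qed.

Let ref_int_le (f : plane R -> R) (a b : R) : continuous f -> 0 <= a -> 0 <= b ->
  (forall x y, refT (x, y) -> f (x, y) <= a * k y + b) ->
  \int[mu2]_(z in refT) f z <= a * grad2 + b.
Proof.
move=> cf a0 b0 h; have [i ->] := ref_iter2 cf; rewrite -Rint_aff.
apply: le_Rintegral => //; first exact: int_aff.
move=> y; rewrite /= in_itv/= => /andP[y0 y1].
have k0 := k_ge0 y.
apply: (@le_trans _ _ (\int[leb]_(x in `[0, 1 - y]) (a * k y + b))); last first.
  rewrite Rintegral_cst_cc ?subr_ge0// ler_piMr//; last by lra.
  by rewrite addr_ge0// mulr_ge0.
apply: le_Rintegral => //.
- exact/integrable_itv_continuous/continuous_slice_fst.
- by apply: integrable_itv_continuous; exact: cst_continuous.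
- move=> x; rewrite /= in_itv/= => /andP[x0 x1]; apply: h; split => //=; lra.
Qed.

Lemma ref_poincare : \int[mu2]_(z in refT) (W z - m) ^+ 2 <= 14 * grad2.
Proof.
(* In [meanP] the part 8 k y is integrated over slices of length at most 1, and 6 is the
   contribution of the averaged endpoint. *)
have -> : 14 * grad2 = 8 * grad2 + 6 * grad2 by ring.
apply: ref_int_le => //.
- by apply: continuous_sqr => z; apply: cvgB; [exact: cW|exact: cvg_cst].
- by rewrite mulr_ge0.
Qed.

Lemma ref_edge_poincare : \int[leb]_(y in U) (A y - m) ^+ 2 <= 14 * grad2.
Proof.
have -> : 14 * grad2 = 8 * grad2 + 6 * grad2 by ring.
rewrite -Rint_aff; apply: le_Rintegral => //.
- apply/integrable_itv_continuous/continuous_sqr => t.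
  by apply: cvgB; [exact: cA|exact: cvg_cst].
- exact: int_aff.
- by move=> y; rewrite /= in_itv/= => /andP[? ?]; apply: meanP; split => //=; rewrite add0r.
Qed.

Lemma ref_trace : \int[leb]_(y in U) (A y) ^+ 2 <=
  4 * \int[mu2]_(z in refT) (W z) ^+ 2 + 56 * grad2.
Proof.
have cW2' := continuous_sqr cW.
have iW2 := integrable_ref_tri cW2'.
have c1 : continuous (cst 1 : plane R -> R) by move=> x; exact: cvg_cst.
set I := \int[mu2]_(z in refT) (W z) ^+ 2.
have -> : 4 * I + 56 * grad2 = 24 * grad2 + (4 * I + 32 * grad2) by ring.
rewrite -Rint_aff; apply: le_Rintegral => //.
- exact/integrable_itv_continuous/continuous_sqr.
- exact: int_aff.
move=> y' y'U.
(* A^2 - 2 W^2 <= 2 (W - A)^2 <= 16 k y + 12 k y'. Integrating over z, where the area is 1/2, and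
   then over y' gives the constants 4 and 2 (16 + 12) = 56. *)
pose f z := A y' ^+ 2 * 1 - 2 * W z ^+ 2.
have : \int[mu2]_(z in refT) f z <= 16 * grad2 + 12 * k y'.
  apply: ref_int_le => //.
  - move=> z; apply: cvgB; first exact: cvg_cst.
    by apply: cvgM; [exact: cvg_cst|exact: cW2'].
  - by rewrite mulr_ge0.
  move=> x y xyT; have := pointP xyT y'U; rewrite /f.
  move: (A y') (W (x, y)) (k y) (k y') => a b c d h.
  by have := sqr_ge0 (a - 2 * b); nra.
rewrite RintegralB//; last 2 first.
- exact: (integrableZl mT _ (integrable_ref_tri c1)).
- exact: (integrableZl mT _ iW2).
rewrite RintegralZl ?RintegralZl//; last exact: integrable_ref_tri c1.
rewrite ref_tri_area -/I.
lra.
Qed.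

(** Fundamental theorem of calculus on each horizontal slice. *)
Lemma ref_green : \int[mu2]_(z in refT) W1 z =
  \int[leb]_(y in U) W (1 - y, y) - \int[leb]_(y in U) A y.
Proof.
have [_ ->] := ref_iter2 cW1.
have cD : continuous (fun y : R => W (1 - y, y)).
  move=> y; apply: (@continuous2_cvg _ _ _ _ _ _ (fun y : R => 1 - y) id (fun a b => W (a, b))).
  - by rewrite (_ : (fun z => W (z.1, z.2)) = W); [exact: cW|apply/funext => -[]].
  - by apply: cvgB; [exact: cvg_cst|exact: cvg_id].
  - exact: cvg_id.
rewrite -RintegralB//; last 2 first.
- exact: integrable_itv_continuous.
- exact: integrable_itv_continuous.
apply: eq_Rintegral => y; rewrite inE/= in_itv/= => /andP[y0 y1].
rewrite (@FTC_itv R (fun x => W (x, y)) (fun x => W1 (x, y)))// ?subr_ge0//.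
exact: continuous_slice_fst.
Qed.

End ref_poincare.

(** * Smooth functions and their derivatives along lines *)

Section smooth_functions.
Context (R : realType).
Implicit Types phi : plane R -> R.

Lemma smooth_diff phi x : smooth phi -> differentiable phi x.
Proof. by move=> /(_ [::]). Qed.

Lemma smooth_continuous phi : smooth phi -> continuous phi.
Proof. by move=> h x; apply: differentiable_continuous; exact: smooth_diff. Qed.

Lemma smooth_pderiv j phi : smooth phi -> smooth (pderiv j phi).
Proof.
move=> h w x; have := h (rcons w j) x.
by rewrite -cats1 foldr_cat.
Qed.

Lemma diff_continuous_pderiv j phi : smooth phi -> continuous (pderiv j phi).
Proof. by move=> h; apply: smooth_continuous; exact: smooth_pderiv. Qed.

Lemma derive_dir phi x (v : plane R) : differentiable phi x ->
  'D_v phi x = v.1 * pderiv ord0 phi x + v.2 * pderiv (lift ord0 ord0) phi x.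
Proof.
move=> dphi; rewrite /pderiv !deriveE// /basis_vec /=.
have -> : v = v.1 *: ((1, 0) : plane R) + v.2 *: ((0, 1) : plane R).
  by case: v => a b; congr pair; rewrite /= /GRing.scale/= ?mulr1 ?mulr0 ?addr0 ?add0r.
by rewrite linearD !linearZ /= /GRing.scale/= !mulr1 !mulr0 addr0 add0r.
Qed.

Lemma line_derive phi (c v : plane R) (s : R) : differentiable phi (c + s *: v) ->
  is_derive s (1 : R) (fun t => phi (c + t *: v))
   (v.1 * pderiv ord0 phi (c + s *: v) + v.2 * pderiv (lift ord0 ord0) phi (c + s *: v)).
Proof.
move=> dphi; rewrite -derive_dir//.
have e : (fun h : R => h^-1 *: (phi (c + (h *: (1 : R) + s) *: v) - phi (c + s *: v))) =
   (fun h : R => h^-1 *: (phi (h *: v + (c + s *: v)) - phi (c + s *: v))).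
  apply/funext => h; congr (_ *: (phi _ - _)).
  by rewrite [h *: 1]mulr1 scalerDl addrCA.
have dv := diff_derivable dphi (v := v).
split; first by rewrite /derivable /= e.
by rewrite /derive /= e.
Qed.

End smooth_functions.

(** * Transport of the estimates to a general triangle *)

Section triangle_estimates.
Context (R : realType).
Local Notation leb := (@lebesgue_measure R).
Local Notation mu2 := (plane_measure R).
Local Notation U := (`[(0 : R), 1]%classic).
Local Notation refT := (@ref_tri R).
Local Notation i1 := (lift ord0 ord0 : 'I_2).

Lemma tri_bounded (a p q : plane R) : exists N, tri a p q `<=` box N.
Proof.
exists (`|a.1| + `|a.2| + `|p.1 - a.1| + `|p.2 - a.2| + `|q.1 - a.1| + `|q.2 - a.2|).
move=> _ [[x y] [/= x0 y0 xy] <-]; rewrite /tri_map /=.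
have x1 : `|x| <= 1 by rewrite ger0_norm//; lra.
have y1 : `|y| <= 1 by rewrite ger0_norm//; lra.
have b (u v w : R) : `|u + x * v + y * w| <= `|u| + `|v| + `|w|.
  apply: (le_trans (ler_normD _ _)); apply: lerD.
    apply: (le_trans (ler_normD _ _)); apply: lerD => //.
    by rewrite normrM ler_piMl.
  by rewrite normrM ler_piMl.
have n (u : R) := normr_ge0 u.
split; rewrite /= in_itv/= -ler_norml; apply: (le_trans (b _ _ _)).
  by have := n a.2; have := n (p.2 - a.2); have := n (q.2 - a.2); lra.
by have := n a.1; have := n (p.1 - a.1); have := n (q.1 - a.1); lra.
Qed.

Lemma tri_sq_int (a p q : plane R) (f : plane R -> R) : continuous f ->
  sq_int mu2 (tri a p q)° f.
Proof.
move=> cf; have [N hN] := tri_bounded a p q.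
apply: (@continuous_sq_int R _ N) => //; first exact: tri_open_measurable.
by move=> x /interior_subset /hN.
Qed.

Lemma tri_integrable (a p q : plane R) (f : plane R -> R) : continuous f ->
  mu2.-integrable (tri a p q)° (EFin \o f).
Proof.
move=> cf; have c1 : continuous (cst 1 : plane R -> R) by move=> x; exact: cvg_cst.
have mD : measurable ((tri a p q)° : set (mplane R)) by exact: tri_open_measurable.
have := sq_intM mD (tri_sq_int a p q cf) (tri_sq_int a p q c1).
by apply: eq_integrable => // x _ /=; rewrite mulr1.
Qed.

Lemma continuous_tri_map (a p q : plane R) (f : plane R -> R) : continuous f ->
  continuous (f \o tri_map a p q).
Proof.
move=> cf z; rewrite /tri_map.
have c (b0 b1 b2 : R) : continuous (fun z : plane R => b0 + z.1 * b1 + z.2 * b2).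
  rewrite (_ : (fun z => _) = (fun z => b0 + b1 * z.1 + b2 * z.2)).
    exact: continuous_lin2.
  by apply/funext => ?; ring.
apply: (@continuous2_cvg _ _ _ _ _ _ (fun z : plane R => a.1 + z.1 * (p.1 - a.1) + z.2 * (q.1 - a.1))
  (fun z : plane R => a.2 + z.1 * (p.2 - a.2) + z.2 * (q.2 - a.2)) (fun u v => f (u, v))).
- by rewrite (_ : (fun z => f (z.1, z.2)) = f); [exact: cf|apply/funext => -[]].
- exact: c.
- exact: c.
Qed.

Lemma Rintegral_tri (a p q : plane R) (f : plane R -> R) : tri_det a p q != 0 ->
  continuous f ->
  \int[mu2]_(x in (tri a p q)°) f x =
  `|tri_det a p q| * \int[mu2]_(z in refT) f (tri_map a p q z).
Proof.
move=> d0; wlog f0 : f / forall z, 0 <= f z.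
  move=> H cf.
  pose f1 := fun z => 2^-1 * (`|f z| + f z); pose f2 := fun z => 2^-1 * (`|f z| - f z).
  have c1 : continuous f1.
    move=> z; apply: cvgM; first exact: cvg_cst.
    by apply: cvgD; [apply: cvg_norm; exact: cf|exact: cf].
  have c2 : continuous f2.
    move=> z; apply: cvgM; first exact: cvg_cst.
    by apply: cvgB; [apply: cvg_norm; exact: cf|exact: cf].
  have p1 z : 0 <= f1 z by rewrite /f1; have := ler_norm (- f z); rewrite normrN; lra.
  have p2 z : 0 <= f2 z by rewrite /f2; have := ler_norm (f z); lra.
  have e z : f z = f1 z - f2 z by rewrite /f1/f2; lra.
  under eq_Rintegral do rewrite e; under [in RHS]eq_Rintegral do rewrite e.
  rewrite RintegralB//; [|exact: tri_open_measurable|exact: tri_integrable|exact: tri_integrable].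
  rewrite H// (H f2)// -mulrBr; congr (_ * _).
  rewrite RintegralB//; first exact: measurable_ref_tri.
    exact/integrable_ref_tri/continuous_tri_map.
  exact/integrable_ref_tri/continuous_tri_map.
move=> cf.
have mf : measurable_fun [set: plane R] (EFin \o f).
  by apply/measurable_EFinP; exact: continuous_measurable_plane.
have := ge0_integral_tri d0 mf (fun z => (f0 z : (0 <= (f z)%:E)%E)).
rewrite /Rintegral => ->; rewrite fineM//.
apply: integrable_fin_num; first exact: measurable_ref_tri.
exact/integrable_ref_tri/continuous_tri_map.
Qed.

Lemma tri_area (a p q : plane R) : tri_det a p q != 0 ->
  \int[mu2]_(x in (tri a p q)°) (1 : R) = `|tri_det a p q| / 2.
Proof.
move=> d0; have c1 : continuous (cst 1 : plane R -> R) by move=> x; exact: cvg_cst.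
by rewrite (Rintegral_tri d0 c1) ref_tri_area.
Qed.

Section one_function.
Variables (a p q : plane R) (phi : plane R -> R).
Hypothesis d0 : tri_det a p q != 0.
Hypothesis sphi : smooth phi.
Let D : set (plane R) := (tri a p q)°.
Let J := `|tri_det a p q|.
Let grad z v := v.1 * pderiv ord0 phi z + v.2 * pderiv i1 phi z.
Let W := phi \o tri_map a p q.
Let W1 z := grad (tri_map a p q z) (p - a).
Let W2 z := grad (tri_map a p q z) (q - a).
Let m := \int[leb]_(t in U) phi (seg_point a q t).
Let G := dot mu2 D (pderiv ord0 phi) (pderiv ord0 phi) + dot mu2 D (pderiv i1 phi) (pderiv i1 phi).
Let L := eucl_dist p a ^+ 2 + eucl_dist q a ^+ 2.

Let cg v : continuous (grad ^~ v).
Proof.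
by move=> z; apply: cvgD; apply: cvgM; try exact: cvg_cst; exact: diff_continuous_pderiv.
Qed.
Let cW : continuous W. Proof. exact/continuous_tri_map/smooth_continuous. Qed.
Let cW1 : continuous W1. Proof. exact: (@continuous_tri_map a p q _ (@cg (p - a))). Qed.
Let cW2 : continuous W2. Proof. exact: (@continuous_tri_map a p q _ (@cg (q - a))). Qed.
Let dW1 (y s : R) : is_derive s (1 : R) (fun t => W (t, y)) (W1 (s, y)).
Proof.
have e t : tri_map a p q (t, y) = tri_map a p q (0, y) + t *: (p - a).
  by rewrite /tri_map /=; congr pair; rewrite /= /GRing.scale/=; ring.
rewrite (_ : (fun t => _) = (fun t => phi (tri_map a p q (0, y) + t *: (p - a)))).
  by rewrite /W1 e; apply: line_derive; exact: smooth_diff.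
by apply/funext => t; rewrite /W /= e.
Qed.
Let dW2 (x s : R) : is_derive s (1 : R) (fun t => W (x, t)) (W2 (x, s)).
Proof.
have e t : tri_map a p q (x, t) = tri_map a p q (x, 0) + t *: (q - a).
  by rewrite /tri_map /=; congr pair; rewrite /= /GRing.scale/=; ring.
rewrite (_ : (fun t => _) = (fun t => phi (tri_map a p q (x, 0) + t *: (q - a)))).
  by rewrite /W2 e; apply: line_derive; exact: smooth_diff.
by apply/funext => t; rewrite /W /= e.
Qed.

Let W0E t : W (0, t) = phi (seg_point a q t).
Proof.
rewrite /W /= /tri_map /seg_point /=; congr phi.
by congr pair; rewrite /= /GRing.scale/=; ring.
Qed.
Let WdE t : W (1 - t, t) = phi (seg_point p q t).
Proof.
rewrite /W /= /tri_map /seg_point /=; congr phi.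
by congr pair; rewrite /= /GRing.scale/=; ring.
Qed.

Let mE : \int[leb]_(y in U) W (0, y) = m.
Proof. by apply: eq_Rintegral => t _; rewrite W0E. Qed.

Let J_gt0 : 0 < J. Proof. by rewrite normr_gt0. Qed.

Let sphi2 j : sq_int mu2 D (pderiv j phi).
Proof. by apply: tri_sq_int; exact: diff_continuous_pderiv. Qed.

Let gradP v : \int[mu2]_(z in D) (grad z v) ^+ 2 <= (v.1 ^+ 2 + v.2 ^+ 2) * G.
Proof.
have mD : measurable (D : set (mplane R)) by exact: tri_open_measurable.
rewrite (_ : Rintegral _ _ _ = dot mu2 D (grad ^~ v) (grad ^~ v)); last first.
  by apply: eq_Rintegral => z _; rewrite expr2.
rewrite dot_sqr_lin//.
(* The component of the gradient orthogonal to v: its square and that of [grad z v] add up to |v|^2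
   times the squared gradient. *)
have := dot_ge0 mu2 D (fun z => v.2 * pderiv ord0 phi z + (- v.1) * pderiv i1 phi z).
rewrite dot_sqr_lin// /G.
move: (dot _ _ _ _) (dot _ _ _ _) (dot _ _ _ _) (v.1) (v.2) => x y z b c; nra.
Qed.

Let grad2P : J * (\int[mu2]_(z in refT) (W1 z) ^+ 2 + \int[mu2]_(z in refT) (W2 z) ^+ 2) <= L * G.
Proof.
rewrite mulrDr -(Rintegral_tri d0 (continuous_sqr (@cg (p - a)))).
rewrite -(Rintegral_tri d0 (continuous_sqr (@cg (q - a)))).
rewrite /L mulrDl /eucl_dist !sqr_sqrtr ?addr_ge0 ?sqr_ge0//.
by apply: lerD; exact: gradP.
Qed.

(** The reference inequality composed with [tri_map]: the Jacobian appears on both sides, and the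
    chain rule costs the squared edge lengths [L]. *)
Lemma tri_poincare :
  dot mu2 D (fun x => phi x - m) (fun x => phi x - m) <= 14 * L * G.
Proof.
have c : continuous (fun x => (phi x - m) ^+ 2).
  apply: continuous_sqr => z; apply: cvgB; last exact: cvg_cst.
  exact: smooth_continuous.
have -> : dot mu2 D (fun x => phi x - m) (fun x => phi x - m) =
    J * \int[mu2]_(z in refT) (W z - m) ^+ 2.
  rewrite -(Rintegral_tri d0 c).
  by apply: eq_Rintegral => z _; rewrite expr2.
have := ref_poincare cW cW1 cW2 dW1 dW2; rewrite mE => h.
by have := grad2P; move: J_gt0 h; move: (Rintegral _ _ _) (_ + _) (L) => A B C; nra.
Qed.

Lemma tri_edge_poincare :
  J * \int[leb]_(t in U) (phi (seg_point a q t) - m) ^+ 2 <= 14 * L * G.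
Proof.
have := ref_edge_poincare cW cW1 cW2 dW1 dW2; rewrite mE.
under eq_Rintegral do rewrite W0E.
by have := grad2P; move: J_gt0; move: (Rintegral _ _ _) (_ + _) (L) => A B C; nra.
Qed.

Lemma tri_trace :
  J * \int[leb]_(t in U) (phi (seg_point a q t)) ^+ 2 <= 4 * dot mu2 D phi phi + 56 * L * G.
Proof.
have c : continuous (fun x => phi x ^+ 2) by exact/continuous_sqr/smooth_continuous.
have -> : dot mu2 D phi phi = J * \int[mu2]_(z in refT) (W z) ^+ 2.
  rewrite -(Rintegral_tri d0 c).
  by apply: eq_Rintegral => z _; rewrite expr2.
have := ref_trace cW cW1 cW2 dW1 dW2.
under eq_Rintegral do rewrite W0E.
by move=> /(ler_wpM2l (ltW J_gt0)); have := grad2P; lra.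
Qed.

(** The direction p - a is tangent to the edge [a, p], so only the other two edges carry boundary
    terms. *)
Lemma tri_green :
  (p.1 - a.1) * \int[mu2]_(x in D) pderiv ord0 phi x +
  (p.2 - a.2) * \int[mu2]_(x in D) pderiv i1 phi x =
  J * (\int[leb]_(t in U) phi (seg_point p q t) - \int[leb]_(t in U) phi (seg_point a q t)).
Proof.
have := ref_green cW cW1 dW1; rewrite mE.
under [X in _ = X - _]eq_Rintegral do rewrite WdE.
move=> <-; rewrite -(Rintegral_tri d0 (@cg (p - a))).
have mD : measurable (D : set (mplane R)) by exact: tri_open_measurable.
have ii j : mu2.-integrable D (EFin \o pderiv j phi).
  by apply: tri_integrable; exact: diff_continuous_pderiv.
rewrite RintegralD//.
- by rewrite !RintegralZl.
- exact: (integrableZl mD _ (ii ord0)).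
- exact: (integrableZl mD _ (ii i1)).
Qed.

End one_function.
End triangle_estimates.

(** * A flat function at the origin *)

Section bump.
Context (R : realType).

(* [flat P] is P(1/t) exp(-1/t) for t > 0, extended by 0. *)
Definition flat (P : {poly R}) (t : R) : R :=
  if 0 < t then P.[t^-1] * expR (- t^-1) else 0.

Lemma pow_le_expR (n : nat) : exists C : R, forall x, 0 <= x -> x ^+ n <= C * expR x.
Proof.
case: n => [|n].
  exists 1 => x x0; rewrite expr0 mul1r.
  by have := expR_ge1Dx x; lra.
have f0 : 0 < (n.+1)`!%:R :> R by rewrite ltr0n fact_gt0.
exists (n.+1)`!%:R => x x0; rewrite mulrC -ler_pdivrMr//.
by have := expR_ge1Dxn n x0; lra.
Qed.

Lemma poly_le_expR (P : {poly R}) (k : nat) :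
  exists C : R, forall x, 0 <= x -> `|P.[x]| * x ^+ k <= C * expR x.
Proof.
elim/poly_ind: P k => [|P c IH] k.
  by exists 0 => x _; rewrite horner0 normr0 !mul0r.
have [C1 h1] := IH k.+1; have [C2 h2] := pow_le_expR k.
exists (C1 + `|c| * C2) => x x0; rewrite hornerMXaddC.
apply: (@le_trans _ _ (`|P.[x]| * x ^+ k.+1 + `|c| * x ^+ k)).
  rewrite exprS mulrA -mulrDl; apply: ler_wpM2r; first exact: exprn_ge0.
  by apply: (le_trans (ler_normD _ _)); rewrite normrM (ger0_norm x0).
rewrite mulrDl; apply: lerD; first exact: h1.
by rewrite -mulrA; apply: ler_wpM2l => //; exact: h2.
Qed.

(** The exponential beats every polynomial in 1/t. The power 2 is what makes the difference quotient
    at 0 vanish. *)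
Lemma flat_bound P : exists C : R, forall t, `|flat P t| <= C * t ^+ 2.
Proof.
have [C h] := poly_le_expR P 2; exists `|C| => t; rewrite /flat.
case: ifPn => t0; last by rewrite normr0 mulr_ge0 ?sqr_ge0.
have ti : 0 <= t^-1 by rewrite invr_ge0 ltW.
have := h _ ti; rewrite exprVn ler_pdivrMr ?exprn_gt0// => {}h.
rewrite normrM (ger0_norm (expR_ge0 _)) expRN ler_pdivrMr ?expR_gt0//.
apply: (le_trans h); rewrite mulrAC; apply: ler_wpM2r; first exact: expR_ge0.
by apply: ler_wpM2r; [exact: sqr_ge0|exact: ler_norm].
Qed.

(** The derivative of P(1/t) exp(-1/t) is t^-2 (P - P')(1/t) exp(-1/t), so the family [flat] is
    stable under differentiation. *)
Definition flat_deriv (P : {poly R}) : {poly R} := 'X^2 * (P - P^`()).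

Lemma flat0 P : flat P 0 = 0. Proof. by rewrite /flat ltxx. Qed.

Lemma is_derive_flat P (t : R) : is_derive t (1 : R) (flat P) (flat (flat_deriv P) t).
Proof.
have [t0|t0|->] := ltgtP t 0.
- have e : \forall z \near t, cst 0 z = flat P z.
    near=> z; rewrite /flat ltNge ltW//; near: z.
    exact: lt_nbhsl.
  rewrite {2}/flat ltNge (ltW t0)/=.
  exact: (near_eq_is_derive e (is_derive_cst _ _ _)).
- have e : \forall z \near t, (horner P \o GRing.inv) z * (expR \o (fun z => - z^-1)) z = flat P z.
    near=> z; rewrite /flat ifT//; near: z.
    exact: lt_nbhsr.
  apply: (near_eq_is_derive e).
  have tn0 : t != 0 by rewrite gt_eqF.
  have dV : is_derive t (1 : R) (fun z : R => z^-1) (- t ^- 2).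
    apply: (is_derive_eq (is_deriveV (f := id) tn0 (is_derive_id _ _))).
    by rewrite /GRing.scale/= mulr1.
  have dN : is_derive t (1 : R) (fun z : R => - z^-1) (t ^- 2).
    by apply: (is_derive_eq (is_deriveN dV)); rewrite opprK.
  have dE := @is_derive1_comp _ expR (fun z : R => - z^-1) t _ _ (is_derive_expR _) dN.
  have dP := @is_derive1_comp _ (horner P) (fun z : R => z^-1) t _ _ (is_derive_poly P _) dV.
  apply: (is_derive_eq (is_deriveM dP dE)).
  rewrite /flat t0 /flat_deriv /GRing.scale/= hornerM hornerXn hornerD hornerN exprVn.
  ring.
(* At the origin the quadratic bound makes the difference quotient O(|z|). *)
- have [C h] := flat_bound P.
  have c : (fun h : R => h^-1 *: (flat P (h *: (1 : R) + 0) - flat P 0)) @ 0^' --> (0 : R).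
    apply/cvgr0Pnorm_le => e e0; near=> z.
    rewrite [z *: 1]mulr1 addr0 flat0 subr0 /GRing.scale/= normrM normfV.
    have z0 : z != 0 by near: z; exact: nbhs_dnbhs_neq.
    rewrite mulrC ler_pdivrMr ?normr_gt0//; apply: (le_trans (h z)).
    rewrite -(real_normK (num_real z)) expr2 mulrA; apply: ler_wpM2r => //.
    have C1 : 0 < `|C| + 1 by rewrite ltr_pwDr.
    apply: (@le_trans _ _ ((`|C| + 1) * `|z|)).
      by apply: ler_wpM2r => //; apply: (le_trans (ler_norm _)); rewrite lerDl.
    rewrite mulrC -ler_pdivlMr//; near: z.
    by apply: dnbhs0_le; rewrite divr_gt0.
  rewrite flat0; split; first exact: cvgP c.
  exact: cvg_lim c.
Unshelve. all: by end_near. Qed.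

Lemma flat_diff P (t : R) : differentiable (flat P) t.
Proof. by apply/derivable1_diffP; have [] := is_derive_flat P t. Qed.

Lemma flat1_ge0 t : 0 <= flat 1 t.
Proof. by rewrite /flat; case: ifP => // _; rewrite hornerC mul1r expR_ge0. Qed.

Lemma flat1_le1 t : flat 1 t <= 1.
Proof.
rewrite /flat; case: ifP => // t0; rewrite hornerC mul1r -expR0 ler_expR.
by rewrite oppr_le0 invr_ge0 ltW.
Qed.

Lemma flat1_cvg t : 0 < t -> flat 1 (n.+1%:R * t) @[n --> \oo] --> (1 : R).
Proof.
move=> t0.
have -> : (fun n => flat 1 (n.+1%:R * t)) = (fun n => expR (- (n.+1%:R^-1 * t^-1))).
  apply/funext => n; rewrite /flat mulr_gt0// hornerC mul1r invfM//.
have H : (- (n.+1%:R^-1 * t^-1)) @[n --> \oo] --> (0 : R).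
  rewrite -[X in _ --> X]oppr0; apply: cvgN; rewrite -[X in _ --> X](mul0r t^-1).
  by apply: cvgM; [exact: cvg_harmonic|exact: cvg_cst].
rewrite -[X in _ --> X](expR0).
exact: (continuous_cvg _ (@continuous_expR R 0) H).
Qed.

End bump.

(** * A criterion for smoothness, and smooth bumps on boxes *)

Section smooth_class.
Context (R : realType).
Local Notation i1 := (lift ord0 ord0 : 'I_2).

(** Iterated partial derivatives never leave a class stable under [pderiv], so proving smoothness
    amounts to exhibiting such a class. *)
Lemma smooth_coind (S : (plane R -> R) -> Prop) :
  (forall f, S f -> forall x, differentiable f x) ->
  (forall f j, S f -> S (pderiv j f)) ->
  forall f, S f -> smooth f.
Proof.
move=> hd hp f Sf w x; apply: hd; elim: w => //= j w IH; exact: hp.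
Qed.

Lemma pderivE (f : plane R -> R) j x df : is_derive x (basis_vec R j) f df -> pderiv j f x = df.
Proof. by move=> h; rewrite /pderiv; exact: derive_val. Qed.

Lemma pderiv_lin (a b : R) (f g : plane R -> R) j :
  (forall x, differentiable f x) -> (forall x, differentiable g x) ->
  pderiv j (fun x => a * f x + b * g x) = (fun x => a * pderiv j f x + b * pderiv j g x).
Proof.
move=> hf hg; apply/funext => x; rewrite /pderiv.
have df := diff_derivable (v := basis_vec R j) (hf x).
have dg := diff_derivable (v := basis_vec R j) (hg x).
have -> : (fun x => a * f x + b * g x) = (a *: f) + (b *: g) by apply/funext.
by rewrite deriveD; [rewrite !deriveZ|exact: derivableZ|exact: derivableZ].
Qed.

Lemma pderivM (f g : plane R -> R) j :
  (forall x, differentiable f x) -> (forall x, differentiable g x) ->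
  pderiv j (fun x => f x * g x) = (fun x => pderiv j f x * g x + f x * pderiv j g x).
Proof.
move=> hf hg; apply/funext => x; rewrite /pderiv.
have df := diff_derivable (v := basis_vec R j) (hf x).
have dg := diff_derivable (v := basis_vec R j) (hg x).
rewrite (deriveM df dg) /GRing.scale/=; ring.
Qed.

Lemma differentiable_lin (a b : R) (f g : plane R -> R) x :
  differentiable f x -> differentiable g x -> differentiable (fun x => a * f x + b * g x) x.
Proof.
move=> df dg; have -> : (fun x => a * f x + b * g x) = (a *: f) + (b *: g) by apply/funext.
by apply: differentiableD; apply: differentiableZ.
Qed.

Lemma smooth_lin (a b : R) (f g : plane R -> R) : smooth f -> smooth g ->
  smooth (fun x => a * f x + b * g x).
Proof.
move=> sf sg.
apply: (@smooth_coind [set h | exists f g, [/\ smooth f, smooth g & h = (fun x => a * f x + b * g x)]]).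
- move=> h [f1 [g1 [s1 s2 ->]]] x; apply: differentiable_lin; exact: smooth_diff.
- move=> h j [f1 [g1 [s1 s2 ->]]]; exists (pderiv j f1), (pderiv j g1).
  split; try exact: smooth_pderiv.
  by apply: pderiv_lin => x; exact: smooth_diff.
- by exists f, g.
Qed.

Definition aff (c0 c1 c2 : R) (x : plane R) : R := c0 + c1 * x.1 + c2 * x.2.

Lemma differentiable_aff (c0 c1 c2 : R) x : differentiable (aff c0 c1 c2) x.
Proof.
have -> : aff c0 c1 c2 = cst c0 + (c1 *: fst) + (c2 *: snd) by apply/funext.
have df : differentiable (fst : plane R -> R) x.
  by apply: linear_differentiable => z; exact: cvg_fst.
have ds : differentiable (snd : plane R -> R) x.
  by apply: linear_differentiable => z; exact: cvg_snd.
apply: differentiableD; last exact: differentiableZ.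
by apply: differentiableD; [exact: differentiable_cst|exact: differentiableZ].
Qed.

Lemma pderiv_aff (c0 c1 c2 : R) j x :
  pderiv j (aff c0 c1 c2) x = c1 * (basis_vec R j).1 + c2 * (basis_vec R j).2.
Proof.
set v := basis_vec R j.
have c : (fun h : R => h^-1 *: (aff c0 c1 c2 (h *: v + x) - aff c0 c1 c2 x)) @ 0^' -->
  c1 * v.1 + c2 * v.2.
  apply: cvg_near_cst; near=> h.
  have h0 : h != 0 by near: h; exact: nbhs_dnbhs_neq.
  by rewrite /aff /= /GRing.scale/=; field.
exact: cvg_lim c.
Unshelve. all: by end_near. Qed.

Lemma smooth_aff (c0 c1 c2 : R) : smooth (aff c0 c1 c2).
Proof.
apply: (@smooth_coind [set f | exists a b c, f = aff a b c]).
- by move=> f [a [b [c ->]]] x; exact: differentiable_aff.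
- move=> f j [a [b [c ->]]].
  exists (b * (basis_vec R j).1 + c * (basis_vec R j).2), 0, 0.
  by apply/funext => x; rewrite pderiv_aff /aff !mul0r !addr0.
- by exists c0, c1, c2.
Qed.

Lemma smooth_cst (c : R) : smooth (fun _ : plane R => c).
Proof.
have -> : (fun _ : plane R => c) = aff c 0 0; last exact: smooth_aff.
by apply/funext => x; rewrite /aff !mul0r !addr0.
Qed.

Lemma pderiv_cst (c : R) j : pderiv j (fun _ : plane R => c) = cst 0.
Proof.
have -> : (fun _ : plane R => c) = aff c 0 0.
  by apply/funext => x; rewrite /aff !mul0r !addr0.
by apply/funext => x; rewrite pderiv_aff !mul0r addr0.
Qed.

Lemma differentiable_flat_aff P (c0 c1 c2 : R) x :
  differentiable (flat P \o aff c0 c1 c2) x.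
Proof. by apply: differentiable_comp; [exact: differentiable_aff|exact: flat_diff]. Qed.

Lemma pderiv_flat_aff P (c0 c1 c2 : R) j :
  pderiv j (flat P \o aff c0 c1 c2) =
  (fun x => (c1 * (basis_vec R j).1 + c2 * (basis_vec R j).2) *
            (flat (flat_deriv P) \o aff c0 c1 c2) x).
Proof.
apply/funext => x; rewrite -(pderiv_aff c0 c1 c2 j x) /pderiv.
have da := differentiable_aff c0 c1 c2 x.
have dg := flat_diff P (aff c0 c1 c2 x).
rewrite deriveE; last exact: differentiable_flat_aff.
rewrite (diff_comp da dg) /= (deriveE _ da).
set l := 'd (aff _ _ _) x _.
rewrite -[l in LHS]mulr1 -[_ * 1 in LHS]/(l *: (1 : R)) linearZ/=.
rewrite -deriveE// /GRing.scale/=; congr (_ * _).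
by have dd := is_derive_flat P (aff c0 c1 c2 x); exact: derive_val.
Qed.

(** Large enough to contain the box bumps, and the chain and Leibniz rules keep derivatives
    inside. *)
Inductive bump_class : (plane R -> R) -> Prop :=
| bump_flat P c0 c1 c2 : bump_class (flat P \o aff c0 c1 c2)
| bump_mul f g : bump_class f -> bump_class g -> bump_class (fun x => f x * g x)
| bump_lin a b f g : bump_class f -> bump_class g ->
    bump_class (fun x => a * f x + b * g x).

Lemma bump_class_diff f : bump_class f -> forall x, differentiable f x.
Proof.
elim=> [P c0 c1 c2 x|g h _ dg _ dh x|a b g h _ dg _ dh x].
- exact: differentiable_flat_aff.
- exact: (differentiableM (dg x) (dh x)).
- exact: differentiable_lin.
Qed.

Lemma bump_class_pderiv f j : bump_class f -> bump_class (pderiv j f).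
Proof.
elim=> [P c0 c1 c2|g h bg dg bh dh|a b g h bg dg bh dh].
- rewrite pderiv_flat_aff; set c := _ + _.
  have -> : (fun x => c * (flat (flat_deriv P) \o aff c0 c1 c2) x) =
    (fun x => c * (flat (flat_deriv P) \o aff c0 c1 c2) x +
              0 * (flat (flat_deriv P) \o aff c0 c1 c2) x).
    by apply/funext => x; rewrite mul0r addr0.
  by apply: bump_lin; exact: bump_flat.
- rewrite pderivM; try exact: bump_class_diff.
  have -> : (fun x => pderiv j g x * h x + g x * pderiv j h x) =
    (fun x => 1 * (pderiv j g x * h x) + 1 * (g x * pderiv j h x)).
    by apply/funext => x; rewrite !mul1r.
  by apply: bump_lin; exact: bump_mul.
- rewrite pderiv_lin; try exact: bump_class_diff.
  exact: bump_lin.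
Qed.

Lemma bump_class_smooth f : bump_class f -> smooth f.
Proof.
apply: smooth_coind; [exact: bump_class_diff|].
by move=> g j; exact: bump_class_pderiv.
Qed.

Definition obox (a b c d : R) : set (plane R) := `]a, b[%classic `*` `]c, d[%classic.
Definition cbox (a b c d : R) : set (plane R) := `[a, b]%classic `*` `[c, d]%classic.

(** For n > 0 it vanishes off the open box, and it tends to 1 inside as n grows: a smooth
    approximation of the indicator. *)
Definition box_bump (a b c d n : R) (x : plane R) : R :=
  flat 1 (n * (x.1 - a)) * flat 1 (n * (b - x.1)) *
  (flat 1 (n * (x.2 - c)) * flat 1 (n * (d - x.2))).

Lemma box_bump_smooth a b c d n : smooth (box_bump a b c d n).
Proof.
apply: bump_class_smooth.
have e1 : (fun x : plane R => flat 1 (n * (x.1 - a))) = flat 1 \o aff (- (n * a)) n 0.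
  by apply/funext => x; rewrite /aff /=; congr flat; ring.
have e2 : (fun x : plane R => flat 1 (n * (b - x.1))) = flat 1 \o aff (n * b) (- n) 0.
  by apply/funext => x; rewrite /aff /=; congr flat; ring.
have e3 : (fun x : plane R => flat 1 (n * (x.2 - c))) = flat 1 \o aff (- (n * c)) 0 n.
  by apply/funext => x; rewrite /aff /=; congr flat; ring.
have e4 : (fun x : plane R => flat 1 (n * (d - x.2))) = flat 1 \o aff (n * d) 0 (- n).
  by apply/funext => x; rewrite /aff /=; congr flat; ring.
apply: (@bump_mul (fun x => _ * _) (fun x => _ * _)).
  by apply: (@bump_mul (fun x => flat 1 (n * (x.1 - a)))); rewrite ?e1 ?e2; exact: bump_flat.
by apply: (@bump_mul (fun x => flat 1 (n * (x.2 - c)))); rewrite ?e3 ?e4; exact: bump_flat.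
Qed.

Lemma flat_le0 (P : {poly R}) t : t <= 0 -> flat P t = 0.
Proof. by rewrite /flat leNgt; case: ifP. Qed.

Lemma box_bump_supp a b c d n x : 0 <= n -> ~ obox a b c d x -> box_bump a b c d n x = 0.
Proof.
move=> n0 nx; apply: contrapT => h; apply: nx; rewrite /box_bump in h.
have pos t : 0 <= n -> flat 1 (n * t) <> 0 -> 0 < t.
  move=> _ ht; rewrite ltNge; apply/negP => t0; apply: ht; apply: flat_le0.
  by rewrite mulr_ge0_le0.
split; rewrite /= in_itv/=; apply/andP; split; rewrite -subr_gt0; apply: pos => // e;
  by apply: h; rewrite e ?(mulr0, mul0r).
Qed.

Lemma box_bump_bound a b c d n x : 0 <= box_bump a b c d n x <= 1.
Proof.
have m (u v : R) : 0 <= u <= 1 -> 0 <= v <= 1 -> 0 <= u * v <= 1.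
  move=> /andP[u0 u1] /andP[v0 v1]; rewrite mulr_ge0//=.
  by apply: (le_trans _ u1); rewrite ler_piMr.
have f t : 0 <= flat 1 t <= 1 by rewrite flat1_ge0 flat1_le1.
by rewrite /box_bump m// m.
Qed.

Lemma box_bump_cvg a b c d x : obox a b c d x ->
  box_bump a b c d n.+1%:R x @[n --> \oo] --> (1 : R).
Proof.
move=> [] /=; rewrite !in_itv/= => /andP[h1 h2] /andP[h3 h4].
rewrite -[X in _ --> X](mulr1 1).
apply: cvgM; rewrite -[X in _ --> X](mulr1 1); apply: cvgM;
  by apply: flat1_cvg; rewrite subr_gt0.
Qed.

Lemma box_bump_test (D : set (plane R)) a b c d n : 0 <= n -> cbox a b c d `<=` D ->
  test_function D (box_bump a b c d n).
Proof.
move=> n0 hD; split; first exact: box_bump_smooth.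
exists (cbox a b c d); split => //; first by apply: compact_setX; exact: segment_compact.
move=> x nx; apply: box_bump_supp => // -[/= h1 h2]; apply: nx.
by split => /=; apply: subset_itv_oo_cc.
Qed.

End smooth_class.

(** * The fundamental lemma of the calculus of variations *)

Section vanishing.
Context (R : realType).
Local Notation mu2 := (plane_measure R).
Local Notation leb := (@lebesgue_measure R).

Definition boxes : set (set (plane R)) := [set B | exists a b c d, B = obox a b c d].

Lemma oboxI a b c d a' b' c' d' : obox a b c d `&` obox a' b' c' d' =
  obox (Num.max a a') (Num.min b b') (Num.max c c') (Num.min d d') :> set (plane R).
Proof.
apply/seteqP; split => -[x y]; rewrite /obox /= !in_itv/= !gt_max !lt_min.
  by move=> [[/andP[-> ->] /andP[-> ->]] [/andP[-> ->] /andP[-> ->]]].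
by move=> [/andP[/andP[-> ->] /andP[-> ->]] /andP[/andP[-> ->] /andP[-> ->]]].
Qed.

Lemma obox_measurable a b c d : measurable (obox a b c d : set (mplane R)).
Proof. by apply: measurableX; exact: measurable_itv. Qed.

(** Supplies the pi-system of a Dynkin argument. Coordinate strips are countable unions of boxes, so
    both projections are measurable for the generated sigma-algebra. *)
Lemma sigma_boxes : @measurable _ (mplane R) = <<s boxes >>.
Proof.
apply/seteqP; split; last first.
  apply: smallest_sub; first exact: sigma_algebra_measurable.
  by move=> _ [a [b [c [d ->]]]]; exact: obox_measurable.
have g1 (a b : R) : <<s boxes >> (fst @^-1` `]a, b[%classic).
  have -> : fst @^-1` `]a, b[%classic = \bigcup_n obox a b (- n%:R) n%:R :> set (plane R).
    apply/seteqP; split => [[x y] /= hx|[x y] [n _] [] //].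
    exists (Num.bound `|y|) => //; split => //=.
    by rewrite in_itv/= -ltr_norml archi_boundP.
  by apply: sigma_algebra_bigcup => n; apply: sub_sigma_algebra; do 4 eexists; reflexivity.
have g2 (a b : R) : <<s boxes >> (snd @^-1` `]a, b[%classic).
  have -> : snd @^-1` `]a, b[%classic = \bigcup_n obox (- n%:R) n%:R a b :> set (plane R).
    apply/seteqP; split => [[x y] /= hx|[x y] [n _] [] //].
    exists (Num.bound `|x|) => //; split => //=.
    by rewrite in_itv/= -ltr_norml archi_boundP.
  by apply: sigma_algebra_bigcup => n; apply: sub_sigma_algebra; do 4 eexists; reflexivity.
have m1 : measurable_fun [set: g_sigma_algebraType boxes] (fst : plane R -> R).
  apply: (measurability _ (RGenOpens.measurableE R)).
  by move=> _ [_ [a [b ->] <-]]; rewrite setTI; exact: g1.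
have m2 : measurable_fun [set: g_sigma_algebraType boxes] (snd : plane R -> R).
  apply: (measurability _ (RGenOpens.measurableE R)).
  by move=> _ [_ [a [b ->] <-]]; rewrite setTI; exact: g2.
apply: smallest_sub; first exact: smallest_sigma_algebra.
move=> _ [[A mA <-]|[A mA <-]].
  exact: (m1 measurableT A mA).
exact: (m2 measurableT A mA).
Qed.

Lemma oboxS (a b c d : R) : obox a b c d `<=` cbox a b c d.
Proof. by move=> x [/= h1 h2]; split => /=; apply: subset_itv_oo_cc. Qed.

Lemma cbox_measurable a b c d : measurable (cbox a b c d : set (mplane R)).
Proof. by apply: measurableX; exact: measurable_itv. Qed.

Lemma obox_integrable (g : plane R -> R) a b c d :
  sq_int mu2 (obox a b c d) g -> mu2.-integrable (obox a b c d) (EFin \o g).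
Proof.
move=> hg; have mB := obox_measurable a b c d.
pose N := `|a| + `|b| + `|c| + `|d|.
have sN : obox a b c d `<=` box N.
  have n (u : R) := normr_ge0 u.
  move=> x [/=]; rewrite !in_itv/= => /andP[h1 h2] /andP[h3 h4].
  have := ler_norm (- a); have := ler_norm b; have := ler_norm (- c).
  have := ler_norm d; rewrite !normrN => *.
  have := n a; have := n b; have := n c; have := n d => *.
  by split; rewrite /= in_itv/= /N; apply/andP; split; lra.
have h1 : sq_int mu2 (obox a b c d) (cst 1).
  by apply: (continuous_sq_int mB sN); exact: cst_continuous.
by have := sq_intM mB hg h1; apply: eq_integrable => // x _ /=; rewrite mulr1.
Qed.

Variables (D : set (plane R)) (g : plane R -> R).
Hypothesis oD : open D.
Hypothesis hg : sq_int mu2 D g.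
Hypothesis g0 : forall phi, test_function D phi -> ip D g phi = 0.

Let mD : measurable (D : set (mplane R)).
Proof. exact: open_measurable_plane. Qed.

(** Dominated convergence along box bumps, each of them a test function orthogonal to g. *)
Let int_obox a b c d : cbox a b c d `<=` D ->
  (\int[mu2]_(x in obox a b c d) (g x)%:E = 0)%E.
Proof.
move=> sD; have mB := obox_measurable a b c d.
have sB : obox a b c d `<=` D by apply: subset_trans sD; exact: oboxS.
have hB := sq_intS mD mB sB hg; have iB := obox_integrable hB.
pose u (n : nat) := fun x => (g x * box_bump a b c d n.+1%:R x)%:E.
have mbump n : measurable_fun (obox a b c d) (box_bump a b c d n.+1%:R).
  apply: measurable_funTS; apply: continuous_measurable_plane.
  by apply: smooth_continuous; exact: box_bump_smooth.
have [_ _ h] : [/\ mu2.-integrable (obox a b c d) (EFin \o g),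
   [sequence (\int[mu2]_(x in obox a b c d) `|u n x - (EFin \o g) x|)%E]_n @ \oo --> 0%E &
   [sequence (\int[mu2]_(x in obox a b c d) (u n x))%E]_n @ \oo -->
     (\int[mu2]_(x in obox a b c d) ((EFin \o g) x))%E].
  apply: (@dominated_convergence _ _ _ mu2 _ mB u (EFin \o g) (abse \o (EFin \o g))).
  - move=> n; apply/measurable_EFinP; apply: measurable_funM; [by have [] := hB|exact: mbump].
  - apply/measurable_EFinP; by have [] := hB.
  - apply: aeW => x xB; apply: cvg_EFin; first exact: nearW.
    rewrite -[X in _ --> X](mulr1 (g x)).
    by apply: cvgM; [exact: cvg_cst|exact: box_bump_cvg].
  - exact: integrable_abse.
  - apply: aeW => x n xB; rewrite /u /= lee_fin normrM.
    have /andP[b0 b1] := box_bump_bound a b c d n.+1%:R x.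
    by rewrite ler_piMr// ger0_norm.
have z n : (\int[mu2]_(x in obox a b c d) u n x = 0)%E.
  have mgb : measurable_fun D (fun x => g x * box_bump a b c d n.+1%:R x).
    apply: measurable_funM; first by have [] := hg.
    apply: measurable_funTS; apply: continuous_measurable_plane.
    by apply: smooth_continuous; exact: box_bump_smooth.
  have fin : mu2.-integrable (obox a b c d) (u n).
    apply: (le_integrable mB _ _ iB).
      apply/measurable_EFinP; exact: measurable_funS mgb.
    move=> x xB; rewrite /u /= lee_fin normrM.
    have /andP[b0 b1] := box_bump_bound a b c d n.+1%:R x.
    by rewrite ler_piMr// ger0_norm.
  have n0 : 0 <= n.+1%:R :> R by [].
  have := g0 (box_bump_test n0 sD); rewrite /ip /Rintegral.
  have -> : (\int[mu2]_(x in D) (g x * box_bump a b c d n.+1%:R x)%:E =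
     \int[mu2]_(x in obox a b c d) u n x)%E.
    rewrite integral_mkcond [RHS]integral_mkcond; apply: eq_integral => x _.
    rewrite !patchE /u; case: ifPn => xD; case: ifPn => xB //.
      by rewrite box_bump_supp ?mulr0// => xB'; move: xB; rewrite mem_set.
    by move: xB; rewrite inE => /sB xD'; move: xD; rewrite mem_set.
  move=> f0; rewrite -[LHS]fineK ?f0//; exact: integrable_fin_num fin.
move: h; rewrite (_ : [sequence _]_n = cst 0%E); last by apply/funext => n; exact: z.
by move/(cvg_unique (@ereal_hausdorff R) (cvg_cst 0%E)) => <-.
Qed.

(** The sets E for which g has integral 0 on the part of E in the box form a Dynkin system
    containing the boxes, hence all measurable sets. *)
Let ae_obox a b c d : cbox a b c d `<=` D ->
  {ae mu2, forall x, obox a b c d x -> g x = 0}.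
Proof.
move=> sD; have mB := obox_measurable a b c d.
have sB : obox a b c d `<=` D by apply: subset_trans sD; exact: oboxS.
have hB := sq_intS mD mB sB hg; have iB := obox_integrable hB.
pose P (E : set (mplane R)) := (\int[mu2]_(x in E `&` obox a b c d) (g x)%:E = 0)%E.
have PT : P setT by rewrite /P setTI int_obox.
have iE (E : set (mplane R)) : measurable E -> mu2.-integrable (E `&` obox a b c d) (EFin \o g).
  by move=> mE; apply: (integrableS mB _ _ iB); [exact: measurableI|exact: subIsetr].
have all E : measurable E -> P E.
  rewrite sigma_boxes; move: E; apply: dynkin_induction => //.
  - exact: sigma_boxes.
  - move=> _ _ [a1 [b1 [c1 [d1 ->]]]] [a2 [b2 [c2 [d2 ->]]]].
    by rewrite oboxI; do 4 eexists; reflexivity.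
  - move=> _ [a1 [b1 [c1 [d1 ->]]]]; rewrite /P oboxI; apply: int_obox.
    apply: subset_trans sD => x [/=]; rewrite !in_itv/= !ge_max !le_min.
    move=> /andP[/andP[? ?] /andP[? ?]] /andP[/andP[? ?] /andP[? ?]].
    by split; rewrite /= in_itv/=; apply/andP.
  - move=> S mS PS; rewrite /P.
    have := PT; rewrite /P setTI.
    have eB : obox a b c d = (S `&` obox a b c d) `|` (~` S `&` obox a b c d).
      by rewrite -setIUl setUv setTI.
    rewrite {1}eB integral_setU//=.
    + by rewrite [X in (X + _)%E]PS add0e.
    + by apply: measurableI; [exact: mS|exact: mB].
    + by apply: measurableI; [apply: measurableC; exact: mS|exact: mB].
    + rewrite -setIUl setUv setTI; apply/measurable_EFinP; by have [] := hB.
    + by apply/disj_setPS => x [[Sx _] [nS _]].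
  - move=> F mF tF PF; rewrite /P setI_bigcupl integral_bigcup//.
    + by apply: eseries0 => n _ _; exact: PF.
    + exact: trivIset_setIr.
    + by move=> n; exact: measurableI.
    + by rewrite -setI_bigcupl; apply: iE; exact: bigcupT_measurable.
have e : ae_eq mu2 (obox a b c d) (EFin \o g) (cst 0%E).
  apply: (integral_ae_eq mB iB) => // E EB mE.
  rewrite integral0; have := all E mE; rewrite /P => <-.
  by congr integral; rewrite setIidl.
by apply: ae_imply e => x h /h [].
Qed.

(** D is covered by countably many rational open boxes whose closures lie in D. *)
Lemma ae_vanish : {ae mu2, forall x, D x -> g x = 0}.
Proof.
pose B (i : (rat * rat) * (rat * rat)) : set (plane R) :=
  obox (ratr i.1.1) (ratr i.1.2) (ratr i.2.1) (ratr i.2.2).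
pose C (i : (rat * rat) * (rat * rat)) : set (plane R) :=
  cbox (ratr i.1.1) (ratr i.1.2) (ratr i.2.1) (ratr i.2.2).
(* Countable quantification over the rational boxes coded by [pickle]; codes of no admissible box
   carry a trivial statement. *)
have : {ae mu2, forall x, forall n : nat, if unpickle n is Some i then
    (if `[< C i `<=` D >] then B i x -> g x = 0 else True) else True}.
  apply: ae_foralln => n; case: unpickle => [i|]; last exact: aeW.
  by case: asboolP => [h|_]; [exact: ae_obox|exact: aeW].
apply: ae_imply => x hx Dx.
have /nbhs_ballP[e /= e0 eU] : nbhs x D by exact: open_nbhs_nbhs.
have l (y : R) : y - e < y by rewrite ltrBlDr ltrDl.
have r (y : R) : y < y + e by rewrite ltrDl.
have [a1] := rat_in_itvoo (l x.1); have [a2] := rat_in_itvoo (r x.1).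
have [b1] := rat_in_itvoo (l x.2); have [b2] := rat_in_itvoo (r x.2).
rewrite !in_itv/= => /andP[h1 h2] /andP[h3 h4] /andP[h5 h6] /andP[h7 h8].
have := hx (pickle ((a1, a2), (b1, b2))); rewrite pickleK.
case: asboolP => [_|].
  by apply; split => /=; rewrite in_itv/=; apply/andP.
case; rewrite /C /cbox => y [/=]; rewrite !in_itv/= => /andP[? ?] /andP[? ?].
by apply: eU; split => /=; rewrite /ball/= ltr_norml; lra.
Qed.

End vanishing.

(** * Weak derivatives on an open set *)

Section weak_derivative.
Context (R : realType) (D : set (plane R)).
Hypothesis oD : open D.
Local Notation mu2 := (plane_measure R).

Let mD : measurable (D : set (mplane R)).
Proof. exact: open_measurable_plane. Qed.

Lemma test_sq_int phi : test_function D phi -> sq_int mu2 D phi.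
Proof.
move=> [sphi [K [cK KD K0]]].
have cphi := smooth_continuous sphi.
have [N KN] : exists N, K `<=` box N.
  have [M [_ hM]] := compact_bounded cK.
  exists (M + 1) => -[x y] Kx; have := hM (M + 1) _ (x, y) Kx.
  rewrite ltrDl => /(_ ltr01); rewrite /= prod_normE/= ge_max => /andP[].
  by rewrite !ler_norml => h1 h2; split; rewrite /= in_itv/=.
have mB : measurable (box N : set (mplane R)).
  by apply: measurableX; exact: measurable_itv.
have [_ fin] := continuous_sq_int mB (@subset_refl _ _) cphi.
split; first by apply: measurable_funTS; exact: continuous_measurable_plane.
have mE (E : set (mplane R)) : measurable E ->
    measurable_fun [set: mplane R] ((fun x => (phi x ^+ 2)%:E) \_ E).
  move=> mE; apply/(measurable_restrictT _ mE); apply/measurable_EFinP.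
  apply: measurable_funX; apply: measurable_funTS; exact: continuous_measurable_plane.
apply: le_lt_trans fin; rewrite integral_mkcond [leRHS]integral_mkcond.
apply: ge0_le_integral => //.
- by move=> x _; rewrite patchE; case: ifP => // _; rewrite lee_fin sqr_ge0.
- exact: mE.
- exact: mE.
move=> x _; rewrite !patchE; case: ifPn => xD; case: ifPn => xB //.
  rewrite K0 ?expr0n// => /KN Kx; by move: xB; rewrite mem_set.
by rewrite lee_fin sqr_ge0.
Qed.

Lemma test_pderiv j phi : test_function D phi -> test_function D (pderiv j phi).
Proof.
move=> [sphi [K [cK KD K0]]]; split; first exact: smooth_pderiv.
exists K; split => // x nK.
have cl : closed K by apply: compact_closed => //; exact: norm_hausdorff.
have e : \forall z \near x, cst 0 z = phi z.
  have : nbhs x (~` K) by apply: open_nbhs_nbhs; split => //; exact: closed_openC.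
  by apply: filterS => z nz; rewrite K0.
by rewrite /pderiv -(near_eq_derive _ e) derive_cst.
Qed.

(** [ae_vanish] applied to g - h. It makes the choice in [wderiv] harmless up to null sets. *)
Lemma is_wderiv_unique j (f g h : plane R -> R) :
  is_wderiv D j f g -> is_wderiv D j f h -> {ae mu2, forall x, D x -> g x = h x}.
Proof.
move=> [g2 hg] [h2 hh].
have g2' : sq_int mu2 D g := g2; have h2' : sq_int mu2 D h := h2.
have : {ae mu2, forall x, D x -> 1 * g x + (-1) * h x = 0}.
  apply: ae_vanish => //; first exact: sq_int_lin.
  move=> phi tphi; have tp := test_sq_int tphi.
  rewrite -[ip _ _ _]/(dot mu2 D _ _) dot_linl//.
  have := hg _ tphi; rewrite (hh _ tphi) /ip => /oppr_inj e.
  by rewrite /dot e; ring.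
by apply: ae_imply => x /[apply] /eqP; rewrite mul1r mulN1r subr_eq0 => /eqP.
Qed.

Lemma is_wderiv_lin j a b (f g f' g' : plane R -> R) :
  sq_int mu2 D f -> sq_int mu2 D g ->
  is_wderiv D j f f' -> is_wderiv D j g g' ->
  is_wderiv D j (fun x => a * f x + b * g x) (fun x => a * f' x + b * g' x).
Proof.
move=> hf hg [f2 wf] [g2 wg].
have f2' : sq_int mu2 D f' := f2; have g2' : sq_int mu2 D g' := g2.
split; first exact: (sq_int_lin mD a b f2' g2').
move=> phi tphi; have tp := test_sq_int tphi; have tdp := test_sq_int (test_pderiv j tphi).
have := wf _ tphi; have := wg _ tphi; rewrite -![ip _ _ _]/(dot mu2 D _ _) => e1 e2.
by rewrite !dot_linl// e1 e2; ring.
Qed.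

Lemma is_wderiv_ae j (f g f' g' : plane R -> R) :
  measurable_fun D f -> measurable_fun D f' -> measurable_fun D g' ->
  {ae mu2, forall x, D x -> f x = f' x} -> {ae mu2, forall x, D x -> g x = g' x} ->
  is_wderiv D j f g -> is_wderiv D j f' g'.
Proof.
move=> mf mf' mg' e1 e2 [g2 h]; have g2' : sq_int mu2 D g := g2.
split; first exact: (ae_sq_int mD mg' e2 g2').
move=> phi tphi; have [mp _] := test_sq_int tphi; have [mdp _] := test_sq_int (test_pderiv j tphi).
have := h _ tphi; rewrite -![ip _ _ _]/(dot mu2 D _ _).
rewrite (eq_dot mD mf mf' mdp mdp e1); last exact: aeW.
by rewrite (eq_dot mD _ mg' mp mp e2)//; [have [] := g2'|exact: aeW].
Qed.

Lemma wderivP j (f : plane R -> R) : (exists g, is_wderiv D j f g) ->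
  is_wderiv D j f (wderiv D j f).
Proof. by move=> [g hg]; rewrite /wderiv; apply: xgetPex; exists g. Qed.

Lemma wderiv_ae j (f g : plane R -> R) : is_wderiv D j f g ->
  {ae mu2, forall x, D x -> wderiv D j f x = g x}.
Proof. by move=> h; apply: (is_wderiv_unique _ h); apply: wderivP; exists g. Qed.

End weak_derivative.

Lemma nneseries_le (R : realType) (f : nat -> \bar R) (M : \bar R) :
  (forall k, 0 <= f k)%E -> (forall n, \sum_(0 <= k < n) f k <= M)%E ->
  (\sum_(k <oo) f k <= M)%E.
Proof.
move=> f0 h; apply: lime_le; first by apply: is_cvg_nneseries => k _ _; exact: f0.
by apply: nearW => n; exact: h.
Qed.

(** * Completeness of L2 *)

Section Riesz_Fischer.
Context d (T : measurableType d) (R : realType) (mu : {measure set T -> \bar R}).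
Variable D : set T.
Hypothesis mD : measurable D.
Variable u : nat -> T -> R.
Hypothesis hu : forall n, sq_int mu D (u n).
Local Notation dist2 f g := (dot mu D (fun x => f x - g x) (fun x => f x - g x)).
Hypothesis cu : forall e : R, 0 < e -> exists N, forall n m, (N <= n)%N -> (N <= m)%N ->
  dist2 (u n) (u m) <= e.

Let fast_subseq : exists v : nat -> nat,
  (forall k, k <= v k)%N /\ forall k, dist2 (u (v k.+1)) (u (v k)) <= 8 ^- k.
Proof.
have h (k : nat) : exists N, forall n m, (N <= n)%N -> (N <= m)%N ->
    dist2 (u n) (u m) <= 8 ^- k by apply: cu; rewrite invr_gt0 exprn_gt0.
pose K k := projT1 (cid (h k)); have hK k := projT2 (cid (h k)).
(* Summing the thresholds makes the index exceed K k at rank k and at every later rank. *)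
exists (fun k => k + \sum_(i < k.+1) K i)%N; split => [k|k]; first by rewrite leq_addr.
have Kk n : (k <= n)%N -> (K k <= n + \sum_(i < n.+1) K i)%N.
  move=> kn; apply: leq_trans (leq_addl _ _).
  have ki : (k < n.+1)%N by rewrite ltnS.
  by rewrite (bigD1 (Ordinal ki))//= leq_addr.
by apply: hK; apply: Kk.
Qed.

(** Along a fast subsequence the increments are summable almost everywhere, which yields a pointwise
    limit; Fatou's lemma then turns the Cauchy property into convergence of the whole sequence. *)
Lemma Riesz_Fischer : exists2 h, sq_int mu D h & cvg2 mu D u h.
Proof.
have [s [sk hs]] := fast_subseq.
pose v k := u (s k); have hv k : sq_int mu D (v k) := hu _.
pose dv k x := v k.+1 x - v k x.
have hdv k : sq_int mu D (dv k) by exact: sq_intB.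
(* The weight 2^k against squared distances 8^-k leaves a finite integral, while 2^k a^2 + 2^-k
   still dominates |a|. *)
pose S x : \bar R := (\sum_(k <oo) (2 ^+ k * (dv k x) ^+ 2)%:E)%E.
have t0 k x : (0 <= (2 ^+ k * (dv k x) ^+ 2)%:E)%E.
  by rewrite lee_fin mulr_ge0 ?sqr_ge0// exprn_ge0.
have mt k : measurable_fun D (fun x => (2 ^+ k * (dv k x) ^+ 2)%:E).
  apply/measurable_EFinP; apply: measurable_funM => //; apply: measurable_funX.
  by have [] := hdv k.
have mS : measurable_fun D S.
  by apply: ge0_emeasurable_sum => // k x _ _; exact: t0.
have S0 x : (0 <= S x)%E by apply: nneseries_ge0 => k _ _; exact: t0.
have iS : (\int[mu]_(x in D) S x < +oo)%E.
  rewrite integral_nneseries//.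
  have e k : (\int[mu]_(x in D) (2 ^+ k * (dv k x) ^+ 2)%:E = (2 ^+ k * dot mu D (dv k) (dv k))%:E)%E.
    under eq_integral do rewrite EFinM.
    rewrite integralZl//; last exact: sq_int_integrable_sq.
    by rewrite dotEFin// -EFinM.
  apply: (@le_lt_trans _ _ 2%:E); last exact: ltry.
  apply: nneseries_le => [k|n]; first by apply: integral_ge0 => x _; exact: t0.
  apply: (@le_trans _ _ (2 - 2 * 2^-1 ^+ n)%:E); last first.
    by rewrite lee_fin lerBlDr lerDl mulr_ge0// exprn_ge0// invr_ge0.
  elim: n => [|n IH]; first by rewrite big_nil expr0 mulr1 subrr.
  rewrite big_nat_recr//=.
  have -> : 2 - 2 * 2^-1 ^+ n.+1 = (2 - 2 * 2^-1 ^+ n) + 2^-1 ^+ n :> R.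
    by rewrite exprS; field.
  rewrite EFinD.
  apply: leeD IH _; rewrite e lee_fin.
  apply: (@le_trans _ _ (2 ^+ n * 8 ^- n)).
    by apply: ler_wpM2l; [exact: exprn_ge0|exact: hs].
  rewrite -exprVn -exprMn; apply: lerXn2r; rewrite ?nnegrE; lra.
have iS' : mu.-integrable D S.
  apply/integrableP; split => //.
  by under eq_integral do rewrite gee0_abs//.
have [N [mN muN hN]] := integrable_ae mD iS'.
have finS x : D x -> ~ N x -> S x \is a fin_num.
  by move=> Dx nx; apply: contrapT => nf; apply: nx; apply: hN => /= /(_ Dx).
have cvgv x : S x \is a fin_num -> cvgn (v ^~ x).
  move=> Sx; have -> : v ^~ x = (fun n => v 0%N x + series (telescope (v ^~ x)) n).
    by apply/funext => n; rewrite -eq_sum_telescope.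
  apply: is_cvgD; first exact: is_cvg_cst.
  apply: normed_cvg; apply: nondecreasing_is_cvgn.
    by apply: nondecreasing_series => n _ _ /=.
  exists (2 + fine (S x)) => _ [n _ <-]; rewrite /series/=.
  apply: (@le_trans _ _ (\sum_(0 <= k < n) (2^-1 ^+ k + 2 ^+ k * dv k x ^+ 2))).
    apply: ler_sum => k _; rewrite /telescope -/(dv k x).
    have p2 : 0 < 2 ^+ k :> R by rewrite exprn_gt0.
    rewrite exprVn -(real_normK (num_real (dv k x))); move: `|dv k x| => a.
    rewrite -(ler_pM2l p2) mulrDr mulfV ?gt_eqF//.
    have := sqr_ge0 (1 - 2 ^+ k * a); have := sqr_ge0 (2 ^+ k * a).
    move: (2 ^+ k) => b; nra.
  rewrite big_split/=; apply: lerD.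
    elim: n => [|n IH]; first by rewrite big_nil.
    have : \sum_(0 <= i < n) (2^-1 : R) ^+ i <= 2 - 2 * 2^-1 ^+ n.
      elim: n {IH} => [|n IH]; first by rewrite big_nil expr0 mulr1 subrr.
      rewrite big_nat_recr//= exprS; lra.
    rewrite big_nat_recr//= => {}IH.
    have : 0 <= (2^-1 : R) ^+ n by rewrite exprn_ge0// invr_ge0.
    lra.
  rewrite -lee_fin fineK// -sumEFin.
  exact: (nneseries_lim_ge _ (fun k _ _ => t0 k x)).
(* Annihilating the exceptional null set makes the limit exist at every point of D, hence
   measurable. *)
pose w k x := v k x * \1_(~` N) x.
pose h x := limn (w ^~ x).
have mw k : measurable_fun D (w k).
  apply: measurable_funM; first by have [] := hv k.
  by apply: measurable_indic; exact: measurableC.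
have wh x : D x -> w ^~ x @ \oo --> h x.
  move=> Dx; have : cvgn (w ^~ x); last by [].
  have [Nx|Nx] := pselect (N x).
    have -> : w ^~ x = cst 0; last exact: is_cvg_cst.
    by apply/funext => k; rewrite /w indicE memNset ?mulr0//; apply.
  have -> : w ^~ x = v ^~ x.
    by apply/funext => k; rewrite /w indicE mem_set ?mulr1.
  by apply: cvgv; exact: finS.
have mh : measurable_fun D h by exact: (measurable_fun_cvg mw).
have evw k : {ae mu, forall x, D x -> w k x = v k x}.
  exists N; split => // x /= hx; apply: contrapT => Nx; apply: hx => Dx.
  by rewrite /w indicE mem_set ?mulr1.
have key e : 0 < e -> exists M, forall n, (M <= n)%N ->
    (\int[mu]_(x in D) ((h x - u n x) ^+ 2)%:E <= e%:E)%E.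
  move=> e0; have [M hM] := cu e0; exists M => n Mn.
  have mf k : measurable_fun D (fun x => ((w k x - u n x) ^+ 2)%:E).
    by apply/measurable_EFinP; apply: measurable_funX; apply: measurable_funB => //; have [] := hu n.
  have f0 k x : D x -> (0 <= ((w k x - u n x) ^+ 2)%:E)%E.
    by move=> _; rewrite lee_fin sqr_ge0.
  (* Fatou in the subsequence index k, with n fixed. *)
  have := fatou mu mD mf f0.
  rewrite (_ : (\int[mu]_(x in D) limn_einf _)%E = (\int[mu]_(x in D) ((h x - u n x) ^+ 2)%:E)%E); last first.
    apply: eq_integral => x /set_mem Dx; have [] := @cvg_limn_einf_sup _ (fun k => ((w k x - u n x) ^+ 2)%:E) ((h x - u n x) ^+ 2)%:E.
      apply: cvg_EFin; first exact: nearW.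
      by apply: cvgM; apply: cvgB; (exact: wh || exact: cvg_cst).
    by [].
  move=> /le_trans; apply; rewrite limn_einf_lim.
  apply: lime_le; first exact: is_cvg_einfs.
  near=> k.
  apply: (@le_trans _ _ (\int[mu]_(x in D) ((w k x - u n x) ^+ 2)%:E)%E).
    by apply: ereal_inf_lbound; exists k => //=.
  rewrite (_ : (\int[mu]_(x in D) _)%E = (\int[mu]_(x in D) ((v k x - u n x) ^+ 2)%:E)%E); last first.
    apply: ae_eq_integral => //.
      by apply/measurable_EFinP; apply: measurable_funX; apply: measurable_funB; [case: (hv k)|case: (hu n)].
    by apply: filterS (evw k) => x + Dx => /(_ Dx) ->.
  rewrite dotEFin//; last exact: sq_intB.
  rewrite lee_fin; apply: hM => //; apply: leq_trans (sk k); near: k.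
  exact: nbhs_infty_ge.
have hh : sq_int mu D h.
  have [M /(_ M (leqnn M)) hM] := key 1 ltr01.
  have hd : sq_int mu D (fun x => h x - u M x).
    split; first by apply: measurable_funB => //; case: (hu M).
    by apply: le_lt_trans hM _; exact: ltry.
  have := sq_intD mD hd (hu M); congr sq_int; apply/funext => x; ring.
exists h => //; apply/cvg2_dot => //; apply/cvgrPdist_le => e e0.
have [M hM] := key e e0; exists M => // n /= Mn.
rewrite sub0r normrN ger0_norm ?dot_ge0//.
by have := hM n Mn; rewrite dotEFin//; exact: sq_intB.
Unshelve. all: by end_near. Qed.

End Riesz_Fischer.

(** * Symmetries of triangles and the Euclidean distance *)

Section tri_permutations.
Context (R : realType).
Implicit Types a p q : plane R.

Lemma tri_swap a p q : tri a p q = tri a q p.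
Proof.
suff s : forall u v w : plane R, tri u v w `<=` tri u w v by apply/seteqP; split; exact: s.
move=> u v w _ [[x y] [/= x0 y0 xy] <-]; exists (y, x); first by split => //=; lra.
by rewrite /tri_map /=; congr pair; ring.
Qed.

Lemma tri_rot a p q : tri a p q = tri p q a.
Proof.
suff s : forall u v w : plane R, tri u v w `<=` tri v w u.
  apply/seteqP; split; first exact: s.
  by apply: subset_trans (s q a p); exact: s.
move=> u v w _ [[x y] [/= x0 y0 xy] <-]; exists (y, 1 - x - y); first by split => //=; lra.
by rewrite /tri_map /=; congr pair; ring.
Qed.

Lemma tri_det_swap a p q : tri_det a q p = - tri_det a p q.
Proof. by rewrite /tri_det; ring. Qed.

Lemma tri_det_rot a p q : tri_det p q a = tri_det a p q.
Proof. by rewrite /tri_det; ring. Qed.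

Lemma eucl_dist_ge0 (x y : plane R) : 0 <= eucl_dist x y.
Proof. exact: sqrtr_ge0. Qed.

Lemma eucl_distC (x y : plane R) : eucl_dist x y = eucl_dist y x.
Proof. by rewrite /eucl_dist -[x.1 - _]opprB -[x.2 - _]opprB !sqrrN. Qed.

Lemma eucl_dist_sqr (x y : plane R) :
  eucl_dist x y ^+ 2 = (x.1 - y.1) ^+ 2 + (x.2 - y.2) ^+ 2.
Proof. by rewrite sqr_sqrtr// addr_ge0 ?sqr_ge0. Qed.

Lemma eucl_dist_gt0 (x y : plane R) : x != y -> 0 < eucl_dist x y.
Proof.
move=> xy; rewrite lt_def eucl_dist_ge0 andbT; apply: contra_neq xy => e.
have := eucl_dist_sqr x y; rewrite e expr0n/= => /esym/eqP.
rewrite paddr_eq0 ?sqr_ge0// !sqrf_eq0 !subr_eq0 => /andP[/eqP h1 /eqP h2].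
by case: x y h1 h2 {e} => [? ?] [? ?] /= -> ->.
Qed.

Lemma tri_det_neq a p q : tri_det a p q != 0 -> [/\ p != a, q != a & p != q].
Proof. by move=> h; split; apply: contra_neq h => ->; rewrite /tri_det; ring. Qed.

End tri_permutations.

Lemma cvg0_le (R : realType) (u : nat -> R) (e : R) : 0 < e ->
  u n @[n --> \oo] --> (0 : R) -> exists N, forall n, (N <= n)%N -> u n <= e.
Proof.
move=> e0 /cvgrPdist_le/(_ _ e0)[N _ hN]; exists N => n /hN /=.
by rewrite sub0r normrN => /ler_normlW.
Qed.

(** * H1 functions approximable by smooth ones *)

Section H1s.
Context (R : realType).
Local Notation mu2 := (plane_measure R).
Local Notation leb := (@lebesgue_measure R).
Local Notation U := (`[(0 : R), 1]%classic).
Local Notation i1 := (lift ord0 ord0 : 'I_2).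

Implicit Types (D : set (plane R)) (f : plane R -> R).

Definition smooth_approx (D : set (plane R)) (f : plane R -> R)
    (phi : nat -> plane R -> R) : Prop :=
  [/\ forall n, smooth (phi n), cvg2 mu2 D phi f &
      forall j, cvg2 mu2 D (fun n => pderiv j (phi n)) (wderiv D j f)].

(* The H^1(D)-closure of the functions that are smooth up to the boundary. *)
Definition H1s (D : set (plane R)) (f : plane R -> R) : Prop :=
  H1 D f /\ exists phi, smooth_approx D f phi.

Definition grad2 (D : set (plane R)) (f : plane R -> R) : R :=
  dot mu2 D (wderiv D ord0 f) (wderiv D ord0 f) +
  dot mu2 D (wderiv D i1 f) (wderiv D i1 f).

Lemma H1_sq_int D f : H1 D f -> sq_int mu2 D f.
Proof. by case. Qed.

Lemma H1_wderiv D j f : H1 D f -> is_wderiv D j f (wderiv D j f).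
Proof. by move=> [_ /(_ j)]; exact: wderivP. Qed.

Lemma H1_wderiv_sq_int D j f : H1 D f -> sq_int mu2 D (wderiv D j f).
Proof. by move=> /(H1_wderiv j)[]. Qed.

Lemma ord2P (j : 'I_2) : j = ord0 \/ j = i1.
Proof. by case: (unliftP ord0 j) => [k ->|->]; [right; rewrite (ord1 k)|left]. Qed.

End H1s.

Section H1_lin.
Context (R : realType) (D : set (plane R)).
Hypothesis oD : open D.
Local Notation mu2 := (plane_measure R).
Let mD : measurable (D : set (mplane R)).
Proof. exact: open_measurable_plane. Qed.

Implicit Types f g : plane R -> R.

Lemma H1_lin a b f g : H1 D f -> H1 D g -> H1 D (fun x => a * f x + b * g x).
Proof.
move=> hf hg; split; first exact: (sq_int_lin mD a b (H1_sq_int hf) (H1_sq_int hg)).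
move=> j; exists (fun x => a * wderiv D j f x + b * wderiv D j g x).
by apply: is_wderiv_lin => //; [exact: H1_sq_int|exact: H1_sq_int|exact: H1_wderiv|exact: H1_wderiv].
Qed.

Lemma wderiv_lin j a b f g : H1 D f -> H1 D g ->
  {ae mu2, forall x, D x -> wderiv D j (fun x => a * f x + b * g x) x =
     a * wderiv D j f x + b * wderiv D j g x}.
Proof.
move=> hf hg; apply: wderiv_ae => //.
by apply: is_wderiv_lin => //; [exact: H1_sq_int|exact: H1_sq_int|exact: H1_wderiv|exact: H1_wderiv].
Qed.

Lemma wderiv_measurable j f : H1 D f -> measurable_fun D (wderiv D j f).
Proof. by move=> /(H1_wderiv_sq_int j)[]. Qed.

Lemma smooth_approx_lin a b f g phi psi :
  (forall h : plane R -> R, continuous h -> sq_int mu2 D h) ->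
  H1 D f -> H1 D g -> smooth_approx D f phi -> smooth_approx D g psi ->
  smooth_approx D (fun x => a * f x + b * g x) (fun n x => a * phi n x + b * psi n x).
Proof.
move=> cD hf hg [s1 c1 d1] [s2 c2 d2].
have q1 n : sq_int mu2 D (phi n) by apply: cD; exact: smooth_continuous.
have q2 n : sq_int mu2 D (psi n) by apply: cD; exact: smooth_continuous.
have r1 j n : sq_int mu2 D (pderiv j (phi n)) by apply: cD; exact: diff_continuous_pderiv.
have r2 j n : sq_int mu2 D (pderiv j (psi n)) by apply: cD; exact: diff_continuous_pderiv.
split.
- by move=> n; exact: smooth_lin.
- by apply: cvg2_lin => //; exact: H1_sq_int.
- move=> j.
  have -> : (fun n => pderiv j (fun x => a * phi n x + b * psi n x)) =
     (fun n x => a * pderiv j (phi n) x + b * pderiv j (psi n) x).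
    by apply/funext => n; apply: pderiv_lin => x; exact: smooth_diff.
  have c : cvg2 mu2 D (fun n x => a * pderiv j (phi n) x + b * pderiv j (psi n) x)
     (fun x => a * wderiv D j f x + b * wderiv D j g x).
    exact: (cvg2_lin mD a b (r1 j) (r2 j) (H1_wderiv_sq_int j hf)
      (H1_wderiv_sq_int j hg) (d1 j) (d2 j)).
  have m n : measurable_fun D (fun x => a * pderiv j (phi n) x + b * pderiv j (psi n) x).
    by have [] := sq_int_lin mD a b (r1 j n) (r2 j n).
  apply: (ae_cvg2 mD m _ m _ _ _ c).
  + have q := H1_wderiv_sq_int j hf; have q' := H1_wderiv_sq_int j hg.
    by have [] := sq_int_lin mD a b q q'.
  + by apply: wderiv_measurable; exact: H1_lin.
  + by move=> n; exact: aeW.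
  + by apply: ae_imply (wderiv_lin j a b hf hg) => x h Dx; rewrite h.
Qed.

End H1_lin.

(** The bookkeeping of [smooth_approx_Cauchy], with integrals replaced by real variables. *)
Lemma trace_arith (R : realType) (J L X An Am Bn Bm B'n B'm P1 P2 P3 e : R) :
  0 < J -> 0 <= L -> J^-1 * (8 * An + 112 * L * (Bn + B'n)) <= e / 2 ->
  J^-1 * (8 * Am + 112 * L * (Bm + B'm)) <= e / 2 ->
  P1 <= 2 * B'n + 2 * B'm -> P2 <= 2 * Bn + 2 * Bm -> P3 <= 2 * An + 2 * Am ->
  J * X <= 4 * P3 + 56 * L * (P2 + P1) -> X <= e.
Proof.
move=> J0 L0; rewrite mulrC ler_pdivrMr// [_^-1 * _]mulrC ler_pdivrMr// => h1 h2 h3 h4 h5 h6.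
rewrite -(ler_pM2l J0); apply: (le_trans h6).
have : L * (P2 + P1) <= L * (2 * Bn + 2 * Bm + (2 * B'n + 2 * B'm)).
  by apply: ler_wpM2l => //; lra.
lra.
Qed.

(** * Traces on the edges of a triangle *)

Section trace_theory.
Context (R : realType).
Local Notation mu2 := (plane_measure R).
Local Notation leb := (@lebesgue_measure R).
Local Notation U := (`[(0 : R), 1]%classic).
Local Notation i1 := (lift ord0 ord0 : 'I_2).
Variables (a p q : plane R) (D : set (plane R)).
Hypothesis d0 : tri_det a p q != 0.
Hypothesis hD : D = (tri a p q)°.
Let mU : measurable (U : set (measurableTypeR R)). Proof. by []. Qed.
Let oD : open D. Proof. by rewrite hD; exact: open_interior. Qed.
Let mD : measurable (D : set (mplane R)). Proof. exact: open_measurable_plane. Qed.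
Let cD (h : plane R -> R) : continuous h -> sq_int mu2 D h.
Proof. by rewrite hD; exact: tri_sq_int. Qed.
Let J := `|tri_det a p q|.
Let J0 : 0 < J. Proof. by rewrite normr_gt0. Qed.
Let L := eucl_dist p a ^+ 2 + eucl_dist q a ^+ 2.

Let len0 : 0 < eucl_dist a q.
Proof. by apply: eucl_dist_gt0; have [_ h _] := tri_det_neq d0; rewrite eq_sym. Qed.

Implicit Types f g : plane R -> R.

Lemma continuous_seg (x y : plane R) (phi : plane R -> R) : continuous phi ->
  continuous (phi \o seg_point x y).
Proof.
move=> cphi t; rewrite /seg_point /=.
apply: (@continuous2_cvg _ _ _ _ _ _ (fun t : R => x.1 + t * (y.1 - x.1))
  (fun t : R => x.2 + t * (y.2 - x.2)) (fun u v => phi (u, v))).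
- by rewrite (_ : (fun z => phi (z.1, z.2)) = phi); [exact: cphi|apply/funext => -[]].
- by apply: cvgD; [exact: cvg_cst|apply: cvgM; [exact: cvg_id|exact: cvg_cst]].
- by apply: cvgD; [exact: cvg_cst|apply: cvgM; [exact: cvg_id|exact: cvg_cst]].
Qed.

Lemma smooth_seg_sq_int (x y : plane R) (phi : plane R -> R) : smooth phi ->
  sq_int leb U (phi \o seg_point x y).
Proof. by move=> s; apply: sq_int_itv; apply: continuous_seg; exact: smooth_continuous. Qed.

(** The edge length in the definition is a positive factor, so it does not affect convergence to
    0. *)
Lemma is_traceP f g : is_trace D a q f g <->
  measurable_fun U (g \o seg_point a q) /\
  exists phi, smooth_approx D f phi /\
    cvg2 leb U (fun n => phi n \o seg_point a q) (g \o seg_point a q).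
Proof.
have eX (phi : nat -> plane R -> R) n :
    (\int[leb]_(t in `[0%R, 1%R]) ((phi n (seg_point a q t) - g (seg_point a q t)) ^+ 2)%:E =
     \int[leb]_(t in U) (((g \o seg_point a q) t - (phi n \o seg_point a q) t) ^+ 2)%:E)%E.
  by apply: eq_integral => t _; rewrite /= -sqrrN opprB.
split=> -[mg [phi]].
  move=> [s c d e]; split => //; exists phi; split => //.
  rewrite /cvg2; under eq_fun do rewrite -eX.
  have i0 : (eucl_dist a q)^-1%:E \is a fin_num by [].
  have := cvgeZl i0 e; rewrite mule0; apply: eq_cvgn => n.
  by rewrite muleA -EFinM mulVf ?mul1e// gt_eqF.
move=> [[s c d] e]; split => //; exists phi; split => //.
have i0 : (eucl_dist a q)%:E \is a fin_num by [].
have := cvgeZl i0 e; rewrite mule0; apply: eq_cvgn => n.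
by rewrite eX.
Qed.

(** The trace inequality [tri_trace] bounds the edge norm by the H1 norm. *)
Lemma edge_vanish (psi : nat -> plane R -> R) : (forall n, smooth (psi n)) ->
  dot mu2 D (psi n) (psi n) @[n --> \oo] --> (0 : R) ->
  (forall j, dot mu2 D (pderiv j (psi n)) (pderiv j (psi n)) @[n --> \oo] --> (0 : R)) ->
  dot leb U (psi n \o seg_point a q) (psi n \o seg_point a q) @[n --> \oo] --> (0 : R).
Proof.
move=> s c0 cj.
have b n : dot leb U (psi n \o seg_point a q) (psi n \o seg_point a q) <=
   J^-1 * (4 * dot mu2 D (psi n) (psi n) + 56 * L *
    (dot mu2 D (pderiv ord0 (psi n)) (pderiv ord0 (psi n)) +
     dot mu2 D (pderiv i1 (psi n)) (pderiv i1 (psi n)))).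
  rewrite mulrC ler_pdivlMr// mulrC; have := tri_trace d0 (s n).
  rewrite -hD -/J -/L; apply: le_trans; rewrite ler_pM2l//.
have c : J^-1 * (4 * dot mu2 D (psi n) (psi n) + 56 * L *
    (dot mu2 D (pderiv ord0 (psi n)) (pderiv ord0 (psi n)) +
     dot mu2 D (pderiv i1 (psi n)) (pderiv i1 (psi n)))) @[n --> \oo] --> (0 : R).
  rewrite (_ : 0 = J^-1 * (4 * 0 + 56 * L * (0 + 0))); last by ring.
  apply: cvgM; first exact: cvg_cst.
  by apply: cvgD; apply: cvgM; try exact: cvg_cst; [|apply: cvgD].
by apply: (squeeze_cvgr _ (cvg_cst 0) c); apply: nearW => n; rewrite dot_ge0 b.
Qed.

(** The trace inequality for phi n - phi m, whose H1 norm is controlled by the distances to f. *)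
Lemma smooth_approx_Cauchy f phi : H1 D f -> smooth_approx D f phi ->
  forall e : R, 0 < e -> exists N, forall n m, (N <= n)%N -> (N <= m)%N ->
   dot leb U (fun t => (phi n \o seg_point a q) t - (phi m \o seg_point a q) t)
             (fun t => (phi n \o seg_point a q) t - (phi m \o seg_point a q) t) <= e.
Proof.
move=> hf [s c d] e e0.
have q0 n : sq_int mu2 D (phi n) by apply: cD; exact: smooth_continuous.
have qj j n : sq_int mu2 D (pderiv j (phi n)) by apply: cD; exact: diff_continuous_pderiv.
pose A n := dot mu2 D (fun x => f x - phi n x) (fun x => f x - phi n x).
pose B j n := dot mu2 D (fun x => wderiv D j f x - pderiv j (phi n) x)
                        (fun x => wderiv D j f x - pderiv j (phi n) x).
have cA : A n @[n --> \oo] --> (0 : R) by apply/(cvg2_dot mD q0 (H1_sq_int hf)).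
have cB j : B j n @[n --> \oo] --> (0 : R).
  by apply/(cvg2_dot mD (qj j) (H1_wderiv_sq_int j hf)).
pose C n := J^-1 * (8 * A n + 112 * L * (B ord0 n + B i1 n)).
have cC : C n @[n --> \oo] --> (0 : R).
  rewrite (_ : 0 = J^-1 * (8 * 0 + 112 * L * (0 + 0))); last by ring.
  apply: cvgM; first exact: cvg_cst.
  by apply: cvgD; apply: cvgM; try exact: cvg_cst; [|apply: cvgD].
have e2 : 0 < e / 2 by rewrite divr_gt0.
have tri2 (F u v : plane R -> R) : sq_int mu2 D F -> sq_int mu2 D u -> sq_int mu2 D v ->
    dot mu2 D (fun x => 1 * u x + (-1) * v x) (fun x => 1 * u x + (-1) * v x) <=
    2 * dot mu2 D (fun x => F x - u x) (fun x => F x - u x) +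
    2 * dot mu2 D (fun x => F x - v x) (fun x => F x - v x).
  move=> hF hu hv; have s1 := sq_intB mD hF hu; have s2 := sq_intB mD hF hv.
  have -> : (fun x => 1 * u x + (-1) * v x) =
     (fun x => (-1) * (F x - u x) + 1 * (F x - v x)) by apply/funext => x; ring.
  rewrite dot_sqr_lin//.
  have := dot_ge0 mu2 D (fun x => 1 * (F x - u x) + 1 * (F x - v x)).
  rewrite dot_sqr_lin//; move: (dot _ _ _ _) (dot _ _ _ _) (dot _ _ _ _) => x y z; lra.
have [N hN] := cvg0_le e2 cC; exists N => n m Nn Nm.
have Cn := hN n Nn; have Cm := hN m Nm.
have -> : (fun t => (phi n \o seg_point a q) t - (phi m \o seg_point a q) t) =
  (fun x => 1 * phi n x + (-1) * phi m x) \o seg_point a q.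
  by apply/funext => t /=; ring.
have sl := smooth_lin 1 (-1) (s n) (s m).
have := tri_trace d0 sl; rewrite -hD -/J -/L.
have pl j := @pderiv_lin R 1 (-1) _ _ j (fun x => smooth_diff x (s n)) (fun x => smooth_diff x (s m)).
rewrite !pl.
have h3 := tri2 f _ _ (H1_sq_int hf) (q0 n) (q0 m).
have h2 := tri2 _ _ _ (H1_wderiv_sq_int ord0 hf) (qj ord0 n) (qj ord0 m).
have h1 := tri2 _ _ _ (H1_wderiv_sq_int i1 hf) (qj i1 n) (qj i1 m).
have L0 : 0 <= L by rewrite addr_ge0 ?sqr_ge0.
exact: (trace_arith J0 L0 Cn Cm h1 h2 h3).
Qed.

End trace_theory.

Lemma cvgZB (R : realType) (k : R) (u v : nat -> R) (x y : R) :
  u n @[n --> \oo] --> x -> v n @[n --> \oo] --> y ->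
  k * (u n - v n) @[n --> \oo] --> k * (x - y).
Proof. by move=> cu cv; apply: cvgM; [exact: cvg_cst|exact: cvgB]. Qed.

Lemma cvg_lin2 (R : realType) (k l : R) (u v : nat -> R) (x y : R) :
  u n @[n --> \oo] --> x -> v n @[n --> \oo] --> y ->
  k * u n + l * v n @[n --> \oo] --> k * x + l * y.
Proof. by move=> cu cv; apply: cvgD; apply: cvgM => //; exact: cvg_cst. Qed.

Section trace_theory2.
Context (R : realType).
Local Notation mu2 := (plane_measure R).
Local Notation leb := (@lebesgue_measure R).
Local Notation U := (`[(0 : R), 1]%classic).
Local Notation i1 := (lift ord0 ord0 : 'I_2).
Variables (a p q : plane R) (D : set (plane R)).
Hypothesis d0 : tri_det a p q != 0.
Hypothesis hD : D = (tri a p q)°.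
Let mU : measurable (U : set (measurableTypeR R)). Proof. by []. Qed.
Let oD : open D. Proof. by rewrite hD; exact: open_interior. Qed.
Let mD : measurable (D : set (mplane R)). Proof. exact: open_measurable_plane. Qed.
Let cD (h : plane R -> R) : continuous h -> sq_int mu2 D h.
Proof. by rewrite hD; exact: tri_sq_int. Qed.
Let J := `|tri_det a p q|.
Let J0 : 0 < J. Proof. by rewrite normr_gt0. Qed.
Let L := eucl_dist p a ^+ 2 + eucl_dist q a ^+ 2.
Implicit Types f g : plane R -> R.

Let len0 : 0 < eucl_dist a q.
Proof. by apply: eucl_dist_gt0; have [_ h _] := tri_det_neq d0; rewrite eq_sym. Qed.

Let qs phi : smooth phi -> sq_int leb U (phi \o seg_point a q).
Proof. exact: smooth_seg_sq_int. Qed.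

Lemma is_trace_sq_int f g : is_trace D a q f g -> sq_int leb U (g \o seg_point a q).
Proof.
move=> /(is_traceP D d0)[mg [phi [[s _ _] c]]].
by apply: (cvg2_measurable_sq_int mU _ mg c) => n; exact: qs.
Qed.

(** Two smooth approximations of f differ by a sequence tending to 0 in H1, whose edge values tend
    to 0 by [edge_vanish]. So the trace can be computed along any approximating sequence, in
    particular one shared by two triangles. *)
Lemma trace_cvg f g phi : H1 D f -> smooth_approx D f phi -> is_trace D a q f g ->
  cvg2 leb U (fun n => phi n \o seg_point a q) (g \o seg_point a q).
Proof.
move=> hf ap tg; have hg := is_trace_sq_int tg.
have /(is_traceP D d0)[mg [psi [ap' c]]] := tg.
have := smooth_approx_lin oD 1 (-1) cD hf hf ap ap'.
have [s1 _ _] := ap; have [s2 _ _] := ap'.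
pose xi n x := 1 * phi n x + -1 * psi n x; rewrite -/xi => -[s3 c3 d3].
have z : H1 D (fun x => 1 * f x + -1 * f x) by exact: H1_lin.
have c30 : dot mu2 D (xi n) (xi n) @[n --> \oo] --> (0 : R).
  have := cvg2_dot_self mD (fun n => cD (smooth_continuous (s3 n))) (H1_sq_int z) c3.
  rewrite (dot0 mD) //; first by have [] := H1_sq_int z.
  by apply: aeW => x _; ring.
have d30 j : dot mu2 D (pderiv j (xi n)) (pderiv j (xi n)) @[n --> \oo] --> (0 : R).
  have := cvg2_dot_self mD (fun n => cD (diff_continuous_pderiv (j := j) (s3 n))) (H1_wderiv_sq_int j z) (d3 j).
  rewrite (dot0 mD) //; first exact: wderiv_measurable.
  by apply: ae_imply (wderiv_lin oD j 1 (-1) hf hf) => x h Dx; rewrite h//; ring.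
have e := edge_vanish d0 hD s3 c30 d30.
have zU : sq_int leb U (cst 0) by apply: sq_int_itv; exact: cst_continuous.
have c4 : cvg2 leb U (fun n => xi n \o seg_point a q) (cst 0).
  apply/(cvg2_dot mU _ zU); first by move=> n; exact: qs.
  have eX (k : R -> R) : dot leb U k k = dot leb U (fun t => cst 0 t - k t) (fun t => cst 0 t - k t).
    by apply: eq_Rintegral => t _ /=; rewrite sub0r mulrNN.
  by apply: eq_cvgn e => n; rewrite eX.
have c5 := cvg2_lin mU 1 1 (fun n => qs (s3 n)) (fun n => qs (s2 n)) zU hg c4 c.
have -> : g \o seg_point a q = (fun t => 1 * cst 0 t + 1 * (g \o seg_point a q) t).
  by apply/funext => t /=; ring.
have -> : (fun n => phi n \o seg_point a q) =
   (fun n t => 1 * (xi n \o seg_point a q) t + 1 * (psi n \o seg_point a q) t).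
  by apply/funext => n; apply/funext => t; rewrite /xi /=; ring.
exact: c5.
Qed.

Lemma trace_unique f g g' : H1 D f -> is_trace D a q f g -> is_trace D a q f g' ->
  {ae leb, forall t, U t -> g (seg_point a q t) = g' (seg_point a q t)}.
Proof.
move=> hf h1 h2; have q1 := is_trace_sq_int h1; have q2 := is_trace_sq_int h2.
have /(is_traceP D d0)[_ [phi [ap c]]] := h1.
have c' := trace_cvg hf ap h2; have [s _ _] := ap.
exact: (cvg2_unique mU (fun n => qs (s n)) q1 q2 c c').
Qed.

Lemma trace_exists f : H1s D f -> exists g, is_trace D a q f g.
Proof.
move=> [hf [phi ap]]; have [s _ _] := ap.
have [h hh c] := Riesz_Fischer mU (fun n => qs (s n)) (smooth_approx_Cauchy d0 hD hf ap).
(* Parameter of the orthogonal projection onto the line through a and q; it turns the limit on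
   [0, 1] into a function on the plane. *)
pose r (x : plane R) := ((x.1 - a.1) * (q.1 - a.1) + (x.2 - a.2) * (q.2 - a.2)) /
  eucl_dist a q ^+ 2.
have rK t : r (seg_point a q t) = t.
  have e := eucl_dist_sqr a q.
  have l2 : eucl_dist a q ^+ 2 != 0 by rewrite expf_neq0// gt_eqF.
  rewrite /r; apply: (mulIf l2); rewrite mulfVK// e /seg_point /= /GRing.scale/=.
  by ring.
exists (h \o r).
have e : (h \o r) \o seg_point a q = h by apply/funext => t /=; rewrite rK.
apply/(is_traceP D d0); rewrite e; split; first by have [] := hh.
by exists phi; split.
Qed.

Lemma traceP f : H1s D f -> is_trace D a q f (trace D a q f).
Proof. by move=> /trace_exists hf; rewrite /trace; exact: xgetPex. Qed.

Lemma trace_ae f g : H1s D f -> is_trace D a q f g ->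
  {ae leb, forall t, U t -> trace D a q f (seg_point a q t) = g (seg_point a q t)}.
Proof. by move=> hf; apply: trace_unique; [case: hf|exact: traceP]. Qed.

Lemma is_trace_lin b1 b2 f f' g g' : H1 D f -> H1 D f' ->
  is_trace D a q f g -> is_trace D a q f' g' ->
  is_trace D a q (fun x => b1 * f x + b2 * f' x) (fun x => b1 * g x + b2 * g' x).
Proof.
move=> hf hf' h h'; have qg := is_trace_sq_int h; have qg' := is_trace_sq_int h'.
have /(is_traceP D d0)[mg [phi [ap c]]] := h.
have /(is_traceP D d0)[mg' [psi [ap' c']]] := h'.
have [s _ _] := ap; have [s' _ _] := ap'.
apply/(is_traceP D d0); split; first by have [] := sq_int_lin mU b1 b2 qg qg'.
exists (fun n x => b1 * phi n x + b2 * psi n x); split.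
  exact: smooth_approx_lin.
exact: (cvg2_lin mU b1 b2 (fun n => qs (s n)) (fun n => qs (s' n)) qg qg' c c').
Qed.

Lemma H1s_lin b1 b2 f f' : H1s D f -> H1s D f' -> H1s D (fun x => b1 * f x + b2 * f' x).
Proof.
move=> [h [phi ap]] [h' [psi ap']]; split; first exact: H1_lin.
by exists (fun n x => b1 * phi n x + b2 * psi n x); exact: smooth_approx_lin.
Qed.

Lemma trace_lin b1 b2 f f' : H1s D f -> H1s D f' ->
  {ae leb, forall t, U t -> trace D a q (fun x => b1 * f x + b2 * f' x) (seg_point a q t) =
     b1 * trace D a q f (seg_point a q t) + b2 * trace D a q f' (seg_point a q t)}.
Proof.
move=> h h'; have hl := H1s_lin b1 b2 h h'.
have [H1f _] := h; have [H1f' _] := h'.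
exact: (trace_ae hl (is_trace_lin b1 b2 H1f H1f' (traceP h) (traceP h'))).
Qed.

Lemma smooth_seg_mean_cvg f phi g : H1 D f -> smooth_approx D f phi -> is_trace D a q f g ->
  \int[leb]_(t in U) phi n (seg_point a q t) @[n --> \oo] -->
  \int[leb]_(t in U) g (seg_point a q t).
Proof.
move=> hf ap tg; have [s _ _] := ap; have c := trace_cvg hf ap tg.
have one : sq_int leb U (cst 1) by apply: sq_int_itv; exact: cst_continuous.
have eX (k : plane R -> R) : dot leb U (k \o seg_point a q) (cst 1) =
    \int[leb]_(t in U) k (seg_point a q t).
  by apply: eq_Rintegral => t _ /=; rewrite mulr1.
have := cvg2_dotl mU (fun n => qs (s n)) (is_trace_sq_int tg) one c.
by rewrite eX; apply: eq_cvgn => n; rewrite eX.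
Qed.

Lemma grad2_cvg f phi : H1 D f -> smooth_approx D f phi ->
  dot mu2 D (pderiv ord0 (phi n)) (pderiv ord0 (phi n)) +
  dot mu2 D (pderiv i1 (phi n)) (pderiv i1 (phi n)) @[n --> \oo] --> grad2 D f.
Proof.
move=> hf [s c d]; have qj j n := cD (diff_continuous_pderiv (j := j) (s n)).
apply: cvgD.
  exact: (cvg2_dot_self mD (qj ord0) (H1_wderiv_sq_int ord0 hf) (d ord0)).
exact: (cvg2_dot_self mD (qj i1) (H1_wderiv_sq_int i1 hf) (d i1)).
Qed.

(** The smooth inequalities subtract the edge mean of phi n, and these means tend to the edge mean
    of the trace, which is 0. *)
Lemma H1s_poincare f g : H1s D f -> is_trace D a q f g ->
  \int[leb]_(t in U) g (seg_point a q t) = 0 ->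
  dot mu2 D f f <= 14 * L * grad2 D f /\
  J * \int[leb]_(t in U) g (seg_point a q t) ^+ 2 <= 14 * L * grad2 D f.
Proof.
move=> [hf [phi ap]] tg g0; have [s c d] := ap.
have m0 := smooth_seg_mean_cvg hf ap tg; rewrite g0 in m0.
have rhs : 14 * L * (dot mu2 D (pderiv ord0 (phi n)) (pderiv ord0 (phi n)) +
     dot mu2 D (pderiv i1 (phi n)) (pderiv i1 (phi n))) @[n --> \oo] --> 14 * L * grad2 D f.
  by apply: cvgM; [exact: cvg_cst|exact: grad2_cvg].
pose m n := \int[leb]_(t in U) phi n (seg_point a q t).
have qphi n := cD (smooth_continuous (s n)).
have cc (c0 : R) : smooth (fun _ : plane R => c0) by exact: smooth_cst.
have q1 : sq_int mu2 D (cst 1) by apply: cD; exact: cst_continuous.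
have o1 : sq_int leb U (cst 1) by apply: sq_int_itv; exact: cst_continuous.
have tg2 := is_trace_sq_int tg.
split.
- have l : dot mu2 D (fun x => phi n x - m n) (fun x => phi n x - m n) @[n --> \oo] --> dot mu2 D f f.
    have e n : dot mu2 D (fun x => phi n x - m n) (fun x => phi n x - m n) =
       dot mu2 D (phi n) (phi n) - 2 * m n * dot mu2 D (phi n) (cst 1) +
       m n ^+ 2 * dot mu2 D (cst 1) (cst 1).
      have -> : (fun x => phi n x - m n) = (fun x => 1 * phi n x + (- m n) * cst 1 x).
        by apply/funext => x /=; ring.
      by rewrite dot_sqr_lin//; ring.
    rewrite (_ : dot mu2 D f f = dot mu2 D f f - 2 * 0 * dot mu2 D f (cst 1) +
       0 * 0 * dot mu2 D (cst 1) (cst 1)); last by ring.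
    apply: (eq_cvgn (fun n => esym (e n))).
    apply: cvgD; [apply: cvgB|].
    + exact: (cvg2_dot_self mD qphi (H1_sq_int hf) c).
    + apply: cvgM; first by apply: cvgM; [exact: cvg_cst|exact: m0].
      exact: (cvg2_dotl mD qphi (H1_sq_int hf) q1 c).
    + by apply: cvgM; [apply: cvgM; exact: m0|exact: cvg_cst].
  apply: (ler_cvg_to l rhs); apply: nearW => n.
  by have := tri_poincare d0 (s n); rewrite -hD.
- have cU := trace_cvg hf ap tg.
  have l : J * dot leb U (fun t => phi n (seg_point a q t) - m n) (fun t => phi n (seg_point a q t) - m n)
     @[n --> \oo] --> J * dot leb U (g \o seg_point a q) (g \o seg_point a q).
    apply: cvgM; first exact: cvg_cst.
    have e n : dot leb U (fun t => phi n (seg_point a q t) - m n) (fun t => phi n (seg_point a q t) - m n) =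
       dot leb U (phi n \o seg_point a q) (phi n \o seg_point a q) -
       2 * m n * dot leb U (phi n \o seg_point a q) (cst 1) +
       m n * m n * dot leb U (cst 1) (cst 1).
      have -> : (fun t => phi n (seg_point a q t) - m n) =
         (fun t => 1 * (phi n \o seg_point a q) t + (- m n) * cst 1 t).
        by apply/funext => x /=; ring.
      have hs := qs (s n); rewrite dot_sqr_lin//; ring.
    rewrite (_ : dot leb U _ _ = dot leb U (g \o seg_point a q) (g \o seg_point a q) -
       2 * 0 * dot leb U (g \o seg_point a q) (cst 1) +
       0 * 0 * dot leb U (cst 1) (cst 1)); last by ring.
    apply: (eq_cvgn (fun n => esym (e n))).
    apply: cvgD; [apply: cvgB|].
    + exact: (cvg2_dot_self mU (fun n => qs (s n)) tg2 cU).
    + apply: cvgM; first by apply: cvgM; [exact: cvg_cst|exact: m0].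
      exact: (cvg2_dotl mU (fun n => qs (s n)) tg2 o1 cU).
    + by apply: cvgM; [apply: cvgM; exact: m0|exact: cvg_cst].
  have -> : \int[leb]_(t in U) g (seg_point a q t) ^+ 2 = dot leb U (g \o seg_point a q) (g \o seg_point a q).
    by apply: eq_Rintegral => t _; rewrite expr2.
  apply: (ler_cvg_to l rhs); apply: nearW => n.
  by have := tri_edge_poincare d0 (s n); rewrite -hD.
Qed.

Lemma wderiv_mean_cvg j f phi : H1 D f -> smooth_approx D f phi ->
  \int[mu2]_(x in D) pderiv j (phi n) x @[n --> \oo] --> \int[mu2]_(x in D) wderiv D j f x.
Proof.
move=> hf [s c d]; have q1 : sq_int mu2 D (cst 1) by apply: cD; exact: cst_continuous.
have eX (k : plane R -> R) : dot mu2 D k (cst 1) = \int[mu2]_(x in D) k x.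
  by apply: eq_Rintegral => t _ /=; rewrite mulr1.
have qj n := cD (diff_continuous_pderiv (j := j) (s n)).
have := cvg2_dotl mD qj (H1_wderiv_sq_int j hf) q1 (d j).
by rewrite eX; apply: eq_cvgn => n; rewrite eX.
Qed.

End trace_theory2.

Section green.
Context (R : realType).
Local Notation mu2 := (plane_measure R).
Local Notation leb := (@lebesgue_measure R).
Local Notation U := (`[(0 : R), 1]%classic).
Local Notation i1 := (lift ord0 ord0 : 'I_2).

(** Limit of [tri_green] along one approximating sequence, which computes the traces on both
    edges. *)
Lemma H1s_green (a p q : plane R) (D : set (plane R)) (f g g' : plane R -> R) :
  tri_det a p q != 0 -> D = (tri a p q)° -> H1s D f ->
  is_trace D a q f g -> is_trace D p q f g' ->
  (p.1 - a.1) * \int[mu2]_(x in D) wderiv D ord0 f x +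
  (p.2 - a.2) * \int[mu2]_(x in D) wderiv D i1 f x =
  `|tri_det a p q| * (\int[leb]_(t in U) g' (seg_point p q t) -
                      \int[leb]_(t in U) g (seg_point a q t)).
Proof.
move=> d0 hD [hf [phi ap]] tg tg'; have [s _ _] := ap.
have d0' : tri_det p a q != 0.
  by rewrite -oppr_eq0; apply: contra_neq d0 => <-; rewrite /tri_det; ring.
have hD' : D = (tri p a q)° by rewrite hD [in RHS]tri_rot [in RHS]tri_swap.
have c1 := smooth_seg_mean_cvg d0 hD hf ap tg.
have c2 := smooth_seg_mean_cvg d0' hD' hf ap tg'.
have w0 := wderiv_mean_cvg hD hf ap (j := ord0).
have w1 := wderiv_mean_cvg hD hf ap (j := i1).
have l := @cvg_lin2 R (p.1 - a.1) (p.2 - a.2) _ _ _ _ w0 w1.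
have r := @cvgZB R `|tri_det a p q| _ _ _ _ c2 c1.
have e n := tri_green d0 (s n); rewrite -hD in e.
exact: (cvg_unique (@Rhausdorff R) l (eq_cvgn (fun n => esym (e n)) r)).
Qed.

End green.

(** * Products of smooth functions; derivatives and traces of affine functions *)

Section smooth_product.
Context (R : realType).

(** Combinations of products of smooth functions, stable under [pderiv] by the Leibniz rule. *)
Inductive product_class : (plane R -> R) -> Prop :=
| product_mul f g : smooth f -> smooth g -> product_class (fun x => f x * g x)
| product_lin a b f g : product_class f -> product_class g ->
    product_class (fun x => a * f x + b * g x).

Lemma smoothM (f g : plane R -> R) : smooth f -> smooth g -> smooth (fun x => f x * g x).
Proof.
move=> sf sg; suff h : forall k, product_class k -> smooth k by apply: h; exact: product_mul.
have dif k : product_class k -> forall x, differentiable k x.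
  elim=> [u v su sv x|b c u v _ du _ dv x].
    by apply: (differentiableM (smooth_diff x su) (smooth_diff x sv)).
  exact: differentiable_lin.
apply: smooth_coind; first exact: dif.
move=> k j; elim=> [u v su sv|b c u v pu du pv dv].
  rewrite pderivM; [|by move=> x; exact: smooth_diff|by move=> x; exact: smooth_diff].
  have -> : (fun x => pderiv j u x * v x + u x * pderiv j v x) =
     (fun x => 1 * (pderiv j u x * v x) + 1 * (u x * pderiv j v x)).
    by apply/funext => x; rewrite !mul1r.
  by apply: product_lin; apply: product_mul => //; exact: smooth_pderiv.
by rewrite pderiv_lin; [exact: product_lin|exact: dif|exact: dif].
Qed.

End smooth_product.

Section affine_H1s.
Context (R : realType).
Local Notation mu2 := (plane_measure R).
Local Notation leb := (@lebesgue_measure R).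
Local Notation U := (`[(0 : R), 1]%classic).
Local Notation i1 := (lift ord0 ord0 : 'I_2).

(* A function supported in the box lives in the interior of the big triangle
   below, so Green's formula there has no boundary term. *)
Lemma Rintegral_pderiv0 (psi : plane R -> R) (N : R) j : smooth psi -> 0 <= N ->
  (forall x, ~ box N x -> psi x = 0) ->
  exists a p q, [/\ tri_det a p q != 0, box N `<=` (tri a p q)° &
    \int[mu2]_(x in (tri a p q)°) pderiv j psi x = 0].
Proof.
move=> s N0 z; pose m := N + 1.
pose a : plane R := (- m, - m); pose p : plane R := (4 * m, - m); pose q : plane R := (- m, 4 * m).
have m0 : 0 < m by rewrite /m; lra.
have m5 : 4 * m - - m != 0 by apply: lt0r_neq0; lra.
have m00 : - m - - m = 0 by ring.
have d0 : tri_det a p q != 0.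
  rewrite /tri_det /a /p /q /= (_ : _ - _ = 25 * m ^+ 2); last by ring.
  by rewrite mulf_neq0// expf_neq0// gt_eqF.
have d0' : tri_det a q p != 0 by rewrite tri_det_swap oppr_eq0.
have bx (x y : R) : (x < - N) || (N < x) || (y < - N) || (N < y) -> psi (x, y) = 0.
  move=> h; apply: z => -[] /=; rewrite !in_itv/= => /andP[h1 h2] /andP[h3 h4].
  by move: h; rewrite !ltNge h1 h2 h3 h4.
have z1 : \int[leb]_(t in U) psi (seg_point a q t) = 0.
  rewrite (@eq_Rintegral _ _ _ leb U (cst 0)); first by rewrite Rintegral_cst_cc ?mul0r.
  move=> t _; apply: bx; rewrite /= /GRing.scale/= -!orbA; apply/orP; left.
  by rewrite /m; lra.
have z2 : \int[leb]_(t in U) psi (seg_point a p t) = 0.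
  rewrite (@eq_Rintegral _ _ _ leb U (cst 0)); first by rewrite Rintegral_cst_cc ?mul0r.
  move=> t _; apply: bx; rewrite /= /GRing.scale/=; apply/orP; left; apply/orP; right.
  by rewrite /m; lra.
have zz (x y : plane R) : x.1 + x.2 = 3 * m -> y.1 + y.2 = 3 * m ->
    \int[leb]_(t in U) psi (seg_point x y t) = 0.
  move=> e1 e2; rewrite (@eq_Rintegral _ _ _ leb U (cst 0)); first by rewrite Rintegral_cst_cc ?mul0r.
  move=> t _; apply: bx; rewrite /= /GRing.scale/=.
  set u := _ + _; set v := x.2 + _.
  have uv : u + v = 3 * m.
    rewrite /u /v -[in RHS](addr0 (3 * m)) -(mulr0 t) -(subrr (3 * m)) -{1}e1 -{1}e2 -e1; ring.
  have [h|h] := leP u N; last by rewrite !orbT.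
  have -> : N < v by move: uv; rewrite /m; lra.
  by rewrite !orbT.
have eD : tri a p q = tri a q p by rewrite tri_swap.
exists a, p, q; split => //.
  apply: subset_trans (tri_interior d0) => -[x y] [] /=; rewrite !in_itv/= => /andP[h1 h2] /andP[h3 h4].
  have dp : 0 < 25 * m ^+ 2 by rewrite mulr_gt0// exprn_gt0.
  have dE : tri_det a p q = 25 * m ^+ 2 by rewrite /tri_det /a /p /q /=; ring.
  have c1 : (tri_coord a p q (x, y)).1 = (x + m) / (5 * m).
    by rewrite /tri_coord dE /=; field; rewrite gt_eqF.
  have c2 : (tri_coord a p q (x, y)).2 = (y + m) / (5 * m).
    by rewrite /tri_coord dE /=; field; rewrite gt_eqF.
  change (ref_tri_int (tri_coord a p q (x, y))); split; rewrite ?c1 ?c2 -?mulrDl.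
  - by rewrite divr_gt0//; rewrite /m; lra.
  - by rewrite divr_gt0//; rewrite /m; lra.
  - by rewrite ltr_pdivrMr ?mul1r; rewrite /m; lra.
have g1 := tri_green d0 s; have g2 := tri_green d0' s.
move: g1 g2; rewrite -eD z1 z2 !zz; try by rewrite /=; ring.
rewrite subrr !mulr0 /a /p /q /= => g1 g2.
have [->|->] := ord2P j.
  move: g1; rewrite m00 mul0r addr0.
  by move/eqP; rewrite mulf_eq0 (negPf m5)/= => /eqP.
move: g2; rewrite m00 mul0r add0r.
by move/eqP; rewrite mulf_eq0 (negPf m5)/= => /eqP.
Qed.

Definition aff_coef (c1 c2 : R) (j : 'I_2) : R := if j == ord0 then c1 else c2.

Lemma pderiv_aff_coef c0 c1 c2 j (x : plane R) :
  pderiv j (aff c0 c1 c2) x = aff_coef c1 c2 j.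
Proof.
rewrite pderiv_aff /aff_coef /basis_vec.
by have [->|->] := ord2P j; rewrite /= ?mulr1 ?mulr0 ?addr0 ?add0r.
Qed.

Variables (a p q : plane R) (D : set (plane R)).
Hypothesis d0 : tri_det a p q != 0.
Hypothesis hD : D = (tri a p q)°.
Let mU : measurable (U : set (measurableTypeR R)). Proof. by []. Qed.
Let oD : open D. Proof. by rewrite hD; exact: open_interior. Qed.
Let mD : measurable (D : set (mplane R)). Proof. exact: open_measurable_plane. Qed.
Let cD (h : plane R -> R) : continuous h -> sq_int mu2 D h.
Proof. by rewrite hD; exact: tri_sq_int. Qed.

Lemma continuous_aff (c0 c1 c2 : R) : continuous (aff c0 c1 c2).
Proof. exact: continuous_lin2. Qed.

Lemma is_wderiv_aff c0 c1 c2 j : is_wderiv D j (aff c0 c1 c2) (cst (aff_coef c1 c2 j)).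
Proof.
have q1 : sq_int mu2 D (cst (aff_coef c1 c2 j)) by apply: cD; exact: cst_continuous.
have q2 : sq_int mu2 D (aff c0 c1 c2) by apply: cD; exact: continuous_aff.
split => // phi tphi.
have tdphi := test_pderiv j tphi.
have [sphi [K [cK KD K0]]] := tphi.
have [N [N0 KN]] : exists N, 0 <= N /\ K `<=` box N.
  have [M [_ hM]] := compact_bounded cK.
  exists (`|M| + 1); split; first by rewrite addr_ge0.
  move=> -[x y] Kx; have := hM (`|M| + 1) _ (x, y) Kx.
  rewrite (le_lt_trans (ler_norm M)) ?ltrDl// => /(_ isT); rewrite /= prod_normE/= ge_max => /andP[].
  by rewrite !ler_norml => h1 h2; split; rewrite /= in_itv/=.
(* Integration by parts: the derivative of this compactly supported product has integral 0. *)
pose psi x := aff c0 c1 c2 x * phi x.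
have dpsi : pderiv j psi = (fun x => aff_coef c1 c2 j * phi x + aff c0 c1 c2 x * pderiv j phi x).
  rewrite /psi pderivM; [|by move=> x; exact: differentiable_aff|by move=> x; exact: smooth_diff].
  by apply/funext => x; rewrite pderiv_aff_coef.
have spsi : smooth psi by apply: smoothM => //; exact: smooth_aff.
have psi0 x : ~ box N x -> psi x = 0 by move=> nx; rewrite /psi K0 ?mulr0// => /KN.
have [a' [p' [q' [d' bS i0]]]] := Rintegral_pderiv0 j spsi N0 psi0.
have q3 := test_sq_int oD tphi; have q4 := test_sq_int oD tdphi.
have dK x : ~ K x -> pderiv j phi x = 0.
  have cl : closed K by apply: compact_closed => //; exact: norm_hausdorff.
  move=> nK; have e : \forall z \near x, cst 0 z = phi z.
    have : nbhs x (~` K) by apply: open_nbhs_nbhs; split => //; exact: closed_openC.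
    by apply: filterS => z nz; rewrite K0.
  by rewrite /pderiv -(near_eq_derive _ e) derive_cst.
have : \int[mu2]_(x in D) pderiv j psi x = 0.
  rewrite -i0 Rintegral_mkcond [RHS]Rintegral_mkcond; apply: eq_Rintegral => x _.
  rewrite !patchE; have [xK|xK] := pselect (K x).
    by rewrite mem_set ?mem_set//; [exact/bS/KN|exact: KD].
  by rewrite dpsi /= K0// dK// !mulr0 addr0; case: ifP; case: ifP.
rewrite dpsi RintegralD//.
- rewrite -/(dot mu2 D (cst _) phi) -/(dot mu2 D (aff _ _ _) (pderiv j phi)).
  by rewrite /ip /dot => /eqP; rewrite addrC addr_eq0 => /eqP.
- exact: (sq_intM mD q1 q3).
- exact: (sq_intM mD q2 q4).
Qed.

Lemma H1_aff c0 c1 c2 : H1 D (aff c0 c1 c2).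
Proof.
split; first by apply: cD; exact: continuous_aff.
by move=> j; exists (cst (aff_coef c1 c2 j)); exact: is_wderiv_aff.
Qed.

Lemma smooth_approx_aff c0 c1 c2 : smooth_approx D (aff c0 c1 c2) (fun=> aff c0 c1 c2).
Proof.
split.
- by move=> n; exact: smooth_aff.
- apply: (eq_cvgn (u := cst 0%E)); last exact: cvg_cst.
  by move=> n; rewrite integral0_eq// => x _; rewrite subrr expr0n.
- move=> j; apply: (eq_cvgn (u := cst 0%E)); last exact: cvg_cst.
  move=> n; rewrite /cst.
  rewrite -(@integral0 _ _ _ mu2 D); apply: ae_eq_integral => //.
    apply/measurable_EFinP; apply: measurable_funX; apply: measurable_funB.
      by apply: wderiv_measurable => //; exact: H1_aff.
    by apply: measurable_funTS; apply: continuous_measurable_plane;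
       apply: diff_continuous_pderiv; exact: smooth_aff.
  apply: ae_imply (wderiv_ae oD (is_wderiv_aff c0 c1 c2 j)) => x hx Dx.
  by rewrite hx// pderiv_aff_coef subrr expr0n.
Qed.

Lemma H1s_aff c0 c1 c2 : H1s D (aff c0 c1 c2).
Proof. by split; [exact: H1_aff|exists (fun=> aff c0 c1 c2); exact: smooth_approx_aff]. Qed.

Lemma wderiv_aff c0 c1 c2 j :
  {ae mu2, forall x, D x -> wderiv D j (aff c0 c1 c2) x = aff_coef c1 c2 j}.
Proof. exact: (wderiv_ae oD (is_wderiv_aff c0 c1 c2 j)). Qed.

Lemma is_trace_aff c0 c1 c2 : is_trace D a q (aff c0 c1 c2) (aff c0 c1 c2).
Proof.
apply/(is_traceP D d0); split.
  apply: measurable_funTS; apply: continuous_measurable_fun.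
  by apply: continuous_seg; exact: continuous_aff.
exists (fun=> aff c0 c1 c2); split; first exact: smooth_approx_aff.
apply: (eq_cvgn (u := cst 0%E)); last exact: cvg_cst.
by move=> n; rewrite integral0_eq// => x _; rewrite subrr expr0n.
Qed.

End affine_H1s.

(** * The Crouzeix-Raviart interpolant on one triangle *)

Section local_interpolant.
Context (R : realType).
Local Notation mu2 := (plane_measure R).
Local Notation leb := (@lebesgue_measure R).
Local Notation U := (`[(0 : R), 1]%classic).
Local Notation i1 := (lift ord0 ord0 : 'I_2).

Definition edge_mean (D : set (plane R)) (x y : plane R) (f : plane R -> R) : R :=
  \int[leb]_(t in U) trace D x y f (seg_point x y t).

Lemma Rintegral_flip_continuous (h : R -> R) : continuous h ->
  \int[leb]_(t in U) h (1 - t) = \int[leb]_(t in U) h t.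
Proof.
move=> ch; pose h1 t := 2^-1 * (`|h t| + h t); pose h2 t := 2^-1 * (`|h t| - h t).
have c1 : continuous h1.
  move=> z; apply: cvgM; first exact: cvg_cst.
  by apply: cvgD; [apply: cvg_norm; exact: ch|exact: ch].
have c2 : continuous h2.
  move=> z; apply: cvgM; first exact: cvg_cst.
  by apply: cvgB; [apply: cvg_norm; exact: ch|exact: ch].
have p1 t : 0 <= h1 t by rewrite /h1; have := ler_norm (- h t); rewrite normrN; lra.
have p2 t : 0 <= h2 t by rewrite /h2; have := ler_norm (h t); lra.
have j1 := integrable_itv_continuous 0 1 c1; have j2 := integrable_itv_continuous 0 1 c2.
have [k1 e1] := Rintegral_flip j1 p1; have [k2 e2] := Rintegral_flip j2 p2.
have e t : h t = h1 t - h2 t by rewrite /h1/h2; lra.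
under eq_Rintegral do rewrite e; under [in RHS]eq_Rintegral do rewrite e.
by rewrite !RintegralB// e1 e2.
Qed.

(** The trace is chosen separately for each ordered pair of endpoints, so reversal is checked on
    smooth approximations. *)
Lemma edge_mean_rev (a p q : plane R) (D : set (plane R)) f : tri_det a p q != 0 ->
  D = (tri a p q)° -> H1s D f -> edge_mean D q a f = edge_mean D a q f.
Proof.
move=> d0 hD hf.
have d0' : tri_det q p a != 0.
  by rewrite -oppr_eq0; apply: contra_neq d0 => <-; rewrite /tri_det; ring.
have hD' : D = (tri q p a)° by rewrite hD [in RHS]tri_swap [in RHS]tri_rot.
have [h [phi ap]] := hf; have [s _ _] := ap.
have c1 := smooth_seg_mean_cvg d0 hD h ap (traceP d0 hD hf).
have c2 := smooth_seg_mean_cvg d0' hD' h ap (traceP d0' hD' hf).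
have e n : \int[leb]_(t in U) phi n (seg_point q a t) = \int[leb]_(t in U) phi n (seg_point a q t).
  rewrite -(Rintegral_flip_continuous (continuous_seg (smooth_continuous (s n)))).
  apply: eq_Rintegral => t _; congr phi; rewrite /seg_point.
  by congr pair; rewrite /= /GRing.scale/=; ring.
exact: (cvg_unique (@Rhausdorff R) c2 (eq_cvgn (fun n => esym (e n)) c1)).
Qed.

Lemma mean_arith (k1 k2 x y J m m' : R) : J != 0 -> x = 0 -> y = 0 ->
  k1 * x + k2 * y = `|J| * (m' - m) -> m' = m.
Proof.
move=> J0 -> ->; rewrite !mulr0 addr0 => /esym/eqP.
by rewrite mulf_eq0 normr_eq0 (negPf J0)/= subr_eq0 => /eqP.
Qed.

(** The left side of [H1s_green] vanishes, so the means on the two edges ending at q coincide. *)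
Lemma edge_mean_green (a p q : plane R) (D : set (plane R)) f : tri_det a p q != 0 ->
  D = (tri a p q)° -> H1s D f -> (forall j, \int[mu2]_(x in D) wderiv D j f x = 0) ->
  edge_mean D p q f = edge_mean D a q f.
Proof.
move=> d0 hD hf z.
have d0' : tri_det p a q != 0.
  by rewrite -oppr_eq0; apply: contra_neq d0 => <-; rewrite /tri_det; ring.
have hD' : D = (tri p a q)° by rewrite hD [in RHS]tri_rot [in RHS]tri_swap.
have G := H1s_green d0 hD hf (traceP d0 hD hf) (traceP d0' hD' hf).
exact: (mean_arith d0 (z ord0) (z i1) G).
Qed.

(** Green's formula carries the vanishing mean from one edge to the next, and reversal covers both
    orientations. *)
Lemma edge_mean_all (a p q : plane R) (D : set (plane R)) f : tri_det a p q != 0 ->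
  D = (tri a p q)° -> H1s D f -> (forall j, \int[mu2]_(x in D) wderiv D j f x = 0) ->
  edge_mean D a q f = 0 ->
  forall x y, x != y -> [\/ x = a, x = p | x = q] -> [\/ y = a, y = p | y = q] ->
  edge_mean D x y f = 0.
Proof.
move=> d0 hD hf z maq.
have d1 : tri_det q p a != 0.
  by rewrite -oppr_eq0; apply: contra_neq d0 => <-; rewrite /tri_det; ring.
have hD1 : D = (tri q p a)° by rewrite hD [in RHS]tri_swap [in RHS]tri_rot.
have d2 : tri_det p a q != 0.
  by rewrite -oppr_eq0; apply: contra_neq d0 => <-; rewrite /tri_det; ring.
have hD2 : D = (tri p a q)° by rewrite hD [in RHS]tri_rot [in RHS]tri_swap.
have d3 : tri_det a q p != 0 by rewrite tri_det_swap oppr_eq0.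
have hD3 : D = (tri a q p)° by rewrite hD [in RHS]tri_swap.
have mqa : edge_mean D q a f = 0 by rewrite (edge_mean_rev d0 hD hf).
have mpq : edge_mean D p q f = 0 by rewrite (edge_mean_green d0 hD hf z).
have mqp : edge_mean D q p f = 0 by rewrite (edge_mean_rev d2 hD2 hf).
have mpa : edge_mean D p a f = 0 by rewrite (edge_mean_green d1 hD1 hf z).
have map : edge_mean D a p f = 0.
  by rewrite -(edge_mean_green d3 hD3 hf z).
by move=> x y xy [?|?|?] [?|?|?]; subst x y; rewrite ?eqxx// in xy.
Qed.

Variables (a p q : plane R) (D : set (plane R)).
Hypothesis d0 : tri_det a p q != 0.
Hypothesis hD : D = (tri a p q)°.
Let mU : measurable (U : set (measurableTypeR R)). Proof. by []. Qed.
Let oD : open D. Proof. by rewrite hD; exact: open_interior. Qed.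
Let mD : measurable (D : set (mplane R)). Proof. exact: open_measurable_plane. Qed.
Let cD (h : plane R -> R) : continuous h -> sq_int mu2 D h.
Proof. by rewrite hD; exact: tri_sq_int. Qed.
Let A := \int[mu2]_(x in D) (1 : R).

Lemma interior_tri_area : A = `|tri_det a p q| / 2.
Proof. by rewrite /A hD tri_area. Qed.

Let A0 : A != 0.
Proof. by rewrite interior_tri_area mulf_neq0 ?normr_eq0// invr_neq0. Qed.

Lemma sq_int_integrable_tri g : sq_int mu2 D g -> mu2.-integrable D (EFin \o g).
Proof.
move=> hg; have q1 : sq_int mu2 D (cst 1) by apply: cD; exact: cst_continuous.
by have := sq_intM mD hg q1; apply: eq_integrable => // x _ /=; rewrite mulr1.
Qed.

Lemma Rintegral_sub_mean g : sq_int mu2 D g ->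
  \int[mu2]_(x in D) (g x - (\int[mu2]_(y in D) g y) / A) = 0.
Proof.
move=> hg; set m := _ / A.
have q1 : sq_int mu2 D (cst 1) by apply: cD; exact: cst_continuous.
have i1' : mu2.-integrable D (EFin \o cst 1) by exact: sq_int_integrable_tri.
transitivity (\int[mu2]_(x in D) (g x - m * cst 1 x)).
  by apply: eq_Rintegral => x _ /=; rewrite mulr1.
rewrite RintegralB//; [|exact: sq_int_integrable_tri|exact: (integrableZl mD m i1')].
rewrite RintegralZl// -/A /m mulfVK// subrr //.
Qed.

Lemma aff_shift (c c1 c2 : R) x (F : R) : 1 * F + (-1) * aff c c1 c2 x =
  1 * (1 * F + (-1) * aff 0 c1 c2 x) + (-1) * aff c 0 0 x.
Proof. by rewrite /aff; ring. Qed.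

Lemma aff_cst (c : R) x : aff c 0 0 x = c.
Proof. by rewrite /aff; ring. Qed.

(** The affine function gets the mean gradient of f, and its constant term is fixed by the mean on
    one edge; the other edge conditions follow from [edge_mean_all]. So no system for three edge
    values is solved, and the gradient of the error has mean zero by construction. *)
Lemma interp_exists f : H1s D f -> exists c0 c1 c2 : R,
  let w := fun x => 1 * f x + (-1) * aff c0 c1 c2 x in
  [/\ H1s D w,
     forall j, \int[mu2]_(x in D) wderiv D j w x = 0,
     forall j, {ae mu2, forall x, D x -> wderiv D j w x =
         wderiv D j f x - (\int[mu2]_(y in D) wderiv D j f y) / A} &
     forall x y, x != y -> [\/ x = a, x = p | x = q] -> [\/ y = a, y = p | y = q] ->
       edge_mean D x y w = 0].
Proof.
move=> hf; have [Hf _] := hf.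
pose g j := (\int[mu2]_(y in D) wderiv D j f y) / A.
pose w c := fun x => 1 * f x + (-1) * aff c (g ord0) (g i1) x.
have hw c : H1s D (w c) := H1s_lin hD 1 (-1) hf (H1s_aff hD c (g ord0) (g i1)).
have dw c j : {ae mu2, forall x, D x -> wderiv D j (w c) x = wderiv D j f x - g j}.
  have [Ha _] := H1s_aff hD c (g ord0) (g i1).
  apply: ae_imply2 (wderiv_lin oD j 1 (-1) Hf Ha) (wderiv_aff hD c (g ord0) (g i1) j).
  move=> x h1 h2 Dx; rewrite h1// h2// mul1r mulN1r /aff_coef.
  by have [->|->] := ord2P j.
have iw c j : \int[mu2]_(x in D) wderiv D j (w c) x = 0.
  have sqf := H1_wderiv_sq_int j Hf; have [Hw _] := hw c.
  rewrite -(Rintegral_sub_mean sqf) /Rintegral; congr fine; apply: ae_eq_integral => //.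
  - by apply/measurable_EFinP; have [] := H1_wderiv_sq_int j Hw.
  - by apply/measurable_EFinP; apply: measurable_funB => //; have [] := sqf.
  - by apply: ae_imply (dw c j) => x h Dx; rewrite h.
pose m0 := edge_mean D a q (w 0).
have mean c : edge_mean D a q (w c) = edge_mean D a q (w 0) - c.
  have e : w c = (fun x => 1 * w 0 x + (-1) * aff c 0 0 x).
    by apply/funext => x; exact: aff_shift.
  have ha := H1s_aff hD c 0 0.
  have := trace_lin d0 hD 1 (-1) (hw 0) ha.
  rewrite -e => h1; have h2 := trace_ae d0 hD ha (is_trace_aff d0 hD c 0 0).
  have s0 := is_trace_sq_int d0 (traceP d0 hD (hw 0)).
  have sc := is_trace_sq_int d0 (traceP d0 hD (hw c)).
  have one : sq_int leb U (cst 1) by apply: sq_int_itv; exact: cst_continuous.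
  have j0 : leb.-integrable U (EFin \o (trace D a q (w 0) \o seg_point a q)).
    by have := sq_intM mU s0 one; apply: eq_integrable => // x _ /=; rewrite mulr1.
  have j1 : leb.-integrable U (EFin \o cst c).
    by apply: integrable_itv_continuous; exact: cst_continuous.
  transitivity (\int[leb]_(t in U) (trace D a q (w 0) (seg_point a q t) - cst c t)); last first.
    by rewrite RintegralB// Rintegral_cst_cc// subr0 mulr1.
  rewrite /edge_mean /Rintegral; congr fine; apply: ae_eq_integral => //.
  - by apply/measurable_EFinP; have [] := sc.
  - by apply/measurable_EFinP; apply: measurable_funB => //; have [] := s0.
  - apply: ae_imply2 h1 h2 => t h1 h2 tU; by rewrite h1// h2// aff_cst mul1r mulN1r.
exists m0, (g ord0), (g i1); split.
- exact: (hw m0).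
- exact: (iw m0).
- exact: (dw m0).
- apply: (edge_mean_all d0 hD (hw m0) (iw m0)).
  by rewrite mean subrr.
Qed.

End local_interpolant.

(** * A Poincare inequality for the Slobodeckij seminorm *)

Section le_integral_any.
Local Open Scope ereal_scope.

(* Without measurability, since the integral of a nonnegative function is a
   supremum over the simple functions below it. *)
Lemma le_integral_nomeas d (T : measurableType d) (R : realType)
    (mu : {measure set T -> \bar R}) (D : set T) (f g : T -> \bar R) :
  (forall x, D x -> 0 <= f x) -> (forall x, D x -> f x <= g x) ->
  \int[mu]_(x in D) f x <= \int[mu]_(x in D) g x.
Proof.
move=> f0 fg; rewrite !ge0_integralE//; last by move=> x Dx; exact: le_trans (f0 _ Dx) (fg _ Dx).
apply: le_ereal_sup => _ [h hf <-]; exists h => // x; apply: le_trans (hf x) _.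
by rewrite /patch; case: ifPn => // /set_mem; exact: fg.
Qed.

End le_integral_any.

Section fractional_poincare.
Context (R : realType).
Local Notation mu2 := (plane_measure R).

Definition frac_kernel (s : R) (g : plane R -> R) (x y : plane R) : R :=
  (g x - g y) ^+ 2 / (eucl_dist x y `^ (2 + 2 * s)).

Definition mean (D : set (plane R)) (g : plane R -> R) : R :=
  (\int[mu2]_(x in D) g x) / \int[mu2]_(x in D) 1.

Definition variance (D : set (plane R)) (g : plane R -> R) : R :=
  dot mu2 D (fun x => g x - mean D g) (fun x => g x - mean D g).

Section one_cell.
Variables (D : set (plane R)) (g : plane R -> R).
Hypothesis mD : measurable (D : set (mplane R)).
Hypothesis sg : sq_int mu2 D g.
Hypothesis s1 : sq_int mu2 D (cst 1).
Hypothesis A0 : 0 < \int[mu2]_(x in D) (1 : R).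
Let A := \int[mu2]_(x in D) (1 : R).
Let I1 := \int[mu2]_(x in D) g x.
Let I2 := dot mu2 D g g.

(** Closed form of the integral of (g x - g y)^2 over y in D. *)
Let psi (x : plane R) : R := A * g x ^+ 2 - 2 * I1 * g x + I2.

Let dot11 : dot mu2 D (cst 1) (cst 1) = A.
Proof. by apply: eq_Rintegral => x _; rewrite /cst mulr1. Qed.

Let dotg1 : dot mu2 D g (cst 1) = I1.
Proof. by apply: eq_Rintegral => x _; rewrite /cst mulr1. Qed.

Let dot_shift a b : dot mu2 D (fun x => a * g x + b * cst 1 x) (fun x => a * g x + b * cst 1 x)
  = a ^+ 2 * I2 + 2 * a * b * I1 + b ^+ 2 * A.
Proof. by rewrite dot_sqr_lin// dot11 dotg1. Qed.

Let psi_dot x : (\int[mu2]_(y in D) ((g x - g y) ^+ 2)%:E)%E = (psi x)%:E.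
Proof.
have e y : g x - g y = (-1) * g y + g x * cst 1 y by rewrite /cst; clear; ring.
under eq_integral do rewrite e.
rewrite (dotEFin mD); last exact: (sq_int_lin mD (-1) (g x) sg s1).
rewrite dot_shift /psi; congr EFin.
move: A I1 I2 (g x) => {}a {}b {}c z.
ring.
Qed.

Lemma var_expand : variance D g = I2 - I1 ^+ 2 / A.
Proof.
have e y : g y - mean D g = 1 * g y + (- (I1 / A)) * cst 1 y.
  by rewrite mul1r mulr1.
rewrite /variance (_ : (fun x => _) = (fun x => 1 * g x + (- (I1 / A)) * cst 1 x)); last first.
  by apply/funext => y; exact: e.
rewrite dot_shift; move: A0; rewrite -/A; move: A I1 I2 => {}a {}b {}c a0.
by field; rewrite gt_eqF.
Qed.

(** Expanding the square and integrating leaves 2 (A I2 - I1^2). *)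
Lemma integral_cell_kernel :
  (\int[mu2]_(x in D) \int[mu2]_(y in D) ((g x - g y) ^+ 2)%:E)%E =
  (2 * A * variance D g)%:E.
Proof.
under eq_integral do rewrite psi_dot.
have i2 := sq_int_integrable_sq sg.
have iA : mu2.-integrable D (EFin \o (fun x => A * g x ^+ 2)).
  by have := integrableZl mD A i2.
have ig : mu2.-integrable D (EFin \o g).
  by have := sq_intM mD sg s1; apply: eq_integrable => // x _ /=; rewrite mulr1.
have ik : mu2.-integrable D (EFin \o cst (1 : R)).
  by have := sq_intM mD s1 s1; apply: eq_integrable => // x _ /=; rewrite mulr1.
have iB : mu2.-integrable D (EFin \o (fun x => (- (2 * I1)) * g x)).
  by have := integrableZl mD (- (2 * I1)) ig.
have iC : mu2.-integrable D (EFin \o (fun x => I2 * cst 1 x)).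
  by have := integrableZl mD I2 ik.
have iAB : mu2.-integrable D (EFin \o (fun x => A * g x ^+ 2 + (- (2 * I1)) * g x)).
  by have := integrableD mD iA iB.
have e x : psi x = (A * g x ^+ 2 + (- (2 * I1)) * g x) + I2 * cst 1 x.
  by rewrite /psi /cst mulr1 mulNr.
under eq_integral do rewrite e.
have iE : mu2.-integrable D (EFin \o (fun x => (A * g x ^+ 2 + (- (2 * I1)) * g x) + I2 * cst 1 x)).
  by have := integrableD mD iAB iC.
transitivity ((\int[mu2]_(x in D) ((A * g x ^+ 2 + (- (2 * I1)) * g x) + I2 * cst 1 x))%:E).
  by rewrite /Rintegral fineK//; exact: (integrable_fin_num mD iE).
rewrite (RintegralD mD iAB iC) (RintegralD mD iA iB).
rewrite (RintegralZl _ mD i2) (RintegralZl _ mD ig) (RintegralZl _ mD ik) -/A -/I1.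
have -> : \int[mu2]_(x in D) (g x ^+ 2) = I2.
  by apply: eq_Rintegral => x _; rewrite expr2.
rewrite var_expand; congr EFin.
move: A0; rewrite -/A; move: A I1 I2 => {}a {}b {}c a0.
by field; rewrite gt_eqF.
Qed.

Lemma mpsi : measurable_fun D (fun x => (\int[mu2]_(y in D) ((g x - g y) ^+ 2)%:E)%E).
Proof.
have [mg _] := sg.
rewrite (_ : (fun x => _) = EFin \o psi); last by apply/funext => x; exact: psi_dot.
apply/measurable_EFinP; apply: measurable_funD; last exact: measurable_cst.
apply: measurable_funB; apply: measurable_funM; [exact: measurable_cst|exact: measurable_funX|exact: measurable_cst|exact: mg].
Qed.

End one_cell.

(** Within a cell the distance is at most [d i], so off the diagonal the kernel dominates (g x - g
    y)^2 divided by [d i] to the power 2 + 2 s. The cells are disjoint, so their diagonal blocks fit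
    into the double integral over Omega. *)
Lemma frac_poincare (I : finType) (P : {set I}) (D_ : I -> set (plane R))
    (Omega : set (plane R)) (s : R) (g : plane R -> R) (d : I -> R) :
  0 < s -> measurable (Omega : set (mplane R)) ->
  (forall i, i \in P -> measurable (D_ i : set (mplane R))) ->
  (forall i, i \in P -> D_ i `<=` Omega) ->
  (forall i k x, i \in P -> k \in P -> D_ i x -> D_ k x -> i = k) ->
  (forall i, i \in P -> sq_int mu2 (D_ i) g) ->
  (forall i, i \in P -> sq_int mu2 (D_ i) (cst 1)) ->
  (forall i, i \in P -> 0 < \int[mu2]_(x in D_ i) (1 : R)) ->
  (forall i, i \in P -> 0 < d i) ->
  (forall i x y, i \in P -> D_ i x -> D_ i y -> eucl_dist x y <= d i) ->
  ((\sum_(i in P) (d i `^ (2 + 2 * s))^-1 *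
     (2 * (\int[mu2]_(x in D_ i) (1 : R)) * variance (D_ i) g))%:E <=
   \int[mu2]_(x in Omega) \int[mu2]_(y in Omega) (frac_kernel s g x y)%:E)%E.
Proof.
move=> s0 mO mD DO dis sg s1 A0 d0 dd.
pose e i := (d i `^ (2 + 2 * s))^-1.
have e0 i : 0 <= e i by rewrite invr_ge0 powR_ge0.
pose k i x := (\int[mu2]_(y in D_ i) ((g x - g y) ^+ 2)%:E)%E.
have k0 i x : (0 <= k i x)%E by apply: integral_ge0 => y _; rewrite lee_fin sqr_ge0.
(* Contribution of cell i as a function of x; at each x at most one of them is nonzero. *)
pose Psi i : plane R -> \bar R := if i \in P then ((fun x => (e i)%:E * k i x)%E \_ (D_ i)) else cst 0%E.
have Psi0 i x : (0 <= Psi i x)%E.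
  by rewrite /Psi; case: ifP => // _; rewrite /patch; case: ifP => // _; apply: mule_ge0 => //; rewrite lee_fin.
have mk i : i \in P -> measurable_fun (D_ i) (fun x => ((e i)%:E * k i x)%E).
  by move=> iP; apply: measurable_funeM; apply: mpsi => //; [exact: mD|exact: sg|exact: s1].
have intPsi i : i \in P -> (\int[mu2]_(x in Omega) Psi i x =
    ((e i) * (2 * (\int[mu2]_(x in D_ i) (1 : R)) * variance (D_ i) g))%:E)%E.
  move=> iP; rewrite /Psi iP -integral_mkcondr setIidr; last exact: DO.
  rewrite ge0_integralZl//; [|exact: mD| |].
  - by rewrite integral_cell_kernel//; [exact: mD|exact: sg|exact: s1|exact: A0].
  - by apply: mpsi => //; [exact: mD|exact: sg|exact: s1].
  - by rewrite lee_fin.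
rewrite -sumEFin; under eq_bigr => i iP do rewrite -intPsi//.
rewrite big_mkcond/= (eq_bigr (fun i => (\int[mu2]_(x in Omega) Psi i x)%E)); last first.
  by move=> i _; case: ifPn => // /negPf iP; rewrite /Psi iP integral0.
rewrite -ge0_integral_sum//; last first.
  move=> i; rewrite /Psi; case: ifPn => [iP|_]; last exact: measurable_cst.
  by apply/(measurable_restrict _ (mD i iP) mO); rewrite setIidr; [exact: mk|exact: DO].
apply: le_integral_nomeas => [x _|x Ox]; first by apply: sume_ge0.
have K0 : (0 <= \int[mu2]_(y in Omega) (frac_kernel s g x y)%:E)%E.
  by apply: integral_ge0 => y _; rewrite lee_fin /frac_kernel divr_ge0 ?sqr_ge0 ?powR_ge0.
have [[i [iP Dx]]|nD] := pselect (exists i, i \in P /\ D_ i x); last first.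
  rewrite big1// => i _; rewrite /Psi; case: ifPn => // iP; rewrite patchN//; apply/negP => /set_mem Dx.
  by apply: nD; exists i.
rewrite (bigD1 i)//= big1 ?adde0; last first.
  move=> k' ki; rewrite /Psi; case: ifPn => // kP; rewrite patchN//; apply/negP => /set_mem Dx'.
  by move/eqP: ki; apply; exact: dis Dx' Dx.
rewrite /Psi iP patchT ?inE// /k -ge0_integralZl//; [|exact: mD| | |].
- rewrite -[X in (\int[_]_(y in X) _)%E](setIidr (DO _ iP)) integral_mkcondr.
  apply: le_integral_nomeas => y Oy; rewrite /patch; case: ifPn => //.
  + by move=> _; rewrite mule_ge0// lee_fin// sqr_ge0.
  + move=> /set_mem Dy; rewrite -EFinM lee_fin /frac_kernel.
    (* On the diagonal both sides vanish. *)
    have [<-|dxy] := eqVneq x y; first by rewrite subrr expr0n/= mulr0 mul0r.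
    rewrite mulrC ler_wpM2l ?sqr_ge0//.
    have dp := eucl_dist_gt0 dxy.
    rewrite /e lef_pV2 ?posrE ?powR_gt0//; last exact: d0.
    by apply: ge0_ler_powR; rewrite ?nnegrE ?eucl_dist_ge0//; [lra|exact: ltW (d0 _ iP)|exact: dd].
  + by move=> _; rewrite lee_fin divr_ge0 ?sqr_ge0 ?powR_ge0.
- by apply/measurable_EFinP; apply: measurable_funX; apply: measurable_funB => //;
    have [] := sg _ iP.
- by move=> y _; rewrite lee_fin sqr_ge0.
- by rewrite lee_fin.
Qed.

End fractional_poincare.

(** * Geometry of triangles: diameters, inscribed discs, shape regularity *)

Section triangle_geometry.
Context (R : realType).
Implicit Types (a p q x y : plane R).

(** Triangle inequality with coefficients of modulus at most 1; Lagrange's identity provides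
    Cauchy-Schwarz. It bounds the diameter of a triangle by two of its sides. *)
Lemma eucl_sum_le (al be u1 u2 v1 v2 : R) : `|al| <= 1 -> `|be| <= 1 ->
  Num.sqrt ((al * u1 + be * v1) ^+ 2 + (al * u2 + be * v2) ^+ 2) <=
  Num.sqrt (u1 ^+ 2 + u2 ^+ 2) + Num.sqrt (v1 ^+ 2 + v2 ^+ 2).
Proof.
move=> ha hb.
have U0 : 0 <= u1 ^+ 2 + u2 ^+ 2 by rewrite addr_ge0 ?sqr_ge0.
have V0 : 0 <= v1 ^+ 2 + v2 ^+ 2 by rewrite addr_ge0 ?sqr_ge0.
rewrite -ler_sqr ?nnegrE ?addr_ge0 ?sqrtr_ge0// sqr_sqrtr ?addr_ge0 ?sqr_ge0//.
rewrite [leRHS]sqrrD !sqr_sqrtr// -mulr_natr -sqrtrM//.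
set S := Num.sqrt _.
have S0 : 0 <= S by exact: sqrtr_ge0.
have CS : `|u1 * v1 + u2 * v2| <= S.
  rewrite -sqrtr_sqr ler_sqrt ?mulr_ge0// -subr_ge0.
  rewrite (_ : _ - _ = (u1 * v2 - u2 * v1) ^+ 2) ?sqr_ge0//; ring.
have ab : `|al * be| <= 1 by rewrite normrM -[leRHS]mul1r ler_pM.
have h : `|al * be * (u1 * v1 + u2 * v2)| <= S.
  by rewrite normrM -[leRHS]mul1r ler_pM.
have a2 : al ^+ 2 <= 1 by rewrite -real_normK ?num_real// expr_le1.
have b2 : be ^+ 2 <= 1 by rewrite -real_normK ?num_real// expr_le1.
have h' := ler_normlW h.
have := ler_wpM2r U0 a2; have := ler_wpM2r V0 b2.
rewrite !mul1r => {}b2 {}a2.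
by move: h' a2 b2; lra.
Qed.

Lemma tri_dist_le a p q x y : tri a p q x -> tri a p q y ->
  eucl_dist x y <= eucl_dist p a + eucl_dist q a.
Proof.
move=> [[x1 x2] [/= hx1 hx2 hx] <-] [[y1 y2] [/= hy1 hy2 hy] <-].
have h1 : `|x1 - y1| <= 1 by rewrite ler_norml; lra.
have h2 : `|x2 - y2| <= 1 by rewrite ler_norml; lra.
have := eucl_sum_le (p.1 - a.1) (p.2 - a.2) (q.1 - a.1) (q.2 - a.2) h1 h2.
rewrite /eucl_dist /tri_map /=; congr (_ <= _); congr Num.sqrt; ring.
Qed.

Lemma tri_vertices a p q : [/\ tri a p q a, tri a p q p & tri a p q q].
Proof.
split; [exists (0, 0)|exists (1, 0)|exists (0, 1)] => //=; try by split => /=; lra.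
- by case: a => a1 a2; rewrite /tri_map/=; congr pair; ring.
- by case: p => a1 a2; rewrite /tri_map/=; congr pair; ring.
- by case: q => a1 a2; rewrite /tri_map/=; congr pair; ring.
Qed.

(* The signed height over [a, p] takes values in an interval of length |J|. *)
Lemma disc_in_tri a p q x (r : R) : tri_det a p q != 0 -> 0 <= r ->
  [set y | eucl_dist x y <= r] `<=` tri a p q ->
  2 * r * eucl_dist p a <= `|tri_det a p q|.
Proof.
move=> d0 r0 h; have [pa _ _] := tri_det_neq d0.
have L0 := eucl_dist_gt0 pa; have L2 := eucl_dist_sqr p a.
set L := eucl_dist p a in L0 L2 *.
pose n1 := - (p.2 - a.2) / L; pose n2 := (p.1 - a.1) / L.
have nn : n1 ^+ 2 + n2 ^+ 2 = 1.
  rewrite /n1 /n2 !exprMn -mulrDl sqrrN addrC -L2 exprVn mulfV//.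
  by rewrite expf_neq0// gt_eqF.
have [[z1 z2] [/= hz1 hz2 hz] ez] : tri a p q (x.1 + r * n1, x.2 + r * n2).
  apply: h => /=; rewrite /eucl_dist /=.
  rewrite (_ : _ + _ = r ^+ 2 * (n1 ^+ 2 + n2 ^+ 2)); last by ring.
  by rewrite nn mulr1 sqrtr_sqr ger0_norm.
have [[w1 w2] [/= hw1 hw2 hw] ew] : tri a p q (x.1 - r * n1, x.2 - r * n2).
  apply: h => /=; rewrite /eucl_dist /=.
  rewrite (_ : _ + _ = r ^+ 2 * (n1 ^+ 2 + n2 ^+ 2)); last by ring.
  by rewrite nn mulr1 sqrtr_sqr ger0_norm.
have e : tri_det a p q * (z2 - w2) = 2 * r * L.
  transitivity (2 * r * ((p.1 - a.1) * n2 - (p.2 - a.2) * n1)).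
    move: ez ew; rewrite /tri_map /= => -[e1 e2] [e3 e4].
    have X : (z1 - w1) * (p.1 - a.1) + (z2 - w2) * (q.1 - a.1) = 2 * r * n1.
      by clear -e1 e3; move: n1 e1 e3 => m e1 e3; lra.
    have Y : (z1 - w1) * (p.2 - a.2) + (z2 - w2) * (q.2 - a.2) = 2 * r * n2.
      by clear -e2 e4; move: n2 e2 e4 => m e2 e4; lra.
    rewrite (_ : 2 * r * (_ - _) = (p.1 - a.1) * (2 * r * n2) - (p.2 - a.2) * (2 * r * n1)).
      by rewrite -X -Y /tri_det; clear; ring.
    by clear; move: n1 n2 => m1 m2; ring.
  rewrite /n1 /n2; congr (_ * _).
  transitivity (((p.1 - a.1) ^+ 2 + (p.2 - a.2) ^+ 2) / L); first by field; rewrite gt_eqF.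
  by rewrite -L2 expr2 mulfK// gt_eqF.
rewrite -e; apply: le_trans (ler_norm _) _; rewrite normrM -[leRHS]mulr1.
by rewrite ler_wpM2l// ler_norml; lra.
Qed.

(** A degenerate triangle lies on a line with some normal n, while a ball also contains a point
    displaced along n. *)
Lemma degenerate_interior a p q : tri_det a p q = 0 -> (tri a p q)° = set0.
Proof.
move=> d0; apply/seteqP; split => // x /=.
have [n1 [n2 [n0 hp hq]]] : exists n1 n2 : R, [/\ n1 ^+ 2 + n2 ^+ 2 != 0,
    n1 * (p.1 - a.1) + n2 * (p.2 - a.2) = 0 & n1 * (q.1 - a.1) + n2 * (q.2 - a.2) = 0].
  have nz (u : plane R) : u != a -> (- (u.2 - a.2)) ^+ 2 + (u.1 - a.1) ^+ 2 != 0.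
    move=> ua; have := eucl_dist_gt0 ua; rewrite sqrrN addrC -eucl_dist_sqr => h.
    by rewrite expf_neq0// gt_eqF.
  have [pa|pa] := eqVneq p a; last first.
    exists (- (p.2 - a.2)), (p.1 - a.1); split; [exact: nz|ring|].
    by rewrite -d0 /tri_det; ring.
  have [qa|qa] := eqVneq q a; last first.
    by exists (- (q.2 - a.2)), (q.1 - a.1); split; [exact: nz|rewrite pa; ring|ring].
  by exists 1, 0; split; rewrite ?pa ?qa ?subrr ?mulr0 ?addr0 ?expr1n ?expr0n/= ?addr0 ?oner_neq0.
have lin (y : plane R) : tri a p q y -> n1 * (y.1 - a.1) + n2 * (y.2 - a.2) = 0.
  move=> [[z1 z2] _ <-]; rewrite /tri_map /=.
  transitivity (z1 * (n1 * (p.1 - a.1) + n2 * (p.2 - a.2)) +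
    z2 * (n1 * (q.1 - a.1) + n2 * (q.2 - a.2))); first by ring.
  by rewrite hp hq; ring.
rewrite /interior /= => /nbhs_ballP[e /= e0 he].
have hx := lin x (he _ (ballxx x e0)).
pose N := `|n1| + `|n2| + 1.
have N0 : 0 < N by rewrite ltr_wpDl// addr_ge0.
(* Small enough for a displacement by t n to stay in the max-norm ball of radius e. *)
pose t := e / 2 / N.
have t0 : 0 < t by rewrite !divr_gt0.
have small n : `|n| <= N -> t * `|n| < e.
  move=> nN; apply: (@le_lt_trans _ _ (t * N)); first by rewrite ler_wpM2l// ltW.
  by rewrite /t divfK ?gt_eqF//; lra.
have : n1 * (x.1 + t * n1 - a.1) + n2 * (x.2 + t * n2 - a.2) = 0.
  apply: (lin (x.1 + t * n1, x.2 + t * n2)); apply: he.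
  split; rewrite /= /ball/= opprD addrA subrr add0r normrN normrM (gtr0_norm t0); apply: small.
    by rewrite /N -addrA lerDl addr_ge0.
  by rewrite /N addrAC lerDr addr_ge0.
have -> : n1 * (x.1 + t * n1 - a.1) + n2 * (x.2 + t * n2 - a.2) =
  (n1 * (x.1 - a.1) + n2 * (x.2 - a.2)) + t * (n1 ^+ 2 + n2 ^+ 2) by ring.
rewrite hx add0r => /eqP; rewrite mulf_eq0 (negPf n0) orbF => /eqP t00.
by rewrite t00 ltxx in t0.
Qed.

End triangle_geometry.

Section hulls.
Context (R : realType) (M : mesh R).
Local Notation V := 'I_(nvert M).
Implicit Types (T : {set V}) (i j k : V).

Lemma hull_tri i j k T : T = [set i; j; k]%SET -> #|T| = 3%N ->
  hull T = tri (vert i) (vert j) (vert k).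
Proof.
move=> -> c3.
have [ij ik jk] : [/\ i != j, i != k & j != k].
  move: c3; rewrite -finset.setUA cardsU1 cards2 !inE.
  by case: eqVneq => //= _; case: eqVneq => //= _; case: eqVneq.
have sum3 (W : nmodType) (F : V -> W) :
    \sum_(l in [set i; j; k]%SET) F l = F i + (F j + F k).
  rewrite -finset.setUA big_setU1 ?inE ?negb_or ?ij ?ik//=.
  by rewrite big_setU1 ?inE ?jk//= big_set1.
apply/seteqP; split => x.
  move=> [c [c0]]; rewrite !sum3 => c1 ->; exists (c j, c k).
    by split => //=; have := c0 i; lra.
  rewrite /tri_map /=; have -> : c i = 1 - c j - c k by lra.
  by congr pair; rewrite /= /GRing.scale /=; ring.
move=> [[z1 z2] [/= h1 h2 h] <-].
exists (fun l => if l == j then z1 else if l == k then z2 else 1 - z1 - z2).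
rewrite !sum3 !eqxx (negPf ij) (negPf ik) [k == j]eq_sym (negPf jk); split.
- by move=> l; case: ifP => // _; case: ifP => // _; lra.
- by lra.
- by rewrite /tri_map /=; congr pair; rewrite /= /GRing.scale /=; ring.
Qed.

(** The hull of at most two points lies in a triangle with a repeated vertex, which is
    degenerate. *)
Lemma hull_small_interior T : (#|T| <= 2)%N -> (hull T)° = set0.
Proof.
have sub (i j : V) : T = [set i; j]%SET -> (hull T)° = set0.
  move=> eT; apply/seteqP; split => // x.
  rewrite -(@degenerate_interior _ (vert i) (vert j) (vert j)); last by rewrite /tri_det; ring.
  apply: interiorS => y [c [c0]]; rewrite eT.
  have [->|ij] := eqVneq i j.
    rewrite finset.setUid !big_set1 => -> ->; rewrite scale1r.
    by have [] := tri_vertices (vert j) (vert j) (vert j).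
  rewrite !big_setU1 ?inE//= !big_set1 => c1 ->; exists (c j, 0).
    by split => //=; have := c0 i; lra.
  rewrite /tri_map /=; have -> : c i = 1 - c j by lra.
  by congr pair; rewrite /= /GRing.scale /=; ring.
case cT : #|T| => [|[|[|]]]// _.
- move/eqP: cT; rewrite cards_eq0 => /eqP eT.
  rewrite (_ : hull T = set0) ?interior0//; apply/seteqP; split => // x [c [_ + _]].
  by rewrite eT big_set0 => /esym/eqP; rewrite oner_eq0.
- move/eqP: cT => /cards1P[i ei]; apply: (sub i i); by rewrite finset.setUid.
- move/eqP: cT => /cards2P[i [j [ij e]]]; exact: (sub i j).
Qed.

Lemma tri_enum T : #|T| = 3%N -> exists i j k, T = [set i; j; k]%SET.
Proof.
move=> c3; have /set0Pn[i iT] : T != finset.set0 by rewrite -card_gt0 c3.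
have c2 : #|(T :\ i)%SET| == 2%N by move: (cardsD1 i T); rewrite iT c3 add1n => -[<-].
have /cards2P[j [k [_ e]]] := c2.
by exists i, j, k; rewrite -finset.setUA -e finset.setD1K.
Qed.

Lemma tri_edge_enum T i k : #|T| = 3%N -> i \in T -> k \in T -> i != k ->
  exists j, T = [set i; j; k]%SET.
Proof.
move=> c3 iT kT ik.
have c1 : #|((T :\ i) :\ k)%SET| == 1%N.
  have := cardsD1 i T; rewrite iT c3 add1n => -[e].
  by move: (cardsD1 k (T :\ i)%SET); rewrite !inE eq_sym ik kT -e add1n => -[<-].
have /cards1P[j e] := c1; exists j; apply/setP => l; move/setP/(_ l): e.
rewrite !inE; case: (eqVneq l i) => [->|li]/=; first by rewrite iT.
by case: (eqVneq l k) => [->|lk]/=; rewrite ?orbT// orbF => ->.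
Qed.

Lemma otri_det i j k T : T = [set i; j; k]%SET -> #|T| = 3%N -> otri T !=set0 ->
  tri_det (vert i) (vert j) (vert k) != 0 /\
  otri T = (tri (vert i) (vert j) (vert k))°.
Proof.
move=> eT c3; rewrite /otri (hull_tri eT c3) => -[x xT]; split => //.
by apply: contraPneq xT => /degenerate_interior ->.
Qed.

Section regular.
Variables (sigma : R) (i j k : V) (T : {set V}).
Hypothesis eT : T = [set i; j; k]%SET.
Hypothesis c3 : #|T| = 3%N.
Hypothesis T0 : otri T !=set0.
Hypothesis sr : diam (hull T) <= sigma * in_diam (hull T).
Let a := vert i.
Let p := vert j.
Let q := vert k.
Let J := `|tri_det a p q|.
Let hE : hull T = tri a p q := hull_tri eT c3.
Let d0 : tri_det a p q != 0. Proof. by have [] := otri_det eT c3 T0. Qed.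

Lemma dist_le_diam x y : hull T x -> hull T y -> eucl_dist x y <= diam (hull T).
Proof.
move=> hx hy; apply: ub_le_sup; last by exists x, y.
exists (eucl_dist p a + eucl_dist q a) => _ [x' [y' [hx' hy' ->]]].
by apply: tri_dist_le; rewrite -hE.
Qed.

Lemma diam_ge : [/\ eucl_dist p a <= diam (hull T), eucl_dist q a <= diam (hull T),
  0 < diam (hull T) & diam (hull T) <= eucl_dist p a + eucl_dist q a].
Proof.
have [va vp vq] := tri_vertices a p q; rewrite -hE in va vp vq.
have [pa _ _] := tri_det_neq d0.
split; [exact: dist_le_diam|exact: dist_le_diam| |].
  by apply: lt_le_trans (dist_le_diam vp va); exact: eucl_dist_gt0.
apply: ge_sup; first by exists (eucl_dist a a), a, a.
by move=> _ [x [y [hx hy ->]]]; apply: tri_dist_le; rewrite -hE.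
Qed.

(** By [disc_in_tri], the inner diameter times either side at [a] is at most J, and the diameter is
    at most the sum of these sides. The modulus of sigma covers either sign. *)
Lemma diam_sqr_le : diam (hull T) ^+ 2 <= 2 * `|sigma| * J.
Proof.
have [h1 h2 h3 h4] := diam_ge.
have [va vp vq] := tri_vertices a p q.
have ne : [set d | exists (x : plane R) (r : R),
    [/\ 0 <= r, [set y | eucl_dist x y <= r] `<=` hull T & d = 2 * r]] !=set0.
  exists (2 * 0), a, 0; split => // y /= hy.
  rewrite hE; have [<-//|/eucl_dist_gt0 ay] := eqVneq a y.
  by move: hy; rewrite leNgt ay.
have le1 L : 0 < L -> (forall x r, 0 <= r -> [set y | eucl_dist x y <= r] `<=` hull T ->
    2 * r * L <= J) -> in_diam (hull T) * L <= J.
  move=> L0 h; rewrite -ler_pdivlMr//; apply: ge_sup => // _ [x [r [r0 hr ->]]].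
  by rewrite ler_pdivlMr//; exact: (h x r r0 hr).
have [pa qa _] := tri_det_neq d0.
have l1 : in_diam (hull T) * eucl_dist p a <= J.
  apply: le1 => [|x r r0]; first exact: eucl_dist_gt0.
  by rewrite hE => h; exact: (disc_in_tri d0 r0 h).
have l2 : in_diam (hull T) * eucl_dist q a <= J.
  apply: le1 => [|x r r0]; first exact: eucl_dist_gt0.
  have d1 : tri_det a q p != 0 by rewrite tri_det_swap oppr_eq0.
  rewrite hE tri_swap => h; have := disc_in_tri d1 r0 h.
  by rewrite (tri_det_swap a p q) normrN.
have id0 : 0 <= in_diam (hull T).
  apply: ub_le_sup; last first.
    case: ne => _ [x [r [_ _ _]]]; exists a, 0; split => //; last by rewrite mulr0.
    move=> y /= hy; rewrite hE; have [<-//|/eucl_dist_gt0 ay] := eqVneq a y.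
    by move: hy; rewrite leNgt ay.
  exists (J / eucl_dist p a) => _ [x [r [r0 hr ->]]].
  by rewrite ler_pdivlMr ?eucl_dist_gt0//; rewrite hE in hr; exact: (disc_in_tri d0 r0 hr).
have s1 : sigma * in_diam (hull T) <= `|sigma| * in_diam (hull T).
  by rewrite ler_wpM2r// ler_norm.
have l3 : in_diam (hull T) * diam (hull T) <= 2 * J.
  apply: le_trans (ler_wpM2l id0 h4) _; rewrite mulrDr.
  by move: l1 l2; lra.
rewrite expr2; apply: (@le_trans _ _ (`|sigma| * in_diam (hull T) * diam (hull T))).
  by rewrite ler_wpM2r ?(ltW h3)//; exact: le_trans sr s1.
rewrite -mulrA (mulrC 2) -mulrA ler_wpM2l//.
Qed.

End regular.
End hulls.

(** * Invariance under almost everywhere equality, and restriction to subdomains *)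

Section ae_congruence.
Context (R : realType) (D : set (plane R)).
Hypothesis oD : open D.
Local Notation mu2 := (plane_measure R).
Local Notation leb := (@lebesgue_measure R).
Let mD : measurable (D : set (mplane R)).
Proof. exact: open_measurable_plane. Qed.

Variables f f' : plane R -> R.
Hypothesis mf : measurable_fun D f.
Hypothesis mf' : measurable_fun D f'.
Hypothesis e : {ae mu2, forall x, D x -> f x = f' x}.
Let e' : {ae mu2, forall x, D x -> f' x = f x}.
Proof. by apply: ae_imply e => x h Dx; rewrite h. Qed.

(** An equality of predicates, so that the choice in [wderiv] returns literally the same function
    for both arguments. *)
Lemma is_wderiv_congr j : is_wderiv D j f = is_wderiv D j f'.
Proof.
apply/funext => g; apply/propext; split => h.
  have [[mg _] _] := h.
  by apply: (is_wderiv_ae oD mf mf' mg e _ h); exact: aeW.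
have [[mg _] _] := h.
by apply: (is_wderiv_ae oD mf' mf mg e' _ h); exact: aeW.
Qed.

Lemma wderiv_congr j : wderiv D j f = wderiv D j f'.
Proof. by rewrite /wderiv is_wderiv_congr. Qed.

Lemma cvg2_congr (phi : nat -> plane R -> R) : (forall n, smooth (phi n)) ->
  cvg2 mu2 D phi f <-> cvg2 mu2 D phi f'.
Proof.
move=> s; suff h n : (\int[mu2]_(x in D) ((f x - phi n x) ^+ 2)%:E =
    \int[mu2]_(x in D) ((f' x - phi n x) ^+ 2)%:E)%E.
  by split; apply: eq_cvgn => n; rewrite h.
have mp : measurable_fun D (phi n).
  apply: measurable_funS (measurableT) (@subsetT _ D) _.
  by apply: continuous_measurable_plane; exact: smooth_continuous.
apply: ae_eq_integral => //.
- by apply/measurable_EFinP; apply: measurable_funX; apply: measurable_funB.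
- by apply/measurable_EFinP; apply: measurable_funX; apply: measurable_funB.
- by apply: ae_imply e => x h Dx; rewrite h.
Qed.

Lemma smooth_approx_congr phi : smooth_approx D f phi <-> smooth_approx D f' phi.
Proof.
split=> -[s c d].
- by split; [exact: s|exact/(cvg2_congr s)|move=> j; rewrite -wderiv_congr; exact: d].
- by split; [exact: s|exact/(cvg2_congr s)|move=> j; rewrite wderiv_congr; exact: d].
Qed.

Lemma is_trace_congr a p q : tri_det a p q != 0 -> is_trace D a q f = is_trace D a q f'.
Proof.
move=> d0; apply/funext => g; apply/propext; rewrite !(is_traceP D d0).
by split=> -[mg [phi [/smooth_approx_congr ap c]]]; split; [exact: mg|exists phi|exact: mg|exists phi].
Qed.

Lemma trace_congr a p q : tri_det a p q != 0 -> trace D a q f = trace D a q f'.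
Proof. by move=> d0; rewrite /trace (is_trace_congr d0). Qed.

Lemma H1s_congr : sq_int mu2 D f' -> H1s D f -> H1s D f'.
Proof.
move=> sf' [[_ h] [phi ap]]; split; last by exists phi; apply/smooth_approx_congr.
by split => // j; have [g] := h j; rewrite is_wderiv_congr; exists g.
Qed.

End ae_congruence.

Section restriction.
Context (R : realType) (D Omega : set (plane R)).
Hypothesis oD : open D.
Hypothesis oO : open Omega.
Hypothesis DO : D `<=` Omega.
Local Notation mu2 := (plane_measure R).
Let mD : measurable (D : set (mplane R)).
Proof. exact: open_measurable_plane. Qed.
Let mO : measurable (Omega : set (mplane R)).
Proof. exact: open_measurable_plane. Qed.

(** A test function on D is one on Omega, and its derivative also vanishes off D, so both integrals
    extend by 0. *)
Lemma is_wderiv_restrict j f g : is_wderiv Omega j f g -> is_wderiv D j f g.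
Proof.
move=> [g2 h]; split; first exact: (sq_intS mO mD DO g2).
have res k psi : (forall x, ~ D x -> psi x = 0) -> ip D k psi = ip Omega k psi.
  move=> z; rewrite /ip /Rintegral integral_mkcond [in RHS]integral_mkcond; congr fine.
  apply: eq_integral => x _; rewrite /patch; case: ifPn => [/set_mem Dx|nD].
    by rewrite ifT// inE; exact: DO.
  case: ifP => // _; rewrite z ?mulr0// => Dx; by move/negP: nD; apply; exact/mem_set.
move=> phi [s [K [cK KD z]]].
have tO : test_function Omega phi.
  by split => //; exists K; split => //; exact: subset_trans KD DO.
have tD : test_function D phi by split => //; exists K.
have [_ [K' [_ K'D z']]] := test_pderiv j tD.
rewrite !res; [exact: h| |].
- by move=> x nD; apply: z => Kx; apply: nD; exact: KD.
- by move=> x nD; apply: z' => Kx; apply: nD; exact: K'D.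
Qed.

Lemma cvg2_restrict (u : nat -> plane R -> R) f : cvg2 mu2 Omega u f -> cvg2 mu2 D u f.
Proof.
move=> c; apply: (squeeze_cvge _ (@cvg_cst _ 0%E _ _ _) c).
apply: nearW => n; apply/andP; split.
  by apply: integral_ge0 => x _; rewrite lee_fin sqr_ge0.
rewrite -[X in (\int[_]_(y in X) _)%E](setIidr DO) integral_mkcondr.
by apply: le_integral_nomeas => x _; rewrite /patch; case: ifP => // _; rewrite lee_fin sqr_ge0.
Qed.

Lemma wderiv_restrict j f : H1 Omega f ->
  {ae mu2, forall x, D x -> wderiv D j f x = wderiv Omega j f x}.
Proof. by move=> hf; apply: wderiv_ae => //; apply: is_wderiv_restrict; exact: H1_wderiv. Qed.

Lemma H1_restrict f : H1 Omega f -> H1 D f.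
Proof.
move=> [f2 h]; split; first exact: (sq_intS mO mD DO f2).
by move=> j; have [g hg] := h j; exists g; exact: is_wderiv_restrict.
Qed.

Lemma smooth_approx_restrict f phi : (forall n, smooth (phi n)) -> H1 Omega f ->
  smooth_approx Omega f phi -> smooth_approx D f phi.
Proof.
move=> s hf [_ c d]; split; [exact: s|exact: cvg2_restrict|] => j; have c' := cvg2_restrict (d j).
suff e n : (\int[mu2]_(x in D) ((wderiv D j f x - pderiv j (phi n) x) ^+ 2)%:E =
    \int[mu2]_(x in D) ((wderiv Omega j f x - pderiv j (phi n) x) ^+ 2)%:E)%E.
  by apply: eq_cvgn c' => n; rewrite e.
have mp : measurable_fun D (pderiv j (phi n)).
  apply: measurable_funS (measurableT) (@subsetT _ D) _.
  apply: continuous_measurable_plane; apply: smooth_continuous; exact: smooth_pderiv.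
have m1 := wderiv_measurable j (H1_restrict hf).
have m2 : measurable_fun D (wderiv Omega j f).
  by have [] := sq_intS mO mD DO (H1_wderiv_sq_int j hf).
apply: ae_eq_integral => //.
- by apply/measurable_EFinP; apply: measurable_funX; apply: measurable_funB.
- by apply/measurable_EFinP; apply: measurable_funX; apply: measurable_funB.
- by apply: ae_imply (wderiv_restrict j hf) => x h Dx; rewrite h.
Qed.

End restriction.

(** * Decomposition of integrals over the mesh *)

Section mesh_integrals.
Context (R : realType) (Omega GD GN : set (plane R)) (M : mesh R).
Hypothesis hO : polygonal_domain Omega.
Hypothesis hM : is_triangulation Omega GD GN M.
Local Notation mu2 := (plane_measure R).
Local Notation V := 'I_(nvert M).

Lemma open_domain : open Omega. Proof. by case: hO. Qed.

Lemma measurable_domain : measurable (Omega : set (mplane R)).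
Proof. by apply: open_measurable_plane; exact: open_domain. Qed.

Lemma domain_sq_int f : continuous f -> sq_int mu2 Omega f.
Proof.
move=> cf; have [_ _ _ [N [_ hN]] _] := hO.
apply: (@continuous_sq_int R Omega (`|N| + 1)) => //; first exact: measurable_domain.
move=> x Ox; have := hN (`|N| + 1) _ x Ox.
have N1 : N < `|N| + 1 by apply: le_lt_trans (ler_norm N) _; rewrite ltrDl.
move=> /(_ N1); rewrite /Num.norm /= ge_max => /andP[h1 h2].
by rewrite /box; split => /=; rewrite in_itv/= -ler_norml.
Qed.

Lemma open_otri (T : {set V}) : open (otri T). Proof. exact: open_interior. Qed.

Lemma measurable_otri (T : {set V}) : measurable (otri T : set (mplane R)).
Proof. by apply: open_measurable_plane; exact: open_otri. Qed.

(** Omega is the interior of its closure, and the closure contains every hull. *)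
Lemma otri_sub T : T \in tris M -> otri T `<=` Omega.
Proof.
move=> TM; have [_ _ _ _ [-> _]] := hO; apply: interiorS.
have [_ <- _ _] := hM; exact: bigcup_sup.
Qed.

(** A common point is interior to the hull of the shared vertices; distinct triangles share at most
    two vertices, whose hull has empty interior. *)
Lemma otri_inj T T' x : T \in tris M -> T' \in tris M -> otri T x -> otri T' x -> T = T'.
Proof.
move=> TM TM' Tx Tx'; have [h _ hI _] := hM; apply/eqP; apply: contraT => nT.
have [c3 _] := h _ TM; have [c3' _] := h _ TM'.
have : (hull (T :&: T')%SET)° x by rewrite -hI// interiorI; split.
rewrite hull_small_interior// -ltnS -c3 proper_card// finset.properEneq finset.subsetIl andbT.
apply: contra_neq nT => e; apply/eqP; rewrite eqEcard c3 c3' leqnn andbT.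
by rewrite -e finset.subsetIr.
Qed.

Lemma hull_null T : T \in tris M -> measurable (hull T `\` otri T : set (mplane R)) /\
  mu2 (hull T `\` otri T) = 0%E.
Proof.
move=> TM; have [/(_ _ TM)[c3 T0] _ _ _] := hM.
have [i [j [k eT]]] := tri_enum c3; have [d0 hD] := otri_det eT c3 T0.
rewrite hD (hull_tri eT c3); split; last exact: tri_boundary_null.
by apply: measurableD; [exact: measurable_tri|exact: tri_open_measurable].
Qed.

(** Off the null union N of the triangle boundaries, Omega is the disjoint union of the open
    cells. *)
Lemma integral_mesh f : mu2.-integrable Omega (EFin \o f) ->
  \int[mu2]_(x in Omega) f x = \sum_(T in tris M) \int[mu2]_(x in otri T) f x.
Proof.
move=> fi; pose N := \big[setU/set0]_(T <- enum (tris M)) (hull T `\` otri T).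
have [mN N0] : measurable (N : set (mplane R)) /\ mu2 N = 0%E.
  rewrite /N big_seq; elim/big_rec : _ => [|T S]; first by split; [exact: measurable0|exact: measure0].
  rewrite mem_enum => /hull_null[mT nT] [mS nS]; split; first exact: measurableU.
  by apply: null_set_setU.
have mO := measurable_domain.
rewrite /Rintegral (negligible_integral mN mO fi N0).
have -> : Omega `\` N = \big[setU/set0]_(T <- enum (tris M)) otri T `\` N.
  apply/seteqP; split => x [hx nx]; split => //.
    have [_ cov _ _] := hM.
    have /= : closure Omega x by exact: subset_closure.
    rewrite -cov => -[T /= TM Tx]; rewrite -bigcup_seq; exists T => /=; first by rewrite mem_enum.
    apply: contrapT => nT; apply: nx; rewrite /N -bigcup_seq; exists T => /=; first by rewrite mem_enum.
    by split.
  move: hx; rewrite -bigcup_seq => -[T /=]; rewrite mem_enum => TM; exact: otri_sub.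
have sub : \big[setU/set0]_(T <- enum (tris M)) otri T `<=` Omega.
  move=> x; rewrite -bigcup_seq => -[T /=]; rewrite mem_enum => TM; exact: otri_sub.
have mW : measurable (\big[setU/set0]_(T <- enum (tris M)) otri T : set (mplane R)).
  by apply: bigsetU_measurable => T _; exact: measurable_otri.
have fiW := integrableS mO mW sub fi.
rewrite -(negligible_integral mN mW fiW N0).
rewrite (@integral_bigsetU_EFin _ _ _ mu2 _ (fun T : {set V} => otri T) f)/=.
- rewrite -big_enum/= big_seq [in RHS]big_seq.
  symmetry; apply: sum_fine => T; rewrite mem_enum => TM.
  have := integrableS mO (measurable_otri T) (otri_sub TM) fi.
  by move=> /(integrable_fin_num (measurable_otri T)).
- by move=> T; exact: measurable_otri.
- exact: enum_uniq.
- move=> T T' /=; rewrite !mem_enum => TM TM' [x [hx hx']]; exact: otri_inj hx hx'.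
- exact: measurable_int fiW.
Qed.

Lemma dot_mesh f g : sq_int mu2 Omega f -> sq_int mu2 Omega g ->
  dot mu2 Omega f g = \sum_(T in tris M) dot mu2 (otri T) f g.
Proof. by move=> hf hg; apply: integral_mesh; exact: (sq_intM measurable_domain hf hg). Qed.

End mesh_integrals.

(** * Bilinearity and positivity of the elastic form *)

Section dot_ae.
Context d (T : measurableType d) (R : realType) (mu : {measure set T -> \bar R}) (D : set T).
Hypothesis mD : measurable D.

Lemma dot_ae_linl a b (f f1 f2 k : T -> R) : measurable_fun D f ->
  sq_int mu D f1 -> sq_int mu D f2 -> sq_int mu D k ->
  {ae mu, forall x, D x -> f x = a * f1 x + b * f2 x} ->
  dot mu D f k = a * dot mu D f1 k + b * dot mu D f2 k.
Proof.
move=> mf h1 h2 hk e; rewrite -(dot_linl mD a b h1 h2 hk).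
have [ml _] := sq_int_lin mD a b h1 h2; have [mk _] := hk.
by apply: (eq_dot mD mf ml mk mk e); exact: aeW.
Qed.

End dot_ae.

Definition vlin (R : realType) (a b : R) (v w : vfield R) : vfield R :=
  fun i x => a * v i x + b * w i x.

Lemma vsubE (R : realType) (v w : vfield R) : vsub v w = vlin 1 (-1) v w.
Proof. by apply/funext => i; apply/funext => x; rewrite /vsub /vlin mul1r mulN1r. Qed.

Section elastic.
Context (R : realType) (D : set (plane R)).
Hypothesis oD : open D.
Local Notation mu2 := (plane_measure R).
Local Notation i1 := (lift ord0 ord0 : 'I_2).
Let mD : measurable (D : set (mplane R)).
Proof. exact: open_measurable_plane. Qed.
Local Notation vH1 v := (forall i : 'I_2, H1 D (v i)).
Implicit Types v w : vfield R.

Lemma vH1_lin a b v w : vH1 v -> vH1 w -> vH1 (vlin a b v w).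
Proof. by move=> hv hw i; exact: (H1_lin oD a b (hv i) (hw i)). Qed.

Lemma strain_sq_int v i j : vH1 v -> sq_int mu2 D (strain D v i j).
Proof.
move=> hv; apply: (sq_intZ mD); apply: (sq_intD mD); exact: H1_wderiv_sq_int.
Qed.

Lemma wdiv_sq_int v : vH1 v -> sq_int mu2 D (wdiv D v).
Proof. by move=> hv; apply: (sq_int_sum mD) => i; exact: H1_wderiv_sq_int. Qed.

Lemma strain_arith (k a b X Y X' Y' : R) :
  k * ((a * X + b * Y) + (a * X' + b * Y')) = a * (k * (X + X')) + b * (k * (Y + Y')).
Proof. by ring. Qed.

Lemma strain_lin a b v w i j : vH1 v -> vH1 w ->
  {ae mu2, forall x, D x -> strain D (vlin a b v w) i j x =
     a * strain D v i j x + b * strain D w i j x}.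
Proof.
move=> hv hw.
apply: ae_imply2 (wderiv_lin oD j a b (hv i) (hw i)) (wderiv_lin oD i a b (hv j) (hw j)).
move=> x h1 h2 Dx; rewrite /strain h1// h2//.
exact: strain_arith.
Qed.

Lemma wdiv_arith (a b X Y X' Y' : R) :
  (a * X + b * X') + (a * Y + b * Y') = a * (X + Y) + b * (X' + Y').
Proof. by ring. Qed.

Lemma one_arith (X Y : R) : X + Y = 1 * X + 1 * Y.
Proof. by rewrite !mul1r. Qed.

Lemma wdivE v x : wdiv D v x = wderiv D ord0 (v ord0) x + wderiv D i1 (v i1) x.
Proof. by rewrite /wdiv big_ord_recl big_ord1. Qed.

Lemma wdiv_lin a b v w : vH1 v -> vH1 w ->
  {ae mu2, forall x, D x -> wdiv D (vlin a b v w) x = a * wdiv D v x + b * wdiv D w x}.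
Proof.
move=> hv hw.
apply: ae_imply2 (wderiv_lin oD ord0 a b (hv ord0) (hw ord0))
  (wderiv_lin oD i1 a b (hv i1) (hw i1)).
move=> x h1 h2 Dx; rewrite !wdivE.
have e1 : wderiv D ord0 (vlin a b v w ord0) x = _ := h1 Dx.
have e2 : wderiv D i1 (vlin a b v w i1) x = _ := h2 Dx.
rewrite e1 e2; exact: wdiv_arith.
Qed.

Lemma elastic_arith (k l a b X Y X' Y' : R) :
  k * (a * X + b * Y) + l * (a * X' + b * Y') = a * (k * X + l * X') + b * (k * Y + l * Y').
Proof. by ring. Qed.

Lemma elastic_linl mu lam a b v v' w : vH1 v -> vH1 v' -> vH1 w ->
  elastic_form mu lam D (vlin a b v v') w =
  a * elastic_form mu lam D v w + b * elastic_form mu lam D v' w.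
Proof.
move=> hv hv' hw; have hl := vH1_lin a b hv hv'.
rewrite /elastic_form -elastic_arith; congr (_ * _ + _ * _).
  rewrite !mulr_sumr -big_split; apply: eq_bigr => i _ /=.
  rewrite !mulr_sumr -big_split; apply: eq_bigr => j _ /=.
  have [ml _] := strain_sq_int i j hl.
  exact: (dot_ae_linl mD ml (strain_sq_int i j hv) (strain_sq_int i j hv')
    (strain_sq_int i j hw) (strain_lin a b i j hv hv')).
have [ml _] := wdiv_sq_int hl.
exact: (dot_ae_linl mD ml (wdiv_sq_int hv) (wdiv_sq_int hv') (wdiv_sq_int hw) (wdiv_lin a b hv hv')).
Qed.

Lemma elasticC mu lam v w : elastic_form mu lam D v w = elastic_form mu lam D w v.
Proof.
have ipC f g : ip D f g = ip D g f := dotC mu2 D f g.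
rewrite /elastic_form (ipC (wdiv D v)); apply: (f_equal (fun z => 2 * mu * z + _)).
by apply: eq_bigr => i _; apply: eq_bigr => j _; exact: ipC.
Qed.

Lemma elastic_ge0 mu lam v : 0 <= mu -> 0 <= lam -> 0 <= elastic_form mu lam D v v.
Proof.
move=> mu0 l0; apply: addr_ge0.
  apply: mulr_ge0; first by rewrite mulr_ge0.
  apply: sumr_ge0 => i _; apply: sumr_ge0 => j _; exact: (dot_ge0 mu2 D (strain D v i j)).
by apply: mulr_ge0; [exact: l0|exact: (dot_ge0 mu2 D (wdiv D v))].
Qed.

(* The interpolation error has mean-zero gradient. *)
Lemma elastic_affine0 mu lam w v (c : 'I_2 -> 'I_2 -> R) : vH1 w -> vH1 v ->
  sq_int mu2 D (cst 1) ->
  (forall i j, \int[mu2]_(x in D) wderiv D j (w i) x = 0) ->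
  (forall i j, {ae mu2, forall x, D x -> wderiv D j (v i) x = c i j}) ->
  elastic_form mu lam D w v = 0.
Proof.
move=> hw hv s1 w0 vc.
have mean0 (f : plane R -> R) k : sq_int mu2 D f -> dot mu2 D f (cst 1) = 0 ->
    forall g, measurable_fun D g -> {ae mu2, forall x, D x -> g x = k} -> dot mu2 D f g = 0.
  move=> hf f0 g mg e; rewrite dotC.
  rewrite (dot_ae_linl mD (a := k) (b := 0) mg s1 s1 hf) ?mul0r ?addr0.
    by rewrite dotC f0 mulr0.
  by apply: ae_imply e => x h Dx; rewrite h//= mulr1 mul0r addr0.
have d0 i j : dot mu2 D (wderiv D j (w i)) (cst 1) = 0.
  by rewrite -(w0 i j); apply: eq_Rintegral => x _; rewrite mulr1.
have sum0 X1 X2 : sq_int mu2 D X1 -> sq_int mu2 D X2 -> dot mu2 D X1 (cst 1) = 0 ->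
    dot mu2 D X2 (cst 1) = 0 -> forall k, dot mu2 D (fun x => k * X1 x + k * X2 x) (cst 1) = 0.
  by move=> h1 h2 e1 e2 k; rewrite dot_linl// e1 e2 !mulr0 addr0.
rewrite /elastic_form big1 ?mulr0 ?add0r; last first.
  move=> i _; apply: big1 => j _.
  have [ms _] := strain_sq_int i j hv.
  apply: (mean0 _ (2^-1 * (c i j + c j i)) (strain_sq_int i j hw) _ _ ms).
    rewrite /strain (_ : (fun x => _) =
      (fun x => 2^-1 * wderiv D j (w i) x + 2^-1 * wderiv D i (w j) x)).
      by apply: sum0 => //; exact: H1_wderiv_sq_int.
    by apply/funext => x; exact: mulrDr.
  by apply: ae_imply2 (vc i j) (vc j i) => x h1 h2 Dx; rewrite /strain (h1 Dx) (h2 Dx).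
have [mv _] := wdiv_sq_int hv.
have -> : ip D (wdiv D w) (wdiv D v) = 0; last by rewrite mulr0.
apply: (mean0 _ (c ord0 ord0 + c i1 i1) (wdiv_sq_int hw) _ _ mv).
  rewrite (_ : wdiv D w =
    (fun x => 1 * wderiv D ord0 (w ord0) x + 1 * wderiv D i1 (w i1) x)).
    by apply: sum0 => //; exact: H1_wderiv_sq_int.
  by apply/funext => x; rewrite wdivE; exact: one_arith.
apply: ae_imply2 (vc ord0 ord0) (vc i1 i1) => x h1 h2 Dx.
by rewrite wdivE (h1 Dx) (h2 Dx).
Qed.

End elastic.

(** * Broken forms: elastic energy, jumps, mesh-dependent norm *)

Section broken.
Context (R : realType) (Omega GD GN : set (plane R)) (M : mesh R).
Hypothesis hO : polygonal_domain Omega.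
Hypothesis hM : is_triangulation Omega GD GN M.
Local Notation mu2 := (plane_measure R).
Local Notation leb := (@lebesgue_measure R).
Local Notation U := (`[(0 : R), 1]%classic).
Local Notation V := 'I_(nvert M).
Local Notation seg e := (seg_point (vert e.1) (vert e.2)).
Let mU : measurable (U : set (measurableTypeR R)). Proof. by []. Qed.
Let mO := measurable_domain hO.
Implicit Types (v w : vfield R) (e : V * V) (i : 'I_2).

Lemma edge_triangle e T : (e.1 < e.2)%N -> T \in edge_tris e ->
  exists k, [/\ T = [set e.1; k; e.2]%SET, T \in tris M,
    tri_det (vert e.1) (vert k) (vert e.2) != 0 &
    otri T = (tri (vert e.1) (vert k) (vert e.2))°].
Proof.
move=> e12; rewrite inE => /andP[TM /andP[e1T e2T]].
have [/(_ _ TM)[c3 T0] _ _ _] := hM.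
have ne : e.1 != e.2 by apply: contraTneq e12 => ->; rewrite ltnn.
have [k eT] := tri_edge_enum c3 e1T e2T ne; exists k.
by have [] := otri_det eT c3 T0.
Qed.

Lemma edge_side_in e n : (n < #|edge_tris e|)%N -> edge_side e n \in edge_tris e.
Proof. by move=> h; rewrite -mem_enum; apply: mem_nth; rewrite -cardE. Qed.

Lemma interior_sides e n : interior_edge e -> (n < 2)%N ->
  (e.1 < e.2)%N /\ edge_side e n \in edge_tris e.
Proof. by move=> /andP[h /eqP c2] n2; split => //; apply: edge_side_in; rewrite c2. Qed.

(** A common space containing the conforming and the discrete fields, on which all the forms are
    bilinear. *)
Definition broken (v : vfield R) : Prop :=
  forall i, sq_int mu2 Omega (v i) /\ forall T, T \in tris M -> H1s (otri T) (v i).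

Lemma broken_H1 v T : broken v -> T \in tris M -> forall i, H1 (otri T) (v i).
Proof. by move=> hv TM i; have [_ /(_ _ TM)[]] := hv i. Qed.

Lemma edge_trace_sq_int e n v i : (e.1 < e.2)%N -> edge_side e n \in edge_tris e ->
  broken v -> sq_int leb U (edge_trace e n v i \o seg e).
Proof.
move=> e12 /(edge_triangle e12)[k [_ TM d0 hD]] hv.
have [_ /(_ _ TM) h] := hv i.
exact: (is_trace_sq_int d0 (traceP d0 hD h)).
Qed.

Lemma edge_trace_lin e n a b v w i : (e.1 < e.2)%N -> edge_side e n \in edge_tris e ->
  broken v -> broken w -> {ae leb, forall t, U t ->
    edge_trace e n (vlin a b v w) i (seg e t) =
    a * edge_trace e n v i (seg e t) + b * edge_trace e n w i (seg e t)}.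
Proof.
move=> e12 /(edge_triangle e12)[k [_ TM d0 hD]] hv hw.
have [_ /(_ _ TM) h] := hv i; have [_ /(_ _ TM) h'] := hw i.
exact: (trace_lin d0 hD a b h h').
Qed.

Lemma broken_lin a b v w : broken v -> broken w -> broken (vlin a b v w).
Proof.
move=> hv hw i; have [v2 vs] := hv i; have [w2 ws] := hw i; split.
  exact: (sq_int_lin mO a b v2 w2).
move=> T TM; have [/(_ _ TM)[c3 T0] _ _ _] := hM.
have [i0 [j0 [k0 eT]]] := tri_enum c3; have [_ hD] := otri_det eT c3 T0.
exact: (H1s_lin hD a b (vs T TM) (ws T TM)).
Qed.

Lemma jump_sq_int e v i : interior_edge e -> broken v ->
  sq_int leb U (jump e v i \o seg e).
Proof.
move=> ie hv; have [e12 s0] := interior_sides ie (ltn0Sn 1).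
have [_ s1] := interior_sides ie (ltnSn 1).
exact: (sq_intB mU (edge_trace_sq_int i e12 s0 hv) (edge_trace_sq_int i e12 s1 hv)).
Qed.

Lemma jump_arith (a b x y x' y' : R) :
  (a * x + b * y) - (a * x' + b * y') = a * (x - x') + b * (y - y').
Proof. by ring. Qed.

Lemma jump_lin e a b v w i : interior_edge e -> broken v -> broken w ->
  {ae leb, forall t, U t -> jump e (vlin a b v w) i (seg e t) =
    a * jump e v i (seg e t) + b * jump e w i (seg e t)}.
Proof.
move=> ie hv hw; have [e12 s0] := interior_sides ie (ltn0Sn 1).
have [_ s1] := interior_sides ie (ltnSn 1).
apply: ae_imply2 (edge_trace_lin a b i e12 s0 hv hw) (edge_trace_lin a b i e12 s1 hv hw).
by move=> t h0 h1 Ut; rewrite /jump /vsub (h0 Ut) (h1 Ut); exact: jump_arith.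
Qed.

(** The length factor of a line integral cancels the weight 1 / h_e, so jumps are integrated over
    the edge parameter without weight. *)
Definition jform (v w : vfield R) : R :=
  \sum_(e | interior_edge (M := M) e) \sum_(i < 2)
    dot leb U (jump e v i \o seg e) (jump e w i \o seg e).

Lemma jformC v w : jform v w = jform w v.
Proof. by apply: eq_bigr => e _; apply: eq_bigr => i _; exact: dotC. Qed.

Lemma jform_ge0 v : 0 <= jform v v.
Proof.
by apply: sumr_ge0 => e _; apply: sumr_ge0 => i _; exact: (dot_ge0 leb U (jump e v i \o seg e)).
Qed.

Lemma jform_linl a b v v' w : broken v -> broken v' -> broken w ->
  jform (vlin a b v v') w = a * jform v w + b * jform v' w.
Proof.
move=> hv hv' hw; rewrite /jform !mulr_sumr -big_split; apply: eq_bigr => e ie /=.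
rewrite !mulr_sumr -big_split; apply: eq_bigr => i _ /=.
have [ml _] := jump_sq_int i ie (broken_lin a b hv hv').
exact: (dot_ae_linl mU ml (jump_sq_int i ie hv) (jump_sq_int i ie hv')
  (jump_sq_int i ie hw) (jump_lin a b i ie hv hv')).
Qed.

Lemma edge_len_gt0 e : interior_edge (M := M) e -> 0 < edge_len e.
Proof.
move=> ie; have [e12 s0] := interior_sides ie (ltn0Sn 1).
have [k [_ _ d0 _]] := edge_triangle e12 s0.
by apply: eucl_dist_gt0; have [_ h _] := tri_det_neq d0; rewrite eq_sym.
Qed.

Lemma edge_int_dot e (F : 'I_2 -> plane R -> R) (G : 'I_2 -> plane R -> R) :
  (forall i, sq_int leb U (F i \o seg e)) -> (forall i, sq_int leb U (G i \o seg e)) ->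
  edge_int e (fun x => \sum_(i < 2) F i x * G i x) =
  edge_len e * \sum_(i < 2) dot leb U (F i \o seg e) (G i \o seg e).
Proof.
move=> hF hG; rewrite /edge_int /line_int -/(edge_len e); congr (_ * _).
rewrite big_ord_recl big_ord1.
have q0 := sq_intM mU (hF ord0) (hG ord0).
have q1 := sq_intM mU (hF (lift ord0 ord0)) (hG (lift ord0 ord0)).
rewrite -(RintegralD mU q0 q1); apply: eq_Rintegral => t _ /=.
by rewrite big_ord_recl big_ord1.
Qed.

Definition eform (mu lam : R) (v w : vfield R) : R :=
  \sum_(T in tris M) elastic_form mu lam (otri T) v w.

Lemma eformC mu lam v w : eform mu lam v w = eform mu lam w v.
Proof. by apply: eq_bigr => T _; exact: elasticC. Qed.

Lemma eform_ge0 mu lam v : 0 <= mu -> 0 <= lam -> 0 <= eform mu lam v v.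
Proof. by move=> m0 l0; apply: sumr_ge0 => T _; exact: elastic_ge0. Qed.

Lemma eform_linl mu lam a b v v' w : broken v -> broken v' -> broken w ->
  eform mu lam (vlin a b v v') w = a * eform mu lam v w + b * eform mu lam v' w.
Proof.
move=> hv hv' hw; rewrite /eform !mulr_sumr -big_split; apply: eq_bigr => T TM /=.
exact: (elastic_linl (@open_otri R M T) mu lam a b (broken_H1 hv TM) (broken_H1 hv' TM) (broken_H1 hw TM)).
Qed.

Lemma ahE mu lam delta v w : broken v -> broken w ->
  ah mu lam delta M v w = eform mu lam v w + stab delta M * (2 * mu * jform v w).
Proof.
move=> hv hw; rewrite /ah; apply: (f_equal (fun z => eform mu lam v w + stab delta M * z)).
rewrite /jform mulr_sumr; apply: eq_bigr => e ie.
rewrite (edge_int_dot (fun i => jump_sq_int i ie hv) (fun i => jump_sq_int i ie hw)).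
by rewrite mulrA divfK// gt_eqF// edge_len_gt0.
Qed.

Lemma normhE mu lam v : 0 <= mu -> 0 <= lam -> broken v ->
  normh mu lam M v ^+ 2 = eform mu lam v v + jform v v.
Proof.
move=> m0 l0 hv.
have -> : normh mu lam M v = Num.sqrt (eform mu lam v v + jform v v).
  rewrite /normh; apply: (f_equal (fun z => Num.sqrt (eform mu lam v v + z))).
  apply: eq_bigr => e ie.
  pose k := (Num.sqrt (edge_len e))^-1.
  have hk i : sq_int leb U ((fun x => k * jump e v i x) \o seg e).
    exact: (sq_intZ mU k (jump_sq_int i ie hv)).
  transitivity (edge_int e (fun x => \sum_(i < 2) (k * jump e v i x) * (k * jump e v i x))).
    by congr edge_int; apply/funext => x; apply: eq_bigr => i _; rewrite expr2.
  rewrite (edge_int_dot hk hk) mulr_sumr; apply: eq_bigr => i _.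
  have q := jump_sq_int i ie hv.
  transitivity (edge_len e * (k ^+ 2 * dot leb U (jump e v i \o seg e) (jump e v i \o seg e))).
    congr (_ * _); have := dot_sqr_lin mU k 0 q q.
    rewrite mulr0 mul0r addr0 expr0n/= mul0r addr0 => <-.
    by apply: eq_Rintegral => t _ /=; rewrite mul0r addr0.
  rewrite mulrA /k exprVn sqr_sqrtr ?(ltW (edge_len_gt0 ie))//.
  by rewrite mulfV ?mul1r// gt_eqF// edge_len_gt0.
by rewrite sqr_sqrtr// addr_ge0 ?eform_ge0 ?jform_ge0.
Qed.

Definition vsq v := forall i, sq_int mu2 Omega (v i).

Lemma bhE v w : vsq v -> vsq w -> bh M v w = vip Omega v w.
Proof.
move=> hv hw; rewrite /bh /vip exchange_big; apply: eq_bigr => i _ /=.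
by rewrite /ip; exact: (esym (dot_mesh hO hM (hv i) (hw i))).
Qed.

Lemma vipC v w : vip Omega v w = vip Omega w v.
Proof. by apply: eq_bigr => i _; exact: dotC. Qed.

Lemma vip_ge0 v : 0 <= vip Omega v v.
Proof. by apply: sumr_ge0 => i _; exact: (dot_ge0 mu2 Omega (v i)). Qed.

Lemma vsq_lin a b v w : vsq v -> vsq w -> vsq (vlin a b v w).
Proof. by move=> hv hw i; exact: (sq_int_lin mO a b (hv i) (hw i)). Qed.

Lemma vip_linl a b v v' w : vsq v -> vsq v' -> vsq w ->
  vip Omega (vlin a b v v') w = a * vip Omega v w + b * vip Omega v' w.
Proof.
move=> hv hv' hw; rewrite /vip !mulr_sumr -big_split; apply: eq_bigr => i _ /=.
exact: (dot_linl mO a b (hv i) (hv' i) (hw i)).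
Qed.

Lemma broken_vsq v : broken v -> vsq v.
Proof. by move=> hv i; have [] := hv i. Qed.

End broken.

(** * Conforming and discrete fields as broken fields *)

Section embeddings.
Context (R : realType) (Omega GD GN : set (plane R)) (M : mesh R).
Hypothesis hO : polygonal_domain Omega.
Hypothesis hbd : boundary_split Omega GD GN.
Hypothesis hM : is_triangulation Omega GD GN M.
Local Notation mu2 := (plane_measure R).
Local Notation leb := (@lebesgue_measure R).
Local Notation U := (`[(0 : R), 1]%classic).
Local Notation V := 'I_(nvert M).
Local Notation seg e := (seg_point (vert e.1) (vert e.2)).
Let mU : measurable (U : set (measurableTypeR R)). Proof. by []. Qed.
Let oO := open_domain hO.
Let mO := measurable_domain hO.
Implicit Types (v w : vfield R) (e : V * V) (i j : 'I_2).

Lemma H1E_H1 u i : H1E Omega GD u -> H1 Omega (u i).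
Proof. by move=> /(_ i)[]. Qed.

(* The Dirichlet condition on a single nondegenerate segment already supplies
   smooth approximations on the whole domain. *)
Lemma H1E_approx u i : H1E Omega GD u -> exists phi, smooth_approx Omega (u i) phi.
Proof.
move=> /(_ i)[_ ht]; have [_ _ _ [p [q [_ pq]]]] := hbd.
by have [_ [phi [s c d _]]] := ht _ _ pq; exists phi.
Qed.

Lemma approx_otri f phi T : H1 Omega f -> smooth_approx Omega f phi -> T \in tris M ->
  smooth_approx (otri T) f phi.
Proof.
move=> hf ap TM; have [s _ _] := ap.
exact: (smooth_approx_restrict (@open_otri R M T) oO (otri_sub hO hM TM) s hf ap).
Qed.

Lemma H1E_broken u : H1E Omega GD u -> broken Omega M u.
Proof.
move=> hu i; have h := H1E_H1 i hu; split; first exact: H1_sq_int.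
move=> T TM; split; first exact: (H1_restrict (@open_otri R M T) oO (otri_sub hO hM TM) h).
by have [phi ap] := H1E_approx i hu; exists phi; exact: approx_otri.
Qed.

(** One sequence of functions smooth on the plane approximates u on both sides, so both traces are
    limits of the same edge values. *)
Lemma H1E_jump u e i : H1E Omega GD u -> interior_edge e ->
  {ae leb, forall t, U t -> jump e u i (seg e t) = 0}.
Proof.
move=> hu ie; have [e12 s0] := interior_sides ie (ltn0Sn 1).
have [_ s1] := interior_sides ie (ltnSn 1).
have [phi ap] := H1E_approx i hu; have [s _ _] := ap.
have h := H1E_H1 i hu; have hb := H1E_broken hu.
have key n : edge_side e n \in edge_tris e ->
    cvg2 leb U (fun n => phi n \o seg e) (edge_trace e n u i \o seg e).
  move=> /(edge_triangle hM e12)[k [_ TM d0 hD]].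
  have [_ /(_ _ TM) hs] := hb i; have [hs1 _] := hs.
  exact: (trace_cvg d0 hD hs1 (approx_otri h ap TM) (traceP d0 hD hs)).
have q n : sq_int leb U (phi n \o seg e) by exact: smooth_seg_sq_int.
have := cvg2_unique mU q (edge_trace_sq_int hM i e12 s0 hb)
  (edge_trace_sq_int hM i e12 s1 hb) (key 0%N s0) (key 1%N s1).
apply: ae_imply => t ht Ut; rewrite /jump /vsub; have /= -> := ht Ut.
exact: subrr.
Qed.

Lemma H1E_jform u w : H1E Omega GD u -> broken Omega M w -> jform M u w = 0.
Proof.
move=> hu hw; have hb := H1E_broken hu.
rewrite /jform big1// => e ie; rewrite big1// => i _.
have [m1 _] := jump_sq_int hM i ie hb; have [m2 _] := jump_sq_int hM i ie hw.
exact: (dot0l mU m1 m2 (H1E_jump i hu ie)).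
Qed.

(** The smooth sequence that witnesses the zero trace on Omega also approximates u on the adjacent
    cell, hence computes the cell trace. *)
Lemma H1E_boundary u e i : H1E Omega GD u -> boundary_edge e -> edge_seg e `<=` GD ->
  {ae leb, forall t, U t -> edge_trace e 0 u i (seg e t) = 0}.
Proof.
move=> hu /andP[e12 /eqP c1] eG.
have s0 : edge_side e 0 \in edge_tris e by apply: edge_side_in; rewrite c1.
have [k [_ TM d0 hD]] := edge_triangle hM e12 s0.
have [h ht] := hu i.
have /(is_traceP _ d0)[mz [phi [ap c]]] := ht _ _ eG.
have hb := H1E_broken hu; have [_ /(_ _ TM) hs] := hb i.
suff tr : is_trace (otri (edge_side e 0)) (vert e.1) (vert e.2) (u i) (fun=> 0).
  exact: (trace_ae d0 hD hs tr).
by apply/(is_traceP _ d0); split; [exact: mz|exists phi; split; [exact: approx_otri|exact: c]].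
Qed.

(** Weak derivatives on a cell are almost everywhere the restrictions of those on Omega. *)
Lemma elastic_mesh mu lam v w : (forall i, H1 Omega (v i)) -> (forall i, H1 Omega (w i)) ->
  eform M mu lam v w = elastic_form mu lam Omega v w.
Proof.
move=> hv hw; rewrite /eform /elastic_form big_split /= -!mulr_sumr.
have dsum f g (F G : {set V} -> plane R -> R) : sq_int mu2 Omega f -> sq_int mu2 Omega g ->
    (forall T, T \in tris M -> measurable_fun (otri T) (F T)) ->
    (forall T, T \in tris M -> measurable_fun (otri T) (G T)) ->
    (forall T, T \in tris M -> {ae mu2, forall x, otri T x -> F T x = f x}) ->
    (forall T, T \in tris M -> {ae mu2, forall x, otri T x -> G T x = g x}) ->
    \sum_(T in tris M) ip (otri T) (F T) (G T) = ip Omega f g.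
  move=> hf hg mF mG eF eG.
  transitivity (\sum_(T in tris M) dot mu2 (otri T) f g); last exact: (esym (dot_mesh hO hM hf hg)).
  apply: eq_bigr => T TM; have mT := @measurable_otri R M T.
  have [mf _] := sq_intS mO mT (otri_sub hO hM TM) hf.
  have [mg _] := sq_intS mO mT (otri_sub hO hM TM) hg.
  exact: (eq_dot mT (mF T TM) mf (mG T TM) mg (eF T TM) (eG T TM)).
have hvT z T : T \in tris M -> (forall i, H1 Omega (z i)) -> forall i, H1 (otri T) (z i).
  by move=> TM hz i; exact: (H1_restrict (@open_otri R M T) oO (otri_sub hO hM TM)).
have ed z T i j : T \in tris M -> (forall i, H1 Omega (z i)) ->
    {ae mu2, forall x, otri T x -> wderiv (otri T) j (z i) x = wderiv Omega j (z i) x}.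
  by move=> TM hz; exact: (wderiv_restrict (@open_otri R M T) oO (otri_sub hO hM TM)).
have es z T i j : T \in tris M -> (forall i, H1 Omega (z i)) ->
    {ae mu2, forall x, otri T x -> strain (otri T) z i j x = strain Omega z i j x}.
  move=> TM hz; apply: ae_imply2 (ed z T i j TM hz) (ed z T j i TM hz) => x h1 h2 Tx.
  by rewrite /strain (h1 Tx) (h2 Tx).
have ew z T : T \in tris M -> (forall i, H1 Omega (z i)) ->
    {ae mu2, forall x, otri T x -> wdiv (otri T) z x = wdiv Omega z x}.
  move=> TM hz; apply: ae_imply2 (ed z T ord0 ord0 TM hz)
    (ed z T (lift ord0 ord0) (lift ord0 ord0) TM hz) => x h1 h2 Tx.
  by rewrite !wdivE (h1 Tx) (h2 Tx).
have ms z T i j : T \in tris M -> (forall i, H1 Omega (z i)) ->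
    measurable_fun (otri T) (strain (otri T) z i j).
  by move=> TM hz; have [] := strain_sq_int (@open_otri R M T) i j (hvT z T TM hz).
have mw z T : T \in tris M -> (forall i, H1 Omega (z i)) ->
    measurable_fun (otri T) (wdiv (otri T) z).
  by move=> TM hz; have [] := wdiv_sq_int (@open_otri R M T) (hvT z T TM hz).
have -> : \sum_(T in tris M) ip (otri T) (wdiv (otri T) v) (wdiv (otri T) w) =
    ip Omega (wdiv Omega v) (wdiv Omega w).
  apply: (dsum _ _ (fun T => wdiv (otri T) v) (fun T => wdiv (otri T) w)).
  - exact: (wdiv_sq_int oO hv).
  - exact: (wdiv_sq_int oO hw).
  - by move=> T TM; exact: mw.
  - by move=> T TM; exact: mw.
  - by move=> T TM; exact: ew.
  - by move=> T TM; exact: ew.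
apply: (f_equal (fun z => 2 * mu * z + _)).
rewrite exchange_big; apply: eq_bigr => i _ /=.
rewrite exchange_big; apply: eq_bigr => j _ /=.
apply: (dsum _ _ (fun T => strain (otri T) v i j) (fun T => strain (otri T) w i j)).
- exact: (strain_sq_int oO i j hv).
- exact: (strain_sq_int oO i j hw).
- by move=> T TM; exact: ms.
- by move=> T TM; exact: ms.
- by move=> T TM; exact: es.
- by move=> T TM; exact: es.
Qed.

Lemma otri_enum T : T \in tris M -> exists i0 j0 k0 : V,
  [/\ T = [set i0; j0; k0]%SET, #|T| = 3%N, otri T !=set0,
   tri_det (vert i0) (vert j0) (vert k0) != 0 &
   otri T = (tri (vert i0) (vert j0) (vert k0))°].
Proof.
move=> TM; have [/(_ _ TM)[c3 T0] _ _ _] := hM.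
have [i0 [j0 [k0 eT]]] := tri_enum c3; have [d0 hD] := otri_det eT c3 T0.
by exists i0, j0, k0.
Qed.

Lemma otri_continuous_sq_int T f : T \in tris M -> continuous f -> sq_int mu2 (otri T) f.
Proof. by move=> /otri_enum[? [? [? [_ _ _ _ ->]]]]; exact: tri_sq_int. Qed.

Lemma CR_local v T i : CR_space Omega GD M v -> T \in tris M ->
  exists c0 c1 c2, {ae mu2, forall x, otri T x -> v i x = aff c0 c1 c2 x}.
Proof.
move=> /(_ i)[_ + _ _] TM => /(_ _ TM)[p [[c0 [c1 [c2 hp]]] e]]; exists c0, c1, c2.
by apply: ae_imply e => x h Tx; rewrite (h Tx) hp.
Qed.

Lemma CR_affine v T i c0 c1 c2 : CR_space Omega GD M v -> T \in tris M ->
  {ae mu2, forall x, otri T x -> v i x = aff c0 c1 c2 x} ->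
  H1s (otri T) (v i) /\
  forall j, {ae mu2, forall x, otri T x -> wderiv (otri T) j (v i) x = aff_coef c1 c2 j}.
Proof.
move=> hv TM e; have [v2 _ _ _] := hv i.
have mT := @measurable_otri R M T; have oT := @open_otri R M T.
have vT : sq_int mu2 (otri T) (v i) := sq_intS mO mT (otri_sub hO hM TM) v2.
have [mv _] := vT; have [i0 [j0 [k0 [_ _ _ d0 hD]]]] := otri_enum TM.
have aT : sq_int mu2 (otri T) (aff c0 c1 c2).
  by apply: otri_continuous_sq_int => //; exact: continuous_aff.
have [ma _] := aT.
have e' : {ae mu2, forall x, otri T x -> aff c0 c1 c2 x = v i x}.
  by apply: ae_imply e => x h Tx; rewrite (h Tx).
split; first exact: (H1s_congr oT ma mv e' vT (H1s_aff hD c0 c1 c2)).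
by move=> j; rewrite (wderiv_congr oT mv ma e j); exact: (wderiv_aff hD).
Qed.

Lemma CR_broken v : CR_space Omega GD M v -> broken Omega M v.
Proof.
move=> hv i; have [v2 _ _ _] := hv i; split => // T TM.
have [c0 [c1 [c2 e]]] := CR_local i hv TM.
by have [] := CR_affine hv TM e.
Qed.

Lemma CR_grad v T : CR_space Omega GD M v -> T \in tris M -> exists c : 'I_2 -> 'I_2 -> R,
  forall i j, {ae mu2, forall x, otri T x -> wderiv (otri T) j (v i) x = c i j}.
Proof.
move=> hv TM.
have [c hc] : {c : 'I_2 -> 'I_2 -> R & forall i j,
    {ae mu2, forall x, otri T x -> wderiv (otri T) j (v i) x = c i j}}.
  apply: (@choice _ _ (fun i (c : 'I_2 -> R) => forall j,
    {ae mu2, forall x, otri T x -> wderiv (otri T) j (v i) x = c j})) => i.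
  have [c0 [c1 [c2 e]]] := CR_local i hv TM; have [_ h] := CR_affine hv TM e.
  by exists (aff_coef c1 c2).
by exists c.
Qed.

End embeddings.

(** * The global interpolant *)

Section interpolation.
Context (R : realType) (Omega GD GN : set (plane R)) (M : mesh R).
Hypothesis hO : polygonal_domain Omega.
Hypothesis hbd : boundary_split Omega GD GN.
Hypothesis hM : is_triangulation Omega GD GN M.
Local Notation mu2 := (plane_measure R).
Local Notation leb := (@lebesgue_measure R).
Local Notation U := (`[(0 : R), 1]%classic).
Local Notation V := 'I_(nvert M).
Local Notation seg e := (seg_point (vert e.1) (vert e.2)).
Let mU : measurable (U : set (measurableTypeR R)). Proof. by []. Qed.
Let oO := open_domain hO.
Let mO := measurable_domain hO.
Implicit Types (v w : vfield R) (e : V * V) (i j : 'I_2) (T : {set V}).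

Lemma sub00 (x y : R) : x = 0 -> y = 0 -> x - y = 0.
Proof. by move=> -> ->; exact: subrr. Qed.

Lemma comb0 (k l x y z : R) : z = k * x + l * y -> x = 0 -> y = 0 -> z = 0.
Proof. by move=> -> -> ->; rewrite !mulr0 addr0. Qed.

Lemma interp_otri T f : T \in tris M -> H1s (otri T) f ->
  exists c : R * R * R, let w := fun x => 1 * f x + (-1) * aff c.1.1 c.1.2 c.2 x in
  [/\ H1s (otri T) w,
     forall j, \int[mu2]_(x in otri T) wderiv (otri T) j w x = 0,
     forall j, {ae mu2, forall x, otri T x -> wderiv (otri T) j w x =
         wderiv (otri T) j f x - mean (otri T) (wderiv (otri T) j f)} &
     forall x y, x \in T -> y \in T -> x != y ->
       edge_mean (otri T) (vert x) (vert y) w = 0].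
Proof.
move=> TM hf; have [i0 [j0 [k0 [eT c3 _ d0 hD]]]] := otri_enum hM TM.
have [c0 [c1 [c2 [h1 h2 h3 h4]]]] := interp_exists d0 hD hf.
exists (c0, c1, c2); split=> //= x y xT yT xy.
have [n1 n2 n3] := tri_det_neq d0.
have vx (z : V) : z \in T -> [\/ z = i0, z = j0 | z = k0].
  rewrite eT !inE -orbA => /or3P[] /eqP ->;
    by [exact: Or31|exact: Or32|exact: Or33].
have vx' (z : V) : z \in T ->
    [\/ vert z = vert i0, vert z = vert j0 | vert z = vert k0].
  by move=> /vx[] ->; [exact: Or31|exact: Or32|exact: Or33].
apply: h4; [|exact: vx'|exact: vx'].
have [?|?|?] := vx _ xT; have [?|?|?] := vx _ yT; subst x y;
  by rewrite ?eqxx// in xy *; rewrite // eq_sym.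
Qed.

Lemma indic_sq_int T f : T \in tris M -> sq_int mu2 Omega f ->
  sq_int mu2 Omega (fun x => \1_(otri T) x * f x).
Proof.
move=> TM [mf ff]; split.
  by apply: measurable_funM => //; apply: measurable_indic; exact: measurable_otri.
apply: le_lt_trans ff; apply: le_integral_nomeas => x _; rewrite lee_fin ?sqr_ge0//.
by rewrite indicE; case: (x \in _); rewrite ?mul1r// mul0r expr0n/= sqr_ge0.
Qed.

Lemma edge_mean0_jump e w i : interior_edge e -> broken Omega M w ->
  (forall n, (n < 2)%N -> edge_mean (otri (edge_side e n)) (vert e.1) (vert e.2) (w i) = 0) ->
  \int[leb]_(t in U) jump e w i (seg e t) = 0.
Proof.
move=> ie hw h0; have [e12 s0] := interior_sides ie (ltn0Sn 1).
have [_ s1] := interior_sides ie (ltnSn 1).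
have one : sq_int leb U (cst 1) by apply: sq_int_itv; exact: cst_continuous.
have int n : edge_side e n \in edge_tris e ->
    leb.-integrable U (EFin \o (edge_trace e n w i \o seg e)).
  move=> sn; have := sq_intM mU (edge_trace_sq_int hM i e12 sn hw) one.
  by apply: eq_integrable => // t _ /=; rewrite mulr1.
transitivity (\int[leb]_(t in U) edge_trace e 0 w i (seg e t) -
    \int[leb]_(t in U) edge_trace e 1 w i (seg e t)).
  exact: (RintegralB mU (int 0%N s0) (int 1%N s1)).
have z0 : \int[leb]_(t in U) edge_trace e 0 w i (seg e t) = 0 := h0 0%N isT.
have z1 : \int[leb]_(t in U) edge_trace e 1 w i (seg e t) = 0 := h0 1%N isT.
exact: (sub00 z0 z1).
Qed.

Lemma mean_diff0 (F G H : R -> R) : sq_int leb U G -> sq_int leb U H ->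
  measurable_fun U F ->
  {ae leb, forall t, U t -> F t = 1 * G t + (-1) * H t} ->
  {ae leb, forall t, U t -> G t = 0} -> \int[leb]_(t in U) H t = 0 ->
  \int[leb]_(t in U) F t = 0.
Proof.
move=> hG hH mF e G0 H0.
have one : sq_int leb U (cst 1) by apply: sq_int_itv; exact: cst_continuous.
have dE (K : R -> R) : dot leb U K (cst 1) = \int[leb]_(t in U) K t.
  by apply: eq_Rintegral => t _; rewrite mulr1.
have [mG _] := hG; have [m1 _] := one; rewrite -dE.
apply: (comb0 (dot_ae_linl mU mF hG hH one e) (dot0l mU mG m1 G0)).
by rewrite dE.
Qed.

(** The local interpolants are glued with indicators. Membership in the discrete space is read off P
    = u - w: u has no jumps and no trace on GD, and w has vanishing edge means from every side. *)
Lemma interpolant u : H1E Omega GD u -> exists P : vfield R,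
  let w := vlin 1 (-1) u P in
  [/\ CR_space Omega GD M P,
    forall T i j, T \in tris M -> \int[mu2]_(x in otri T) wderiv (otri T) j (w i) x = 0,
    forall T i j, T \in tris M -> {ae mu2, forall x, otri T x -> wderiv (otri T) j (w i) x =
      wderiv Omega j (u i) x - mean (otri T) (wderiv Omega j (u i))} &
    forall T i x y, T \in tris M -> x \in T -> y \in T -> x != y ->
       edge_mean (otri T) (vert x) (vert y) (w i) = 0].
Proof.
move=> hu; have hb := H1E_broken hO hbd hM hu.
pose Q (iT : 'I_2 * {set V}) (c : R * R * R) := iT.2 \in tris M ->
    let w := fun x => 1 * u iT.1 x + (-1) * aff c.1.1 c.1.2 c.2 x in
    [/\ H1s (otri iT.2) w,
     forall j, \int[mu2]_(x in otri iT.2) wderiv (otri iT.2) j w x = 0,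
     forall j, {ae mu2, forall x, otri iT.2 x -> wderiv (otri iT.2) j w x =
         wderiv (otri iT.2) j (u iT.1) x - mean (otri iT.2) (wderiv (otri iT.2) j (u iT.1))} &
     forall x y, x \in iT.2 -> y \in iT.2 -> x != y ->
       edge_mean (otri iT.2) (vert x) (vert y) w = 0].
(* Off the mesh the property is void, so that [choice] can range over all sets of vertices. *)
have exQ iT : exists c, Q iT c.
  case: iT => i T; rewrite /Q /=; have [TM|_] := boolP (T \in tris M); last by exists (0, 0, 0).
  have [_ /(_ _ TM) hf] := hb i; have [c h] := interp_otri TM hf.
  by exists c.
have [c hc] := choice exQ.
pose af i T := aff (c (i, T)).1.1 (c (i, T)).1.2 (c (i, T)).2.
pose P : vfield R := fun i x => \sum_(T <- enum (tris M)) (if T \in tris M then \1_(otri T) x * af i T x else 0).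
exists P; cbv zeta; set w := vlin 1 (-1) u P.
have PE i T x : T \in tris M -> otri T x -> P i x = af i T x.
  move=> TM Tx; rewrite /P big_enum/= (bigD1 T)//= TM big1 ?addr0.
    by rewrite indicE mem_set// mul1r.
  move=> T' /andP[TM' TT']; rewrite TM' indicE memNset ?mul0r// => Tx'.
  by move/eqP: TT'; apply; exact: (otri_inj hM TM' TM Tx' Tx).
have P2 i : sq_int mu2 Omega (P i).
  apply: (sq_int_sum mO) => T; case TM : (T \in tris M).
    apply: indic_sq_int => //; apply: (domain_sq_int hO); exact: continuous_aff.
  by apply: (domain_sq_int hO); exact: cst_continuous.
have PT i T : T \in tris M -> sq_int mu2 (otri T) (P i).
  move=> TM; exact: (sq_intS mO (@measurable_otri R M T) (otri_sub hO hM TM) (P2 i)).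
have aT i T : T \in tris M -> sq_int mu2 (otri T) (af i T).
  by move=> TM; apply: (otri_continuous_sq_int hM TM); exact: continuous_aff.
have Pb : broken Omega M P.
  move=> i; split => // T TM; have [i0 [j0 [k0 [_ _ _ _ hD]]]] := otri_enum hM TM.
  have [mP _] := PT i T TM; have [ma _] := aT i T TM.
  apply: (H1s_congr (@open_otri R M T) ma mP _ (PT i T TM) (H1s_aff hD _ _ _)).
  by apply: aeW => x Tx; rewrite (PE i T).
have hw : broken Omega M w := broken_lin hO hM 1 (-1) hb Pb.
pose wT i T x := 1 * u i x + (-1) * af i T x.
have uT i T : T \in tris M -> sq_int mu2 (otri T) (u i).
  move=> TM; have [u2 _] := hb i.
  exact: (sq_intS mO (@measurable_otri R M T) (otri_sub hO hM TM) u2).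
have mw i T : T \in tris M -> measurable_fun (otri T) (w i).
  by move=> TM; have [] := sq_int_lin (@measurable_otri R M T) 1 (-1) (uT i T TM) (PT i T TM).
have mwT i T : T \in tris M -> measurable_fun (otri T) (wT i T).
  by move=> TM; have [] := sq_int_lin (@measurable_otri R M T) 1 (-1) (uT i T TM) (aT i T TM).
have ew i T : T \in tris M -> {ae mu2, forall x, otri T x -> w i x = wT i T x}.
  by move=> TM; apply: aeW => x Tx; rewrite /w /vlin /wT (PE i T).
have dw i T j : T \in tris M -> wderiv (otri T) j (w i) = wderiv (otri T) j (wT i T).
  by move=> TM; exact: (wderiv_congr (@open_otri R M T) (mw i T TM) (mwT i T TM) (ew i T TM)).
have means T i x y : T \in tris M -> x \in T -> y \in T -> x != y ->
    edge_mean (otri T) (vert x) (vert y) (w i) = 0.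
  move=> TM xT yT xy; have [_ _ _ h] := hc (i, T) TM.
  have [/(_ _ TM)[c3 T0] _ _ _] := hM.
  have [k ek] := tri_edge_enum c3 xT yT xy; have [d0 _] := otri_det ek c3 T0.
  rewrite /edge_mean (trace_congr (@open_otri R M T) (mw i T TM) (mwT i T TM) (ew i T TM) d0).
  exact: h.
have jw e i : interior_edge e -> \int[leb]_(t in U) jump e w i (seg e t) = 0.
  move=> ie; apply: edge_mean0_jump => // n n2; have [e12 sn] := interior_sides ie n2.
  move: sn; rewrite inE => /andP[TM /andP[h1 h2]]; apply: means => //.
  by apply: contraTneq e12 => ->; rewrite ltnn.
have Puw : P = vlin 1 (-1) u w.
  by apply/funext => i; apply/funext => x; rewrite /w /vlin !mul1r !mulN1r opprB addrC subrK.
split=> //.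
- move=> i; split; first exact: (P2 i).
  + move=> T TM; exists (af i T); split; first by do 3 eexists.
    by apply: aeW => x Tx; rewrite (PE i T).
  + move=> e ie; rewrite /edge_int /line_int.
    have [mP _] := jump_sq_int hM i ie Pb.
    rewrite (_ : Rintegral _ _ _ = 0) ?mulr0//.
    apply: (mean_diff0 (jump_sq_int hM i ie hb) (jump_sq_int hM i ie hw) mP) => //.
      by have := jump_lin hM 1 (-1) i ie hb hw; rewrite -Puw.
      exact: (H1E_jump hO hbd hM i hu ie).
    exact: jw.
  + move=> e be eG; rewrite /edge_int /line_int.
    have /andP[e12 /eqP c1] := be.
    have s0 : edge_side e 0 \in edge_tris e by apply: edge_side_in; rewrite c1.
    have [mP _] := edge_trace_sq_int hM i e12 s0 Pb.
    rewrite (_ : Rintegral _ _ _ = 0) ?mulr0//.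
    apply: (mean_diff0 (edge_trace_sq_int hM i e12 s0 hb) (edge_trace_sq_int hM i e12 s0 hw) mP).
      by have := edge_trace_lin hM 1 (-1) i e12 s0 hb hw; rewrite -Puw.
      exact: (H1E_boundary hO hbd hM i hu be eG).
    move: s0; rewrite inE => /andP[TM /andP[h1 h2]]; apply: means => //.
    by apply: contraTneq e12 => ->; rewrite ltnn.
- move=> T i j TM; rewrite dw//; have [_ h _ _] := hc (i, T) TM; exact: h.
- move=> T i j TM; rewrite dw//; have [_ _ h _] := hc (i, T) TM.
  have eD := wderiv_restrict (@open_otri R M T) oO (otri_sub hO hM TM) j (H1E_H1 i hu).
  have -> : mean (otri T) (wderiv Omega j (u i)) = mean (otri T) (wderiv (otri T) j (u i)).
    have mT := @measurable_otri R M T.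
    rewrite /mean; congr (_ / _); rewrite /Rintegral; congr fine; apply: ae_eq_integral => //.
    + apply/measurable_EFinP.
      by have [] := sq_intS mO mT (otri_sub hO hM TM) (H1_wderiv_sq_int j (H1E_H1 i hu)).
    + by apply/measurable_EFinP; apply: wderiv_measurable; exact: (broken_H1 hb TM).
    + by apply: ae_imply eD => x h' Tx; rewrite h'.
  by apply: ae_imply2 eD (h j) => x h1 h2 Tx; rewrite (h2 Tx) (h1 Tx).
Qed.

End interpolation.

(** * Interpolation error on a shape-regular mesh *)

Section error_bounds.
Context (R : realType) (Omega GD GN : set (plane R)) (M : mesh R) (sigma : R).
Hypothesis hO : polygonal_domain Omega.
Hypothesis hM : is_triangulation Omega GD GN M.
Hypothesis hs : shape_regular sigma M.
Local Notation mu2 := (plane_measure R).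
Local Notation leb := (@lebesgue_measure R).
Local Notation U := (`[(0 : R), 1]%classic).
Local Notation V := 'I_(nvert M).
Local Notation seg e := (seg_point (vert e.1) (vert e.2)).
Let mU : measurable (U : set (measurableTypeR R)). Proof. by []. Qed.
Let oO := open_domain hO.
Let mO := measurable_domain hO.
Implicit Types (v w : vfield R) (e : V * V) (i j : 'I_2) (T : {set V}).

(** Edge lengths are at most the diameter d, and d^2 <= 2 r J trades d^2 for the Jacobian in the
    edge estimate. *)
Lemma poincare_arith (d l1 l2 J G X Y r : R) : 0 <= l1 -> l1 <= d -> 0 <= l2 -> l2 <= d ->
  d ^+ 2 <= 2 * r * J -> 0 < J -> 0 <= G ->
  X <= 14 * (l1 ^+ 2 + l2 ^+ 2) * G -> J * Y <= 14 * (l1 ^+ 2 + l2 ^+ 2) * G ->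
  X <= 28 * d ^+ 2 * G /\ Y <= 56 * r * G.
Proof.
move=> l10 h1 l20 h2 hd J0 G0 hX hY.
have q1 : l1 ^+ 2 <= d ^+ 2 by rewrite ler_sqr ?nnegrE//; exact: le_trans h1.
have q2 : l2 ^+ 2 <= d ^+ 2 by rewrite ler_sqr ?nnegrE//; exact: le_trans h1.
have L : 14 * (l1 ^+ 2 + l2 ^+ 2) * G <= 28 * d ^+ 2 * G by apply: ler_wpM2r => //; lra.
split; first exact: le_trans L.
rewrite -(ler_pM2l J0); apply: le_trans hY _; apply: le_trans L _.
have -> : J * (56 * r * G) = (28 * (2 * r * J)) * G by ring.
by apply: ler_wpM2r => //; lra.
Qed.

Lemma grad2_ge0 (D : set (plane R)) f : 0 <= grad2 D f.
Proof.
by apply: addr_ge0; [exact: (dot_ge0 mu2 D (wderiv D ord0 f))|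
  exact: (dot_ge0 mu2 D (wderiv D (lift ord0 ord0) f))].
Qed.

Lemma cell_bounds T f (i k l : V) : T \in tris M -> T = [set i; k; l]%SET -> H1s (otri T) f ->
  edge_mean (otri T) (vert i) (vert l) f = 0 ->
  dot mu2 (otri T) f f <= 28 * diam (hull T) ^+ 2 * grad2 (otri T) f /\
  \int[leb]_(t in U) trace (otri T) (vert i) (vert l) f (seg_point (vert i) (vert l) t) ^+ 2
    <= 56 * `|sigma| * grad2 (otri T) f.
Proof.
move=> TM eT hf m0; have [/(_ _ TM)[c3 T0] _ _ _] := hM.
have [d0 hD] := otri_det eT c3 T0.
have [l1 l2 _ _] := diam_ge eT c3 T0.
have [hX hY] := H1s_poincare d0 hD hf (traceP d0 hD hf) m0.
have J0 : 0 < `|tri_det (vert i) (vert k) (vert l)| by rewrite normr_gt0.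
exact: (poincare_arith (eucl_dist_ge0 _ _) l1 (eucl_dist_ge0 _ _) l2
  (diam_sqr_le eT c3 T0 (hs TM)) J0 (grad2_ge0 _ _) hX hY).
Qed.

Section interpolation_error.
Variables (s : R) (u w : vfield R).
Hypothesis hw : broken Omega M w.
Hypothesis hu : forall i, H1 Omega (u i).
Hypothesis wgrad : forall T i j, T \in tris M ->
  {ae mu2, forall x, otri T x -> wderiv (otri T) j (w i) x =
      wderiv Omega j (u i) x - mean (otri T) (wderiv Omega j (u i))}.
Hypothesis wmean : forall T i x y, T \in tris M -> x \in T -> y \in T -> x != y ->
  edge_mean (otri T) (vert x) (vert y) (w i) = 0.

Lemma cell_L2_bound T i : T \in tris M ->
  dot mu2 (otri T) (w i) (w i) <= 28 * diam (hull T) ^+ 2 * grad2 (otri T) (w i).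
Proof.
move=> TM; have [i0 [j0 [k0 [eT c3 T0 d0 _]]]] := otri_enum hM TM.
have [_ /(_ _ TM) h] := hw i.
have ik : i0 != k0.
  by have [_ + _] := tri_det_neq d0; apply: contra_neq => ->.
have m0 : edge_mean (otri T) (vert i0) (vert k0) (w i) = 0.
  by apply: wmean => //; rewrite eT !inE eqxx ?orbT.
by have [] := cell_bounds TM eT h m0.
Qed.

Lemma edge_L2_bound e n i : (e.1 < e.2)%N -> edge_side e n \in edge_tris e ->
  dot leb U (edge_trace e n w i \o seg e) (edge_trace e n w i \o seg e) <=
  56 * `|sigma| * grad2 (otri (edge_side e n)) (w i).
Proof.
move=> e12 sn; have [k [eT TM d0 _]] := edge_triangle hM e12 sn.
have [_ /(_ _ TM) h] := hw i.
have ne : e.1 != e.2 by apply: contraTneq e12 => ->; rewrite ltnn.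
have m0 : edge_mean (otri (edge_side e n)) (vert e.1) (vert e.2) (w i) = 0.
  by apply: wmean => //; rewrite eT !inE eqxx ?orbT.
have [_] := cell_bounds TM eT h m0; apply: le_trans.
by rewrite le_eqVlt; apply/orP; left; apply/eqP; apply: eq_Rintegral => t _ /=; rewrite expr2.
Qed.

Lemma jump_L2_arith (a b c k X Y : R) :
  X = 1 ^+ 2 * a + 2 * 1 * (-1) * b + (-1) ^+ 2 * c ->
  Y = 1 ^+ 2 * a + 2 * 1 * 1 * b + 1 ^+ 2 * c -> 0 <= Y -> a <= k -> c <= k -> X <= 4 * k.
Proof. by rewrite sqrrN expr1n; lra. Qed.

(** |a - b|^2 <= 2 |a|^2 + 2 |b|^2, where the two one-sided traces are bounded by the same sum over
    the adjacent triangles. *)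
Lemma jump_L2_bound e i : interior_edge e ->
  dot leb U (jump e w i \o seg e) (jump e w i \o seg e) <=
  4 * (56 * `|sigma| * \sum_(T in edge_tris e) grad2 (otri T) (w i)).
Proof.
move=> ie; have [e12 s0] := interior_sides ie (ltn0Sn 1).
have [_ s1] := interior_sides ie (ltnSn 1).
have side n : edge_side e n \in edge_tris e ->
    dot leb U (edge_trace e n w i \o seg e) (edge_trace e n w i \o seg e) <=
    56 * `|sigma| * \sum_(T in edge_tris e) grad2 (otri T) (w i).
  move=> sn; apply: le_trans (edge_L2_bound i e12 sn) _; apply: ler_wpM2l.
    by rewrite mulr_ge0.
  rewrite (bigD1 (edge_side e n))//=; rewrite lerDl.
  by apply: sumr_ge0 => T _; exact: grad2_ge0.
have q0 := edge_trace_sq_int hM i e12 s0 hw; have q1 := edge_trace_sq_int hM i e12 s1 hw.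
have dS := dot_sqr_lin mU 1 (-1) q0 q1; have dD := dot_sqr_lin mU 1 1 q0 q1.
have p0 := dot_ge0 leb U (fun t => 1 * (edge_trace e 0 w i \o seg e) t + 1 * (edge_trace e 1 w i \o seg e) t).
have -> : dot leb U (jump e w i \o seg e) (jump e w i \o seg e) =
    dot leb U (fun t => 1 * (edge_trace e 0 w i \o seg e) t + (-1) * (edge_trace e 1 w i \o seg e) t)
    (fun t => 1 * (edge_trace e 0 w i \o seg e) t + (-1) * (edge_trace e 1 w i \o seg e) t).
  by apply: eq_Rintegral => t _; rewrite /jump /vsub /= mul1r mulN1r.
exact: (jump_L2_arith dS dD p0 (side 0%N s0) (side 1%N s1)).
Qed.

(** A triangle is adjacent to boundedly many edges, so a sum over edges is controlled by one over
    triangles; 2016 is 4 times 56 times 9. *)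
Lemma jform_bound : jform M w w <=
  2016 * `|sigma| * \sum_(i < 2) \sum_(T in tris M) grad2 (otri T) (w i).
Proof.
pose G i T := grad2 (otri T) (w i).
have G0 i T : 0 <= G i T by exact: grad2_ge0.
pose k := 4 * (56 * `|sigma|).
have k0 : 0 <= k by rewrite /k !mulr_ge0.
have step : jform M w w <= \sum_(i < 2) \sum_(T in tris M) k * (9 * G i T).
  rewrite /jform exchange_big; apply: ler_sum => i _ /=.
  apply: (@le_trans _ _ (\sum_(e : V * V | interior_edge e) \sum_(T in edge_tris e) k * G i T)).
    apply: ler_sum => e ie; rewrite -mulr_sumr /k -mulrA; exact: jump_L2_bound.
  apply: (@le_trans _ _ (\sum_(e : V * V) \sum_(T in edge_tris e) k * G i T)).
    rewrite big_mkcond/=; apply: ler_sum => e _; case: ifP => // _.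
    by apply: sumr_ge0 => T _; rewrite mulr_ge0.
  rewrite (exchange_big_dep (mem (tris M)))/=; last by move=> e T _; rewrite inE => /andP[].
  apply: ler_sum => T TM; rewrite sumr_const -[leLHS]mulr_natr -mulrA; apply: ler_wpM2l => //.
  rewrite mulrC; apply: ler_wpM2r => //.
  have [/(_ _ TM)[c3 _] _ _ _] := hM.
  (* An edge of T is a pair of vertices of T, and there are 9 such ordered pairs. *)
  rewrite (ler_nat R _ 9); apply: (@leq_trans #|finset.setX T T|); last by rewrite cardsX c3.
  apply: subset_leq_card; apply/fintype.subsetP => e eT.
  have : T \in edge_tris e := eT.
  by rewrite inE => /andP[_ /andP[h1 h2]]; rewrite (surjective_pairing e) finset.in_setX h1.
apply: le_trans step _; rewrite mulr_sumr; apply: ler_sum => i _.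
rewrite mulr_sumr; apply: ler_sum => T _; rewrite /k /G.
by move: (grad2 _ _) (`|sigma|) => a b; lra.
Qed.

Lemma diam_le_mesh T : T \in tris M -> 0 <= diam (hull T) /\ diam (hull T) <= mesh_size M.
Proof.
move=> TM; have [i0 [j0 [k0 [eT c3 T0 _ _]]]] := otri_enum hM TM.
have [_ _ /ltW h _] := diam_ge eT c3 T0; split => //.
by rewrite /mesh_size; apply: (le_bigmax_cond _ (fun T => diam (hull T)) TM).
Qed.

Lemma L2_bound : vip Omega w w <= 28 * mesh_size M ^+ 2 *
  \sum_(i < 2) \sum_(T in tris M) grad2 (otri T) (w i).
Proof.
rewrite /vip mulr_sumr; apply: ler_sum => i _; have [w2 _] := hw i.
apply: (@le_trans _ _ (dot mu2 Omega (w i) (w i))); first exact: lexx.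
rewrite (dot_mesh hO hM w2 w2) mulr_sumr; apply: ler_sum => T TM.
apply: le_trans (cell_L2_bound i TM) _; apply: ler_wpM2r; first exact: grad2_ge0.
have [d0 dh] := diam_le_mesh TM; apply: ler_wpM2l => //.
by rewrite ler_sqr ?nnegrE//; exact: le_trans dh.
Qed.

(** The gradient of w is the deviation of that of u from its cell mean. *)
Lemma grad2_variance T i : T \in tris M ->
  grad2 (otri T) (w i) = \sum_(j < 2) variance (otri T) (wderiv Omega j (u i)).
Proof.
move=> TM; rewrite big_ord_recl big_ord1 /grad2.
have key j : dot mu2 (otri T) (wderiv (otri T) j (w i)) (wderiv (otri T) j (w i)) =
    variance (otri T) (wderiv Omega j (u i)).
  have mT := @measurable_otri R M T.
  have m1 := wderiv_measurable j (broken_H1 hw TM i).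
  have [m2 _] := sq_intS mO mT (otri_sub hO hM TM) (H1_wderiv_sq_int j (hu i)).
  have m3 : measurable_fun (otri T) (fun x => wderiv Omega j (u i) x - mean (otri T) (wderiv Omega j (u i))).
    by apply: measurable_funB.
  exact: (eq_dot mT m1 m3 m1 m3 (wgrad i j TM) (wgrad i j TM)).
exact: (f_equal2 (fun x y => x + y) (key ord0) (key (lift ord0 ord0))).
Qed.

Hypothesis s0 : 0 < s.

Lemma variance_ge0 (D : set (plane R)) f : 0 <= variance D f.
Proof. exact: (dot_ge0 mu2 D (fun x => f x - mean D f)). Qed.

(** Split the power of d into d^2, absorbed by J through shape regularity, and d^(2 s), at most h^(2
    s). *)
Lemma fractional_arith (d h J W r : R) : 0 < d -> d <= h -> d ^+ 2 <= 2 * r * J -> 0 <= r ->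
  0 <= W -> W <= 2 * r * h `^ (2 * s) * ((d `^ (2 + 2 * s))^-1 * (J * W)).
Proof.
move=> d0 dh hd r0 W0; have h0 : 0 < h := lt_le_trans d0 dh.
have e : d `^ (2 + 2 * s) = d ^+ 2 * d `^ (2 * s).
  by rewrite powRD ?(gt_eqF d0)// ?implybT// powR_mulrn// ltW.
have p0 : 0 < d `^ (2 * s) by rewrite powR_gt0.
have ph : d `^ (2 * s) <= h `^ (2 * s).
  have s20 : 0 <= 2 * s by rewrite mulr_ge0// ltW.
  by apply: (ge0_ler_powR s20); rewrite ?nnegrE ?(ltW d0) ?(ltW h0).
have d20 : 0 < d ^+ 2 by rewrite exprn_gt0.
rewrite e; move: ph p0 hd d20; move: (d `^ _) (h `^ _) (d ^+ 2) => x y z xy x0 zJ z0.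
rewrite (_ : 2 * r * y * _ = (2 * r * J) * y * W / (z * x)); last by field; rewrite !gt_eqF.
rewrite ler_pdivlMr ?mulr_gt0// mulrC; apply: ler_wpM2r => //.
by apply: ler_pM => //; exact: ltW.
Qed.

(** [frac_poincare] on the mesh cells, with shape regularity comparing the squared diameter of a
    cell to its area. *)
Lemma fractional_bound g : sq_int mu2 Omega g ->
  (\int[mu2]_(x in Omega) \int[mu2]_(y in Omega) (frac_kernel s g x y)%:E < +oo)%E ->
  \sum_(T in tris M) variance (otri T) g <= 2 * `|sigma| * mesh_size M `^ (2 * s) *
   fine (\int[mu2]_(x in Omega) \int[mu2]_(y in Omega) (frac_kernel s g x y)%:E)%E.
Proof.
move=> hg fin; set Q := (\int[mu2]_(x in Omega) _)%E in fin *.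
have Q0 : (0 <= Q)%E.
  apply: integral_ge0 => x _; apply: integral_ge0 => y _.
  by rewrite lee_fin /frac_kernel divr_ge0 ?sqr_ge0 ?powR_ge0.
have area T : T \in tris M -> exists J : R, [/\ 0 < J, \int[mu2]_(x in otri T) (1 : R) = J / 2 &
    diam (hull T) ^+ 2 <= 2 * `|sigma| * J].
  move=> TM; have [i0 [j0 [k0 [eT c3 T0 d0 hD]]]] := otri_enum hM TM.
  exists `|tri_det (vert i0) (vert j0) (vert k0)|.
  by rewrite normr_gt0 d0 (interior_tri_area d0 hD); split => //; exact: (diam_sqr_le eT c3 T0 (hs TM)).
have dpos T : T \in tris M -> 0 < diam (hull T).
  by move=> TM; have [i0 [j0 [k0 [eT c3 T0 _ _]]]] := otri_enum hM TM; have [] := diam_ge eT c3 T0.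
have F := @frac_poincare R _ (tris M) (fun T => otri T) Omega s g (fun T => diam (hull T)) s0 mO
  (fun T _ => @measurable_otri R M T) (fun T TM => otri_sub hO hM TM)
  (fun T T' x TM TM' => @otri_inj R Omega GD GN M hM T T' x TM TM')
  (fun T TM => sq_intS mO (@measurable_otri R M T) (otri_sub hO hM TM) hg)
  (fun T TM => otri_continuous_sq_int hM TM (@cst_continuous _ _ (1 : R))).
have A0 T : T \in tris M -> 0 < \int[mu2]_(x in otri T) (1 : R).
  by move=> TM; have [J [J0 -> _]] := area T TM; rewrite divr_gt0.
have dd T x y : T \in tris M -> otri T x -> otri T y -> eucl_dist x y <= diam (hull T).
  move=> TM /interior_subset hx /interior_subset hy.
  have [i0 [j0 [k0 [eT c3 _ _ _]]]] := otri_enum hM TM; exact: (dist_le_diam eT c3).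
have {F} := F A0 dpos dd; rewrite -[X in (_ <= X)%E](@fineK _ Q) ?ge0_fin_numE// lee_fin => F.
apply: le_trans (ler_wpM2l _ F); last by rewrite !mulr_ge0 ?powR_ge0.
rewrite mulr_sumr; apply: ler_sum => T TM.
have [J [J0 -> hJ]] := area T TM; have [_ dh] := diam_le_mesh TM.
rewrite (_ : 2 * (J / 2) = J); last by field.
exact: (fractional_arith (dpos T TM) dh hJ (normr_ge0 _) (variance_ge0 _ _)).
Qed.

End interpolation_error.
End error_bounds.

(** * The Slobodeckij double integral as a functional *)

Section fractional_integral.
Context (R : realType) (Omega : set (plane R)) (s : R).
Local Notation mu2 := (plane_measure R).
Hypothesis mO : measurable (Omega : set (mplane R)).
Implicit Types g : plane R -> R.

Definition frac_inner g (x : plane R) : \bar R :=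
  (\int[mu2]_(y in Omega) (frac_kernel s g x y)%:E)%E.

Definition frac_int g : \bar R := (\int[mu2]_(x in Omega) frac_inner g x)%E.

Lemma frac_kernel_ge0 g x y : 0 <= frac_kernel s g x y.
Proof. by rewrite /frac_kernel divr_ge0 ?sqr_ge0 ?powR_ge0. Qed.

Lemma frac_inner_ge0 g x : (0 <= frac_inner g x)%E.
Proof. by apply: integral_ge0 => y _; rewrite lee_fin frac_kernel_ge0. Qed.

Lemma frac_int_ge0 g : (0 <= frac_int g)%E.
Proof. by apply: integral_ge0 => x _; exact: frac_inner_ge0. Qed.

Lemma measurable_kernel_joint (G : plane R -> R) : measurable_fun [set: mplane R] G ->
  measurable_fun [set: mplane R * mplane R] (fun z : mplane R * mplane R => frac_kernel s G z.1 z.2).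
Proof.
move=> mG; rewrite /frac_kernel; apply: measurable_funM.
  apply: measurable_funX; apply: measurable_funB.
    exact: (measurableT_comp mG measurable_fst).
  exact: (measurableT_comp mG measurable_snd).
rewrite (_ : (fun z => _) =
  (@powR R ^~ (- (2 + 2 * s))) \o (fun z : mplane R * mplane R => eucl_dist z.1 z.2)); last first.
  by apply/funext => z /=; rewrite powRN.
apply: measurableT_comp => //; rewrite /eucl_dist.
rewrite (_ : (fun z => _) = (@Num.sqrt R) \o (fun z : mplane R * mplane R =>
  (z.1.1 - z.2.1) ^+ 2 + (z.1.2 - z.2.2) ^+ 2)); last by [].
apply: measurableT_comp.
  by apply: continuous_measurable_fun; exact: sqrt_continuous.
by apply: measurable_funD; apply: measurable_funX; apply: measurable_funB;
  apply: measurableT_comp => //; do ?[exact: measurable_fst|exact: measurable_snd].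
Qed.

Lemma measurable_restr g : measurable_fun Omega g ->
  measurable_fun [set: mplane R] (fun x => \1_Omega x * g x).
Proof.
move=> mg; rewrite (_ : (fun x => _) = g \_ Omega).
  exact/(measurable_restrictT _ mO).
apply/funext => x; rewrite indicE /patch; case: ifP => xO; first by rewrite mul1r.
by rewrite mul0r.
Qed.

(** Tonelli in four real variables, after extending g by 0 outside Omega. *)
Lemma measurable_frac_inner g : measurable_fun Omega g -> measurable_fun Omega (frac_inner g).
Proof.
move=> mg; have mG := measurable_restr mg; set G := (fun x => _) in mG.
pose F (z : mplane R * mplane R) : \bar R :=
  (\1_Omega z.1 * \1_Omega z.2 * frac_kernel s G z.1 z.2)%:E.
have mF : measurable_fun [set: mplane R * mplane R] F.
  apply/measurable_EFinP; apply: measurable_funM; last exact: measurable_kernel_joint.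
  have m1 : measurable_fun [set: mplane R] (\1_Omega : mplane R -> R) by exact: measurable_indic.
  apply: measurable_funM; first exact: (measurableT_comp m1 measurable_fst).
  exact: (measurableT_comp m1 measurable_snd).
have F0 z : (0 <= F z)%E.
  rewrite lee_fin; apply: mulr_ge0; last exact: frac_kernel_ge0.
  by apply: mulr_ge0; rewrite indicE ler0n.
(* Regroups the variables so that the inner plane integral becomes two successive line integrals,
   each preserving measurability. *)
pose F3 (z : (mplane R * measurableTypeR R) * measurableTypeR R) : \bar R :=
  F (z.1.1, (z.1.2, z.2)).
have mF3 : measurable_fun setT F3.
  apply: (measurableT_comp mF); apply: measurable_fun_pair.
    exact: (measurableT_comp measurable_fst measurable_fst).
  apply: measurable_fun_pair; last exact: measurable_snd.
  exact: (measurableT_comp measurable_snd measurable_fst).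
have mI3 : measurable_fun setT (fubini_F (@lebesgue_measure R) F3).
  exact: (measurable_fun_fubini_tonelli_F F3 mF3 (fun z => F0 _)).
have I30 z : (0 <= fubini_F (@lebesgue_measure R) F3 z)%E.
  by apply: integral_ge0 => t _; exact: F0.
have mI := measurable_fun_fubini_tonelli_F (m2 := @lebesgue_measure R) _ mI3 I30.
apply: (eq_measurable_fun _ _ (measurable_funS measurableT (@subsetT _ Omega) mI)).
move=> x /set_mem xO.
transitivity (\int[mu2]_z F (x, z))%E.
  have mx : measurable_fun [set: mplane R] (fun z => F (x, z)).
    by apply: (measurableT_comp mF); exact: measurable_pair1.
  by rewrite (fubini_tonelli1 (fun z => F (x, z)) mx (fun z => F0 _)).
rewrite /frac_inner [in RHS]integral_mkcond.
apply: eq_integral => y _; rewrite /F /= indicE mem_set// mul1r indicE /patch.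
case: ifPn => yO; last by rewrite mul0r.
by rewrite mul1r /frac_kernel /G !indicE mem_set// yO !mul1r.
Qed.

Lemma measurable_kernel g x : measurable_fun Omega g ->
  measurable_fun Omega (fun y => frac_kernel s g x y).
Proof.
move=> mg.
have mG := measurable_kernel_joint (measurable_cst (0 : R)).
rewrite /frac_kernel; apply: measurable_funM.
  by apply: measurable_funX; apply: measurable_funB.
apply: measurable_funS (measurableT) (@subsetT _ Omega) _.
rewrite (_ : (fun z => _) =
  (@powR R ^~ (- (2 + 2 * s))) \o (fun z : mplane R => eucl_dist x z)); last first.
  by apply/funext => z /=; rewrite powRN.
apply: measurableT_comp => //; rewrite /eucl_dist.
rewrite (_ : (fun z => _) = (@Num.sqrt R) \o (fun z : mplane R =>
  (x.1 - z.1) ^+ 2 + (x.2 - z.2) ^+ 2)); last by [].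
apply: measurableT_comp.
  by apply: continuous_measurable_fun; exact: sqrt_continuous.
by apply: measurable_funD; apply: measurable_funX; apply: measurable_funB.
Qed.

(** The null set is discarded first in the outer variable, then in the inner one. *)
Lemma frac_int_ae (g h : plane R -> R) : measurable_fun Omega g -> measurable_fun Omega h ->
  {ae mu2, forall x, Omega x -> g x = h x} -> frac_int g = frac_int h.
Proof.
move=> mg mh e; apply: ae_eq_integral => //; [exact: measurable_frac_inner|exact: measurable_frac_inner|].
have e2 := e; apply: ae_imply e2 => x hx Ox; have ex := hx Ox; rewrite /frac_inner.
apply: ae_eq_integral => //.
- by apply/measurable_EFinP; exact: measurable_kernel.
- by apply/measurable_EFinP; exact: measurable_kernel.
- by apply: ae_imply e => y hy Oy; rewrite /frac_kernel ex hy.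
Qed.

Lemma frac_kernel_lin (a b : R) (g h : plane R -> R) x y :
  frac_kernel s (fun z => a * g z + b * h z) x y <=
  2 * a ^+ 2 * frac_kernel s g x y + 2 * b ^+ 2 * frac_kernel s h x y.
Proof.
rewrite /frac_kernel; set k := (_ `^ _)^-1.
have k0 : 0 <= k by rewrite invr_ge0 powR_ge0.
rewrite !mulrA -mulrDl; apply: ler_wpM2r => //.
rewrite -subr_ge0; move: (g x) (g y) (h x) (h y) => p q r t.
rewrite (_ : _ - _ = (a * (p - q) - b * (r - t)) ^+ 2) ?sqr_ge0//; ring.
Qed.

Lemma frac_int_lin (a b : R) (g h : plane R -> R) : measurable_fun Omega g -> measurable_fun Omega h ->
  (frac_int (fun z => a * g z + b * h z)%R <=
   (2 * a ^+ 2)%R%:E * frac_int g + (2 * b ^+ 2)%R%:E * frac_int h)%E.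
Proof.
move=> mg mh.
have A0 : 0 <= 2 * a ^+ 2 by rewrite mulr_ge0 ?sqr_ge0.
have B0 : 0 <= 2 * b ^+ 2 by rewrite mulr_ge0 ?sqr_ge0.
rewrite /frac_int -!ge0_integralZl//; try (by move=> *; exact: frac_inner_ge0);
  try exact: measurable_frac_inner.
rewrite -ge0_integralD//; try (by move=> *; rewrite mule_ge0 ?frac_inner_ge0);
  try (by apply: measurable_funeM; exact: measurable_frac_inner).
apply: le_integral_nomeas => [x _|x _]; first exact: frac_inner_ge0.
have mk g' : measurable_fun Omega g' -> measurable_fun Omega (fun y => (frac_kernel s g' x y)%:E).
  by move=> m'; apply/measurable_EFinP; exact: measurable_kernel.
rewrite /frac_inner -!ge0_integralZl//; try (by move=> *; rewrite lee_fin frac_kernel_ge0);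
  try exact: mk.
rewrite -ge0_integralD//; try (by move=> *; rewrite mule_ge0// lee_fin frac_kernel_ge0);
  try (by apply: measurable_funeM; exact: mk).
apply: le_integral_nomeas => y _; first by rewrite lee_fin frac_kernel_ge0.
by rewrite -!EFinM -EFinD lee_fin frac_kernel_lin.
Qed.

End fractional_integral.

(** * Uniqueness of the j-th eigenvalue *)

Section eigenvalue_uniqueness.
Context (R : realType) (Omega : set (plane R)).
Hypothesis hO : polygonal_domain Omega.
Local Notation mu2 := (plane_measure R).
Let mO := measurable_domain hO.
Implicit Types u v w : vfield R.

Definition vcomb (I : Type) (r : seq I) (c : I -> R) (phi : I -> vfield R) : vfield R :=
  fun i x => \sum_(k <- r) c k * phi k i x.

Lemma vcomb_cons (I : Type) k (r : seq I) c phi :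
  vcomb (k :: r) c phi = vlin (c k) 1 (phi k) (vcomb r c phi).
Proof. by apply/funext => i; apply/funext => x; rewrite /vcomb /vlin big_cons mul1r. Qed.

Lemma vcomb_vsq (I : Type) (r : seq I) c phi : (forall k, vsq Omega (phi k)) ->
  vsq Omega (vcomb r c phi).
Proof.
move=> h; elim: r => [|k r ih]; last by rewrite vcomb_cons; exact: vsq_lin.
move=> i; have := domain_sq_int hO (@cst_continuous _ _ (0 : R)).
by congr sq_int; apply/funext => x; rewrite /vcomb big_nil.
Qed.

Lemma vip_null u v : vsq Omega u -> vsq Omega v -> vip Omega u u = 0 -> vip Omega u v = 0.
Proof.
move=> hu hv /eqP; rewrite psumr_eq0; last by move=> i _; exact: (dot_ge0 mu2 Omega (u i)).
move=> /allP h0; rewrite /vip big1// => i _.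
have /eqP z := h0 i (mem_index_enum i).
have [m1 _] := hu i; have [m2 _] := hv i.
exact: (dot0l mO m1 m2 (dot_eq0 mO (hu i) z)).
Qed.

Lemma vip_vcomb (I : Type) (r : seq I) c phi v : (forall k, vsq Omega (phi k)) -> vsq Omega v ->
  vip Omega (vcomb r c phi) v = \sum_(k <- r) c k * vip Omega (phi k) v.
Proof.
move=> h hv; elim: r => [|k r ih].
  rewrite big_nil /vip big1// => i _; apply: (dot0l mO _ _ _).
  - by have [] := vcomb_vsq [::] c h i.
  - by have [] := hv i.
  - by apply: aeW => x _; rewrite /vcomb big_nil.
rewrite vcomb_cons (vip_linl hO (c k) 1 (h k) (vcomb_vsq r c h) hv) ih big_cons.
by rewrite [1 * _]mul1r.
Qed.

(* The coordinates C of psi in phi satisfy C C^T = 1, so n is at most the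
   rank of C. *)
Lemma orthonormal_le (E : vfield R -> Prop) m (phi : 'I_m -> vfield R) n (psi : 'I_n -> vfield R) :
  (forall u, E u -> vsq Omega u) ->
  (forall k, E (phi k)) -> (forall k l, vip Omega (phi k) (phi l) = (k == l)%:R) ->
  (forall u, E u -> exists c : 'I_m -> R,
     let r := vsub u (fun i x => \sum_(k < m) c k * phi k i x) in vip Omega r r = 0) ->
  (forall k, E (psi k)) -> (forall k l, vip Omega (psi k) (psi l) = (k == l)%:R) ->
  (n <= m)%N.
Proof.
move=> Es hphi ophi span hpsi opsi.
have [c hc] := choice (fun k => span (psi k) (hpsi k)).
have sphi k : vsq Omega (phi k) := Es _ (hphi k).
have spsi k : vsq Omega (psi k) := Es _ (hpsi k).
have coord k v : vsq Omega v -> vip Omega (psi k) v = \sum_(l < m) c k l * vip Omega (phi l) v.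
  move=> hv; have sc := vcomb_vsq (index_enum 'I_m) (c k) sphi.
  have nul := hc k; rewrite /= -/(vcomb (index_enum 'I_m) (c k) phi) vsubE in nul.
  have := vip_null (vsq_lin hO 1 (-1) (spsi k) sc) hv nul.
  rewrite (vip_linl hO 1 (-1) (spsi k) sc hv) mul1r mulN1r => /eqP; rewrite subr_eq0 => /eqP ->.
  exact: vip_vcomb.
have CC : (\matrix_(k < n, l < m) c k l) *m (\matrix_(k < n, l < m) c k l)^T = 1%:M.
  apply/matrixP => k k'; rewrite !mxE -opsi coord//; apply: eq_bigr => l _; rewrite !mxE.
  congr (_ * _); rewrite vipC coord// (bigD1 l)//= ophi eqxx mulr1 big1 ?addr0// => l' ll'.
  by rewrite ophi (negPf ll') mulr0.
have := mxrank1 R n; rewrite -CC => <-.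
exact: leq_trans (mxrankM_maxl _ _) (rank_leq_col _).
Qed.

Section nth.
Variables (W : vfield R -> Prop) (a : vfield R -> vfield R -> R).
Hypothesis Ws : forall u, W u -> vsq Omega u.

Lemma multiplicity_unique t m m' :
  multiplicity W a (vip Omega) t m -> multiplicity W a (vip Omega) t m' -> m = m'.
Proof.
have Es u : in_eigenspace W a (vip Omega) t u -> vsq Omega u by move=> [/Ws].
move=> [phi [h1 h2 h3]] [psi [k1 k2 k3]]; apply/eqP; rewrite eqn_leq.
by rewrite (orthonormal_le Es k1 k2 k3 h1 h2) (orthonormal_le Es h1 h2 h3 k1 k2).
Qed.

(** If t < t', the entries of l' that are at most t form a permutation of l, since multiplicities
    are intrinsic; so there are at least j of them. But l' is sorted with t' at position j - 1,
    which leaves room for at most j - 1. *)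
Lemma nth_eigenvalue_le j t t' : nth_eigenvalue W a (vip Omega) j t ->
  nth_eigenvalue W a (vip Omega) j t' -> t <= t' -> t' <= t.
Proof.
move=> [l [sl al ml /andP[j0 jl] nl]] [l' [sl' al' ml' /andP[_ jl'] nl']] tt'.
rewrite leNgt; apply/negP => lt.
have cnt r : r <= t -> count_mem r l' = count_mem r l.
  by move=> rt; apply: (multiplicity_unique (ml' r (le_trans rt tt')) (ml r rt)).
have pe : perm_eq l [seq r <- l' | r <= t].
  apply/allP => r; rewrite mem_cat mem_filter => h.
  have rt : r <= t by case/orP: h => [/(allP al)|/andP[]].
  rewrite /= count_filter -(cnt _ rt); apply/eqP; apply: eq_count => z /=.
  by case: eqVneq => // ->; rewrite rt.
pose P (r : R) := r <= t.
have sz : (j <= count P l')%N.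
  by rewrite -size_filter -(perm_size pe).
move: sz; rewrite -(cat_take_drop j.-1 l') count_cat.
(* From position j - 1 on, every entry is at least t', hence larger than t. *)
have -> : count P (drop j.-1 l') = 0%N.
  apply/eqP; rewrite -leqn0 leqNgt -has_count; apply/hasPn => z.
  have jj : (j.-1 < size l')%N by rewrite prednK.
  rewrite (drop_nth 0 jj) nl' => hz.
  have sd : sorted <=%R (t' :: drop j.-1.+1 l').
    by rewrite -[X in X :: _]nl' -drop_nth//; exact: drop_sorted.
  have az : all (fun y => t' <= y) (drop j.-1.+1 l').
    by apply: order_path_min sd; exact: le_trans.
  rewrite /P -ltNge; move: hz; rewrite inE => /orP[/eqP ->//|/(allP az)].
  exact: lt_le_trans.
rewrite addn0 => h; have := leq_trans h (count_size _ _).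
by rewrite size_take_min leq_min -ltnS prednK// ltnn.
Qed.

Lemma nth_eigenvalue_unique j t t' : nth_eigenvalue W a (vip Omega) j t ->
  nth_eigenvalue W a (vip Omega) j t' -> t = t'.
Proof.
move=> h h'; have [tt'|/ltW tt'] := leP t t'; apply/eqP; rewrite eq_le tt'.
  exact: (nth_eigenvalue_le h h').
by rewrite andbT; exact: (nth_eigenvalue_le h' h).
Qed.

End nth.
End eigenvalue_uniqueness.

(** * A uniform fractional bound on an eigenspace *)

Section eigenspace_regularity.
Context (R : realType) (Omega GD GN : set (plane R)) (mu lam s : R).
Hypothesis hO : polygonal_domain Omega.
Hypothesis hbd : boundary_split Omega GD GN.
Local Notation mu2 := (plane_measure R).
Local Notation leb := (@lebesgue_measure R).
Local Notation U := (`[(0 : R), 1]%classic).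
Local Notation W := (H1E Omega GD).
Let mU : measurable (U : set (measurableTypeR R)). Proof. by []. Qed.
Let oO := open_domain hO.
Let mO := measurable_domain hO.
Implicit Types u v w : vfield R.

Lemma cvg_zero_comb (x y : R) : x * 0 + y * 0 = 0.
Proof. by rewrite !mulr0 addr0. Qed.

Lemma H1E_lin a b v w : W v -> W w -> W (vlin a b v w).
Proof.
move=> hv hw i; have hvi := H1E_H1 i hv; have hwi := H1E_H1 i hw.
split; first exact: (H1_lin oO a b hvi hwi).
have cO (h : plane R -> R) : continuous h -> sq_int mu2 Omega h := @domain_sq_int R Omega hO h.
(* A degenerate segment has weight 0 in the trace condition, so any approximating sequence
   serves. *)
move=> p q pq; have [pqE|npq] := eqVneq p q.
  have [phi ap] := H1E_approx hbd i hv; have [psi ap'] := H1E_approx hbd i hw.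
  have [s1 c1 d1] := smooth_approx_lin oO a b cO hvi hwi ap ap'.
  split; first exact: measurable_cst.
  exists (fun n x => a * phi n x + b * psi n x); split; [exact: s1|exact: c1|exact: d1|].
  have -> : eucl_dist p q = 0 by rewrite pqE /eucl_dist !subrr expr0n/= addr0 sqrtr0.
  by under eq_fun do rewrite mul0e; exact: cvg_cst.
(* Third vertex, obtained by turning q - p through a right angle, so that the triangle-based
   [is_traceP] applies to the segment. *)
pose p' : plane R := (p.1 - (q.2 - p.2), p.2 + (q.1 - p.1)).
have d0 : tri_det p p' q != 0.
  rewrite (_ : tri_det p p' q = - (eucl_dist p q ^+ 2)).
    by rewrite oppr_eq0 expf_neq0// gt_eqF// eucl_dist_gt0.
  by rewrite eucl_dist_sqr /tri_det /p' /=; ring.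
have [_ /(_ _ _ pq)/(is_traceP _ d0)[mz [phi [ap c1]]]] := hv i.
have [_ /(_ _ _ pq)/(is_traceP _ d0)[_ [psi [ap' c2]]]] := hw i.
have [s1 _ _] := ap; have [s2 _ _] := ap'.
apply/(is_traceP _ d0); split; first exact: measurable_cst.
exists (fun n x => a * phi n x + b * psi n x); split.
  exact: (smooth_approx_lin oO a b cO hvi hwi ap ap').
have z0 : sq_int leb U ((fun=> 0 : R) \o seg_point p q) by apply: sq_int_itv; exact: cst_continuous.
have := cvg2_lin mU a b (fun n => smooth_seg_sq_int p q (s1 n))
  (fun n => smooth_seg_sq_int p q (s2 n)) z0 z0 c1 c2.
by rewrite (_ : (fun x => a * _ + b * _) = (fun=> 0 : R) \o seg_point p q)//;
  apply/funext => x; exact: cvg_zero_comb.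
Qed.

Lemma H1E_vsq u : W u -> vsq Omega u.
Proof. by move=> hu i; exact: (H1_sq_int (H1E_H1 i hu)). Qed.

Local Notation a := (elastic_form mu lam Omega).
Local Notation b := (vip Omega).

Lemma eigenspace_arith (t x y p q r z : R) : p = t * r -> q = t * z ->
  x * p + y * q = t * (x * r + y * z).
Proof. by move=> -> ->; ring. Qed.

Lemma eigenspace_lin t x y v w : in_eigenspace W a b t v -> in_eigenspace W a b t w ->
  in_eigenspace W a b t (vlin x y v w).
Proof.
move=> [hv ev] [hw ew]; split; first exact: H1E_lin.
move=> z hz.
rewrite (elastic_linl oO mu lam x y (fun i => H1E_H1 i hv) (fun i => H1E_H1 i hw) (fun i => H1E_H1 i hz)).
rewrite (vip_linl hO x y (H1E_vsq hv) (H1E_vsq hw) (H1E_vsq hz)).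
exact: (eigenspace_arith x y (ev z hz) (ew z hz)).
Qed.

(** The square of the Slobodeckij seminorm of the gradient; under [H1frac] each [fine] is applied to
    a finite value. *)
Definition frac_semi u : R :=
  \sum_(i < 2) \sum_(j < 2) fine (frac_int Omega s (wderiv Omega j (u i))).

Lemma frac_semi_ge0 u : 0 <= frac_semi u.
Proof.
by apply: sumr_ge0 => i _; apply: sumr_ge0 => j _; apply: fine_ge0; exact: frac_int_ge0.
Qed.

Lemma H1frac_fin u i j : H1frac Omega s u -> (frac_int Omega s (wderiv Omega j (u i)) < +oo)%E.
Proof. by move=> /(_ i)[_ /(_ j)[]]. Qed.

Lemma frac_int_wderiv_lin x y v w i j : H1 Omega (v i) -> H1 Omega (w i) ->
  (frac_int Omega s (wderiv Omega j (vlin x y v w i)) <=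
   (2 * x ^+ 2)%R%:E * frac_int Omega s (wderiv Omega j (v i)) +
   (2 * y ^+ 2)%R%:E * frac_int Omega s (wderiv Omega j (w i)))%E.
Proof.
move=> hv hw; have m1 := wderiv_measurable j hv; have m2 := wderiv_measurable j hw.
apply: le_trans (frac_int_lin s mO x y m1 m2).
rewrite le_eqVlt; apply/orP; left; apply/eqP.
apply: (frac_int_ae s mO _ _ (wderiv_lin oO j x y hv hw)).
  exact: (wderiv_measurable j (H1_lin oO x y hv hw)).
by have [] := sq_int_lin mO x y (H1_wderiv_sq_int j hv) (H1_wderiv_sq_int j hw).
Qed.

Lemma H1frac_lin x y v w : H1frac Omega s v -> H1frac Omega s w -> H1frac Omega s (vlin x y v w).
Proof.
move=> hv hw i; have [v1 _] := hv i; have [w1 _] := hw i.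
have hl := H1_lin oO x y v1 w1; split=> // j; split; first exact: (H1_wderiv_sq_int j hl).
apply: le_lt_trans (frac_int_wderiv_lin x y j v1 w1) _.
apply: lte_add_pinfty; (apply: lte_mul_pinfty;
  [by rewrite lee_fin mulr_ge0 ?sqr_ge0|by []|]).
  exact: (H1frac_fin i j hv).
exact: (H1frac_fin i j hw).
Qed.

Lemma frac_semi_lin x y v w : H1frac Omega s v -> H1frac Omega s w ->
  frac_semi (vlin x y v w) <= 2 * x ^+ 2 * frac_semi v + 2 * y ^+ 2 * frac_semi w.
Proof.
move=> hv hw; rewrite /frac_semi !mulr_sumr -big_split; apply: ler_sum => i _ /=.
rewrite !mulr_sumr -big_split; apply: ler_sum => j _ /=.
have [v1 _] := hv i; have [w1 _] := hw i.
have fin u : H1frac Omega s u -> frac_int Omega s (wderiv Omega j (u i)) \is a fin_num.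
  by move=> hu; rewrite ge0_fin_numE ?frac_int_ge0//; exact: H1frac_fin.
have := frac_int_wderiv_lin x y j v1 w1.
rewrite -(fineK (fin _ hv)) -(fineK (fin _ hw)) -(fineK (fin _ (H1frac_lin x y hv hw))).
by rewrite -!EFinM -EFinD lee_fin.
Qed.

Lemma vip_sqr_lin x y v w : vsq Omega v -> vsq Omega w ->
  b (vlin x y v w) (vlin x y v w) = x ^+ 2 * b v v + 2 * x * y * b v w + y ^+ 2 * b w w.
Proof.
move=> hv hw; have hl := vsq_lin hO x y hv hw.
rewrite (vip_linl hO x y hv hw hl) (vipC Omega v) (vipC Omega w).
rewrite (vip_linl hO x y hv hw hv) (vip_linl hO x y hv hw hw) (vipC Omega w v).
by move: (b v v) (b v w) (b w w) => p q r; ring.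
Qed.

(** Fields equal almost everywhere have literally equal chosen derivatives, by [wderiv_congr]. *)
Lemma frac_semi_null u v : W u -> W v ->
  b (vsub u v) (vsub u v) = 0 -> frac_semi u = frac_semi v.
Proof.
move=> hu hv; rewrite vsubE => /eqP; rewrite psumr_eq0; last first.
  by move=> i _; exact: (dot_ge0 mu2 Omega (vlin 1 (-1) u v i)).
move=> /allP h0; apply: eq_bigr => i _; apply: eq_bigr => j _.
have /eqP z := h0 i (mem_index_enum i).
have [mu' _] := H1E_vsq hu i; have [mv _] := H1E_vsq hv i.
have e := dot_eq0 mO (vsq_lin hO 1 (-1) (H1E_vsq hu) (H1E_vsq hv) i) z.
suff -> : wderiv Omega j (u i) = wderiv Omega j (v i) by [].
apply: (wderiv_congr oO mu' mv); apply: ae_imply e => x h Ox.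
by have := h Ox; rewrite /vlin mul1r mulN1r => /eqP; rewrite subr_eq0 => /eqP.
Qed.

Section bound.
Variables (t : R) (m : nat).
Hypothesis hm : multiplicity W a b t m.

(** Regularity is not assumed of the whole eigenspace; the regular eigenfunctions form a subspace,
    where [frac_semi] is controlled. *)
Definition regular_eigen u : Prop := in_eigenspace W a b t u /\ H1frac Omega s u.
Local Notation F := regular_eigen.

Lemma regular_eigen_lin x y v w : F v -> F w -> F (vlin x y v w).
Proof. by move=> [v1 v2] [w1 w2]; split; [exact: eigenspace_lin|exact: H1frac_lin]. Qed.

Lemma regular_eigen_vsq u : F u -> vsq Omega u.
Proof. by move=> [[hu _] _]; exact: H1E_vsq. Qed.

(** The squared seminorm is subadditive only up to a factor 2, hence the fold; the point is that the
    bound does not depend on the coefficients. *)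
Lemma regular_eigen_vcomb (I : Type) (r : seq I) (c : I -> R) (psi : I -> vfield R) u :
  F u -> (forall k, F (psi k)) -> (forall k, c k ^+ 2 <= 1) -> F (vcomb r c psi) /\
  frac_semi (vcomb r c psi) <= foldr (fun k z => 2 * frac_semi (psi k) + 2 * z) 0 r.
Proof.
move=> hu hpsi c1; elim: r => [|k r [ih1 ih2]] /=.
  have -> : vcomb [::] c psi = vlin 0 0 u u.
    by apply/funext => i; apply/funext => x; rewrite /vcomb /vlin big_nil !mul0r addr0.
  split; first exact: regular_eigen_lin.
  have [_ h] := hu; apply: le_trans (frac_semi_lin 0 0 h h) _.
  by rewrite expr0n/= !mulr0 !mul0r addr0.
rewrite vcomb_cons; split; first exact: (regular_eigen_lin (c k) 1 (hpsi k) ih1).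
have [_ h1] := hpsi k; have [_ h2] := ih1.
apply: le_trans (frac_semi_lin (c k) 1 h1 h2) _; apply: lerD.
  by apply: ler_wpM2r; [exact: frac_semi_ge0|rewrite -[leRHS]mulr1 ler_wpM2l].
by rewrite expr1n mulr1 ler_wpM2l.
Qed.

(** A maximal orthonormal family of regular eigenfunctions exists because the eigenspace has finite
    dimension. A unit regular eigenfunction equals its projection on that family almost everywhere,
    as otherwise the normalised remainder would enlarge the family; its coefficients are at most 1
    in modulus. *)
Lemma frac_semi_bound : exists B, forall u, F u -> b u u = 1 -> frac_semi u <= B.
Proof.
pose P n : bool := `[< exists psi : 'I_n -> vfield R, (forall k, F (psi k)) /\
  forall k l, b (psi k) (psi l) = (k == l)%:R >].
have exP : exists n, P n.
  by exists 0%N; apply/asboolP; exists (fun=> fun=> fun=> 0); split => -[].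
have [phi [p1 p2 p3]] := hm.
have ubP n : P n -> (n <= m)%N.
  move=> /asboolP[psi [h1 h2]]; apply: (orthonormal_le hO _ p1 p2 p3 _ h2).
    by move=> u [hu _]; exact: H1E_vsq.
  by move=> k; have [] := h1 k.
have [n /asboolP[psi [hF ho]] nmax] := ex_maxnP exP ubP.
exists (foldr (fun k z => 2 * frac_semi (psi k) + 2 * z) 0 (index_enum 'I_n)) => u hu u1.
have su := regular_eigen_vsq hu; have sp k := regular_eigen_vsq (hF k).
pose c k := b u (psi k).
(* Bessel's inequality for one vector: the squared norm of u - c k psi k is 1 - (c k)^2. *)
have c1 k : c k ^+ 2 <= 1.
  have := vip_ge0 Omega (vlin 1 (- c k) u (psi k)); rewrite (vip_sqr_lin _ _ su (sp k)).
  rewrite u1 ho eqxx -/(c k) -[c k ^+ 2 <= 1]subr_ge0; move: (c k) => z.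
  by rewrite [true%:R]mulr1n (_ : _ + _ = 1 - z ^+ 2) //; ring.
have [hv hB] := regular_eigen_vcomb (index_enum 'I_n) hu hF c1.
set v := vcomb _ _ _ in hv hB; have sv := regular_eigen_vsq hv.
pose r := vlin 1 (-1) u v.
have hr : F r by exact: regular_eigen_lin.
have sr := regular_eigen_vsq hr.
have orth k : b r (psi k) = 0.
  rewrite (vip_linl hO 1 (-1) su sv (sp k)) (vip_vcomb hO _ _ sp (sp k)).
  rewrite (bigD1 k)//= ho eqxx big1 ?addr0 ?mulr1 ?mul1r ?mulN1r ?subrr//.
  by move=> l lk; rewrite ho (negPf lk) mulr0.
have [r0|r0] := eqVneq (b r r) 0.
  rewrite (frac_semi_null (u := u) (v := v)) ?vsubE//.
    by have [[]] := hu.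
  by have [[]] := hv.
have rp : 0 < b r r by rewrite lt_def r0 vip_ge0.
pose e := vlin (Num.sqrt (b r r))^-1 0 r r.
have he : F e by exact: regular_eigen_lin.
have ee : b e e = 1.
  rewrite (vip_sqr_lin _ _ sr sr) mulr0 mul0r expr0n/= mul0r !addr0 exprVn.
  by rewrite sqr_sqrtr ?vip_ge0// mulVf.
have ep k : b e (psi k) = 0.
  by rewrite (vip_linl hO _ _ sr sr (sp k)) orth !mulr0 addr0.
(* The normalised remainder e would extend psi to n + 1 orthonormal regular eigenfunctions. *)
exfalso; apply: (negP (negbT (ltnn n))); apply: nmax.
apply/asboolP; exists (fun k : 'I_n.+1 => if unlift ord_max k is Some l then psi l else e).
split=> [k|k l]; first by case: (unlift _ k).
case: (unliftP ord_max k) => [k' ->|->]; case: (unliftP ord_max l) => [l' ->|->].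
- by rewrite ho (inj_eq lift_inj).
- by rewrite vipC ep eq_sym (negPf (neq_lift _ _)).
- by rewrite ep (negPf (neq_lift _ _)).
- by rewrite ee eqxx.
Qed.

End bound.
End eigenspace_regularity.

(** * The error identity and the interpolation estimate *)

Section error_identity.
Context (R : realType).
Implicit Types u v w : vfield R.

Lemma sqr_arith (x y p q r : R) :
  x * (x * p + y * q) + y * (x * q + y * r) = x ^+ 2 * p + 2 * x * y * q + y ^+ 2 * r.
Proof. by ring. Qed.

Lemma form_sqr_lin (K : vfield R -> Prop) (f : vfield R -> vfield R -> R) x y v w :
  (forall v w, f v w = f w v) ->
  (forall a b v v' w, K v -> K v' -> K w -> f (vlin a b v v') w = a * f v w + b * f v' w) ->
  K v -> K w -> K (vlin x y v w) ->
  f (vlin x y v w) (vlin x y v w) = x ^+ 2 * f v v + 2 * x * y * f v w + y ^+ 2 * f w w.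
Proof.
move=> fC fl hv hw hl; rewrite (fl x y v w _ hv hw hl) (fC v) (fC w).
rewrite (fl x y v w v hv hw hv) (fl x y v w w hv hw hw) (fC w v); exact: sqr_arith.
Qed.

(** E, J, b are the elastic, jump and L2 forms; the suffixes u, h, P, e, w stand for the fields u,
    uh, P, u - uh, u - P. Expanding, E(e,e) + k J(e,e) = g + gh - 2 E(u,uh); then E(u,uh) = E(P,uh)
    = gh b(P,uh) - k J(P,uh), and J(P,uh) = J(w,e). *)
Lemma identity_arith (g gh k Eee Euu Euh Ehh EPh Ewh Jee Juu Juh Jhh Jwe Jue JPe JPu JPh
    bee buu buh bhh bwh bPh : R) :
  Eee = 1 ^+ 2 * Euu + 2 * 1 * (-1) * Euh + (-1) ^+ 2 * Ehh ->
  Jee = 1 ^+ 2 * Juu + 2 * 1 * (-1) * Juh + (-1) ^+ 2 * Jhh ->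
  bee = 1 ^+ 2 * buu + 2 * 1 * (-1) * buh + (-1) ^+ 2 * bhh ->
  Ewh = 1 * Euh + (-1) * EPh -> Jwe = 1 * Jue + (-1) * JPe ->
  JPe = 1 * JPu + (-1) * JPh -> bwh = 1 * buh + (-1) * bPh ->
  Juu = 0 -> Juh = 0 -> Jue = 0 -> JPu = 0 -> Ewh = 0 -> buu = 1 -> bhh = 1 ->
  Euu = g * buu -> Ehh + k * Jhh = gh * bhh -> EPh + k * JPh = gh * bPh ->
  g - gh = Eee + k * Jee - 2 * (k * Jwe) - 2 * (gh * bwh) - gh * bee.
Proof.
move=> -> -> -> e1 -> -> -> -> -> -> -> ew -> -> -> h1 h2.
have e : Euh = EPh by move: e1; rewrite ew; lra.
by rewrite e; move: h1 h2; rewrite sqrrN expr1n; lra.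
Qed.

Context (Omega GD GN : set (plane R)) (M : mesh R).
Hypothesis hO : polygonal_domain Omega.
Hypothesis hbd : boundary_split Omega GD GN.
Hypothesis hM : is_triangulation Omega GD GN M.

(** Three facts feed [identity_arith]: E(w,uh) = 0, since uh has constant gradients on the cells and
    w mean-zero ones; P is an admissible test field in the discrete equation; and u has no jumps. *)
Lemma error_identity mu lam delta g gh u uh P :
  in_eigenspace (H1E Omega GD) (elastic_form mu lam Omega) (vip Omega) g u ->
  vip Omega u u = 1 ->
  in_eigenspace (CR_space Omega GD M) (ah mu lam delta M) (bh M) gh uh ->
  bh M uh uh = 1 -> CR_space Omega GD M P ->
  let w := vlin 1 (-1) u P in let e := vlin 1 (-1) u uh in
  (forall T i j, T \in tris M ->
     \int[plane_measure R]_(x in otri T) wderiv (otri T) j (w i) x = 0) ->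
  let k := stab delta M * (2 * mu) in
  g - gh = eform M mu lam e e + k * jform M e e - 2 * (k * jform M w e)
    - 2 * (gh * vip Omega w uh) - gh * vip Omega e e.
Proof.
move=> [hu eu] u1 [hh eh] h1 hP; cbv zeta; set w := vlin 1 (-1) u P; set e := vlin 1 (-1) u uh.
move=> w0.
have bu := H1E_broken hO hbd hM hu; have bH := CR_broken hO hM hh; have bP := CR_broken hO hM hP.
have bw : broken Omega M w := broken_lin hO hM 1 (-1) bu bP.
have be : broken Omega M e := broken_lin hO hM 1 (-1) bu bH.
have su := broken_vsq bu; have sH := broken_vsq bH; have sP := broken_vsq bP.
have se := broken_vsq be.
have ECl := fun a b v v' w => @eform_linl R Omega M mu lam a b v v' w.
have JCl := fun a b v v' w => @jform_linl R Omega GD GN M hO hM a b v v' w.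
have VCl := fun a b v v' w => @vip_linl R Omega hO a b v v' w.
have E1 := form_sqr_lin (@eformC R M mu lam) ECl bu bH be.
have E2 := form_sqr_lin (@jformC R M) JCl bu bH be.
have E3 := form_sqr_lin (@vipC R Omega) VCl su sH se.
have Ewh : eform M mu lam w uh = 0.
  rewrite /eform big1// => T TM; have [cc hcc] := CR_grad hO hM hh TM.
  apply: (elastic_affine0 (@open_otri R M T) mu lam (broken_H1 bw TM) (broken_H1 bH TM) _ _ hcc).
    by apply: (otri_continuous_sq_int hM TM); exact: cst_continuous.
  by move=> i j; exact: w0.
have ah1 : eform M mu lam uh uh + stab delta M * (2 * mu) * jform M uh uh = gh * vip Omega uh uh.
  rewrite -(bhE hO hM sH sH) -(eh _ hh) (ahE hM mu lam delta bH bH).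
  by rewrite -!mulrA.
have ah2 : eform M mu lam P uh + stab delta M * (2 * mu) * jform M P uh = gh * vip Omega P uh.
  rewrite (vipC Omega P uh) -(bhE hO hM sH sP) -(eh _ hP) (ahE hM mu lam delta bH bP).
  by rewrite (@eformC R M mu lam uh P) (@jformC R M uh P) -!mulrA.
have JPe : jform M P e = 1 * jform M P u + (-1) * jform M P uh.
  exact: (etrans (@jformC R M P e) (etrans (JCl 1 (-1) u uh P bu bH bP)
    (f_equal2 (fun x y => 1 * x + (-1) * y) (@jformC R M u P) (@jformC R M uh P)))).
have JPu : jform M P u = 0.
  exact: (etrans (@jformC R M P u) (H1E_jform hO hbd hM hu bP)).
have bhh : vip Omega uh uh = 1 by rewrite -(bhE hO hM sH sH).
have Euu : eform M mu lam u u = g * vip Omega u u.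
  by rewrite (elastic_mesh hO hM mu lam (fun i => H1E_H1 i hu) (fun i => H1E_H1 i hu)) (eu _ hu).
exact: (identity_arith E1 E2 E3 (ECl 1 (-1) u P uh bu bP bH) (JCl 1 (-1) u P e bu bP be)
  JPe (VCl 1 (-1) u P uh su sP sH) (H1E_jform hO hbd hM hu bu) (H1E_jform hO hbd hM hu bH)
  (H1E_jform hO hbd hM hu be) JPu Ewh u1 bhh Euu ah1 ah2).
Qed.

(** [jform_bound] and [L2_bound] reduce both quantities to the broken gradient of w, a sum of cell
    variances that [fractional_bound] controls. *)
Lemma interpolation_bounds sigma s u w : 0 < s -> shape_regular sigma M ->
  H1frac Omega s u -> broken Omega M w ->
  (forall T i j, T \in tris M ->
     {ae plane_measure R, forall x, otri T x -> wderiv (otri T) j (w i) x =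
      wderiv Omega j (u i) x - mean (otri T) (wderiv Omega j (u i))}) ->
  (forall T i x y, T \in tris M -> x \in T -> y \in T -> x != y ->
       edge_mean (otri T) (vert x) (vert y) (w i) = 0) ->
  jform M w w <= 2016 * `|sigma| *
     (2 * `|sigma| * mesh_size M `^ (2 * s) * frac_semi Omega s u) /\
  vip Omega w w <= 28 * mesh_size M ^+ 2 *
     (2 * `|sigma| * mesh_size M `^ (2 * s) * frac_semi Omega s u).
Proof.
move=> s0 hs hr bw wg wm.
have c1 : 0 <= 2016 * `|sigma| by apply: mulr_ge0; [exact: ler0n|exact: normr_ge0].
have c2 : 0 <= 28 * mesh_size M ^+ 2 by apply: mulr_ge0; [exact: ler0n|exact: sqr_ge0].
have hu i : H1 Omega (u i) by have [] := hr i.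
have S : \sum_(i < 2) \sum_(T in tris M) grad2 (otri T) (w i) <=
    2 * `|sigma| * mesh_size M `^ (2 * s) * frac_semi Omega s u.
  rewrite /frac_semi mulr_sumr; apply: ler_sum => i _.
  rewrite (eq_bigr (fun T => \sum_(j < 2) variance (otri T) (wderiv Omega j (u i)))); last first.
    by move=> T TM; exact: (grad2_variance hO hM bw hu wg).
  rewrite exchange_big mulr_sumr; apply: ler_sum => j _ /=.
  apply: (fractional_bound hO hM hs s0 (H1_wderiv_sq_int j (hu i))).
  exact: (H1frac_fin i j hr).
split; first exact: (le_trans (jform_bound hM hs bw wm) (ler_wpM2l c1 S)).
exact: (le_trans (L2_bound hO hM hs bw wm) (ler_wpM2l c2 S)).
Qed.

Lemma mesh_size_gt0 : 0 < mesh_size M.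
Proof.
have [_ _ [x Ox] _ _] := hO; have [_ cov _ _] := hM.
have : closure Omega x by exact: subset_closure.
rewrite -cov => -[T /= TM _].
have [i0 [j0 [k0 [eT c3 T0 _ _]]]] := otri_enum hM TM.
have [_ _ d _] := diam_ge eT c3 T0; have [_ dh] := diam_le_mesh hM TM.
exact: lt_le_trans dh.
Qed.

End error_identity.

(** The constant depends on sigma alone, so that it can be fixed before the mesh and the
    eigenfunction. *)
Lemma interpolation_estimate (R : realType) (sigma : R) : exists2 K : R, 0 <= K &
  forall (Omega GD GN : set (plane R)) (M : mesh R) (s : R) (u w : vfield R),
  polygonal_domain Omega -> is_triangulation Omega GD GN M ->
  0 < s -> shape_regular sigma M ->
  H1frac Omega s u -> broken Omega M w ->
  (forall T i j, T \in tris M ->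
     {ae plane_measure R, forall x, otri T x -> wderiv (otri T) j (w i) x =
      wderiv Omega j (u i) x - mean (otri T) (wderiv Omega j (u i))}) ->
  (forall T i x y, T \in tris M -> x \in T -> y \in T -> x != y ->
       edge_mean (otri T) (vert x) (vert y) (w i) = 0) ->
  jform M w w <= K * (mesh_size M `^ (2 * s) * frac_semi Omega s u) /\
  vip Omega w w <= K * (mesh_size M ^+ 2 * mesh_size M `^ (2 * s) * frac_semi Omega s u).
Proof.
pose k1 : R := 2016 * `|sigma| * (2 * `|sigma|); pose k2 : R := 28 * (2 * `|sigma|).
have k10 : 0 <= k1.
  by apply: mulr_ge0; apply: mulr_ge0; [exact: ler0n|exact: normr_ge0|exact: ler0n|exact: normr_ge0].
have k20 : 0 <= k2.
  by apply: mulr_ge0; [exact: ler0n|apply: mulr_ge0; [exact: ler0n|exact: normr_ge0]].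
exists (k1 + k2) => [|Omega GD GN M s u w hO hM s0 hs hr bw wg wm]; first exact: addr_ge0.
have [h1 h2] := interpolation_bounds hO hM s0 hs hr bw wg wm.
have Q0 := frac_semi_ge0 Omega s u; have X0 : 0 <= mesh_size M `^ (2 * s) := powR_ge0 _ _.
have H0 : 0 <= mesh_size M ^+ 2 := sqr_ge0 _.
have e1 : 2016 * `|sigma| * (2 * `|sigma| * mesh_size M `^ (2 * s) * frac_semi Omega s u) =
    k1 * (mesh_size M `^ (2 * s) * frac_semi Omega s u).
  by rewrite /k1 -!mulrA.
have e2 : 28 * mesh_size M ^+ 2 * (2 * `|sigma| * mesh_size M `^ (2 * s) * frac_semi Omega s u) =
    k2 * (mesh_size M ^+ 2 * mesh_size M `^ (2 * s) * frac_semi Omega s u).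
  rewrite /k2; move: (28 : R) (2 : R) `|sigma| (mesh_size M ^+ 2) (mesh_size M `^ _) (frac_semi _ _ _).
  by move=> p q r x y z; ring.
rewrite e1 in h1; rewrite e2 in h2; split.
  apply: (le_trans h1); apply: ler_wpM2r; first exact: mulr_ge0.
  by rewrite lerDl.
apply: (le_trans h2); apply: ler_wpM2r; first by apply: mulr_ge0 => //; exact: mulr_ge0.
by rewrite lerDr.
Qed.

(** The comparisons of powers of h: delta < s / 2 means 4 delta < 2 s, and s < 1 means 2 s < 1 +
    s. *)
Lemma mesh_scales (R : realType) (h s delta : R) : 0 < h -> h <= 1 -> s < 1 ->
  0 < delta -> delta < s / 2 ->
  [/\ h `^ (2 * s) <= (h `^ delta) ^+ 4, h `^ (1 + s) <= h `^ (2 * s),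
    (h `^ (1 + s)) ^+ 2 = h ^+ 2 * h `^ (2 * s) & (h `^ s) ^+ 2 = h `^ (2 * s)].
Proof.
move=> h0 h1 s1 d0 ds; have h01 : 0 < h <= 1 by rewrite h0.
have sqr r n : (h `^ r) ^+ n = h `^ (r * n%:R) by rewrite powRrM powR_mulrn// powR_ge0.
split.
- by rewrite sqr; apply: ger_powR => //; lra.
- by apply: ger_powR => //; lra.
- rewrite sqr -[h ^+ 2]powR_mulrn ?(ltW h0)// -powRD; last by rewrite (gt_eqF h0) implybT.
  by congr powR; lra.
- by rewrite sqr mulrC.
Qed.

(** The sign of the error identity with all terms as real numbers; X stands for h^(2 s) and tau for
    h^(1 + s). Young's inequality splits J(w,e) so that half of the jump penalty survives, and [key]
    says that the surviving lower bound, of order X / st, beats every O(X) term. *)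
Lemma final_arith (R : realType) (D S Jee Jww Jwe bwu bww bee gh mu st c C G X tau Cj Cv : R) :
  0 < mu -> 0 < st -> st <= 1 -> mu * st <= 1 -> 0 <= G -> `|gh| <= G ->
  0 <= S -> 0 <= Jee -> 0 <= X -> 0 < tau -> tau <= X -> 0 <= Cj -> 0 <= Cv -> 0 <= bee ->
  D = S + st * (2 * mu) * Jee - 2 * (st * (2 * mu) * Jwe) - 2 * (gh * bwu) - gh * bee ->
  2 * Jwe <= 2 * Jww + Jee / 2 ->
  Jww <= Cj * X -> 2 * `|bwu| * tau <= tau ^+ 2 + bww -> bww <= Cv * tau ^+ 2 ->
  (c / st) ^+ 2 * X <= S + Jee -> bee <= C ^+ 2 * X ->
  st * (4 * mu * Cj + G * (1 + Cv) + G * C ^+ 2) <= mu * c ^+ 2 -> 0 <= D.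
Proof.
move=> mu0 st0 st1 ms G0 hG S0 J0 X0 t0 tX Cj0 Cv0 b0 -> hJ hw hb1 hb2 hS hb key.
(* Half the jump coefficient. As m <= 1, S + m Jee is at least m (S + Jee), to which the lower bound
   applies. *)
set m := mu * st in ms *; have m0 : 0 < m by rewrite mulr_gt0.
have i1 : m * (2 * Jwe) <= m * (2 * Jww + Jee / 2) by rewrite ler_pM2l.
have i2 : m * S <= S by rewrite -[leRHS]mul1r ler_wpM2r.
have i3 : m * ((c / st) ^+ 2 * X) <= m * (S + Jee) by rewrite ler_pM2l.
have i4 : m * Jww <= mu * Cj * X.
  apply: (@le_trans _ _ (m * (Cj * X))); first by rewrite ler_pM2l.
  rewrite -mulrA ler_wpM2r ?mulr_ge0// /m -[leRHS]mulr1 ler_wpM2l// ltW//.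
(* Young's inequality with weight tau, divided by tau: the product of w with uh is O(tau). *)
have bt : 2 * `|bwu| <= tau * (1 + Cv).
  rewrite -(ler_pM2r t0); apply: le_trans hb1 _.
  rewrite (_ : tau * (1 + Cv) * tau = tau ^+ 2 + Cv * tau ^+ 2); last by ring.
  by rewrite lerD2l.
have C1 : 0 <= 1 + Cv by rewrite addr_ge0.
have i5 : 2 * (gh * bwu) <= G * (1 + Cv) * X.
  apply: (@le_trans _ _ (G * (2 * `|bwu|))).
    apply: le_trans (ler_norm _) _; rewrite !normrM (ger0_norm (ler0n _ 2)).
    by rewrite mulrCA; apply: ler_wpM2r => //; rewrite mulr_ge0.
  rewrite -mulrA; apply: ler_wpM2l => //; apply: le_trans bt _.
  by rewrite mulrC; apply: ler_wpM2l.
have i6 : gh * bee <= G * C ^+ 2 * X.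
  apply: (@le_trans _ _ (G * bee)).
    by apply: ler_wpM2r => //; apply: le_trans (ler_norm _) hG.
  by rewrite -mulrA; apply: ler_wpM2l.
have i7 : (4 * mu * Cj + G * (1 + Cv) + G * C ^+ 2) * X <= m * ((c / st) ^+ 2 * X).
  rewrite (_ : m * _ = (mu * c ^+ 2 / st) * X).
    by apply: ler_wpM2r => //; rewrite ler_pdivlMr// mulrC.
  by rewrite /m; field; rewrite gt_eqF.
have e1 : st * (2 * mu) * Jee = 2 * (m * Jee) by rewrite /m; ring.
have e2 : 2 * (st * (2 * mu) * Jwe) = 2 * (m * (2 * Jwe)) by rewrite /m; ring.
rewrite e1 e2.
have e3 : m * (2 * Jww + Jee / 2) = 2 * (m * Jww) + m * Jee / 2 by ring.
have e4 : m * (S + Jee) = m * S + m * Jee by ring.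
have e5 : (4 * mu * Cj + G * (1 + Cv) + G * C ^+ 2) * X =
  4 * (mu * Cj * X) + G * (1 + Cv) * X + G * C ^+ 2 * X by ring.
rewrite {}e3 in i1; rewrite {}e4 in i3; rewrite {}e5 in i7.
have mJ : 0 <= m * Jee by rewrite mulr_ge0// ltW.
move: i1 i2 i3 i4 i5 i6 i7 mJ; clear.
move: (m * Jee) (m * (2 * Jwe)) (m * S) (m * Jww) (mu * Cj * X) (gh * bwu) (gh * bee)
  (G * (1 + Cv) * X) (G * C ^+ 2 * X) (m * ((c / st) ^+ 2 * X)).
by move=> a1 a2 a3 a4 a5 a6 a7 a8 a9 a10; lra.
Qed.

Lemma sqr_le_of_le (R : realType) (x y : R) : 0 <= x -> x <= y -> x ^+ 2 <= y ^+ 2.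
Proof. by move=> x0 xy; rewrite ler_sqr ?nnegrE//; exact: le_trans xy. Qed.

Lemma young_arith (R : realType) (x y z : R) :
  0 <= 2 ^+ 2 * x + 2 * 2 * (-1) * y + (-1) ^+ 2 * z -> 2 * y <= 2 * x + z / 2.
Proof. by rewrite sqrrN expr1n; lra. Qed.

Lemma abs_arith (R : realType) (x y t : R) : 0 <= x + 2 * t * y + t ^+ 2 ->
  0 <= x + 2 * (- t) * y + (- t) ^+ 2 -> 2 * `|y| * t <= t ^+ 2 + x.
Proof. by rewrite sqrrN => q1 q2; case: (ger0P y) => _; lra. Qed.

Theorem lemma5p6 (R : realType) (s : R) (hs : 0 < s < 1) :
  exists2 delta0 : R, 0 < delta0 &
  forall (delta : R) (hdelta : 0 < delta < delta0)
    (Omega GD GN : set (plane R))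
    (hOmega : polygonal_domain Omega) (hbd : boundary_split Omega GD GN)
    (mu sigma c C : R) (j : nat) (hmu : 0 < mu) (hc : 0 < c)
    (lam : R) (hlam : 0 < lam),
  exists2 h0 : R, 0 < h0 &
  forall (M : mesh R)
    (hM : is_triangulation Omega GD GN M) (hsigma : shape_regular sigma M)
    (hh : mesh_size M < h0)
    (g gh : R) (u uh : vfield R)
    (hu : nth_eigenpair (H1E Omega GD) (elastic_form mu lam Omega) (vip Omega)
            j g u)
    (huh : nth_eigenpair (CR_space Omega GD M) (ah mu lam delta M) (bh M)
            j gh uh)
    (hreg : H1frac Omega s u)
    (hest_h : normh mu lam M (vsub u uh)
                <= C * (stab delta M)^-1 * mesh_size M `^ s)
    (hest_0 : vL2norm Omega (vsub u uh)
                <= C * (stab delta M) ^- 2 * mesh_size M `^ (2 * s))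
    (hest_ev : `|g - gh| <= C * (stab delta M) ^- 2 * mesh_size M `^ (2 * s))
    (hlow : c * (stab delta M)^-1 * mesh_size M `^ s
                <= normh mu lam M (vsub u uh)),
  gh <= g.
Proof.
(* With delta < s / 2, st^-4 h^(2 s) stays bounded, which keeps the squared L2 error of order h^(2
   s). *)
have [s0 s1] := andP hs; exists (s / 2); first by rewrite divr_gt0.
move=> delta /andP[d0 ds] Omega GD GN hO hbd mu sigma c C j hmu hc lam hlam.
(* The constants use the j-th eigenvalue, so it is fixed in advance; if there is none the claim is
   void. *)
have [[g0 hg0]|no] := pselect (exists g,
    nth_eigenvalue (H1E Omega GD) (elastic_form mu lam Omega) (vip Omega) j g); last first.
  by exists 1 => // M _ _ _ g gh u uh [hg _]; exfalso; apply: no; exists g.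
have [l [_ _ ml _ _]] := hg0; have hm := ml g0 (lexx _).
have [B0 hB0] := frac_semi_bound s hO hbd hm.
have [K K0 hK] := interpolation_estimate sigma.
pose B := Num.max 0 B0; have Bge0 : 0 <= B by rewrite le_max lexx.
have hB u : regular_eigen Omega GD mu lam s g0 u -> vip Omega u u = 1 -> frac_semi Omega s u <= B.
  by move=> h1 h2; apply: le_trans (hB0 u h1 h2) _; rewrite le_max lexx orbT.
pose Cj := K * B; have Cj0 : 0 <= Cj by exact: mulr_ge0.
(* Bounds |gh|: below the threshold h^(2 s) <= st^2, so the eigenvalue error is at most |C|. *)
pose G := `|g0| + `|C|; have G0 : 0 <= G by exact: addr_ge0.
(* Total constant of the O(h^(2 s)) terms to be beaten. *)
pose Kt := 4 * mu * Cj + G * (1 + Cj) + G * C ^+ 2.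
have Kt0 : 0 <= Kt.
  apply: addr_ge0; last exact: (mulr_ge0 G0 (sqr_ge0 C)).
  apply: addr_ge0; last exact: (mulr_ge0 G0 (addr_ge0 ler01 Cj0)).
  exact: (mulr_ge0 (mulr_ge0 (ler0n R 4) (ltW hmu)) Cj0).
(* Threshold for st = h^delta, ensuring st <= 1, mu st <= 1 and st Kt <= mu c^2; the mesh-size
   threshold is its power 1 / delta. *)
pose eta := Num.min 1 (Num.min mu^-1 (mu * c ^+ 2 / (Kt + 1))).
have Kt1 : 0 < Kt + 1 by rewrite ltr_wpDl.
have eta0 : 0 < eta.
  by rewrite !lt_min ltr01 invr_gt0 hmu divr_gt0// mulr_gt0// exprn_gt0.
have eta1 : eta <= 1 by rewrite ge_min lexx.
have eta2 : mu * eta <= 1.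
  rewrite -(mulfV (lt0r_neq0 hmu)) ler_wpM2l ?(ltW hmu)//.
  by rewrite ge_min [X in _ || X]ge_min lexx orbT.
have eta3 : eta * Kt <= mu * c ^+ 2.
  apply: (@le_trans _ _ (eta * (Kt + 1))); first by rewrite ler_wpM2l ?(ltW eta0)// lerDl.
  by rewrite -ler_pdivlMr// !ge_min lexx !orbT.
exists (eta `^ delta^-1); first exact: powR_gt0.
move=> M hM hsg hh g gh u uh [hn [u1 hu]] [_ [uh1 huh]] hreg _ he0 hev hlow.
(* Uniqueness identifies the given eigenvalue with the one from which the constants were built. *)
have gE : g = g0 := nth_eigenvalue_unique hO (@H1E_vsq R Omega GD) hn hg0.
rewrite {}gE in hn hu hev *.
have h0 := mesh_size_gt0 hO hM; set h := mesh_size M in h0 hh he0 hev hlow.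
have stE : stab delta M = h `^ delta by [].
have hle : h `^ delta <= eta.
  have d00 : 0 <= delta := ltW d0.
  have := @ge0_ler_powR R delta d00 h (eta `^ delta^-1).
  rewrite !nnegrE (ltW h0) powR_ge0 => /(_ isT isT (ltW hh)).
  by rewrite -powRrM mulVf ?gt_eqF// powRr1// ltW.
have h1 : h <= 1.
  apply: le_trans (ltW hh) _.
  have := @ge0_ler_powR R delta^-1 _ eta 1; rewrite powR1 !nnegrE (ltW eta0) ler01; apply => //.
  by rewrite invr_ge0 ltW.
have [X4 tX t2 hs2] := mesh_scales h0 h1 s1 d0 ds.
rewrite stE in he0 hev hlow.
set st := h `^ delta in hle X4 stE he0 hev hlow; set X := h `^ (2 * s) in X4 tX t2 hs2 he0 hev.
set tau := h `^ (1 + s) in tX t2.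
have st0 : 0 < st by exact: powR_gt0.
have st1 : st <= 1 by exact: le_trans hle eta1.
have X0 : 0 <= X by exact: powR_ge0.
have tau0 : 0 < tau by exact: powR_gt0.
have [huH _] := hu; have [hhC _] := huh.
have [P [hP w0 wg wm]] := interpolant hO hbd hM huH.
have bu := H1E_broken hO hbd hM huH; have bP := CR_broken hO hM hP; have bh' := CR_broken hO hM hhC.
have bw : broken Omega M (vlin 1 (-1) u P) := broken_lin hO hM 1 (-1) bu bP.
have be : broken Omega M (vlin 1 (-1) u uh) := broken_lin hO hM 1 (-1) bu bh'.
have [jb vb] := hK Omega GD GN M s u _ hO hM s0 hsg hreg bw wg wm.
have id := error_identity hO hbd hM hu u1 huh uh1 hP w0.
rewrite /= stE in id; rewrite vsubE in he0 hlow.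
set w := vlin 1 (-1) u P in bw jb vb id; set e := vlin 1 (-1) u uh in be id he0 hlow.
have Q1 : frac_semi Omega s u <= B by exact: (hB u (conj hu hreg) u1).
have z1 : X / st ^+ 2 <= 1.
  rewrite ler_pdivrMr ?exprn_gt0// mul1r; apply: le_trans X4 _.
  rewrite (_ : st ^+ 4 = st ^+ 2 * st ^+ 2); last by rewrite -exprD.
  by rewrite -[leRHS]mulr1 ler_wpM2l ?sqr_ge0// expr_le1// ltW.
have ghG : `|gh| <= G.
  have hd : `|g0 - gh| <= `|C|.
    apply: le_trans hev _; apply: le_trans (ler_norm _) _.
    rewrite -mulrA normrM -[leRHS]mulr1; apply: ler_wpM2l => //.
    by rewrite mulrC ger0_norm// divr_ge0// sqr_ge0.
  rewrite (_ : gh = g0 - (g0 - gh)); last by rewrite opprB addrC subrK.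
  by apply: le_trans (ler_normB _ _) _; rewrite lerD2l.
have vpos := vip_ge0 Omega e.
(* The squared L2 error is at most C^2 st^-4 X^2, and X <= st^4 removes one factor X. *)
have hbee : vip Omega e e <= C ^+ 2 * X.
  have := sqr_le_of_le (sqrtr_ge0 _) he0; rewrite sqr_sqrtr// => /le_trans; apply.
  rewrite -mulrA exprMn; apply: ler_wpM2l; first exact: sqr_ge0.
  rewrite (_ : (st ^- 2 * X) ^+ 2 = X / st ^+ 4 * X).
    rewrite -[leRHS]mul1r; apply: ler_wpM2r => //.
    by rewrite ler_pdivrMr ?exprn_gt0// mul1r.
  by field; rewrite gt_eqF.
have hlow2 : (c / st) ^+ 2 * X <= eform M mu lam e e + jform M e e.
  rewrite -(normhE hM (ltW hmu) (ltW hlam) be) -hs2 -exprMn.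
  apply: sqr_le_of_le hlow; apply: mulr_ge0; last exact: powR_ge0.
  by apply: mulr_ge0; [exact: ltW|rewrite invr_ge0 ltW].
(* Nonnegativity of the jump form at 2 w - e. *)
have hJ : 2 * jform M w e <= 2 * jform M w w + jform M e e / 2.
  have JCl := fun a b v v' w => @jform_linl R Omega GD GN M hO hM a b v v' w.
  have bl := broken_lin hO hM 2 (-1) bw be.
  apply: young_arith; rewrite -(form_sqr_lin (@jformC R M) JCl bw be bl).
  exact: jform_ge0.
(* Nonnegativity of the squared norm of w + x uh at x = tau and x = -tau, uh having norm 1. *)
have hb : 2 * `|vip Omega w uh| * tau <= tau ^+ 2 + vip Omega w w.
  have VCl := fun a b v v' w => @vip_linl R Omega hO a b v v' w.
  have sw := broken_vsq bw; have sh := broken_vsq bh'.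
  have hsq x := vip_ge0 Omega (vlin 1 x w uh).
  have q x : 0 <= vip Omega w w + 2 * x * vip Omega w uh + x ^+ 2.
    have := hsq x; rewrite (form_sqr_lin (@vipC R Omega) VCl sw sh (vsq_lin hO 1 x sw sh)).
    by rewrite -(bhE hO hM sh sh) uh1 expr1n !mulr1 mul1r.
  exact: (abs_arith (q tau) (q (- tau))).
have Jw : jform M w w <= Cj * X.
  apply: le_trans jb _; rewrite /Cj -mulrA; apply: ler_wpM2l => //.
  by rewrite mulrC; apply: ler_wpM2r.
have Vw : vip Omega w w <= Cj * tau ^+ 2.
  apply: le_trans vb _; rewrite -t2 /Cj -mulrA; apply: ler_wpM2l => //.
  by rewrite mulrC; apply: ler_wpM2r => //; exact: sqr_ge0.
have m1 : mu * st <= 1.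
  by apply: le_trans eta2; rewrite ler_wpM2l// ltW.
have key : st * Kt <= mu * c ^+ 2.
  by apply: le_trans eta3; rewrite ler_wpM2r.
rewrite -subr_ge0.
exact: (final_arith hmu st0 st1 m1 G0 ghG (eform_ge0 M e (ltW hmu) (ltW hlam)) (jform_ge0 M e)
  X0 tau0 tX Cj0 Cj0 vpos id hJ Jw hb Vw hlow2 hbee key).
Qed.
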